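(* Let $m_1,m_2,m_3>0$, $h>0$, and let $q_0$ be a point in the interior of the Hill region $Q_h$. Consider JM minimizers $\gamma$ from $q_0$ to the Hill boundary $\partial Q_h$. (a) If $m_1=m_2$ and if the starting point $q_0$ is a collision point with $r_{12}=0$, then the JM minimizers from $q_0$ to $\partial Q_h$ are isosceles brake orbits: $r_{13}=r_{23}$ throughout the orbit. (b) If $m_1=m_2$ and if $q_0$ is collinear with $r_{13}<r_{23}$ (resp. $r_{13}>r_{23}$), then a JM minimizer $\gamma$ from $q_0$ to $\partial Q_h$ satisfies the same inequality: at every point $\gamma(t)$ we have $r_{13}(t)<r_{23}(t)$ (resp. $r_{13}(t)>r_{23}(t)$). (c) If $m_1=m_2=m_3$ and $q_0$ is collinear, then a JM minimizer $\gamma$ from $q_0$ to $\partial Q_h$ satisfies the same side length inequalities as $q_0$: if $r_{12}<r_{13}<r_{23}$ for $q_0$, then at every point $\gamma(t)$ of $\gamma$ we have $r_{12}(t)<r_{13}(t)<r_{23}(t)$.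
   Context: Planar Newtonian three-body problem with positions $q_i\in\mathbb{C}$, center of mass at $0$, $r_{ij}=|q_i-q_j|$, $U=\sum_{i<j}m_im_j/r_{ij}$, equations $m_i\ddot q_i=\nabla_{q_i}U$. Set $\xi_1=q_2-q_1$, $\xi_2=q_3-\frac{m_1q_1+m_2q_2}{m_1+m_2}$, $\mu_1=\frac{m_1m_2}{m_1+m_2}$, $\mu_2=\frac{(m_1+m_2)m_3}{m_1+m_2+m_3}$, $\|\xi\|^2=\mu_1|\xi_1|^2+\mu_2|\xi_2|^2$, $r=\|\xi\|$. Configurations modulo translations and rotations are described by $r\ge0$ and the shape $[\xi_1,\xi_2]\in\mathbb{CP}^1$, with $r=0$ collapsed to one point, the triple collision. The reduced (zero angular momentum) kinetic energy is $K_0=\frac12\dot r^2+\frac12r^2\frac{\mu_1\mu_2}{\|\xi\|^4}|\xi_1\dot\xi_2-\xi_2\dot\xi_1|^2$. Hill region: $Q_h=\{U\ge h\}$ (collisions included); Hill boundary: $\partial Q_h=\{U=h\}$. For a rectifiable curve $\gamma:[t_0,t_1]\to Q_h$ (rectifiable for the distance of the metric $2K_0$) the Jacobi–Maupertuis action is $A_{JM}(\gamma)=\int_{t_0}^{t_1}\sqrt{K_0}\sqrt{2(U-h)}\,dt$, independent of parametrization. A JM minimizer from $q_0$ to $\partial Q_h$ is a rectifiable curve in $Q_h$ from $q_0$ to a point of $\partial Q_h$ minimizing $A_{JM}$ among all such curves. Since $A_{JM}$ vanishes on curves in $\partial Q_h$, a minimizer is understood to be stopped at the first time it reaches $\partial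 Q_h$. A brake orbit is (the projection of) a zero angular momentum solution of Newton's equations of energy $-h$ whose velocities all vanish at some instant, here at the endpoint on $\partial Q_h$. *)

(* Defs.v *)
From mathcomp Require Import all_boot all_order all_algebra all_fingroup complex.
From mathcomp Require Import all_classical all_reals all_analysis.

Set Implicit Arguments.
Unset Strict Implicit.
Unset Printing Implicit Defensive.

Import Order.TTheory GRing.Theory Num.Theory.
Import numFieldNormedType.Exports.
Import ComplexField.Normc.

Local Open Scope classical_set_scope.
Local Open Scope ring_scope.
Local Open Scope complex_scope.

Definition b1 : 'I_3 := @Ordinal 3 0 isT.
Definition b2 : 'I_3 := @Ordinal 3 1 isT.
Definition b3 : 'I_3 := @Ordinal 3 2 isT.

(* A point of the reduced space (configurations modulo translations and
   rotations) is given by any representative q; equality of points is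
   [same_conf].  The notions of points and curves of the reduced space below
   (mutual distances, U, collinearity, dist, A_JM) depend on classes only; the
   centre of mass is put at the origin only for solutions of Newton's equations. *)
Definition conf (R : realType) : Type := 'I_3 -> R[i].

Section ThreeBody.
Variable R : realType.
Implicit Types (m : 'I_3 -> R) (h t a b : R) (q : conf R) (g x : R -> conf R).

Definition same_conf q q' : Prop :=
  exists u c : R[i], normc u = 1 /\ forall i, q' i = u * q i + c.

Definition rdist q (i j : 'I_3) : R := normc (q i - q j).

(* Collisions: [inve 0 = +oo] in \bar R, hence U = +oo there. *)
Definition U m q : \bar R :=
  (\sum_(i < 3) \sum_(j < 3 | (i < j)%N) (m i * m j)%:E / (rdist q i j)%:E)%E.

Definition hill m h : set (conf R) := [set q | (h%:E <= U m q)%E].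
Definition hill_boundary m h : set (conf R) := [set q | U m q = h%:E].

Definition xi1 q : R[i] := q b2 - q b1.
Definition xi2 m q : R[i] :=
  q b3 - ((m b1)%:C * q b1 + (m b2)%:C * q b2) / (m b1 + m b2)%:C.
Definition mu1 m : R := m b1 * m b2 / (m b1 + m b2).
Definition mu2 m : R := (m b1 + m b2) * m b3 / (m b1 + m b2 + m b3).
Definition xinorm m q : R :=
  Num.sqrt (mu1 m * normc (xi1 q) ^+ 2 + mu2 m * normc (xi2 m q) ^+ 2).

Definition collinear q : Prop :=
  exists p v : R[i], v != 0 /\ forall i, exists s : R, q i = p + s%:C * v.

Definition derivC (z : R -> R[i]) (t : R) : R[i] :=
  derive1 (fun s => complex.Re (z s)) t +i* derive1 (fun s => complex.Im (z s)) t.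

Definition derivableC (z : R -> R[i]) (t : R) : Prop :=
  derivable (fun s => complex.Re (z s)) t 1 /\
  derivable (fun s => complex.Im (z s)) t 1.

Definition C1 (z : R -> R[i]) : Prop :=
  (forall t, derivableC z t) /\
  continuous (fun t => complex.Re (derivC z t)) /\
  continuous (fun t => complex.Im (derivC z t)).

(* Reduced kinetic energy at time t of the curve in the reduced space that is
   represented by x. *)
Definition K0 m x t : R :=
  2^-1 * (derive1 (fun s => xinorm m (x s)) t) ^+ 2 +
  2^-1 * xinorm m (x t) ^+ 2 * (mu1 m * mu2 m / xinorm m (x t) ^+ 4) *
    normc (xi1 (x t) * derivC (fun s => xi2 m (x s)) t -
           xi2 m (x t) * derivC (fun s => xi1 (x s)) t) ^+ 2.

(* Riemannian distance of the metric 2 K_0: infimum of the lengths of the C^1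
   paths.  (A piecewise C^1 path becomes C^1 after reparametrization.) *)
Definition dist m q q' : \bar R :=
  ereal_inf [set (\int[lebesgue_measure]_(t in `[0%R, 1%R])
                    (Num.sqrt (2 * K0 m x t))%:E)%E
            | x in [set x | (forall i, C1 (fun t => x t i)) /\
                            same_conf (x 0) q /\ same_conf (x 1) q']].

Definition hill_interior m h : set (conf R) :=
  [set q | exists2 e : R, 0 < e &
     forall q', (dist m q q' < e%:E)%E -> hill m h q'].

Definition curve_length m a b g : \bar R :=
  ereal_sup [set (\sum_(0 <= n < size s)
                   dist m (g (nth b (a :: s) n)) (g (nth b (a :: s) n.+1)))%E
            | s in [set s : seq R | itv_partition a b s]].

Definition rectifiable m a b g : Prop :=
  (forall t, t \in `[a, b] -> forall e : R, 0 < e ->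
     \forall s \near within [set` `[a, b]] (nbhs t),
       (dist m (g t) (g s) < e%:E)%E) /\
  (curve_length m a b g < +oo)%E.

(* The curve g on [t0, t1] is x on [a, b] up to the change of parameter phi
   (which may be constant on intervals where g rests). *)
Definition reparametrizes t0 t1 g a b x : Prop :=
  exists phi : R -> R,
    [/\ {within `[t0, t1], continuous phi},
        {in `[t0, t1] &, {homo phi : s t / s <= t}},
        phi t0 = a, phi t1 = b &
        forall t, t \in `[t0, t1] -> same_conf (x (phi t)) (g t)].

Definition lipschitz_curve a b x : Prop :=
  forall i, [lipschitz complex.Re (x t i) | t in `[a, b]%classic] /\
            [lipschitz complex.Im (x t i) | t in `[a, b]%classic].

Definition action_integral m h a b x : \bar R :=
  (\int[lebesgue_measure]_(t in `[a, b])
     ((Num.sqrt (K0 m x t))%:E * sqrte (2%:E * (U m (x t) - h%:E))))%E.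

(* A rectifiable curve need not be differentiable (nor absolutely continuous)
   in its given parametrization.  The action is the value of the integral for a
   parametrization lifting to a Lipschitz curve of configurations, such as the
   one by arc length; as it does not depend on the choice, the infimum below is
   over a single value. *)
Definition A_JM m h t0 t1 g : \bar R :=
  ereal_inf [set v | exists a b x,
    [/\ a <= b, lipschitz_curve a b x, reparametrizes t0 t1 g a b x &
        v = action_integral m h a b x]].

Definition curve_to_boundary m h q0 t0 t1 g : Prop :=
  [/\ t0 < t1, rectifiable m t0 t1 g,
      forall t, t \in `[t0, t1] -> hill m h (g t),
      same_conf (g t0) q0 & hill_boundary m h (g t1)].

Definition JM_minimizer m h q0 t0 t1 g : Prop :=
  [/\ curve_to_boundary m h q0 t0 t1 g,
      forall t, t \in `[t0, t1[ -> ~ hill_boundary m h (g t) &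
      forall s0 s1 g', curve_to_boundary m h q0 s0 s1 g' ->
        (A_JM m h t0 t1 g <= A_JM m h s0 s1 g')%E].

Definition move q (i : 'I_3) (z : R[i]) : conf R :=
  fun j => if j == i then q i + z else q j.

(* Meaningful where q has no collision, U being finite near such a q. *)
Definition gradU m q (i : 'I_3) : R[i] :=
  derive1 (fun s : R => fine (U m (move q i s%:C))) 0 +i*
  derive1 (fun s : R => fine (U m (move q i (s *i)))) 0.

Definition newton_solution m a b x : Prop :=
  forall t, t \in `]a, b[ ->
    [/\ \sum_(i < 3) (m i)%:C * x t i = 0,
        forall i j, i != j -> x t i != x t j &
        forall i, [/\ derivableC (fun s => x s i) t,
                      derivableC (derivC (fun s => x s i)) t &
          (m i)%:C * derivC (derivC (fun s => x s i)) t = gradU m (x t) i]].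

Definition angular_momentum m x t : R :=
  \sum_(i < 3) m i * complex.Im ((x t i)^* * derivC (fun s => x s i) t).

Definition energy m x t : \bar R :=
  ((2^-1 * \sum_(i < 3) m i * normc (derivC (fun s => x s i) t) ^+ 2)%:E
   - U m (x t))%E.

(* The solution lives on ]0, b[ and g is its projection on [0, T]: the starting
   point may be a collision, and the velocities vanish at the endpoint. *)
Definition brake_orbit m h t0 t1 g : Prop :=
  exists T b x,
    [/\ 0 < T < b,
        newton_solution m 0 b x,
        forall t, t \in `]0, b[ ->
          angular_momentum m x t = 0 /\ energy m x t = (- h)%:E,
        forall i, derivC (fun s => x s i) T = 0 &
        reparametrizes t0 t1 g 0 T x].

End ThreeBody.

(* Main.v *)
(** The Hopf coordinates [w] of a shape satisfy [|w| = r^2], [w3] is proportional to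
the area, [w2] to [r23^2 - r13^2] if [m1 = m2], and [K_0 = |w'|^2 / (8 |w|)].

Reflecting [w3] and translating along it costs O(d) and gains a larger power of
[d]: minimizers avoid the triple collision. For (b), a minimizer reaching [w2 = 0]
may be continued by isosceles shapes; moving it slightly off [w2 = 0] lowers the
action to first order. (c) is (b) for two relabellings.

For (a), [(w1, w2, w3) -> (w1, 0, sqrt (w2^2 + w3^2))] contracts lengths and raises
[U], so minimizers are isosceles. In Newtonian time [s] run back from the Hill
boundary, tent-shaped variations give second differences up to [o(n^2)], hence
[W'' = grad U]; the speed tends to 0, so the even extension is the brake orbit. *)
Require Import Defs.
From HB Require Import structures.
From mathcomp Require Import all_boot all_order all_algebra all_fingroup complex.
From mathcomp Require Import all_classical all_reals all_analysis.
From mathcomp Require Import measurable_realfun ring lra.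
Set Implicit Arguments.
Unset Strict Implicit.
Unset Printing Implicit Defensive.
Import Order.TTheory GRing.Theory Num.Theory.
Import numFieldNormedType.Exports.
Import ComplexField.Normc HBNNSimple.
Local Open Scope classical_set_scope.
Local Open Scope ring_scope.
Local Notation JM := action_integral.
Local Notation lipc := lipschitz_curve.
Local Notation sqrt := Num.sqrt.
Local Notation Re := complex.Re.
Local Notation Im := complex.Im.
Local Notation posm m := (forall i, 0 < m i).
Local Notation minr := Num.min.
Local Notation maxr := Num.max.

(** Actions are never computed. The integrand may be infinite at collisions, and [derive1] brings no
    measurability, so the action of a Lipschitz curve is pinned down by finite increments: it is at
    least [c] times a chord when the weight stays above [c] along the arc, and at most the increment
    of any [D] that dominates all such weighted chords. Reparametrizing, folding, shifting,
    relabelling and reversing time then reduce to inequalities between chords and between values of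
    [U]. Chords are taken in two charts: Hopf coordinates, which see classes only, with weight
    [sqrt (U - h) / (2 sqrt |w|)], and mass-weighted Jacobi coordinates with weight [sqrt (U - h)],
    sharp on isosceles curves in a fixed frame.

    Both ends are singular: the weight vanishes on the Hill boundary and is infinite at an initial
    collision. A dilation bounds the remaining action [A] by a power of [U - h]; read backwards,
    [U - h >= k A^(3/4)]. This makes [dA / (U - h)] integrable up to the end, which controls the
    error term in (b) and the Newtonian time in (a). *)

Lemma le_of_eq (d : Order.disp_t) (T : porderType d) (x y : T) : x = y -> (x <= y)%O.
Proof. by move->. Qed.

Local Notation leb := (@lebesgue_measure _).

Lemma ae_imp (R : realType) (P Q : R -> Prop) : (forall x, P x -> Q x) ->
 {ae leb, forall x : R, P x} -> {ae leb, forall x : R, Q x}.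
Proof.
by move=> PQ; apply: filterS => //; exact: (ae_filter_ringOfSetsType leb).
Qed.

Lemma ae_and (R : realType) (P Q : R -> Prop) : {ae leb, forall x : R, P x} ->
 {ae leb, forall x : R, Q x} -> {ae leb, forall x : R, P x /\ Q x}.
Proof. by apply: filterI; exact: (ae_filter_ringOfSetsType leb). Qed.

(** * Lipschitz functions are integrals of their derivatives *)

Lemma lebesgue_stieltjes_ocitv (R : realType) (G : cumulative R R) (a b : R) :
 a <= b -> lebesgue_stieltjes_measure G `]a, b]%classic = (G b - G a)%:E.
Proof.
move=> ab; rewrite /lebesgue_stieltjes_measure /measure_extension/=.
by rewrite measurable_mu_extE/= ?wlength_itv_bnd//; exact: is_ocitv.
Qed.

(** Adding the slope [L] makes [F] nondecreasing, and being Lipschitz gives right continuity, so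
    Stieltjes measures apply. *)
Lemma lipschitz_cumulative (R : realType) (F : R -> R) (L : R) :
 (forall x y, `|F x - F y| <= L * `|x - y|) ->
 {G : cumulative R R | forall x, G x = F x + L * x}.
Proof.
move=> FL; have nd : {homo (fun x => F x + L * x) : x y / x <= y}.
 move=> x y xy; have := FL x y; rewrite (ler0_norm (_ : x - y <= 0)) ?subr_le0//.
 by rewrite ler_norml => /andP[_]; lra.
have cF : continuous F.
 move=> x; apply/cvgrPdist_le => e e0.
 have L0 : 0 <= L by have := FL 1 0; rewrite subr0 normr1 mulr1; apply: le_trans.
 near=> t; apply: le_trans (FL _ _) _.
 apply: (@le_trans _ _ (L * (e / (L + 1)))).
 apply: ler_wpM2l => //; near: t; apply: cvgr_dist_le => //.
 by rewrite divr_gt0// ltr_pwDr.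
 by rewrite mulrA ler_pdivrMr ?ltr_pwDr// mulrDr mulr1 mulrC lerDl ltW.
have rc : forall x : R, (fun x => F x + L * x) @ at_right x --> F x + L * x.
 apply: right_continuousW => x.
 by apply: cvgD; [exact: cF|apply: cvgM; [exact: cvg_cst|exact: cvg_id]].
pose G : cumulative R R := HB.pack (fun x => F x + L * x)
 (isCumulative.Build R _ R _ nd rc).
by exists G.
Unshelve. all: by end_near. Qed.

(** The measures of [F x + L x] and of [- F x + L x] add up to [2 L] times Lebesgue measure, because
    they do so on half-open intervals. Hence each of them vanishes on null sets. *)
Lemma lipschitz_stieltjes_dominates (R : realType) (F : R -> R) (L : R)
 (G : cumulative R R) : 0 < L ->
 (forall x y, `|F x - F y| <= L * `|x - y|) -> (forall x, G x = F x + L * x) ->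
 forall A, measurable A -> leb A = 0%E -> lebesgue_stieltjes_measure G A = 0%E.
Proof.
move=> L0 FL GE A mA A0.
have NFL x y : `|(- F x) - (- F y)| <= L * `|x - y|.
 by rewrite -opprD normrN; exact: FL.
have [H HE] := lipschitz_cumulative NFL.
have c0 : 0 <= (2 * L)^-1 by rewrite invr_ge0 mulr_ge0// ltW.
pose mu := mscale (NngNum c0) (measure_add (lebesgue_stieltjes_measure G)
 (lebesgue_stieltjes_measure H)).
have muE X : mu X = ((2 * L)^-1%:E * (lebesgue_stieltjes_measure G X +
 lebesgue_stieltjes_measure H X))%E by rewrite -measure_addE.
have : leb A = mu A.
 apply: lebesgue_measure_unique => // X [[x y] _ /= <-].
 rewrite [RHS]muE.
 have [xy|yx] := leP x y; last first.
 by rewrite set_itv_ge ?measure0 ?adde0 ?mule0// -leNgt bnd_simp ltW.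
 rewrite [LHS](_ : _ = (y - x)%:E); last first.
 by rewrite -(@lebesgue_stieltjes_ocitv _ idfun).
 rewrite [X in (_ * (X + _))%E]lebesgue_stieltjes_ocitv//.
 rewrite [X in (_ * (_ + X))%E]lebesgue_stieltjes_ocitv//.
 rewrite -EFinD -EFinM !GE !HE; congr EFin.
 by field; rewrite gt_eqF.
rewrite A0 muE => /esym/eqP.
rewrite mule_eq0 eqe invr_eq0 gt_eqF ?mulr_gt0//=.
by rewrite padde_eq0 ?measure_ge0// => /andP[/eqP].
Qed.

Lemma integrable_cst_itv (R : realType) (s t k : R) :
 leb.-integrable `[s, t] (EFin \o cst k).
Proof.
apply: continuous_compact_integrable; first exact: segment_compact.
by apply: continuous_subspaceT => x; exact: cvg_cst.
Qed.

(* Lipschitz functions are absolutely continuous: the density comes from the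
 Radon-Nikodym theorem applied to the Stieltjes measure of [F x + L x]. *)
Lemma lipschitz_density (R : realType) (F : R -> R) (L a b : R) : a < b ->
 (forall x y, `|F x - F y| <= L * `|x - y|) ->
 exists f : R -> R, [/\ measurable_fun setT f,
 leb.-integrable `[a, b] (EFin \o f),
 {ae leb, forall x, x \in `]a, b[ -> is_derive x 1 F (f x)} &
 forall s t, a <= s -> s <= t -> t <= b ->
 (\int[leb]_(x in `[s, t]) (f x)%:E = (F t - F s)%:E)%E].
Proof.
move=> ab FL0; pose L' : R := `|L| + 1; have L'0 : 0 < L' by rewrite ltr_pwDr.
have FL x y : `|F x - F y| <= L' * `|x - y|.
 apply: le_trans (FL0 x y) _; apply: ler_wpM2r => //.
 by rewrite /L' (le_trans (ler_norm L))// lerDl.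
have [G GE] := lipschitz_cumulative FL.
have mI : measurable (`]a, b]%classic : set (measurableTypeR R)) by exact: measurable_itv.
have finI : (lebesgue_stieltjes_measure G `]a, b]%classic < +oo)%E.
 by rewrite lebesgue_stieltjes_ocitv ?ltry// ltW.
(* The Stieltjes measure is restricted to []a, b]] to make it finite before taking a Radon-Nikodym
   density. *)
pose nu := mfrestr mI finI.
have nudom : nu `<< leb.
 apply/null_content_dominatesP => A mA A0; rewrite /nu/= /mfrestr /mrestr.
 apply: (lipschitz_stieltjes_dominates L'0 FL GE); first exact: measurableI.
 by apply: (subset_measure0 (B := A)) => //; exact: measurableI.
have [p [p0 pfin intp pE]] : exists p : R -> \bar R,
 [/\ forall x, (0 <= p x)%E, forall x, p x \is a fin_num,
 leb.-integrable [set: R] p &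
 forall A, measurable A -> nu A = (\int[leb]_(x in A) p x)%E].
 exact: (radon_nikodym_sigma_finite nudom).
have mp : measurable_fun setT p by exact: measurable_int intp.
pose g := fine \o p.
have gE : EFin \o g = p by apply/funext => x; rewrite /= /g fineK.
have mg : measurable_fun setT g.
 by apply/measurable_EFinP; rewrite gE.
have intg A : measurable A -> leb.-integrable A (EFin \o g).
 by move=> mA; rewrite gE; exact: (integrableS measurableT).
have Gi s t : a <= s -> s <= t -> t <= b ->
 (\int[leb]_(x in `[s, t]) (g x)%:E = (G t - G s)%:E)%E.
 move=> sa st tb.
 rewrite -[LHS]integral_itv_obnd_cbnd; last first.
 by apply/measurable_EFinP; exact: measurable_funTS.
 transitivity (nu `]s, t]%classic).
 by rewrite pE//; apply: eq_integral => x _; rewrite /g fineK.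
 rewrite /nu/= /mfrestr /mrestr setIidl ?lebesgue_stieltjes_ocitv//.
 by apply: subset_itv; rewrite bnd_simp.
have mf : measurable_fun setT (fun x => g x - L') by exact: measurable_funB.
have bndint : leb.-integrable `[a, b] (EFin \o (fun x => g x - L')).
 rewrite [X in _.-integrable _ X](_ : _ = (EFin \o g) \- (EFin \o cst L'))%E//.
 apply: integrableB => //; first exact: intg.
 exact: integrable_cst_itv.
(* [g] is the density of [F x + L' x], so the slope is subtracted again. *)
exists (fun x => g x - L'); split => //.
(* Lebesgue differentiation of the primitive of [g]; near an interior point, [F] is this primitive
   up to an affine function. *)
- have : {ae leb, forall x, a < x ->
 derivable (fun y => \int[leb]_(t in `[a, y]) g t) x 1 /\
 derive1 (fun y => \int[leb]_(t in `[a, y]) g t) x = g x}.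
 have := @FTC1 R g (BLeft a) (fun y => intg _ _).
 have locg : locally_integrable [set: R] g.
 split => //; first exact: openT.
 move=> K _ cK; have /integrableP[_] := intg K (compact_measurable cK).
 by under eq_integral do rewrite /=.
 move=> /(_ (fun y => measurable_itv _) locg).
 by apply: ae_imp => x + ax; apply.
 apply: ae_imp => x Hx; rewrite in_itv/= => /andP[ax xb].
 have [dx Ex] := Hx ax.
 have nF : \forall y \near x,
 F a + (\int[leb]_(t in `[a, y]) g t)%R - L' * (y - a) = F y.
 near=> y.
 have ay : a <= y by near: y; exact: lt_le_nbhsr.
 have yb : y <= b by near: y; exact: lt_le_nbhsl.
 by rewrite /Rintegral (Gi a y)//= !GE; ring.
 set I := fun y => \int[leb]_(t in `[a, y]) g t in nF dx Ex *.
 have D : is_derive x 1 (fun y => F a + I y - L' * (y - a)) (g x - L').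
 have D1 : is_derive x 1 I (g x).
 by rewrite -Ex derive1E; exact: DeriveDef dx erefl.
 apply: is_derive_eq.
 by rewrite /GRing.scale/=; ring.
 exact: near_eq_is_derive nF D.
- move=> s t sa st tb.
 transitivity (\int[leb]_(x in `[s, t]) ((g x)%:E - (L')%:E))%E.
 by apply: eq_integral => x _; rewrite EFinB.
 rewrite integralB_EFin//; last first.
 - exact: integrable_cst_itv.
 - exact: intg.
 rewrite Gi// integral_cst//= lebesgue_measure_itv/= lte_fin.
 have [st'|ts] := ltP s t.
 transitivity (G t - G s - L' * (t - s))%:E => //.
 by rewrite !GE; congr EFin; ring.
 have -> : s = t by apply/eqP; rewrite eq_le st ts.
 by rewrite mule0 sube0 !subrr.
Unshelve. all: by end_near. Qed.

(** * Euclidean norms, and integrals of functions that are not known to be measurable *)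

Section EuclideanNorm.
Variables (R : realType) (n : nat).
Implicit Types u v : 'I_n -> R.

Definition enorm u : R := sqrt (\sum_i u i ^+ 2).

Lemma enorm_ge0 u : 0 <= enorm u. Proof. exact: sqrtr_ge0. Qed.

Lemma sqr_enorm u : enorm u ^+ 2 = \sum_i u i ^+ 2.
Proof. by rewrite sqr_sqrtr// sumr_ge0// => i _; exact: sqr_ge0. Qed.
Lemma cauchy_schwarz u v : \sum_i u i * v i <= enorm u * enorm v.
Proof.
have [u0|u0] := eqVneq (enorm u) 0.
 have h : \sum_i u i ^+ 2 = 0 by rewrite -sqr_enorm u0 expr0n.
 rewrite u0 mul0r big1// => i _; apply/eqP; rewrite mulf_eq0 -sqrf_eq0.
 by rewrite (psumr_eq0P _ h) ?eqxx// => j _; exact: sqr_ge0.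
have [v0|v0] := eqVneq (enorm v) 0.
 have h : \sum_i v i ^+ 2 = 0 by rewrite -sqr_enorm v0 expr0n.
 rewrite v0 mulr0 big1// => i _; apply/eqP; rewrite mulf_eq0 orbC -sqrf_eq0.
 by rewrite (psumr_eq0P _ h) ?eqxx// => j _; exact: sqr_ge0.
have U : 0 < enorm u by rewrite lt_def u0 enorm_ge0.
have V : 0 < enorm v by rewrite lt_def v0 enorm_ge0.
have : 0 <= \sum_i (u i * enorm v - v i * enorm u) ^+ 2.
 by apply: sumr_ge0 => i _; exact: sqr_ge0.
have -> : \sum_i (u i * enorm v - v i * enorm u) ^+ 2 =
 (\sum_i u i ^+ 2) * enorm v ^+ 2 -
 (\sum_i u i * v i) * (enorm u * enorm v *+ 2) +
 (\sum_i v i ^+ 2) * enorm u ^+ 2.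
 rewrite !mulr_suml -sumrB -big_split/=.
 by apply: eq_bigr => i _; ring.
rewrite -!sqr_enorm.
have -> : enorm u ^+ 2 * enorm v ^+ 2 -
 (\sum_i u i * v i) * (enorm u * enorm v *+ 2) + enorm v ^+ 2 * enorm u ^+ 2 =
 (enorm u * enorm v - \sum_i u i * v i) * (enorm u * enorm v *+ 2) by ring.
by rewrite pmulr_lge0 ?subr_ge0// pmulrn_rgt0 ?mulr_gt0.
Qed.

Lemma enormD u v : enorm (fun i => u i + v i) <= enorm u + enorm v.
Proof.
rewrite -(ler_pXn2r (_ : 0 < 2)%N) ?nnegrE ?addr_ge0 ?enorm_ge0//.
have -> : enorm (fun i => u i + v i) ^+ 2 =
 enorm u ^+ 2 + (\sum_i u i * v i) *+ 2 + enorm v ^+ 2.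
 rewrite !sqr_enorm -sumrMnl -!big_split/=.
 by apply: eq_bigr => i _; rewrite sqrrD.
by rewrite sqrrD lerD2r lerD2l lerMn2r cauchy_schwarz.
Qed.

Lemma le_enorm u v : (forall i, `|u i| <= `|v i|) -> enorm u <= enorm v.
Proof.
move=> uv; rewrite ler_wsqrtr// ler_sum// => i _.
by rewrite -real_normK ?num_real// -[leRHS]real_normK ?num_real// lerXn2r ?nnegrE.
Qed.

Lemma enormZ k u : enorm (fun i => k * u i) = `|k| * enorm u.
Proof.
rewrite /enorm; under eq_bigr => i _ do rewrite exprMn.
by rewrite -mulr_sumr sqrtrM ?sqr_ge0// sqrtr_sqr.
Qed.

Lemma enorm_le_sum u : enorm u <= \sum_i `|u i|.
Proof.
rewrite -(ler_pXn2r (_ : 0 < 2)%N) ?nnegrE ?enorm_ge0 ?sumr_ge0//.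
rewrite sqr_enorm expr2 mulr_suml ler_sum// => i _.
rewrite -real_normK ?num_real// expr2 ler_wpM2l//.
by rewrite (bigD1 i)//= lerDl sumr_ge0.
Qed.

Lemma enorm_ge u i : `|u i| <= enorm u.
Proof.
rewrite -sqrtr_sqr ler_wsqrtr// (bigD1 i)//= lerDl sumr_ge0// => j _.
exact: sqr_ge0.
Qed.
End EuclideanNorm.

(* No measurability is needed: both integrals are suprema over the simple
 functions below the integrand. *)
Lemma ae_le_integral_ge0 (d : measure_display) (T : measurableType d)
 (R : realType) (mu : {measure set T -> \bar R}) (f g : T -> \bar R)
 (D : set T) : measurable D ->
 (forall x, D x -> 0 <= f x)%E -> (forall x, D x -> 0 <= g x)%E ->
 {ae mu, forall x, D x -> (f x <= g x)%E} ->
 (\int[mu]_(x in D) f x <= \int[mu]_(x in D) g x)%E.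
Proof.
move=> mD f0 g0 [N [mN N0 NP]].
rewrite [leLHS]integral_mkcond [leRHS]integral_mkcond.
have p0 (k : T -> \bar R) (k0 : forall x, D x -> (0 <= k x)%E) x :
 (0 <= (k \_ D) x)%E.
 by rewrite patchE; case: ifPn => // /set_mem; exact: k0.
rewrite !ge0_integralTE//; [|exact: p0..].
apply: ge_ereal_sup => _ [k kf <-].
have mA : measurable (~` N) by exact: measurableC.
have -> : sintegral mu k = sintegral mu (proj_nnsfun k mA).
 rewrite -!integralT_nnsfun; apply: ge0_ae_eq_integral => //=.
 - exact/measurable_EFinP.
 - by apply/measurable_EFinP; exact: measurable_funM.
 - by move=> x _; rewrite lee_fin.
 - by move=> x _; rewrite lee_fin mulr_ge0// ?indicE.
 exists N; split => // x; apply: contra_notP => Nx /=.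
 by move=> _; rewrite /= mindicE mem_set ?mulr1.
apply: ereal_sup_ubound; exists (proj_nnsfun k mA) => //= x.
rewrite mindicE; have [xA|xA] := boolP (x \in ~` N); last by rewrite mulr0 p0.
rewrite mulr1; apply: le_trans (kf x) _; rewrite !patchE; case: ifPn => // /set_mem xD.
apply: contrapT => h; have : N x by apply: NP => /= /(_ xD).
by move/set_mem : xA.
Qed.

Section NonMeasurable.
Variable R : realType.
Implicit Types f g : R -> \bar R.

Lemma ae_eq_integral_ge0 f g (D : set R) : measurable D ->
 (forall x, D x -> 0 <= f x)%E -> (forall x, D x -> 0 <= g x)%E ->
 {ae leb, forall x, D x -> f x = g x} ->
 (\int[leb]_(x in D) f x = \int[leb]_(x in D) g x)%E.
Proof.
move=> mD f0 g0 fg; apply/eqP; rewrite eq_le; apply/andP; split;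
 apply: ae_le_integral_ge0 => //; apply: ae_imp fg => x H xD.
- by rewrite H.
- by rewrite H.
Qed.

Lemma ae_neq (a : R) : {ae leb, forall x : R, x != a}.
Proof.
exists [set a]; split => //; first exact: lebesgue_measure_set1.
by move=> x /= /negP; rewrite negbK => /eqP.
Qed.

Lemma ae_itv_oo (a b : R) (P : R -> Prop) :
 {ae leb, forall x, x \in `]a, b[ -> P x} ->
 {ae leb, forall x, x \in `[a, b] -> P x}.
Proof.
move=> h; apply: ae_imp (ae_and (ae_and (ae_neq a) (ae_neq b)) h).
move=> x [[xa xb] hx]; rewrite in_itv/= => /andP[ax xb']; apply: hx.
by rewrite in_itv/= !lt_neqAle eq_sym xa ax xb xb'.
Qed.

Lemma integral_itv_split (g : R -> \bar R) (s t u : R) :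
 measurable_fun setT g -> (forall x, 0 <= g x)%E -> s <= t -> t <= u ->
 (\int[leb]_(x in `[s, u]) g x =
 \int[leb]_(x in `[s, t]) g x + \int[leb]_(x in `[t, u]) g x)%E.
Proof.
move=> mg g0 st tu.
rewrite -[X in (_ + X)%E]integral_itv_obnd_cbnd; last exact: measurable_funTS.
rewrite -ge0_integral_setU//=.
- congr (integral _ _ _); rewrite -itv_bndbnd_setU//.
- exact: measurable_funTS.
- rewrite disj_set2E; apply/eqP/seteqP; split => // x [] /=.
 by rewrite !in_itv/= => /andP[_ xt] /andP[tx _]; move: (lt_le_trans tx xt); rewrite ltxx.
Qed.
End NonMeasurable.

Lemma filter_forall_ord (R : realType) (p : nat) (P : 'I_p -> R -> Prop) :
 (forall j, {ae leb, forall t : R, P j t}) -> {ae leb, forall t : R, forall j, P j t}.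
Proof. by move=> h; apply: (@filter_forall _ _ P) => //; exact: (ae_filter_ringOfSetsType leb). Qed.

(** * Weighted length of a Lipschitz curve, bounded from both sides by its chords *)

Section Speed.
Variables (R : realType) (n : nat) (Z : 'I_n -> R -> R) (L a b : R).
Hypotheses (ab : a < b) (ZL : forall i x y, `|Z i x - Z i y| <= L * `|x - y|).

Lemma lipschitz_derivatives : exists z : 'I_n -> R -> R,
 (forall i, measurable_fun setT (z i)) /\
 {ae leb, forall t, t \in `]a, b[ -> forall i, is_derive t 1 (Z i) (z i t)}.
Proof.
have /choice[z zP] : forall i, exists f : R -> R, measurable_fun setT f /\
 {ae leb, forall x, x \in `]a, b[ -> is_derive x 1 (Z i) (f x)}.
 by move=> i; have [f [mf _ df _]] := lipschitz_density ab (ZL i); exists f.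
exists z; split; first by move=> i; have [] := zP i.
have : {ae leb, forall t : R, forall i, t \in `]a, b[ -> is_derive t 1 (Z i) (z i t)}.
 by apply: filter_forall_ord => i; have [] := zP i.
by apply: ae_imp => t h tab i; exact: h.
Qed.

Lemma ae_derivable_family :
 {ae leb, forall t, t \in `]a, b[ -> forall i, derivable (Z i) t 1}.
Proof.
have [z [_ +]] := lipschitz_derivatives.
by apply: ae_imp => t h tab i; have [] := h tab i.
Qed.

Lemma lipschitz_comb (y : 'I_n -> R) x x' :
 `|\sum_i y i * Z i x - \sum_i y i * Z i x'| <= (\sum_i `|y i| * L) * `|x - x'|.
Proof.
rewrite -sumrB mulr_suml (le_trans (ler_norm_sum _ _ _))// ler_sum// => i _.
by rewrite -mulrBr normrM -mulrA ler_wpM2l.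
Qed.
End Speed.

(** Testing against a fixed vector of norm at most 1 replaces the vector curve by one scalar
    function, to which the density lemma applies. *)
Lemma enorm_derive_ge (R : realType) (n : nat) (Z : 'I_n -> R -> R) (y z : 'I_n -> R)
 (t f : R) : enorm y <= 1 ->
 (forall i, is_derive t 1 (Z i) (z i)) ->
 is_derive t 1 (fun s => \sum_i y i * Z i s) f -> `|f| <= enorm z.
Proof.
move=> y1 dZ dF.
have dF' : is_derive t 1 (fun s => \sum_i y i * Z i s) (\sum_i y i * z i).
 have -> : (fun s => \sum_i y i * Z i s) = \sum_i (y i *: Z i).
 by apply/funext => s; rewrite fct_sumE.
 by apply: is_derive_sum => i.
have -> : f = \sum_i y i * z i.
 by rewrite -(@derive_val _ _ _ _ _ _ _ dF) -(@derive_val _ _ _ _ _ _ _ dF').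
have z0 := enorm_ge0 z.
have h (u : 'I_n -> R) : enorm u <= 1 -> \sum_i u i * z i <= enorm z.
 move=> u1; apply: le_trans (cauchy_schwarz u z) _.
 by rewrite -[leRHS]mul1r ler_wpM2r.
rewrite ler_norml h// andbT lerNl -sumrN.
under eq_bigr => i _ do rewrite -mulNr.
apply: h; rewrite /enorm; under eq_bigr => i _ do rewrite sqrrN.
exact: y1.
Qed.

(** Project the curve on the direction of its chord. The projection is Lipschitz, its increment is
    the chord length, and this is the integral of a derivative bounded by the speed. The family [W]
    carries the functions whose differentiability the bound on [dens] relies on. *)
Lemma arc_lower (R : realType) (n p : nat) (Z : 'I_n -> R -> R)
 (W : 'I_p -> R -> R) (L a b c : R) (dens : R -> \bar R) : a < b ->
 (forall i x y, `|Z i x - Z i y| <= L * `|x - y|) ->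
 (forall j x y, `|W j x - W j y| <= L * `|x - y|) ->
 0 <= c -> (forall t, 0 <= dens t)%E ->
 (forall t, t \in `]a, b[ -> (forall j, derivable (W j) t 1) ->
 (forall i, derivable (Z i) t 1) ->
 ((c * enorm (fun i => derive1 (Z i) t))%:E <= dens t)%E) ->
 ((c * enorm (fun i => Z i b - Z i a)%R)%:E <= \int[leb]_(t in `[a, b]) dens t)%E.
Proof.
move=> ab ZL WL c0 dens0 H.
pose d i := Z i b - Z i a.
have [d0|d0] := eqVneq (enorm d) 0.
 by rewrite [enorm _]d0 mulr0 integral_ge0.
have dgt0 : 0 < enorm d by rewrite lt_def d0 enorm_ge0.
pose y i := (enorm d)^-1 * d i.
have y1 : enorm y <= 1.
 by rewrite enormZ ger0_norm ?invr_ge0 ?enorm_ge0// mulVf.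
pose F s := \sum_i y i * Z i s.
have [f [mf intf df fE]] := lipschitz_density ab (lipschitz_comb ZL y).
have [z [mz dz]] := lipschitz_derivatives ab ZL.
have FE : F b - F a = enorm d.
 rewrite /F -sumrB; under eq_bigr => i _ do rewrite -mulrBr -/(d i) /y -mulrA.
 rewrite -mulr_sumr; under eq_bigr => i _ do rewrite -expr2.
 by rewrite -sqr_enorm expr2 mulrA mulVf// mul1r.
have cf0 : leb.-integrable `[a, b] (EFin \o (fun x => c * f x)).
 rewrite [X in _.-integrable _ X](_ : _ = (fun x => c%:E * (EFin \o f) x)%E)//.
 exact: integrableZl.
have -> : (c * enorm d)%:E = (\int[leb]_(t in `[a, b]) (c * f t)%:E)%E.
 under eq_integral do rewrite EFinM.
 by rewrite integralZl//= fE// ?ltW// -/(F _) -/(F _) FE.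
apply: (@le_trans _ _ (\int[leb]_(t in `[a, b]) `|(c * f t)%:E|)%E).
 apply: le_trans (lee_abs _) _; apply: le_abse_integral => //.
 by case/integrableP : cf0.
apply: ae_le_integral_ge0 => //.
apply: ae_itv_oo.
apply: ae_imp (ae_and (ae_and df dz) (ae_derivable_family ab WL)).
move=> t [[h1 h2] h3] tab; apply: le_trans (H t tab (h3 tab) _); last first.
 by move=> i; have [] := h2 tab i.
rewrite /= lee_fin normrM (ger0_norm c0) ler_wpM2l//.
apply: (enorm_derive_ge y1 _ (h1 tab)) => i; have [di dE] := h2 tab i.
by rewrite derive1E; exact: DeriveDef.
Qed.

Section Chains.
Variables (R : realType) (n : nat) (Z : 'I_n -> R -> R) (w : R -> R) (a b : R).

(* [chain t v]: [v] is one of the lower sums, over subdivisions of [[a, t]],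
 of the length of [Z] weighted by [w]. *)
Inductive chain : R -> R -> Prop :=
| Chain0 : chain a 0
| ChainS s t v c : chain s v -> s <= t -> t <= b -> 0 <= c ->
 (forall u, s <= u <= t -> c <= w u) ->
 chain t (v + c * enorm (fun i => Z i t - Z i s)).

Lemma chain_itv t v : a <= b -> chain t v -> a <= t <= b.
Proof.
move=> ab; elim => [|s t' v' c _ /andP[as' _] st tb _ _]; first by rewrite lexx.
by rewrite (le_trans as' st).
Qed.

Lemma chain_le (D : R -> R) t v :
 a <= b ->
 (forall s t c, a <= s -> s <= t -> t <= b -> 0 <= c ->
 (forall u, s <= u <= t -> c <= w u) ->
 c * enorm (fun i => Z i t - Z i s) <= D t - D s) ->
 chain t v -> v <= D t - D a.
Proof.
move=> ab H; elim => [|s t' v' c sv IH st tb c0 cw]; first by rewrite subrr.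
have /andP[as' _] := chain_itv ab sv.
by have := H s t' c as' st tb c0 cw; lra.
Qed.

(** The link that straddles [s] is cut there by the triangle inequality, and the links after [s]
    cost at most [K] times their duration. This makes the supremum of the lower sums Lipschitz in
    [t]. *)
Lemma chain_split (K : R) s t v : a <= s -> a <= b -> 0 <= K ->
 (forall s t c, a <= s -> s <= t -> t <= b -> 0 <= c ->
 (forall u, s <= u <= t -> c <= w u) ->
 c * enorm (fun i => Z i t - Z i s) <= K * (t - s)) ->
 chain t v -> s <= t -> exists2 v0, chain s v0 & v <= v0 + K * (t - s).
Proof.
move=> as' ab K0 H; elim => [sa|r t' v' c rv IH rt tb c0 cw st].
 have -> : s = a by apply/le_anti; rewrite as' sa.
 by exists 0; [exact: Chain0|rewrite subrr mulr0 addr0].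
have /andP[ar _] := chain_itv ab rv.
have [sr|/ltW rs] := leP s r.
 have [v0 sv0 v'v0] := IH sr; exists v0 => //.
 by have := H r t' c ar rt tb c0 cw; rewrite !mulrBr; move: v'v0; rewrite mulrBr; lra.
exists (v' + c * enorm (fun i => Z i s - Z i r)).
 apply: ChainS => //; first exact: le_trans st tb.
 by move=> u /andP[ru us]; apply: cw; rewrite ru (le_trans us).
rewrite -addrA lerD2l.
have := H s t' c as' st tb c0 _.
have -> : (fun i => Z i t' - Z i r) = (fun i => (Z i t' - Z i s) + (Z i s - Z i r)).
 by apply/funext => i; ring.
have := ler_wpM2l c0 (enormD (fun i => Z i t' - Z i s) (fun i => Z i s - Z i r)).
rewrite mulrDr => h1 h2.
apply: le_trans h1 _; rewrite [leRHS]addrC lerD2r h2// => u /andP[su ut].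
by apply: cw; rewrite ut (le_trans rs).
Qed.
End Chains.

Definition clamp (R : realType) (a b t : R) : R := maxr a (minr t b).

Lemma clamp_itv (R : realType) (a b t : R) : a <= b -> a <= clamp a b t <= b.
Proof. by move=> ab; rewrite /clamp le_max lexx/= ge_max ab ge_min lexx orbT. Qed.
Lemma clamp_id (R : realType) (a b t : R) : a <= t <= b -> clamp a b t = t.
Proof.
by move=> /andP[at_ tb]; rewrite /clamp (min_idPl tb); apply/max_idPr.
Qed.

Lemma clamp_homo (R : realType) (a b s t : R) : s <= t -> clamp a b s <= clamp a b t.
Proof.
move=> st; rewrite /clamp ge_max le_max lexx/= le_max; apply/orP; right.
by rewrite le_min !ge_min st/= lexx !orbT.
Qed.

Lemma clamp_lipschitz (R : realType) (a b s t : R) :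
 `|clamp a b s - clamp a b t| <= `|s - t|.
Proof.
wlog st : s t / s <= t => [h|].
 have [/h//|/ltW/h] := leP s t.
 by rewrite distrC (distrC t).
rewrite distrC (distrC s) !ger0_norm ?subr_ge0 ?clamp_homo//.
rewrite /clamp /maxr /minr.
by repeat case: ifPn; rewrite -?leNgt => *; lra.
Qed.


Lemma is_derive_eps (R : realType) (G : R -> R) (t g : R) :
 is_derive t 1 G g <-> forall e, 0 < e -> exists2 d, 0 < d &
 forall h, `|h| < d -> `|G (t + h) - G t - g * h| <= e * `|h|.
Proof.
have E h : h != 0 -> `|g - h^-1 *: ((G \o shift t) (h *: 1) - G t)| =
 `|G (t + h) - G t - g * h| / `|h|.
 move=> h0; rewrite -normfV -normrM distrC.
 rewrite /= /GRing.scale/= mulr1 (addrC h t); congr (`|_|).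
 by field.
split=> [[dG gE] e e0|H].
 have : h^-1 *: ((G \o shift t) (h *: 1) - G t) @[h --> 0^'] --> g.
 by rewrite -gE; exact: dG.
 move=> /cvgrPdist_le /(_ e e0) [d /= d0 dP]; exists d => // h hd.
 have [->|h0] := eqVneq h 0; first by rewrite addr0 subrr mulr0 subrr normr0 mulr0.
 have := dP h; rewrite /= sub0r normrN => /(_ hd h0).
 by rewrite E// ler_pdivrMr ?normr_gt0.
have C : h^-1 *: ((G \o shift t) (h *: 1) - G t) @[h --> 0^'] --> g.
 apply/cvgrPdist_le => e e0; have [d d0 dP] := H e e0.
 exists d => //= h; rewrite /= sub0r normrN => hd h0.
 by rewrite E// ler_pdivrMr ?normr_gt0// dP.
by apply: DeriveDef; [apply/cvg_ex; exists g|exact/cvg_lim].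
Qed.

Lemma ge0_derive_right (R : realType) (G : R -> R) (t g d : R) :
 is_derive t 1 G g -> 0 < d -> (forall k, 0 < k < d -> G t <= G (t + k)) -> 0 <= g.
Proof.
move=> /is_derive_eps dG d0 H; rewrite leNgt; apply/negP => g0.
have [|r r0 rP] := dG (- g / 2); first by lra.
pose k : R := minr d r / 2.
have k0 : 0 < k by rewrite divr_gt0// lt_min d0.
have kd : k < d.
 by rewrite ltr_pdivrMr// (le_lt_trans (_ : _ <= d)) ?ge_min ?lexx//; lra.
have kr : k < r.
 by rewrite ltr_pdivrMr// (le_lt_trans (_ : _ <= r)) ?ge_min ?lexx ?orbT//; lra.
have := rP k; rewrite gtr0_norm// => /(_ kr); rewrite ler_norml => /andP[_].
have := H k; rewrite k0 kd => /(_ isT); nra.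
Qed.

Section ArcUpper.
Variables (R : realType) (n : nat) (Z : 'I_n -> R -> R) (L a b : R).
Hypotheses (ab : a < b) (ZL : forall i x y, `|Z i x - Z i y| <= L * `|x - y|).

Lemma enorm_lipschitz s t : enorm (fun i => Z i t - Z i s) <= n%:R * L * `|t - s|.
Proof.
apply: le_trans (enorm_le_sum _) _.
rewrite -mulrA mulr_natl -[X in _ *+ X]card_ord -sumr_const.
by apply: ler_sum => i _; exact: ZL.
Qed.

(** [D] is an arbitrary function, possibly without derivatives, so the supremum [E0 t] of the lower
    sums up to [t] is put between: it is Lipschitz, its total increment is at most that of [D], and
    almost everywhere its derivative is at least the weighted speed. Integrating that derivative
    gives the bound. *)
Lemma weighted_length_upper (w : R -> R) (D : R -> R) (z : 'I_n -> R -> R) :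
 continuous w -> (forall t, 0 <= w t) ->
 (forall i, measurable_fun setT (z i)) ->
 {ae leb, forall t, t \in `]a, b[ -> forall i, is_derive t 1 (Z i) (z i t)} ->
 (forall s t c, a <= s -> s <= t -> t <= b -> 0 <= c ->
 (forall u, s <= u <= t -> c <= w u) ->
 c * enorm (fun i => Z i t - Z i s) <= D t - D s) ->
 (\int[leb]_(t in `[a, b]) (w t * enorm (z^~ t))%:E <= (D b - D a)%:E)%E.
Proof.
move=> cw w0 mz dz HD.
have leab := ltW ab.
have [m mab wm] := EVT_max leab (continuous_subspaceT cw).
pose K : R := w m * `|n%:R * L|.
have K0 : 0 <= K by rewrite mulr_ge0.
have HK s t c : a <= s -> s <= t -> t <= b -> 0 <= c ->
 (forall u, s <= u <= t -> c <= w u) ->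
 c * enorm (fun i => Z i t - Z i s) <= K * (t - s).
 move=> as_ st tb c0 cwu.
 have cm : c <= w m.
 apply: le_trans (wm s _); first by apply: cwu; rewrite lexx.
 by rewrite in_itv/= as_ (le_trans st).
 rewrite /K -mulrA ler_pM ?enorm_ge0// (le_trans (enorm_lipschitz _ _))//.
 rewrite (ger0_norm (_ : 0 <= t - s)) ?subr_ge0// ler_wpM2r ?subr_ge0//.
 exact: ler_norm.
pose C t := [set v | chain Z w a b t v].
have C0 t : a <= t <= b -> C t !=set0.
 move=> /andP[at_ tb]; exists (0 + 0 * enorm (fun i => Z i t - Z i a)).
 by apply: ChainS => //; exact: Chain0.
have Cub t : has_ubound (C t).
 exists (K * (t - a)) => v vC.
 have := chain_le (D := fun x => K * x) leab _ vC; rewrite -mulrBr; apply.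
 by move=> s' t' c h1 h2 h3 h4 h5; rewrite -mulrBr; exact: HK.
pose E0 t := sup (C t).
have Estep s t c : a <= s -> s <= t -> t <= b -> 0 <= c ->
 (forall u, s <= u <= t -> c <= w u) ->
 c * enorm (fun i => Z i t - Z i s) <= E0 t - E0 s.
 move=> as_ st tb c0 cwu; rewrite lerBrDl -lerBrDr.
 apply: ge_sup; first by apply: C0; rewrite as_ (le_trans st).
 move=> v vs; rewrite lerBrDr; apply: ub_le_sup => //.
 exact: ChainS.
have Emon s t : a <= s -> s <= t -> t <= b -> E0 s <= E0 t.
 move=> as_ st tb; have := Estep s t 0 as_ st tb (lexx _) (fun u _ => w0 u).
 by rewrite mul0r subr_ge0.
have ELip s t : a <= s -> s <= t -> t <= b -> E0 t <= E0 s + K * (t - s).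
 move=> as_ st tb; apply: ge_sup; first by apply: C0; rewrite tb (le_trans as_).
 move=> v vt; have [v0 vs0 vv0] := chain_split as_ leab K0 HK vt st.
 by apply: le_trans vv0 _; rewrite lerD2r; exact: ub_le_sup.
pose E t := E0 (clamp a b t).
have EL x y : `|E x - E y| <= K * `|x - y|.
 wlog xy : x y / x <= y => [h|].
 have [/h//|/ltW/h] := leP x y.
 by rewrite distrC (distrC y).
 have /andP[ax xb] := clamp_itv x leab; have /andP[ay yb] := clamp_itv y leab.
 have cxy := clamp_homo a b xy.
 have e1 := Emon _ _ ax cxy yb; have e2 := ELip _ _ ax cxy yb.
 rewrite distrC ger0_norm ?subr_ge0// lerBlDl (le_trans e2)// lerD2l.
 apply: ler_wpM2l => //; rewrite distrC; apply: le_trans (clamp_lipschitz a b y x).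
 exact: ler_norm.
have [e [me inte de eE]] := lipschitz_density ab EL.
have Eab : E b - E a <= D b - D a.
 rewrite /E !clamp_id ?lexx ?leab//.
 have -> : E0 a = 0.
 apply/le_anti/andP; split.
 apply: ge_sup; first by apply: C0; rewrite lexx.
 move=> v va.
 have := chain_le (D := fun x => K * x) leab _ va; rewrite subrr; apply.
 by move=> s' t' c h1 h2 h3 h4 h5; rewrite -mulrBr; exact: HK.
 by apply: ub_le_sup => //; exact: Chain0.
 rewrite subr0; apply: ge_sup; first by apply: C0; rewrite lexx leab.
 by move=> v vb; exact: chain_le vb.
apply: (@le_trans _ _ (E b - E a)%:E); last by rewrite lee_fin.
rewrite -(eE a b)//.
have pw t : t \in `]a, b[ -> (forall i, is_derive t 1 (Z i) (z i t)) ->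
 is_derive t 1 E (e t) -> w t * enorm (z^~ t) <= e t.
 rewrite in_itv/= => /andP[at_ tb] dZ dE.
 (* By continuity a constant [c < w t] stays below [w] near [t], so short links from [t] with weight
    [c] are admissible. The case of [w t] itself follows by letting [c] increase. *)
 have key c : 0 <= c -> c < w t -> c * enorm (z^~ t) <= e t.
 move=> c0 cw_.
 have [z0|z0] := eqVneq (enorm (z^~ t)) 0.
 rewrite z0 mulr0; apply: (ge0_derive_right (d := b - t) dE); first by lra.
 move=> k /andP[k0 kb]; rewrite /E !clamp_id; [|lra|lra].
 by apply: Emon; lra.
 have zgt0 : 0 < enorm (z^~ t) by rewrite lt_def z0 enorm_ge0.
 pose y i := (enorm (z^~ t))^-1 * z i t.
 have y1 : enorm y = 1.
 by rewrite enormZ ger0_norm ?invr_ge0 ?enorm_ge0// mulVf.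
 have dG : is_derive t 1 (fun s => E s - c * \sum_i y i * Z i s)
 (e t - c * enorm (z^~ t)).
 have dS : is_derive t 1 (\sum_i (y i *: Z i)) (\sum_i y i * z i t).
 by apply: is_derive_sum => i.
 have -> : (fun s => E s - c * \sum_i y i * Z i s) =
 E - c *: (\sum_i (y i *: Z i)).
 by apply/funext => s /=; rewrite !fctE fct_sumE.
 apply: is_derive_eq; rewrite /GRing.scale/=; congr (_ - _ * _).
 under eq_bigr => i _ do rewrite -mulrA -expr2.
 by rewrite -mulr_sumr -sqr_enorm expr2 mulrA mulVf// mul1r.
 have [d d0 dP] : exists2 d, 0 < d & forall u, `|t - u| < d -> c <= w u.
 have : \forall u \near t, c <= w u.
 by apply: cvgr_ge (cw t) _ cw_.
 by move=> [d d0 dP]; exists d => // u ud; exact: dP.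
 have := ge0_derive_right (d := minr d (b - t)) dG _ _.
 rewrite subr_ge0; apply; first by rewrite lt_min d0 subr_gt0.
 move=> k /andP[k0]; rewrite lt_min => /andP[kd kb].
 rewrite /E !clamp_id; [|lra|lra].
 have h' : c * enorm (fun i => Z i (t + k) - Z i t) <= E0 (t + k) - E0 t.
 apply: Estep => //; [lra|lra|lra|move=> u /andP[tu uk]; apply: dP].
 by rewrite ler0_norm; lra.
 have : c * (\sum_i y i * Z i (t + k) - \sum_i y i * Z i t) <=
 c * enorm (fun i => Z i (t + k) - Z i t).
 apply: ler_wpM2l => //; rewrite -sumrB.
 under eq_bigr => i _ do rewrite -mulrBr.
 by apply: le_trans (cauchy_schwarz _ _) _; rewrite y1 mul1r.
 by lra.
 have [wt0|wt0] := eqVneq (w t) 0.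
 rewrite wt0 mul0r.
 apply: (ge0_derive_right (d := b - t) dE); first by lra.
 move=> k /andP[k0 kb]; rewrite /E !clamp_id; [|lra|lra].
 by apply: Emon; lra.
 have wt : 0 < w t by rewrite lt_def wt0 w0.
 rewrite leNgt; apply/negP => lt_e.
 have e0 : 0 <= e t by have := key 0 (lexx _) wt; rewrite mul0r.
 have zp : 0 < enorm (z^~ t).
 by rewrite lt_def enorm_ge0 andbT; apply: contraTneq lt_e => ->; rewrite mulr0 -leNgt.
 pose c : R := (e t / enorm (z^~ t) + w t) / 2.
 have ez0 : 0 <= e t / enorm (z^~ t) by rewrite divr_ge0 ?enorm_ge0.
 have ezw : e t / enorm (z^~ t) < w t by rewrite ltr_pdivrMr.
 have c1 : 0 <= c by rewrite /c; lra.
 have c2 : c < w t by rewrite /c; lra.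
 have := key c c1 c2; rewrite leNgt => /negP; apply.
 by rewrite -ltr_pdivrMr// /c; lra.
have intE : leb.-integrable `[a, b] (EFin \o e) by [].
(* [e] is known to be nonnegative only almost everywhere, while the comparison of integrals wants
   nonnegative integrands everywhere. *)
apply: (@le_trans _ _ (\int[leb]_(t in `[a, b]) `|(e t)%:E|)%E).
 apply: ae_le_integral_ge0 => //.
 by move=> t _; rewrite lee_fin mulr_ge0 ?enorm_ge0.
 apply: ae_itv_oo; apply: ae_imp (ae_and dz de) => t [h1 h2] tab.
 rewrite /= lee_fin (le_trans (pw t tab (h1 tab) (h2 tab)))//.
 exact: ler_norm.
apply: le_of_eq.
apply: ae_eq_integral => //; first by apply: measurableT_comp => //; apply/measurable_EFinP; exact: measurable_funTS.
 by apply/measurable_EFinP; exact: measurable_funTS.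
apply: ae_itv_oo; apply: ae_imp (ae_and dz de) => t [h1 h2] tab.
rewrite /= ger0_norm//; apply: le_trans (pw t tab (h1 tab) (h2 tab)).
by rewrite mulr_ge0 ?enorm_ge0.
Qed.
End ArcUpper.

(** Monotone convergence extends the bound to densities that are only limits of continuous weights,
    as happens where the potential is infinite. *)
Lemma arc_upper (R : realType) (n p : nat) (Z : 'I_n -> R -> R)
 (W : 'I_p -> R -> R) (L a b : R) (w : nat -> R -> R) (D : R -> R)
 (dens : R -> \bar R) : a < b ->
 (forall i x y, `|Z i x - Z i y| <= L * `|x - y|) ->
 (forall j x y, `|W j x - W j y| <= L * `|x - y|) ->
 (forall k, continuous (w k)) -> (forall k t, 0 <= w k t) ->
 (forall k t, w k t <= w k.+1 t) ->
 (forall t, 0 <= dens t)%E ->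
 (forall t, t \in `]a, b[ -> (forall j, derivable (W j) t 1) ->
 (forall i, derivable (Z i) t 1) ->
 (dens t <= limn (fun k => (w k t * enorm (fun i => derive1 (Z i) t))%:E))%E) ->
 (forall k s t c, a <= s -> s <= t -> t <= b -> 0 <= c ->
 (forall u, s <= u <= t -> c <= w k u) ->
 c * enorm (fun i => Z i t - Z i s) <= D t - D s) ->
 (\int[leb]_(t in `[a, b]) dens t <= (D b - D a)%:E)%E.
Proof.
move=> ab ZL WL cw w0 wmon dens0 H HD.
have [z [mz dz]] := lipschitz_derivatives ab ZL.
pose g k t : \bar R := (w k t * enorm (z^~ t))%:E.
have mz2 : measurable_fun setT (fun t => enorm (z^~ t)).
 apply: measurableT_comp.
 by apply: continuous_measurable_fun; exact: sqrt_continuous.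
 by apply: measurable_sum => i; exact: measurable_funX.
have mg k : measurable_fun setT (g k).
 apply/measurable_EFinP; apply: measurable_funM => //.
 exact: continuous_measurable_fun.
have g0 k t : (0 <= g k t)%E by rewrite lee_fin mulr_ge0 ?enorm_ge0.
have gmon t : nondecreasing_seq (g ^~ t).
 by apply/nondecreasing_seqP => k; rewrite lee_fin ler_wpM2r ?enorm_ge0.
apply: (@le_trans _ _ (\int[leb]_(t in `[a, b]) (limn (g ^~ t)))%E).
 apply: ae_le_integral_ge0 => //.
 move=> t _; apply: lime_ge; last by apply: nearW => k; exact: g0.
 exact: ereal_nondecreasing_is_cvgn.
 apply: ae_itv_oo; apply: ae_imp (ae_and dz (ae_derivable_family ab WL)).
 move=> t [h1 h2] tab; apply: le_trans (H t tab (h2 tab) _) _.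
 by move=> i; have [] := h1 tab i.
 suff -> : (fun i => derive1 (Z i) t) = z^~ t by [].
 by apply/funext => i; have [di dE] := h1 tab i; rewrite derive1E.
have mgD k : measurable_fun `[a, b] (g k) by exact: measurable_funTS.
rewrite monotone_convergence//.
apply: lime_le.
 apply: ereal_nondecreasing_is_cvgn => k k' kk'.
 apply: ge0_le_integral => //; [exact: mgD|exact: mgD|].
 by move=> t _; exact: gmon.
apply: nearW => k; apply: weighted_length_upper ZL _ _ _ _ _ _ dz _ => //.
exact: HD.
Qed.

(* A plain-typed form of [is_derive] for real functions of a real variable. *)
Definition isd (R : realType) (f : R -> R) (t a : R) : Prop := is_derive t (1 : R) f a.

Section DerivativeRules.
Variables (R : realType) (t : R).
Implicit Types (f g : R -> R) (a b k : R).

Lemma isd_eq f a b : isd f t a -> a = b -> isd f t b.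
Proof. by move=> ? <-. Qed.
Lemma isd_ext f g a : f =1 g -> isd f t a -> isd g t a.
Proof. by move=> /funext ->. Qed.
Lemma isd_uniq f a b : isd f t a -> isd f t b -> a = b.
Proof.
by move=> fa fb; rewrite -(@derive_val _ _ _ _ _ _ _ fa) -(@derive_val _ _ _ _ _ _ _ fb).
Qed.

Lemma isd_derive1 f a : isd f t a -> derive1 f t = a.
Proof. by move=> fa; rewrite derive1E (@derive_val _ _ _ _ _ _ _ fa). Qed.
Lemma isd_derivable f a : isd f t a -> derivable f t 1.
Proof. by move=> [df _]. Qed.
Lemma derivable_isd f : derivable f t 1 -> isd f t (derive1 f t).
Proof. by move=> df; rewrite /isd derive1E; exact: DeriveDef. Qed.
Lemma isdD f g a b : isd f t a -> isd g t b -> isd (fun s => f s + g s) t (a + b).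
Proof. exact: is_deriveD. Qed.
Lemma isdN f a : isd f t a -> isd (fun s => - f s) t (- a).
Proof. exact: is_deriveN. Qed.
Lemma isdB f g a b : isd f t a -> isd g t b -> isd (fun s => f s - g s) t (a - b).
Proof. exact: is_deriveB. Qed.
Lemma isdM f g a b : isd f t a -> isd g t b ->
 isd (fun s => f s * g s) t (a * g t + f t * b).
Proof.
move=> fa gb; have H := is_deriveM fa gb.
have -> : a * g t + f t * b = f t *: b + g t *: a.
 by rewrite /GRing.scale/= addrC (mulrC (g t)).
exact: H.
Qed.

Lemma isd_cst k : isd (fun=> k) t 0.
Proof. exact: is_derive_cst. Qed.
Lemma isdZ k f a : isd f t a -> isd (fun s => k * f s) t (k * a).
Proof. by move=> fa; exact: (is_deriveZ k fa). Qed.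
Lemma isdX2 f a : isd f t a -> isd (fun s => f s ^+ 2) t (2 * f t * a).
Proof.
move=> fa; have H := isdM fa fa.
by rewrite (_ : 2 * f t * a = a * f t + f t * a); [exact: H|ring].
Qed.

Lemma isd_id : isd (fun s => s) t 1.
Proof. exact: is_derive_id. Qed.
End DerivativeRules.

(** * Hopf coordinates of the shape and the reduced kinetic energy *)

Section HopfCoordinates.
Variables (R : realType) (m : 'I_3 -> R).
Hypothesis hm : posm m.
Implicit Types (q : conf R) (x : R -> conf R).

Definition X1 q : R := Re (xi1 q).
Definition Y1 q : R := Im (xi1 q).
Definition X2 q : R := Re (xi2 m q).
Definition Y2 q : R := Im (xi2 m q).
Definition inertia q : R :=
 mu1 m * (X1 q ^+ 2 + Y1 q ^+ 2) + mu2 m * (X2 q ^+ 2 + Y2 q ^+ 2).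
Definition kappa : R := sqrt (mu1 m * mu2 m).

(* The shape space modulo rotations is [R^3]: [|hopf q|] is the moment of
 inertia, [hopf q 2] is twice a multiple of the signed area. *)
Definition hopf q (i : 'I_3) : R := match val i with
 | 0 => mu1 m * (X1 q ^+ 2 + Y1 q ^+ 2) - mu2 m * (X2 q ^+ 2 + Y2 q ^+ 2)
 | 1 => - (2 * kappa * (X1 q * X2 q + Y1 q * Y2 q))
 | _ => 2 * kappa * (Y1 q * X2 q - X1 q * Y2 q)
 end.

Lemma mu1_gt0 : 0 < mu1 m.
Proof. by rewrite divr_gt0 ?mulr_gt0 ?addr_gt0. Qed.
Lemma mu2_gt0 : 0 < mu2 m.
Proof. by rewrite divr_gt0 ?mulr_gt0 ?addr_gt0. Qed.
Lemma kappa_gt0 : 0 < kappa.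
Proof. by rewrite sqrtr_gt0 mulr_gt0 ?mu1_gt0 ?mu2_gt0. Qed.
Lemma sqr_kappa : kappa ^+ 2 = mu1 m * mu2 m.
Proof. by rewrite sqr_sqrtr// mulr_ge0 ?ltW ?mu1_gt0 ?mu2_gt0. Qed.
Lemma sqr_normc (z : R[i]) : normc z ^+ 2 = Re z ^+ 2 + Im z ^+ 2.
Proof. by case: z => a b; rewrite sqr_sqrtr// addr_ge0 ?sqr_ge0. Qed.
Lemma normc_sqrt (z : R[i]) : normc z = sqrt (Re z ^+ 2 + Im z ^+ 2).
Proof. by case: z. Qed.
Lemma normc_ge0' (z : R[i]) : 0 <= normc z. Proof. by case: z => a b; exact: sqrtr_ge0. Qed.

Lemma inertia_ge0 q : 0 <= inertia q.
Proof.
by rewrite addr_ge0// mulr_ge0 ?addr_ge0 ?sqr_ge0// ltW ?mu1_gt0 ?mu2_gt0.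
Qed.

Lemma xinormE q : xinorm m q = sqrt (inertia q).
Proof. by rewrite /xinorm !sqr_normc. Qed.
Lemma sqr_xinorm q : xinorm m q ^+ 2 = inertia q.
Proof. by rewrite xinormE sqr_sqrtr// inertia_ge0. Qed.
Lemma inertia_eq0 q : inertia q = 0 -> [/\ X1 q = 0, Y1 q = 0, X2 q = 0 & Y2 q = 0].
Proof.
rewrite /inertia; move: (mu1 m) (mu2 m) mu1_gt0 mu2_gt0 => u v u0 v0 /eqP.
rewrite paddr_eq0 ?(mulr_ge0 (ltW _)) ?addr_ge0 ?sqr_ge0//.
rewrite !mulf_eq0 (gt_eqF u0) (gt_eqF v0)/= !paddr_eq0 ?sqr_ge0// !sqrf_eq0.
by move=> /andP[/andP[/eqP-> /eqP->] /andP[/eqP-> /eqP->]].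
Qed.

Lemma big_ord3 (F : 'I_3 -> R) : \sum_i F i = F b1 + F b2 + F b3.
Proof.
rewrite !big_ord_recl big_ord0 addr0 addrA.
by congr (_ + _ + _); congr F; exact/val_inj.
Qed.

Lemma enorm_hopf q : enorm (hopf q) = inertia q.
Proof.
rewrite /enorm big_ord3 /hopf/= sqrrN !exprMn sqr_kappa /inertia.
rewrite -[RHS](ger0_norm (inertia_ge0 q)) -sqrtr_sqr; congr sqrt.
by rewrite /inertia; ring.
Qed.
End HopfCoordinates.

Section KineticEnergy.
Variables (R : realType) (m : 'I_3 -> R).
Hypothesis hm : posm m.
Variables (x : R -> conf R) (t : R).

Definition speed2 : R :=
 mu1 m * (derive1 (fun s => X1 (x s)) t ^+ 2 + derive1 (fun s => Y1 (x s)) t ^+ 2) +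
 mu2 m * (derive1 (fun s => X2 m (x s)) t ^+ 2 + derive1 (fun s => Y2 m (x s)) t ^+ 2).
Definition moment : R :=
 mu1 m * (X1 (x t) * derive1 (fun s => Y1 (x s)) t - Y1 (x t) * derive1 (fun s => X1 (x s)) t) +
 mu2 m * (X2 m (x t) * derive1 (fun s => Y2 m (x s)) t - Y2 m (x t) * derive1 (fun s => X2 m (x s)) t).

Hypotheses (dX1 : derivable (fun s => X1 (x s)) t 1)
 (dY1 : derivable (fun s => Y1 (x s)) t 1)
 (dX2 : derivable (fun s => X2 m (x s)) t 1)
 (dY2 : derivable (fun s => Y2 m (x s)) t 1)
 (dr : derivable (fun s => xinorm m (x s)) t 1).

Let a1 : R := derive1 (fun s => X1 (x s)) t.
Let a2 : R := derive1 (fun s => Y1 (x s)) t.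
Let a3 : R := derive1 (fun s => X2 m (x s)) t.
Let a4 : R := derive1 (fun s => Y2 m (x s)) t.
Let r' : R := derive1 (fun s => xinorm m (x s)) t.

Lemma derive_hopf i : isd (fun s => hopf m (x s) i) t (match val i with
 | 0 => 2 * mu1 m * (X1 (x t) * a1 + Y1 (x t) * a2) - 2 * mu2 m * (X2 m (x t) * a3 + Y2 m (x t) * a4)
 | 1 => - (2 * kappa m * (a1 * X2 m (x t) + X1 (x t) * a3 + a2 * Y2 m (x t) + Y1 (x t) * a4))
 | _ => 2 * kappa m * (a2 * X2 m (x t) + Y1 (x t) * a3 - a1 * Y2 m (x t) - X1 (x t) * a4)
 end).
Proof.
have i1 := derivable_isd dX1; have i2 := derivable_isd dY1.
have i3 := derivable_isd dX2; have i4 := derivable_isd dY2.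
rewrite -/a1 in i1; rewrite -/a2 in i2; rewrite -/a3 in i3; rewrite -/a4 in i4.
rewrite /hopf; case: (val i) => [|[|k]].
- apply: isd_eq.
 exact: (isdB (isdZ (mu1 m) (isdD (isdX2 i1) (isdX2 i2)))
 (isdZ (mu2 m) (isdD (isdX2 i3) (isdX2 i4)))).
 by ring.
- apply: isd_eq; first exact: (isdN (isdZ (2 * kappa m) (isdD (isdM i1 i3) (isdM i2 i4)))).
 by ring.
- apply: isd_eq; first exact: (isdZ (2 * kappa m) (isdB (isdM i2 i3) (isdM i1 i4))).
 by ring.
Qed.

Lemma derive_inertia :
 xinorm m (x t) * r' =
 mu1 m * (X1 (x t) * a1 + Y1 (x t) * a2) + mu2 m * (X2 m (x t) * a3 + Y2 m (x t) * a4).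
Proof.
have i1 := derivable_isd dX1; have i2 := derivable_isd dY1.
have i3 := derivable_isd dX2; have i4 := derivable_isd dY2.
rewrite -/a1 in i1; rewrite -/a2 in i2; rewrite -/a3 in i3; rewrite -/a4 in i4.
have h1 := isdX2 (derivable_isd dr); rewrite -/r' in h1.
have h2 := isdD (isdZ (mu1 m) (isdD (isdX2 i1) (isdX2 i2)))
 (isdZ (mu2 m) (isdD (isdX2 i3) (isdX2 i4))).
have h3 := isd_uniq h1 (isd_ext (fun s => esym (sqr_xinorm hm (x s))) h2).
by apply: (@mulfI _ 2%:R); rewrite ?pnatr_eq0// mulrA h3; ring.
Qed.

(** The norm is minimal where it vanishes. *)
Lemma derive_xinorm_eq0 : xinorm m (x t) = 0 -> r' = 0.
Proof.
move=> r0; have r_ge0 s : 0 <= xinorm m (x s) by exact: sqrtr_ge0.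
have d1 := derivable_isd dr; rewrite -/r' in d1.
apply/eqP; rewrite eq_le; apply/andP; split; last first.
 by apply: (ge0_derive_right (d := 1) d1) => // k _; rewrite r0.
have d2 : isd (fun s => xinorm m (x (- s))) (- t) (- r').
 apply/is_derive_eps => e e0; move/is_derive_eps: d1 => /(_ e e0)[d d0 dP].
 exists d => // h hd; have := dP (- h); rewrite normrN => /(_ hd).
 by rewrite opprD !opprK mulrN mulNr.
have := ge0_derive_right (d := 1) d2 ltr01; rewrite oppr_ge0; apply.
by move=> k _; rewrite opprK r0.
Qed.

(** The form without division survives at the triple collision, where both sides vanish. *)
Lemma K0_hopf : K0 m x t * (8 * inertia m (x t)) =
 (enorm (fun i => derive1 (fun s => hopf m (x s) i) t)) ^+ 2.
Proof.
have dE i := isd_derive1 (derive_hopf i).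
rewrite sqr_enorm big_ord3 !dE/=.
have hk := sqr_kappa hm.
have hr := derive_inertia; have hN := sqr_xinorm hm (x t).
rewrite /K0 -/r' sqr_normc.
change (Defs.derivC (fun s => xi2 m (x s)) t) with (Complex a3 a4).
change (Defs.derivC (fun s => xi1 (x s)) t) with (Complex a1 a2).
have h0 := @inertia_eq0 _ _ hm (x t).
rewrite !exprMn sqrrN !exprMn hk.
move: hr hN h0; rewrite /inertia /X1 /Y1 /X2 /Y2.
case: (xi1 (x t)) => u1 v1; case: (xi2 m (x t)) => u2 v2 /=.
move: (mu1 m) (mu2 m) => k l.
have r'0 := derive_xinorm_eq0; move: r'0.
set r := xinorm m (x t) => r'0 hr hN h0.
have [r0|r0] := eqVneq r 0.
 have [|-> -> -> ->] := h0; first by rewrite -hN r0 expr0n.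
 by rewrite r0 (r'0 r0); ring.
rewrite -hN.
transitivity (4 * (r * r') ^+ 2 + 4 * (k * l) * ((u1 * a3 - v1 * a4 - (u2 * a1 - v2 * a2)) ^+ 2 +
 (u1 * a4 + v1 * a3 - (u2 * a2 + v2 * a1)) ^+ 2)).
 by field.
by rewrite hr; ring.
Qed.

(* Lagrange's identity: the reduced kinetic energy is the kinetic energy minus
 its rotational part. *)
Lemma K0_speed2 : (2 * K0 m x t) * inertia m (x t) = speed2 * inertia m (x t) - moment ^+ 2.
Proof.
apply: (@mulfI _ 4%:R); first by rewrite pnatr_eq0.
transitivity (K0 m x t * (8 * inertia m (x t))); first by ring.
rewrite K0_hopf sqr_enorm big_ord3 !(isd_derive1 (derive_hopf _))/=.
rewrite !exprMn sqrrN !exprMn (sqr_kappa hm) /speed2 /moment /inertia.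
by rewrite -/a1 -/a2 -/a3 -/a4; ring.
Qed.

(** At the triple collision [xinorm] vanishes together with its derivative, which kills both terms
    of [K0] whatever value the quotient in the second one has. *)
Lemma K0_eq0 : inertia m (x t) = 0 -> K0 m x t = 0.
Proof.
move=> N0; have r0 : xinorm m (x t) = 0 by rewrite xinormE// N0 sqrtr0.
by rewrite /K0 -/r' (derive_xinorm_eq0 r0) r0; ring.
Qed.

Lemma speed2_ge0 : 0 <= speed2.
Proof.
by rewrite addr_ge0// mulr_ge0 ?addr_ge0 ?sqr_ge0// ltW ?mu1_gt0 ?mu2_gt0.
Qed.

Lemma K0_le_speed2 : 2 * K0 m x t <= speed2.
Proof.
have [N0|N0] := eqVneq (inertia m (x t)) 0.
 by rewrite K0_eq0// mulr0 speed2_ge0.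
have Ngt0 : 0 < inertia m (x t) by rewrite lt_def N0 inertia_ge0.
by rewrite -(ler_pM2r Ngt0) K0_speed2 gerDl oppr_le0 sqr_ge0.
Qed.

Lemma K0_ge0 : 0 <= K0 m x t.
Proof.
rewrite /K0; move: (mu1 m) (mu2 m) (ltW (mu1_gt0 hm)) (ltW (mu2_gt0 hm)) => k l k0 l0.
move: (derive1 _ _) (xinorm _ _) (normc _) => d r n.
have i0 : (0 : R) <= 2^-1 by rewrite invr_ge0.
have r4 : 0 <= r ^+ 4 by rewrite (exprM r 2 2) sqr_ge0.
rewrite addr_ge0// ?(mulr_ge0 i0) ?sqr_ge0// mulr_ge0 ?sqr_ge0//.
by rewrite mulr_ge0 ?divr_ge0 ?(mulr_ge0 k0)// (mulr_ge0 i0)// sqr_ge0.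
Qed.

Lemma derive_hopf_eq0 : inertia m (x t) = 0 ->
 enorm (fun i => derive1 (fun s => hopf m (x s) i) t) = 0.
Proof.
move=> N0; have := K0_hopf; rewrite N0 mulr0 mulr0 => /esym/eqP.
by rewrite sqrf_eq0 => /eqP.
Qed.
End KineticEnergy.

Local Notation xi1sq q := (X1 q ^+ 2 + Y1 q ^+ 2).
Local Notation xi2sq m q := (X2 m q ^+ 2 + Y2 m q ^+ 2).

Section Distances.
Variables (R : realType) (m : 'I_3 -> R).
Hypothesis hm : posm m.
Implicit Types (q : conf R).

Lemma cReB (z z' : R[i]) : Re (z - z') = Re z - Re z'.
Proof. by case: z z' => a b []. Qed.
Lemma cImB (z z' : R[i]) : Im (z - z') = Im z - Im z'.
Proof. by case: z z' => a b []. Qed.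
Lemma cReD (z z' : R[i]) : Re (z + z') = Re z + Re z'.
Proof. by case: z z' => a b []. Qed.
Lemma cImD (z z' : R[i]) : Im (z + z') = Im z + Im z'.
Proof. by case: z z' => a b []. Qed.
Lemma cReM (z z' : R[i]) : Re (z * z') =
 Re z * Re z' - Im z * Im z'.
Proof. by case: z z' => a b []. Qed.
Lemma cImM (z z' : R[i]) : Im (z * z') =
 Re z * Im z' + Im z * Re z'.
Proof. by case: z z' => a b []. Qed.
Lemma cReZ (k : R) (z : R[i]) : Re (k%:C%C * z) = k * Re z.
Proof. by case: z => a b; rewrite /= mul0r subr0. Qed.
Lemma cImZ (k : R) (z : R[i]) : Im (k%:C%C * z) = k * Im z.
Proof. by case: z => a b; rewrite /= mul0r addr0. Qed.
Lemma divC (z : R[i]) (k : R) : z / k%:C%C = (k^-1)%:C%C * z.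
Proof. by rewrite mulrC fmorphV. Qed.
Lemma complex_eq (z z' : R[i]) : Re z = Re z' ->
 Im z = Im z' -> z = z'.
Proof. by case: z z' => a b [c d] /= -> ->. Qed.
Lemma X1E q : X1 q = Re (q b2) - Re (q b1). Proof. exact: cReB. Qed.
Lemma Y1E q : Y1 q = Im (q b2) - Im (q b1). Proof. exact: cImB. Qed.
Lemma X2E q : X2 m q = Re (q b3) -
 (m b1 + m b2)^-1 * (m b1 * Re (q b1) + m b2 * Re (q b2)).
Proof. by rewrite /X2 /xi2 cReB divC cReZ cReD !cReZ. Qed.
Lemma Y2E q : Y2 m q = Im (q b3) -
 (m b1 + m b2)^-1 * (m b1 * Im (q b1) + m b2 * Im (q b2)).
Proof. by rewrite /Y2 /xi2 cImB divC cImZ cImD !cImZ. Qed.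

Let M12 : m b1 + m b2 != 0. Proof. by rewrite gt_eqF ?addr_gt0. Qed.

Lemma same_conf_xi q q' (u c : R[i]) : (forall i, q' i = u * q i + c) ->
 xi1 q' = u * xi1 q /\ xi2 m q' = u * xi2 m q.
Proof.
move=> H; rewrite /xi1 /xi2 !H; split; first by ring.
rewrite rmorphD /=; field.
by rewrite -rmorphD /= fmorph_eq0.
Qed.

Lemma same_conf_rdist q q' i j : same_conf q q' -> rdist q' i j = rdist q i j.
Proof.
move=> [u [c [u1 H]]]; rewrite /rdist !H opprD addrACA subrr addr0 -mulrBr.
by rewrite normcM u1 mul1r.
Qed.

Lemma same_conf_U q q' : same_conf q q' -> U m q' = U m q.
Proof.
move=> H; rewrite /U; apply: eq_bigr => i _; apply: eq_bigr => j _.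
by rewrite (same_conf_rdist _ _ H).
Qed.

Lemma same_conf_hopf q q' : same_conf q q' -> hopf m q' = hopf m q.
Proof.
move=> [u [c [u1 /same_conf_xi[H1 H2]]]].
have u2 : Re u ^+ 2 + Im u ^+ 2 = 1 by rewrite -sqr_normc u1 expr1n.
apply/funext => i; rewrite /hopf /X1 /Y1 /X2 /Y2 H1 H2 !cReM !cImM.
move: (Re u) (Im u) u2 => a b u2.
case: (xi1 q) => x1 y1; case: (xi2 m q) => x2 y2 /=.
case: (val i) => [|[|k]].
- transitivity ((a ^+ 2 + b ^+ 2) * (mu1 m * (x1 ^+ 2 + y1 ^+ 2) - mu2 m * (x2 ^+ 2 + y2 ^+ 2))).
 by ring.
 by rewrite u2 mul1r.
- transitivity ((a ^+ 2 + b ^+ 2) * - (2 * kappa m * (x1 * x2 + y1 * y2))); first by ring.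
 by rewrite u2 mul1r.
- transitivity ((a ^+ 2 + b ^+ 2) * (2 * kappa m * (y1 * x2 - x1 * y2))); first by ring.
 by rewrite u2 mul1r.
Qed.

Lemma same_conf_refl q : same_conf q q.
Proof.
exists 1, 0; split; last by move=> i; rewrite mul1r addr0.
by rewrite normc_sqrt /= expr1n expr0n addr0 sqrtr1.
Qed.

Lemma normc_eq0 (z : R[i]) : normc z = 0 -> z = 0.
Proof. exact: eq0_normc. Qed.
Lemma same_conf_sym q q' : same_conf q q' -> same_conf q' q.
Proof.
move=> [u [c [u1 H]]]; have u0 : u != 0.
 by apply: contra_eq_neq u1 => ->; rewrite normc0 eq_sym oner_eq0.
exists u^-1, (- (u^-1 * c)); split.
 apply: (@mulfI _ (normc u)); first by rewrite u1 oner_eq0.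
 by rewrite -normcM divff// normc1 u1 mulr1.
by move=> i; rewrite H; field.
Qed.

Lemma same_conf_trans q q' q'' : same_conf q q' -> same_conf q' q'' -> same_conf q q''.
Proof.
move=> [u [c [u1 H]]] [v [d [v1 K]]]; exists (v * u), (v * c + d); split.
 by rewrite normcM u1 v1 mulr1.
by move=> i; rewrite K H; ring.
Qed.

Lemma same_conf_of_xi q q' (u : R[i]) : normc u = 1 ->
 xi1 q' = u * xi1 q -> xi2 m q' = u * xi2 m q -> same_conf q q'.
Proof.
move=> u1 H1 H2; exists u, (q' b1 - u * q b1); split => //.
have e2 : q' b2 = u * q b2 + (q' b1 - u * q b1).
 by move: H1; rewrite /xi1 mulrBr => /eqP; rewrite subr_eq => /eqP ->; ring.
have hM : (m b1)%:C%C + (m b2)%:C%C != 0 :> R[i].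
 by rewrite -rmorphD /= fmorph_eq0.
have e3 : q' b3 = u * q b3 + (q' b1 - u * q b1).
 move: H2; rewrite /xi2 rmorphD /= => /eqP; rewrite subr_eq => /eqP ->.
 by rewrite e2; field.
move=> i; have [->|[->|->]] : i = b1 \/ i = b2 \/ i = b3.
- case: i => [[|[|[|//]]] Hi]; [left|right;left|right;right]; exact/val_inj.
- by ring.
- exact: e2.
- exact: e3.
Qed.

Lemma hopf_P q : mu1 m * (xi1sq q) = (inertia m q + hopf m q b1) / 2.
Proof. by rewrite /inertia /hopf /=; field. Qed.
Lemma hopf_S q : mu2 m * (xi2sq m q) = (inertia m q - hopf m q b1) / 2.
Proof. by rewrite /inertia /hopf /=; field. Qed.
(** The coordinates determine [|xi1|], [|xi2|] and the product of [xi1] with the conjugate of [xi2].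
    The rotation is read off [xi2], or off [xi1] when [xi2] vanishes. *)
Lemma hopf_inj q q' : hopf m q = hopf m q' -> same_conf q q'.
Proof.
move=> H.
have HN : inertia m q = inertia m q' by rewrite -!(enorm_hopf hm) H.
have k0 : 2 * kappa m != 0 by rewrite mulf_neq0 ?pnatr_eq0 ?gt_eqF ?kappa_gt0.
have HP : X1 q ^+ 2 + Y1 q ^+ 2 = X1 q' ^+ 2 + Y1 q' ^+ 2.
 apply: (@mulfI _ (mu1 m)); first by rewrite gt_eqF ?mu1_gt0.
 by rewrite !hopf_P HN H.
have HS : X2 m q ^+ 2 + Y2 m q ^+ 2 = X2 m q' ^+ 2 + Y2 m q' ^+ 2.
 apply: (@mulfI _ (mu2 m)); first by rewrite gt_eqF ?mu2_gt0.
 by rewrite !hopf_S HN H.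
have Hc : X1 q * X2 m q + Y1 q * Y2 m q = X1 q' * X2 m q' + Y1 q' * Y2 m q'.
 have := congr1 (fun f => f b2) H; rewrite /hopf /= => /oppr_inj.
 exact: mulfI.
have Hs : Y1 q * X2 m q - X1 q * Y2 m q = Y1 q' * X2 m q' - X1 q' * Y2 m q'.
 by have := congr1 (fun f => f b3) H; rewrite /hopf /=; exact: mulfI.
have nE (z z' : R[i]) : Re z ^+ 2 + Im z ^+ 2 =
 Re z' ^+ 2 + Im z' ^+ 2 -> normc z = normc z'.
 by rewrite !normc_sqrt => ->.
have n0 (z z' : R[i]) : Re z ^+ 2 + Im z ^+ 2 =
 Re z' ^+ 2 + Im z' ^+ 2 -> z = 0 -> z' = 0.
 by move=> /nE h z0; apply: normc_eq0; rewrite -h z0 normc0.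
have nd (z z' : R[i]) : Re z ^+ 2 + Im z ^+ 2 =
 Re z' ^+ 2 + Im z' ^+ 2 -> z != 0 -> normc (z' / z) = 1.
 move=> /nE h z0; have nz : normc z != 0 by apply: contra_neq z0; exact: normc_eq0.
 apply: (@mulIf _ (normc z)) => //; rewrite -normcM mulfVK// mul1r.
 by rewrite h.
have [z20|z20] := eqVneq (xi2 m q) 0.
 have z20' := n0 _ _ HS z20.
 have [z10|z10] := eqVneq (xi1 q) 0.
 have z10' := n0 _ _ HP z10.
 have n1 : normc (1 : R[i]) = 1.
 by rewrite normc_sqrt /= expr1n expr0n addr0 sqrtr1.
 apply: (same_conf_of_xi n1); first by rewrite z10 z10' mulr0.
 by rewrite z20 z20' mulr0.
 apply: (same_conf_of_xi (nd _ _ HP z10)); first by rewrite mulfVK.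
 by rewrite z20 z20' mulr0.
apply: (same_conf_of_xi (nd _ _ HS z20)); last by rewrite mulfVK.
apply: (@mulIf _ (xi2 m q)) => //; rewrite mulrAC mulfVK//.
have S0 : X2 m q ^+ 2 + Y2 m q ^+ 2 != 0.
 apply: contra_neq z20 => h; apply: normc_eq0; rewrite normc_sqrt.
 by rewrite -/(X2 m q) -/(Y2 m q) h sqrtr0.
move: HP HS Hc Hs S0; rewrite /X1 /Y1 /X2 /Y2.
case: (xi1 q) => x1 y1; case: (xi2 m q) => x2 y2.
case: (xi1 q') => x1' y1'; case: (xi2 m q') => x2' y2' /= HP HS Hc Hs S0.
apply: complex_eq => /=; apply: (mulfI S0).
- rewrite {1}HS.
 transitivity ((x1' * x2' + y1' * y2') * (x2 * x2' - y2 * y2') -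
 (y1' * x2' - x1' * y2') * (x2 * y2' + y2 * x2')); first by ring.
 by rewrite -Hc -Hs; ring.
- rewrite {1}HS.
 transitivity ((x1' * x2' + y1' * y2') * (x2 * y2' + y2 * x2') +
 (y1' * x2' - x1' * y2') * (x2 * x2' - y2 * y2')); first by ring.
 by rewrite -Hc -Hs; ring.
Qed.
End Distances.

(** * The potential and its truncation near collisions *)

Section Potential.
Variables (R : realType) (m : 'I_3 -> R).
Hypothesis hm : posm m.
Implicit Types (q : conf R) (e h c : R).

(** Distances below [e] are raised to [e]. The result is finite and Lipschitz along Lipschitz
    curves, and it equals [U] as long as no distance is below [e]. *)
Definition pot3 (e : R) q : R :=
 m b1 * m b2 / maxr (rdist q b1 b2) e + m b1 * m b3 / maxr (rdist q b1 b3) e +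
 m b2 * m b3 / maxr (rdist q b2 b3) e.

Lemma rdist_ge0 q i j : 0 <= rdist q i j.
Proof. exact: normc_ge0'. Qed.
Lemma rdistC q i j : rdist q i j = rdist q j i.
Proof. by rewrite /rdist -normcN opprB. Qed.
Lemma potentialE q : (U m q = (m b1 * m b2)%:E / (rdist q b1 b2)%:E +
 (m b1 * m b3)%:E / (rdist q b1 b3)%:E + (m b2 * m b3)%:E / (rdist q b2 b3)%:E)%E.
Proof.
have big3 (F : 'I_3 -> \bar R) : (\sum_(i < 3) F i = F b1 + F b2 + F b3)%E.
 rewrite !big_ord_recl big_ord0 adde0 addeA.
 by congr (_ + _ + _)%E; congr F; exact/val_inj.
have S (F : 'I_3 -> \bar R) (P : pred 'I_3) :
 (\sum_(j < 3 | P j) F j = (if P b1 then F b1 else 0) + (if P b2 then F b2 else 0)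
 + (if P b3 then F b3 else 0))%E by rewrite big_mkcond big3.
by rewrite /U big3 !S /= !add0e !adde0.
Qed.

Lemma div_ereal_ge (k r e : R) : 0 <= k -> 0 <= r -> 0 < e ->
 ((k / maxr r e)%:E <= k%:E / r%:E)%E.
Proof.
move=> k0 r0 e0; have [->|rn0] := eqVneq r 0.
 rewrite (max_idPr (ltW e0)); have [->|kn0] := eqVneq k 0; first by rewrite mul0r mul0e.
 by rewrite inve0 gt0_muley ?leey// lte_fin lt_def kn0.
have rgt0 : 0 < r by rewrite lt_def rn0.
rewrite inver (negbTE rn0) -EFinM lee_fin ler_wpM2l// lef_pV2 ?posrE//.
 by rewrite le_max lexx.
by rewrite lt_max rgt0.
Qed.

Lemma div_ereal_eq (k r e : R) : 0 < e -> e <= r ->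
 (k%:E / r%:E = (k / maxr r e)%:E)%E.
Proof.
by move=> e0 er; rewrite (max_idPl er) inver gt_eqF ?(lt_le_trans e0)// EFinM.
Qed.

Let k12 : 0 < m b1 * m b2. Proof. by rewrite mulr_gt0. Qed.
Let k13 : 0 < m b1 * m b3. Proof. by rewrite mulr_gt0. Qed.
Let k23 : 0 < m b2 * m b3. Proof. by rewrite mulr_gt0. Qed.

Lemma pot3_le e q : 0 < e -> ((pot3 e q)%:E <= U m q)%E.
Proof.
move=> e0; rewrite potentialE /pot3 !EFinD.
by rewrite !leeD// div_ereal_ge ?rdist_ge0 ?ltW.
Qed.

Lemma pot3_eq e q : 0 < e -> (forall i j, i != j -> e <= rdist q i j) ->
 U m q = (pot3 e q)%:E.
Proof.
move=> e0 H; rewrite potentialE /pot3 !EFinD.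
by rewrite !(@div_ereal_eq _ _ e)// H.
Qed.

Lemma pot3_mon e e' q : 0 < e' -> e' <= e -> pot3 e q <= pot3 e' q.
Proof.
move=> e0 ee'; have H k r : 0 < k -> k / maxr r e <= k / maxr r e'.
 move=> k0; apply: ler_wpM2l; first exact: ltW.
 rewrite lef_pV2 ?posrE ?lt_max ?e0 ?(lt_le_trans e0 ee') ?orbT//.
 by rewrite ge_max le_max lexx/= le_max ee' orbT.
by rewrite /pot3 !lerD ?H.
Qed.

Definition mmin : R := minr (m b1 * m b2) (minr (m b1 * m b3) (m b2 * m b3)).

Lemma mmin_gt0 : 0 < mmin. Proof. by rewrite !lt_min k12 k13. Qed.

Lemma mmin_le i j : i != j -> mmin <= m i * m j.
Proof.
have o : forall i : 'I_3, [\/ i = b1, i = b2 | i = b3].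
 by case=> [[|[|[|//]]] Hi]; [apply: Or31|apply: Or32|apply: Or33]; exact/val_inj.
have h1 : mmin <= m b1 * m b2 by rewrite ge_min lexx.
have h2 : mmin <= m b1 * m b3 by rewrite !ge_min lexx orbT.
have h3 : mmin <= m b2 * m b3 by rewrite !ge_min lexx !orbT.
by case: (o i) => ->; case: (o j) => -> //= _; rewrite // mulrC.
Qed.

Lemma pot3_big e q i j : 0 < e -> i != j -> rdist q i j <= e ->
 mmin / e <= pot3 e q.
Proof.
move=> e0; have p r : 0 <= (maxr r e)^-1 by rewrite invr_ge0 le_max (ltW e0) orbT.
have o : forall i : 'I_3, [\/ i = b1, i = b2 | i = b3].
 by case=> [[|[|[|//]]] Hi]; [apply: Or31|apply: Or32|apply: Or33]; exact/val_inj.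
have h12 : 0 <= m b1 * m b2 / maxr (rdist q b1 b2) e by rewrite mulr_ge0// ltW.
have h13 : 0 <= m b1 * m b3 / maxr (rdist q b1 b3) e by rewrite mulr_ge0// ltW.
have h23 : 0 <= m b2 * m b3 / maxr (rdist q b2 b3) e by rewrite mulr_ge0// ltW.
have H k l : k != l -> rdist q k l <= e -> mmin / e <= m k * m l / maxr (rdist q k l) e.
 by move=> kl /max_idPr ->; rewrite ler_pM2r ?invr_gt0// mmin_le.
move=> ij rij; have := H _ _ ij rij; rewrite /pot3.
case: (o i) ij rij => -> ; case: (o j) => -> //= _ _;
 rewrite ?(rdistC q b2 b1) ?(rdistC q b3 b1) ?(rdistC q b3 b2)
 ?(mulrC (m b2) (m b1)) ?(mulrC (m b3) (m b1)) ?(mulrC (m b3) (m b2)); lra.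
Qed.

(** A single pair closer than [mmin m / h] would already contribute more than [h]. *)
Lemma U_le_rdist h q i j : 0 < h -> (U m q <= h%:E)%E -> i != j -> mmin / h <= rdist q i j.
Proof.
move=> h0 Uh ij; rewrite leNgt; apply/negP => rij.
pose e := mmin / (2 * h); have mp := mmin_gt0.
pose e' := maxr (rdist q i j) (mmin / (2 * h)).
have e'0 : 0 < e' by rewrite lt_max divr_gt0 ?orbT// mulr_gt0.
have e'h : e' < mmin / h.
 rewrite gt_max rij/= ltr_pM2l// ltf_pV2 ?posrE// ?mulr_gt0//.
 by rewrite mulr_natl mulr2n ltrDl.
have h1 : mmin / e' <= pot3 e' q.
 by apply: (pot3_big e'0 ij); rewrite le_max lexx.
have : ((pot3 e' q)%:E <= h%:E)%E by apply: le_trans Uh; exact: pot3_le.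
rewrite lee_fin => h2; have := le_trans h1 h2; rewrite leNgt => /negP; apply.
by rewrite ltr_pdivlMr// mulrC -ltr_pdivlMr.
Qed.

(** Half of the smallest distance compatible with [U <= h]. A pair at this distance or closer brings
    the truncated potential to [2 h] at least, so [U] and its truncation agree on which side of the
    level [h] a configuration lies. *)
Definition ereg h : R := mmin / (2 * h).

Lemma ereg_gt0 h : 0 < h -> 0 < ereg h.
Proof. by move=> h0; rewrite divr_gt0 ?mmin_gt0// mulr_gt0. Qed.
Lemma U_le_potential3 h q : 0 < h ->
 (U m q <= h%:E)%E -> U m q = (pot3 (ereg h) q)%:E.
Proof.
move=> h0 Uh; apply: pot3_eq; first exact: ereg_gt0.
move=> i j ij; apply: le_trans (U_le_rdist h0 Uh ij).
rewrite ler_pM2l ?mmin_gt0// lef_pV2 ?posrE ?mulr_gt0//.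
by rewrite mulr_natl mulr2n lerDl ltW.
Qed.

Lemma pot3_le_U h q : 0 < h -> pot3 (ereg h) q <= h ->
 U m q = (pot3 (ereg h) q)%:E.
Proof.
move=> h0 ph; have e0 := ereg_gt0 h0; apply: pot3_eq => // i j ij.
rewrite leNgt; apply/negP => /ltW rij.
have := le_trans (pot3_big e0 ij rij) ph.
rewrite /ereg invf_div mulrA mulrAC divff ?gt_eqF ?mmin_gt0// mul1r.
by rewrite leNgt => /negP; apply; rewrite mulr_natl mulr2n ltrDl.
Qed.

Lemma hillP h q : 0 < h -> hill m h q <-> h <= pot3 (ereg h) q.
Proof.
move=> h0; rewrite /hill/=; split=> [hU|hp]; last first.
 by apply: le_trans (pot3_le q (ereg_gt0 h0)); rewrite lee_fin.
have [//|ph] := leP h (pot3 (ereg h) q).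
by have := hU; rewrite (pot3_le_U h0 (ltW ph)) lee_fin leNgt ph.
Qed.

Lemma hill_boundaryP h q : 0 < h -> hill_boundary m h q <-> pot3 (ereg h) q = h.
Proof.
move=> h0; rewrite /hill_boundary/=; split=> [Uh|ph].
 by apply/EFin_inj; rewrite -U_le_potential3 ?Uh.
by rewrite (@pot3_le_U h) ?ph.
Qed.

Lemma U_leP h q : 0 < h -> (U m q <= h%:E)%E <-> pot3 (ereg h) q <= h.
Proof.
move=> h0; split=> [Uh|ph]; last by rewrite (pot3_le_U h0 ph) lee_fin.
by rewrite -lee_fin -U_le_potential3.
Qed.
End Potential.

(** * Lipschitz functions on an interval and Lipschitz curves of configurations *)

Section LipschitzOn.
Variables (R : realType) (a b : R).
Implicit Types f g : R -> R.

Definition lipon f : Prop := exists2 L, 0 <= L &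
 forall s t, a <= s <= b -> a <= t <= b -> `|f s - f t| <= L * `|s - t|.

Lemma lipon_bounded f : lipon f -> exists2 M, 0 <= M & forall s, a <= s <= b -> `|f s| <= M.
Proof.
move=> [L L0 fL]; have [ab|ab] := leP a b; last first.
 by exists 0 => // s /andP[as_ sb]; have := le_trans as_ sb; rewrite leNgt ab.
exists (`|f a| + L * (b - a)); first by rewrite addr_ge0// mulr_ge0// subr_ge0.
move=> s /andP[as_ sb]; rewrite -[f s](subrK (f a)) addrC (le_trans (ler_normD _ _))//.
rewrite lerD2l (le_trans (fL s a _ _)) ?as_ ?sb ?lexx ?ab//.
by rewrite ler_wpM2l// ger0_norm ?subr_ge0// lerD2r.
Qed.

Lemma lipon_cst k : lipon (fun=> k).
Proof. by exists 0 => // s t _ _; rewrite subrr normr0 mul0r. Qed.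
Lemma lipon_id : lipon id.
Proof. by exists 1 => // s t _ _; rewrite mul1r. Qed.
Lemma liponD f g : lipon f -> lipon g -> lipon (fun t => f t + g t).
Proof.
move=> [L L0 fL] [M M0 gM]; exists (L + M); first exact: addr_ge0.
move=> s t hs ht; rewrite opprD addrACA mulrDl (le_trans (ler_normD _ _))//.
by rewrite lerD ?fL ?gM.
Qed.

Lemma liponN f : lipon f -> lipon (fun t => - f t).
Proof. by move=> [L L0 fL]; exists L => // s t hs ht; rewrite -opprD normrN fL. Qed.
Lemma liponB f g : lipon f -> lipon g -> lipon (fun t => f t - g t).
Proof. by move=> hf hg; apply: liponD => //; exact: liponN. Qed.
Lemma liponM f g : lipon f -> lipon g -> lipon (fun t => f t * g t).
Proof.
move=> hf hg; have [A A0 fA] := lipon_bounded hf; have [B B0 gB] := lipon_bounded hg.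
case: hf hg => [L L0 fL] [M M0 gM]; exists (A * M + B * L).
 by rewrite addr_ge0 ?mulr_ge0.
move=> s t hs ht.
have -> : f s * g s - f t * g t = f s * (g s - g t) + g t * (f s - f t) by ring.
rewrite (le_trans (ler_normD _ _))// !normrM mulrDl lerD//.
 by rewrite -mulrA ler_pM ?fA ?gM.
by rewrite -mulrA ler_pM ?gB ?fL.
Qed.

Lemma liponZ k f : lipon f -> lipon (fun t => k * f t).
Proof. by apply: liponM; exact: lipon_cst. Qed.
Lemma lipon_ext f g : (forall t, a <= t <= b -> f t = g t) -> lipon f -> lipon g.
Proof. by move=> fg [L L0 fL]; exists L => // s t hs ht; rewrite -!fg ?fL. Qed.
Lemma lipon_dom f (F : seq (R -> R)) (k : R) : 0 <= k -> (forall g, List.In g F -> lipon g) ->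
 (forall s t, a <= s <= b -> a <= t <= b ->
 `|f s - f t| <= k * \sum_(g <- F) `|g s - g t|) -> lipon f.
Proof.
move=> k0 hF fF.
have [L L0 HL] : exists2 L, 0 <= L & forall s t, a <= s <= b -> a <= t <= b ->
 \sum_(g <- F) `|g s - g t| <= L * `|s - t|.
 elim: F hF {fF} => [|g F IH] hF.
 by exists 0 => // s t _ _; rewrite big_nil mul0r.
 have [|L L0 HL] := IH; first by move=> g' g'F; apply: hF; right.
 have [|M M0 HM] := hF g; first by left.
 exists (M + L); first exact: addr_ge0.
 by move=> s t hs ht; rewrite big_cons mulrDl lerD ?HM ?HL.
exists (k * L); first exact: mulr_ge0.
by move=> s t hs ht; rewrite (le_trans (fF s t hs ht))// -mulrA ler_wpM2l ?HL.
Qed.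

Lemma lipon_max f g : lipon f -> lipon g -> lipon (fun t => maxr (f t) (g t)).
Proof.
move=> hf hg; apply: (@lipon_dom _ [:: f; g] 1) => //.
 by move=> h [<-|[<-|[]]].
move=> s t _ _; rewrite !big_cons big_nil addr0 mul1r.
rewrite ler_norml /maxr; have := ler_norm (f s - f t); have := ler_norm (g s - g t).
have := ler_norm (f t - f s); have := ler_norm (g t - g s).
have := normr_ge0 (f t - f s); have := normr_ge0 (g t - g s).
rewrite (distrC (f s)) (distrC (g s)).
by case: ifPn; case: ifPn; rewrite -?leNgt => *; lra.
Qed.

Lemma lipon_sqrt2 f g : lipon f -> lipon g ->
 lipon (fun t => sqrt (f t ^+ 2 + g t ^+ 2)).
Proof.
move=> hf hg; apply: (@lipon_dom _ [:: f; g] 1) => //.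
 by move=> h [<-|[<-|[]]].
move=> s t _ _; rewrite !big_cons big_nil addr0 mul1r.
pose v u (i : 'I_2) := if i == ord0 then f u else g u.
have E u : sqrt (f u ^+ 2 + g u ^+ 2) = enorm (v u).
 by rewrite /enorm !big_ord_recl big_ord0 addr0 /v /=.
rewrite !E; have S w : enorm (fun i => v s i - v t i) <= w -> enorm (fun i => v t i - v s i) <= w ->
 `|enorm (v s) - enorm (v t)| <= w.
 move=> h1 h2; have := enormD (fun i => v s i - v t i) (v t).
 have := enormD (fun i => v t i - v s i) (v s).
 under eq_fun do rewrite subrK; under [in X in _ -> X]eq_fun do rewrite subrK.
 rewrite ler_norml; have -> : enorm (fun i => v t i) = enorm (v t) by [].
 have -> : enorm (fun i => v s i) = enorm (v s) by [].
 by move=> *; apply/andP; split; lra.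
apply: S.
- by apply: le_trans (enorm_le_sum _) _; rewrite !big_ord_recl big_ord0 addr0 /v/=.
- apply: le_trans (enorm_le_sum _) _; rewrite !big_ord_recl big_ord0 addr0 /v/=.
 by rewrite (distrC (f t)) (distrC (g t)).
Qed.

Lemma lipon_clamp f : a <= b -> lipon f ->
 exists2 L, 0 <= L & forall s t, `|f (clamp a b s) - f (clamp a b t)| <= L * `|s - t|.
Proof.
move=> ab [L L0 fL]; exists L => // s t.
apply: le_trans (fL _ _ _ _) _; [exact: clamp_itv|exact: clamp_itv|].
by rewrite ler_wpM2l// clamp_lipschitz.
Qed.

Lemma liponP f : lipon f <-> [lipschitz f t | t in `[a, b]%classic].
Proof.
split=> [[L L0 fL]|].
 exists L; split; first exact: num_real.
 move=> M LM [s t] /= [hs ht]; rewrite /= in_itv/= in hs; rewrite /= in_itv/= in ht.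
 by apply: le_trans (fL s t hs ht) _; rewrite ler_wpM2r// ltW.
move=> [M [_ HM]]; exists (maxr 0 M + 1).
 by rewrite addr_ge0// le_max lexx.
move=> s t hs ht; have := HM (maxr 0 M + 1) _ (s, t); apply => /=.
 by rewrite (le_lt_trans (_ : _ <= maxr 0 M)) ?le_max ?lexx ?orbT// ltrDl.
by split; rewrite in_itv/=.
Qed.

Lemma lipon_near_continuous f (t : R) : a <= b -> lipon f ->
 continuous (fun t => f (clamp a b t)).
Proof.
move=> ab hf u; have [L L0 fL] := lipon_clamp ab hf.
apply/cvgrPdist_le => e e0; near=> v.
apply: le_trans (fL _ _) _.
apply: (@le_trans _ _ (L * (e / (L + 1)))).
 apply: ler_wpM2l => //; near: v; apply: cvgr_dist_le => //.
 by rewrite divr_gt0// ltr_pwDr.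
by rewrite mulrA ler_pdivrMr ?ltr_pwDr// mulrDr mulr1 mulrC lerDl ltW.
Unshelve. all: by end_near. Qed.
End LipschitzOn.

Lemma lipon_sub (R : realType) (a b s t : R) (f : R -> R) : a <= s -> t <= b ->
 lipon a b f -> lipon s t f.
Proof.
move=> as_ tb [L L0 fL]; exists L => // u v /andP[su ut] /andP[sv vt].
by apply: fL; rewrite ?(le_trans as_) ?(le_trans _ tb).
Qed.

Section LipschitzCurves.
Variables (R : realType) (m : 'I_3 -> R).
Hypothesis hm : posm m.
Implicit Types (x y : R -> conf R) (a b s t : R).

Lemma lipcP a b x : lipc a b x <->
 forall i, lipon a b (fun t => Re (x t i)) /\ lipon a b (fun t => Im (x t i)).
Proof. by split=> H i; have [h1 h2] := H i; split; apply/liponP. Qed.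
Lemma lipc_sub a b s t x : a <= s -> t <= b ->
 lipc a b x -> lipc s t x.
Proof.
move=> as_ tb /lipcP H; apply/lipcP => i.
by have [h1 h2] := H i; split; apply: lipon_sub h1 || apply: lipon_sub h2.
Qed.

Variables (a b : R) (x : R -> conf R).
Hypothesis (xL : lipc a b x).

Lemma lipon_X1 : lipon a b (fun t => X1 (x t)).
Proof.
apply: (@lipon_ext _ _ _ (fun t => Re (x t b2) - Re (x t b1))).
 by move=> t _; rewrite X1E.
by move/lipcP : xL => H; apply: liponB; [exact: (H b2).1|exact: (H b1).1].
Qed.

Lemma lipon_Y1 : lipon a b (fun t => Y1 (x t)).
Proof.
apply: (@lipon_ext _ _ _ (fun t => Im (x t b2) - Im (x t b1))).
 by move=> t _; rewrite Y1E.
by move/lipcP : xL => H; apply: liponB; [exact: (H b2).2|exact: (H b1).2].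
Qed.

Lemma lipon_X2 : lipon a b (fun t => X2 m (x t)).
Proof.
apply: lipon_ext => [t _|]; first by rewrite X2E.
move/lipcP : xL => H; apply: liponB; first exact: (H b3).1.
by apply: liponZ; apply: liponD; apply: liponZ; [exact: (H b1).1|exact: (H b2).1].
Qed.

Lemma lipon_Y2 : lipon a b (fun t => Y2 m (x t)).
Proof.
apply: lipon_ext => [t _|]; first by rewrite Y2E.
move/lipcP : xL => H; apply: liponB; first exact: (H b3).2.
by apply: liponZ; apply: liponD; apply: liponZ; [exact: (H b1).2|exact: (H b2).2].
Qed.

Lemma lipon_rdist i j : lipon a b (fun t => rdist (x t) i j).
Proof.
apply: (@lipon_ext _ _ _ (fun t => sqrt
 ((Re (x t i) - Re (x t j)) ^+ 2 + (Im (x t i) - Im (x t j)) ^+ 2))).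
 by move=> t _; rewrite /rdist normc_sqrt cReB cImB.
move/lipcP : xL => H; apply: lipon_sqrt2; apply: liponB;
 by [exact: (H i).1|exact: (H j).1|exact: (H i).2|exact: (H j).2].
Qed.

Lemma lipon_xinorm : lipon a b (fun t => xinorm m (x t)).
Proof.
have p1 := mu1_gt0 hm; have p2 := mu2_gt0 hm.
apply: (@lipon_ext _ _ _ (fun t => sqrt
 (sqrt ((sqrt (mu1 m) * X1 (x t)) ^+ 2 + (sqrt (mu1 m) * Y1 (x t)) ^+ 2) ^+ 2 +
 sqrt ((sqrt (mu2 m) * X2 m (x t)) ^+ 2 + (sqrt (mu2 m) * Y2 m (x t)) ^+ 2) ^+ 2))).
 move=> t _; rewrite xinormE// !sqr_sqrtr ?addr_ge0 ?sqr_ge0//.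
 by rewrite !exprMn !sqr_sqrtr ?ltW// -!mulrDr.
by apply: lipon_sqrt2; apply: lipon_sqrt2; apply: liponZ;
 [exact: lipon_X1|exact: lipon_Y1|exact: lipon_X2|exact: lipon_Y2].
Qed.

Lemma lipon_inertia : lipon a b (fun t => inertia m (x t)).
Proof.
apply: (@lipon_ext _ _ _ (fun t => xinorm m (x t) * xinorm m (x t))).
 by move=> t _; rewrite -expr2 sqr_xinorm.
by apply: liponM; exact: lipon_xinorm.
Qed.

Lemma lipon_hopf i : lipon a b (fun t => hopf m (x t) i).
Proof.
have h1 := lipon_X1; have h2 := lipon_Y1; have h3 := lipon_X2; have h4 := lipon_Y2.
rewrite /hopf; case: (val i) => [|[|k]].
- apply: (@lipon_ext _ _ _ (fun t => mu1 m * (X1 (x t) * X1 (x t) + Y1 (x t) * Y1 (x t)) -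
 mu2 m * (X2 m (x t) * X2 m (x t) + Y2 m (x t) * Y2 m (x t)))).
 by move=> t _; rewrite !expr2.
 by apply: liponB; apply: liponZ; apply: liponD; exact: liponM.
- by apply: liponN; apply: liponZ; apply: liponD; exact: liponM.
- by apply: liponZ; apply: liponB; exact: liponM.
Qed.

(** Mass-weighted Jacobi coordinates: their Euclidean norm is [xinorm], and the squared speed in
    them is [speed2], which dominates [2 K0]. *)
Definition xivec q (i : 'I_4) : R := match val i with
 | 0 => sqrt (mu1 m) * X1 q
 | 1 => sqrt (mu1 m) * Y1 q
 | 2 => sqrt (mu2 m) * X2 m q
 | _ => sqrt (mu2 m) * Y2 m q
 end.

Lemma lipon_xivec i : lipon a b (fun t => xivec (x t) i).
Proof.
rewrite /xivec; case: (val i) => [|[|[|k]]]; apply: liponZ;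
 by [exact: lipon_X1|exact: lipon_Y1|exact: lipon_X2|exact: lipon_Y2].
Qed.
End LipschitzCurves.

(** * The action as a limit of weighted lengths *)

Section ActionDensity.
Variables (R : realType) (m : 'I_3 -> R) (h : R).
Hypotheses (hm : posm m) (hh : 0 < h).
Implicit Types (x y : R -> conf R) (q : conf R) (a b s t c : R).

Definition dens x t : \bar R :=
 ((sqrt (K0 m x t))%:E * sqrte (2%:E * (U m (x t) - h%:E)))%E.

Lemma actionE a b x : JM m h a b x = (\int[leb]_(t in `[a, b]) dens x t)%E.
Proof. by []. Qed.
Lemma dens_ge0 x t : (0 <= dens x t)%E.
Proof. by rewrite mule_ge0 ?lee_fin ?sqrtr_ge0 ?sqrte_ge0. Qed.
Lemma action_ge0 a b x : (0 <= JM m h a b x)%E.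
Proof. by rewrite actionE integral_ge0// => t _; exact: dens_ge0. Qed.
Lemma K0_near x y t : (\forall s \near t, x s = y s) -> K0 m x t = K0 m y t.
Proof.
move=> xy; have xyt : x t = y t by exact: nbhs_singleton xy.
have E (F : conf R -> R) : derive1 (fun s => F (x s)) t = derive1 (fun s => F (y s)) t.
 rewrite !derive1E; apply: near_eq_derive; apply: filterS xy => s xys.
 by rewrite xys.
rewrite /K0 xyt; congr (_ * _ ^+ 2 + _ * _ ^+ 2); first exact: E.
by congr (normc (_ * _ - _ * _)); rewrite /Defs.derivC; congr Complex;
 [exact: (E (fun q => Re (xi2 m q)))|exact: (E (fun q => Im (xi2 m q)))
 |exact: (E (fun q => Re (xi1 q)))|exact: (E (fun q => Im (xi1 q)))].
Qed.

Lemma dens_near x y t : (\forall s \near t, x s = y s) -> dens x t = dens y t.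
Proof.
move=> xy; have xyt : x t = y t by exact: nbhs_singleton xy.
by rewrite /dens (K0_near xy) xyt.
Qed.

Lemma eq_action a b x y : (forall t, a < t < b -> x t = y t) ->
 JM m h a b x = JM m h a b y.
Proof.
move=> xy; rewrite !actionE; apply: ae_eq_integral_ge0 => //.
- by move=> t _; exact: dens_ge0.
- by move=> t _; exact: dens_ge0.
apply: ae_itv_oo; apply: nearW => t tab; apply: dens_near.
have := near_in_itvoo tab; apply: filterS => s.
by rewrite in_itv/=; exact: xy.
Qed.

Definition ek (k : nat) : R := k.+1%:R^-1.
(** Truncated factors of the action density, nondecreasing in [k]. [vk] goes with the speed
    [sqrt (2 K0)] and approximates [sqrt (U - h)]. [wk] goes with the speed in Hopf coordinates: the
    density is [sqrt (U - h) / (2 sqrt N)] times that speed, where [N] is the inertia. *)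
Definition vk (k : nat) q : R := sqrt (maxr 0 (pot3 m (ek k) q - h)).
Definition wk (k : nat) q : R := vk k q / (2 * sqrt (maxr (inertia m q) (ek k))).

Lemma ek_gt0 k : 0 < ek k. Proof. by rewrite invr_gt0. Qed.

Lemma ek_mon k : ek k.+1 <= ek k.
Proof. by rewrite lef_pV2 ?posrE// ler_nat. Qed.
Lemma vk_ge0 k q : 0 <= vk k q. Proof. exact: sqrtr_ge0. Qed.

Lemma vk_mon k q : vk k q <= vk k.+1 q.
Proof.
rewrite ler_wsqrtr// ge_max !le_max lexx/=; apply/orP; right.
by rewrite lerD2r pot3_mon ?ek_gt0 ?ek_mon.
Qed.

Let dgt0 k q : 0 < 2 * sqrt (maxr (inertia m q) (ek k)).
Proof. by rewrite mulr_gt0// sqrtr_gt0 lt_max ek_gt0 orbT. Qed.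
Lemma wk_ge0 k q : 0 <= wk k q.
Proof. by rewrite mulr_ge0 ?vk_ge0// invr_ge0 ltW. Qed.
Lemma wk_mon k q : wk k q <= wk k.+1 q.
Proof.
rewrite ler_pM ?vk_ge0 ?invr_ge0 ?(ltW (dgt0 _ _)) ?vk_mon// lef_pV2 ?posrE//.
rewrite ler_pM2l// ler_wsqrtr// ge_max le_max lexx/= le_max ek_mon orbT//.
Qed.

Lemma vk_rate k q c : 0 < c -> c <= vk k q -> ((c ^+ 2 + h)%:E <= U m q)%E.
Proof.
move=> c0 cv.
have : c ^+ 2 <= maxr 0 (pot3 m (ek k) q - h).
 by rewrite -[leRHS]sqr_sqrtr ?le_max ?lexx// lerXn2r ?nnegrE ?vk_ge0// ltW.
rewrite le_max leNgt exprn_gt0//= => h1.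
apply: le_trans (pot3_le hm q (ek_gt0 k)); rewrite lee_fin; lra.
Qed.

(** This is [c <= sqrt (U - h) / (2 sqrt N)] cleared of roots and quotients. The cleared form makes
    sense at every collision and depends only on the class of [q]; all lower bounds of the weight
    are passed on in this form. *)
Lemma wk_rate k q c : 0 < c -> c <= wk k q ->
 ((4 * c ^+ 2 * inertia m q + h)%:E <= U m q)%E.
Proof.
move=> c0; rewrite /wk ler_pdivlMr// => /vk_rate.
move=> /(_ (mulr_gt0 c0 (dgt0 _ _))); apply: le_trans.
rewrite lee_fin lerD2r !exprMn sqr_sqrtr ?le_max ?(ltW (ek_gt0 _)) ?orbT//.
have -> : c ^+ 2 * (2 ^+ 2 * maxr (inertia m q) (ek k)) =
 4 * c ^+ 2 * maxr (inertia m q) (ek k) by ring.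
have c4 : 0 <= 4 * c ^+ 2 by rewrite mulr_ge0 ?sqr_ge0.
by apply: ler_wpM2l => //; rewrite le_max lexx.
Qed.

Lemma vk_cvg q : ((forall k, U m q != (pot3 m (ek k) q)%:E) /\ U m q = +oo%E /\
 forall A : R, \forall k \near \oo, A <= vk k q) \/
 exists2 u, U m q = u%:E & \forall k \near \oo, vk k q = sqrt (maxr 0 (u - h)).
Proof.
have [[i [j [ij r0]]]|H] := pselect (exists i j, i != j /\ rdist q i j = 0).
 have big k : mmin m * k.+1%:R <= pot3 m (ek k) q.
 have := @pot3_big _ _ hm (ek k) q i j (ek_gt0 k) ij.
 by rewrite r0 (ltW (ek_gt0 k)) /ek invrK => /(_ isT).
 have Uoo : U m q = +oo%E.
 apply/eqyP => A A0; apply: le_trans (pot3_le hm q (ek_gt0 (Num.truncn (A / mmin m)))).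
 rewrite lee_fin (le_trans _ (big _))// -ler_pdivrMl ?mmin_gt0// mulrC.
 by rewrite ltW// truncnS_gt.
 left; split; first by move=> k; rewrite Uoo.
 split => // A.
 exists (Num.truncn ((A ^+ 2 + h) / mmin m)) => // k /= kA.
 have [A0|A0] := leP A 0; first exact: le_trans A0 (vk_ge0 _ _).
 rewrite -[A](gtr0_norm A0) -sqrtr_sqr ler_wsqrtr// le_max; apply/orP; right.
 rewrite lerBrDr (le_trans _ (big _))// -ler_pdivrMl ?mmin_gt0// mulrC.
 rewrite ltW// (lt_le_trans (truncnS_gt _))// ler_nat ltnS//.
right.
have r_gt0 i j : i != j -> 0 < rdist q i j.
 move=> ij; rewrite lt_def rdist_ge0 andbT; apply/eqP => r0.
 by apply: H; exists i, j.
pose e := minr (rdist q b1 b2) (minr (rdist q b1 b3) (rdist q b2 b3)).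
have e0 : 0 < e by rewrite !lt_min !r_gt0.
have o : forall i : 'I_3, [\/ i = b1, i = b2 | i = b3].
 by case=> [[|[|[|//]]] Hi]; [apply: Or31|apply: Or32|apply: Or33]; exact/val_inj.
have er i j : i != j -> e <= rdist q i j.
 have h1 : e <= rdist q b1 b2 by rewrite ge_min lexx.
 have h2 : e <= rdist q b1 b3 by rewrite !ge_min lexx orbT.
 have h3 : e <= rdist q b2 b3 by rewrite !ge_min lexx !orbT.
 by case: (o i) => ->; case: (o j) => -> //= _; rewrite // rdistC.
exists (pot3 m e q); first exact: pot3_eq.
exists (Num.truncn e^-1) => // k /= ke.
have eke : ek k <= e.
 rewrite -[e]invrK lef_pV2 ?posrE ?invr_gt0//.
 by rewrite ltW// (lt_le_trans (truncnS_gt _))// ler_nat ltnS.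
rewrite /vk; congr (sqrt (maxr 0 (_ - h))).
apply: EFin_inj; rewrite -!pot3_eq ?ek_gt0// => i j ij.
exact: le_trans eke (er _ _ ij).
Qed.

Lemma sqrte_real (u : R) : sqrte (2%:E * (u%:E - h%:E)) = (sqrt (2 * (u - h)))%:E.
Proof. by []. Qed.
Lemma sqrte_oo : sqrte (2%:E * (+oo - h%:E))%E = +oo%E.
Proof. by rewrite addye ?ltNyr// gt0_muley ?lte_fin. Qed.
Lemma is_cvg_vk q S : 0 <= S -> cvgn (fun k => (vk k q * S)%:E).
Proof.
move=> S0; apply: ereal_nondecreasing_is_cvgn; apply/nondecreasing_seqP => k.
by rewrite lee_fin ler_wpM2r ?vk_mon.
Qed.

Lemma is_cvg_wk q S : 0 <= S -> cvgn (fun k => (wk k q * S)%:E).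
Proof.
move=> S0; apply: ereal_nondecreasing_is_cvgn; apply/nondecreasing_seqP => k.
by rewrite lee_fin ler_wpM2r ?wk_mon.
Qed.

(** Where [K0] vanishes at a collision, both sides are 0 by the convention that 0 times infinity is
    0. *)
Lemma dens_limE x t :
 dens x t = limn (fun k => (vk k (x t) * sqrt (2 * K0 m x t))%:E).
Proof.
have K := K0_ge0 hm x t.
rewrite /dens; have [K00|K00] := eqVneq (K0 m x t) 0.
 rewrite K00 sqrtr0 mul0e; apply/esym/cvg_lim => //.
 under eq_fun do rewrite mulr0 sqrtr0 mulr0.
 exact: cvg_cst.
have Kp : 0 < K0 m x t by rewrite lt_def K00.
have sK : 0 < sqrt (2 * K0 m x t) by rewrite sqrtr_gt0 mulr_gt0.
have [[_ [Uoo H]]|[u Uu H]] := vk_cvg (x t).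
 rewrite Uoo sqrte_oo gt0_muley ?lte_fin ?sqrtr_gt0//; apply/esym.
 apply/eqyP => A A0; apply: lime_ge; first by apply: is_cvg_vk; exact: ltW.
 apply: filterS (H (A / sqrt (2 * K0 m x t))) => k.
 by rewrite lee_fin ler_pdivrMr.
rewrite Uu sqrte_real; apply/esym/lim_near_cst => //.
apply: filterS H => k ->; rewrite -EFinM; congr EFin.
have [u0|u0] := leP (u - h) 0.
 by rewrite sqrtr0 mul0r (@ler0_sqrtr _ (2 * (u - h))) ?mulr0// mulr_ge0_le0.
by rewrite !sqrtrM//; ring.
Qed.

Lemma dens_wk_lim x t S : 0 <= S -> (inertia m (x t) = 0 -> K0 m x t = 0 /\ S = 0) ->
 K0 m x t * (8 * inertia m (x t)) = S ^+ 2 ->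
 dens x t = limn (fun k => (wk k (x t) * S)%:E).
Proof.
move=> S0 H0 HK; rewrite dens_limE.
have [N0|N0] := eqVneq (inertia m (x t)) 0.
 have [-> ->] := H0 N0; rewrite mulr0 sqrtr0.
 by congr (limn _); apply/funext => k; rewrite !mulr0.
have Np : 0 < inertia m (x t) by rewrite lt_def N0 inertia_ge0.
have E : \forall k \near \oo, (vk k (x t) * sqrt (2 * K0 m x t))%:E = (wk k (x t) * S)%:E.
 exists (Num.truncn (inertia m (x t))^-1) => // k /= ke.
 have eke : ek k <= inertia m (x t).
 rewrite -[inertia _ _]invrK lef_pV2 ?posrE ?invr_gt0//.
 by rewrite ltW// (lt_le_trans (truncnS_gt _))// ler_nat ltnS.
 rewrite /wk (max_idPl eke); congr EFin; rewrite -mulrA; congr (_ * _).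
 have s2 : 2 = sqrt (2 ^+ 2) :> R by rewrite sqrtr_sqr ger0_norm.
 apply: (@mulfI _ (2 * sqrt (inertia m (x t)))).
 by rewrite mulf_neq0 ?pnatr_eq0// gt_eqF// sqrtr_gt0.
 rewrite mulVKf; last by rewrite mulf_neq0 ?pnatr_eq0// gt_eqF// sqrtr_gt0.
 rewrite -[RHS](ger0_norm S0) -sqrtr_sqr -HK {1}s2 -!sqrtrM ?mulr_ge0 ?sqr_ge0 ?inertia_ge0//.
 by congr sqrt; ring.
apply/esym/cvg_lim => //.
have := is_cvg_vk (q := x t) (sqrtr_ge0 (2 * K0 m x t)).
by apply: cvg_trans; apply: near_eq_cvg.
Qed.

Lemma dens_ge x t c S : 0 <= c -> 0 <= S -> S ^+ 2 = 2 * K0 m x t ->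
 ((c ^+ 2 + h)%:E <= U m (x t))%E -> ((c * S)%:E <= dens x t)%E.
Proof.
move=> c0 S0 SK cU; rewrite /dens.
have [K00|K00] := eqVneq (K0 m x t) 0.
 rewrite K00 sqrtr0 mul0e lee_fin.
 by move: SK; rewrite K00 mulr0 => /eqP; rewrite sqrf_eq0 => /eqP ->; rewrite mulr0.
have Kp : 0 < K0 m x t by rewrite lt_def K00 K0_ge0.
case: (U m (x t)) cU => [u| |//]; last first.
 by rewrite sqrte_oo gt0_muley ?leey// lte_fin sqrtr_gt0.
rewrite lee_fin sqrte_real -EFinM lee_fin => cu.
have uh : 0 <= u - h by have := sqr_ge0 c; lra.
rewrite -sqrtrM ?(ltW Kp)// -[leLHS]ger0_norm ?mulr_ge0// -sqrtr_sqr ler_wsqrtr//.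
rewrite exprMn SK; have -> : K0 m x t * (2 * (u - h)) = (u - h) * (2 * K0 m x t) by ring.
by rewrite ler_wpM2r ?mulr_ge0 ?(ltW Kp)//; lra.
Qed.
End ActionDensity.

Lemma common_lipschitz (R : realType) (n : nat) (F : 'I_n -> R -> R) :
 (forall i, exists2 L, 0 <= L & forall s t, `|F i s - F i t| <= L * `|s - t|) ->
 exists L, forall i s t, `|F i s - F i t| <= L * `|s - t|.
Proof.
move=> H; have /choice[L LP] : forall i, exists L, 0 <= L /\ forall s t, `|F i s - F i t| <= L * `|s - t|.
 by move=> i; have [L] := H i; exists L.
exists (\sum_i L i) => i s t; have [L0 HL] := LP i.
apply: le_trans (HL s t) _; apply: ler_wpM2r => //.
by rewrite (bigD1 i)//= lerDl sumr_ge0// => j _; have [] := LP j.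
Qed.

Lemma common_lipschitz2 (R : realType) (n p : nat) (F : 'I_n -> R -> R) (W : 'I_p -> R -> R) :
 (forall i, exists2 L, 0 <= L & forall s t, `|F i s - F i t| <= L * `|s - t|) ->
 (forall j, exists2 L, 0 <= L & forall s t, `|W j s - W j t| <= L * `|s - t|) ->
 exists2 L, forall i s t, `|F i s - F i t| <= L * `|s - t| &
 forall j s t, `|W j s - W j t| <= L * `|s - t|.
Proof.
move=> /common_lipschitz[L1 H1] /common_lipschitz[L2 H2].
have l1 : L1 <= maxr L1 L2 by rewrite le_max lexx.
have l2 : L2 <= maxr L1 L2 by rewrite le_max lexx orbT.
exists (maxr L1 L2) => i s t.
 by apply: le_trans (H1 i s t) _; apply: ler_wpM2r l1.
by apply: le_trans (H2 i s t) _; apply: ler_wpM2r l2.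
Qed.

Section ContinuityRules.
Variables (R : realType) (T : topologicalType).
Implicit Types f g : T -> R.

Lemma cont_max f g : continuous f -> continuous g -> continuous (fun t => maxr (f t) (g t)).
Proof.
move=> cf cg t; under eq_fun do rewrite maxr_absE.
apply: cvgM; last exact: cvg_cst.
apply: cvgD; first by apply: cvgD; [exact: cf|exact: cg].
by apply: cvg_norm; apply: cvgB; [exact: cf|exact: cg].
Qed.

Lemma cont_inv f : continuous f -> (forall t, f t != 0) -> continuous (fun t => (f t)^-1).
Proof. by move=> cf f0 t; apply: cvgV => //; exact: cf. Qed.
Lemma contM f g : continuous f -> continuous g -> continuous (fun t => f t * g t).
Proof. by move=> cf cg t; apply: cvgM; [exact: cf|exact: cg]. Qed.
Lemma contD f g : continuous f -> continuous g -> continuous (fun t => f t + g t).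
Proof. by move=> cf cg t; apply: cvgD; [exact: cf|exact: cg]. Qed.
Lemma cont_cst (k : R) : continuous (fun _ : T => k).
Proof. by move=> t; exact: cvg_cst. Qed.
Lemma cont_sqrt f : continuous f -> continuous (fun t => sqrt (f t)).
Proof. by move=> cf t; apply: continuous_comp; [exact: cf|exact: sqrt_continuous]. Qed.
End ContinuityRules.

Section ContinuousWeights.
Variables (R : realType) (m : 'I_3 -> R) (h : R) (y : R -> conf R).
Hypothesis cr : forall i j, continuous (fun t => rdist (y t) i j).

Lemma continuous_vk k : continuous (fun t => vk m h k (y t)).
Proof.
have ci i j : continuous (fun t => (maxr (rdist (y t) i j) (ek R k))^-1).
 apply: cont_inv; last by move=> t; rewrite gt_eqF// lt_max ek_gt0 orbT.
 by apply: cont_max; [exact: cr|exact: cont_cst].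
apply: cont_sqrt; apply: cont_max; first exact: cont_cst.
apply: contD; last exact: cont_cst.
by rewrite /pot3; apply: contD; first apply: contD;
 apply: contM; (exact: cont_cst || exact: ci).
Qed.

Lemma continuous_wk k : continuous (fun t => inertia m (y t)) ->
 continuous (fun t => wk m h k (y t)).
Proof.
move=> cN; apply: contM; first exact: continuous_vk.
apply: cont_inv; last first.
 by move=> t; rewrite gt_eqF// mulr_gt0// sqrtr_gt0 lt_max ek_gt0 orbT.
apply: contM; first exact: cont_cst.
by apply: cont_sqrt; apply: cont_max; [exact: cN|exact: cont_cst].
Qed.
End ContinuousWeights.

(** The curve is frozen outside [[a, b]], which makes its coordinates Lipschitz on the whole line,
    as the integration lemmas require. *)
Definition clampc (R : realType) (a b : R) (x : R -> conf R) : R -> conf R :=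
 fun t => x (clamp a b t).

(** [xinorm] is listed with the Jacobi coordinates because [K0] differentiates it, and at the triple
    collision its differentiability does not follow from theirs. *)
Definition coords (R : realType) (m : 'I_3 -> R) (y : R -> conf R) (j : 'I_5) (t : R) : R :=
 match val j with
 | 0 => X1 (y t) | 1 => Y1 (y t) | 2 => X2 m (y t) | 3 => Y2 m (y t)
 | _ => xinorm m (y t) end.

Section Pointwise.
Variables (R : realType) (m : 'I_3 -> R) (h : R).
Hypotheses (hm : posm m) (hh : 0 < h).
Variables (y : R -> conf R) (t : R).
Hypothesis dW : forall j, derivable (coords m y j) t 1.

Lemma coords_derivable : [/\ derivable (fun s => X1 (y s)) t 1,
 derivable (fun s => Y1 (y s)) t 1, derivable (fun s => X2 m (y s)) t 1,
 derivable (fun s => Y2 m (y s)) t 1 & derivable (fun s => xinorm m (y s)) t 1].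
Proof.
have d j (f : R -> R) : coords m y j = f -> derivable f t 1 by move=> <-; exact: dW.
split; [exact: (d (@Ordinal 5 0 isT))|exact: (d (@Ordinal 5 1 isT))
 |exact: (d (@Ordinal 5 2 isT))|exact: (d (@Ordinal 5 3 isT))
 |exact: (d (@Ordinal 5 4 isT))].
Qed.

Let S : R := enorm (fun i => derive1 (fun s => hopf m (y s) i) t).

Lemma K0_hopf_coords : K0 m y t * (8 * inertia m (y t)) = S ^+ 2 /\
 (inertia m (y t) = 0 -> K0 m y t = 0 /\ S = 0).
Proof.
have [d1 d2 d3 d4 d5] := coords_derivable.
split; first exact: (K0_hopf hm d1 d2 d3 d4 d5).
by move=> N0; split; [exact: (K0_eq0 d5)|exact: (derive_hopf_eq0 hm d1 d2 d3 d4 d5)].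
Qed.

Lemma dens_ge_hopf c : 0 <= c -> ((4 * c ^+ 2 * inertia m (y t) + h)%:E <= U m (y t))%E ->
 ((c * S)%:E <= dens m h y t)%E.
Proof.
move=> c0 cU; have [HK HN] := K0_hopf_coords.
have S0 : 0 <= S by exact: enorm_ge0.
have [N0|N0] := eqVneq (inertia m (y t)) 0.
 by have [_ ->] := HN N0; rewrite mulr0 dens_ge0.
have Np : 0 < inertia m (y t) by rewrite lt_def N0 inertia_ge0.
move: (inertia m (y t)) HK HN N0 Np cU => N HK HN N0 Np cU.
have sN : 0 < sqrt N by rewrite sqrtr_gt0.
have -> : c * S = (2 * c * sqrt N) * (S / (2 * sqrt N)).
 by field; rewrite gt_eqF.
have c0' : 0 <= 2 * c * sqrt N by rewrite !mulr_ge0// ltW.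
have S0' : 0 <= S / (2 * sqrt N) by rewrite divr_ge0// mulr_ge0// ltW.
apply: (dens_ge hm c0' S0').
- rewrite expr_div_n -HK exprMn sqr_sqrtr ?(ltW Np)//; field.
 by rewrite N0.
- rewrite exprMn sqr_sqrtr ?(ltW Np)//.
 by have -> : (2 * c) ^+ 2 * N + h = 4 * c ^+ 2 * N + h by ring.
Qed.

Let Sx : R := enorm (fun i => derive1 (fun s => xivec m (y s) i) t).

Lemma derive_xivec : Sx ^+ 2 = speed2 m y t.
Proof.
have [d1 d2 d3 d4 d5] := coords_derivable.
have e k (f : R -> R) : derivable f t 1 -> derive1 (fun s => k * f s) t = k * derive1 f t.
 by move=> df; exact: isd_derive1 (isdZ k (derivable_isd df)).
have p1 := ltW (mu1_gt0 hm); have p2 := ltW (mu2_gt0 hm).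
rewrite sqr_enorm !big_ord_recl big_ord0 addr0 /speed2 /xivec/=.
rewrite (e _ _ d1) (e _ _ d2) (e _ _ d3) (e _ _ d4) !exprMn.
by rewrite (sqr_sqrtr p1) (sqr_sqrtr p2); ring.
Qed.

Lemma dens_le_xi : (dens m h y t <= limn (fun k => (vk m h k (y t) * Sx)%:E))%E.
Proof.
have [d1 d2 d3 d4 d5] := coords_derivable; have Sx0 : 0 <= Sx by exact: enorm_ge0.
rewrite (dens_limE h hm).
apply: lee_lim; [exact: (is_cvg_vk hm (sqrtr_ge0 _))|exact: (is_cvg_vk hm)|].
apply: nearW => k; rewrite lee_fin; apply: ler_wpM2l; first exact: vk_ge0.
rewrite -[leRHS](ger0_norm Sx0) -sqrtr_sqr ler_wsqrtr// derive_xivec.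
exact: (K0_le_speed2 hm d1 d2 d3 d4 d5).
Qed.

(* On isosceles curves drawn in a fixed frame the kinetic energy is entirely
 reduced, so the bound by the configuration speed is sharp. *)
Lemma dens_ge_isosceles c : 0 <= c ->
 (\forall s \near t, X1 (y s) = 0 /\ Y2 m (y s) = 0) ->
 ((c ^+ 2 + h)%:E <= U m (y t))%E -> ((c * Sx)%:E <= dens m h y t)%E.
Proof.
move=> c0 ny cU; have [d1 d2 d3 d4 d5] := coords_derivable.
have Sx0 : 0 <= Sx by exact: enorm_ge0.
apply: (dens_ge hm c0 Sx0 _ cU); rewrite derive_xivec.
have near0 (f : R -> R) : (\forall s \near t, f s = 0) -> derive1 f t = 0.
 move=> Hf; rewrite derive1E (_ : 'D_1 f t = 'D_1 (fun=> 0 : R) t); last exact: near_eq_derive.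
 by rewrite -derive1E; exact: isd_derive1 (isd_cst t 0).
have z1 : derive1 (fun s => X1 (y s)) t = 0 by apply: near0; apply: filterS ny => s [].
have z2 : derive1 (fun s => Y2 m (y s)) t = 0 by apply: near0; apply: filterS ny => s [].
have [x0 y0] := nbhs_singleton ny.
have mom0 : moment m y t = 0 by rewrite /moment z1 z2 x0 y0; ring.
have := K0_speed2 hm d1 d2 d3 d4 d5; rewrite mom0 expr0n subr0.
have [N0 _|N0 /(mulIf N0) <-//] := eqVneq (inertia m (y t)) 0.
have r0 : xinorm m (y t) = 0 by rewrite xinormE// N0 sqrtr0.
rewrite (K0_eq0 d5 N0) mulr0.
(* At the triple collision Lagrange's identity is empty. There each weighted coordinate is dominated
   by [xinorm], which vanishes with its derivative, so all the speeds are zero. *)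
have sm (f : R -> R) k : 0 < k -> (forall s, `|k * f s| <= xinorm m (y s)) ->
 derivable f t 1 -> derive1 f t = 0.
 move=> k0 fr df; have dr := derivable_isd d5; rewrite (derive_xinorm_eq0 d5 r0) in dr.
 have f0 : f t = 0.
 have := fr t; rewrite r0 normr_le0 mulf_eq0 gt_eqF//= => /eqP //.
 have hd : isd f t 0.
 apply/is_derive_eps => e' e0; move/is_derive_eps : dr => /(_ (k * e') (mulr_gt0 k0 e0))[d d0 dP].
 exists d => // u ud; have := dP u ud; rewrite r0 f0 !mul0r !subr0.
 move=> hu; rewrite -(ler_pM2l k0) mulrA; apply: le_trans hu.
 rewrite -[X in X * `|f _|](gtr0_norm k0) -normrM; apply: le_trans (fr _) _.
 exact: ler_norm.
 exact: isd_derive1 hd.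
have p1 := mu1_gt0 hm; have p2 := mu2_gt0 hm.
have bd k v s : 0 <= k -> k * v ^+ 2 <= inertia m (y s) -> `|sqrt k * v| <= xinorm m (y s).
 move=> k0 hk; rewrite xinormE -sqrtr_sqr ler_wsqrtr// exprMn sqr_sqrtr//.
have q1 s : 0 <= mu1 m * (xi1sq (y s)) by apply: mulr_ge0; rewrite ?addr_ge0 ?sqr_ge0// ltW.
have q2 s : 0 <= mu2 m * (xi2sq m (y s)) by apply: mulr_ge0; rewrite ?addr_ge0 ?sqr_ge0// ltW.
have zz1 : derive1 (fun s => Y1 (y s)) t = 0.
 apply: (sm _ (sqrt (mu1 m))); [by rewrite sqrtr_gt0|move=> s|assumption].
 apply: bd (ltW p1) _; rewrite /inertia.
 have : 0 <= mu1 m * X1 (y s) ^+ 2 by apply: mulr_ge0; rewrite ?sqr_ge0// ltW.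
 by have := q2 s; rewrite mulrDr; lra.
have zz2 : derive1 (fun s => X2 m (y s)) t = 0.
 apply: (sm _ (sqrt (mu2 m))); [by rewrite sqrtr_gt0|move=> s|assumption].
 apply: bd (ltW p2) _; rewrite /inertia.
 have : 0 <= mu2 m * Y2 m (y s) ^+ 2 by apply: mulr_ge0; rewrite ?sqr_ge0// ltW.
 by have := q1 s; rewrite [mu2 m * (_ + _)]mulrDr; lra.
by rewrite /speed2 z1 z2 zz1 zz2; ring.
Qed.
End Pointwise.

Section ActionLength.
Variables (R : realType) (m : 'I_3 -> R) (h : R).
Hypotheses (hm : posm m) (hh : 0 < h).
Implicit Types (q : conf R).

Section OneCurve.
Variables (a b : R) (x : R -> conf R).
Hypotheses (ab : a < b) (xL : lipc a b x).

Let leab : a <= b. Proof. exact: ltW. Qed.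
Local Notation y := (clampc a b x).

Let yE t : a <= t <= b -> y t = x t. Proof. by move=> tab; rewrite /clampc clamp_id. Qed.

Let aab : a <= a <= b. Proof. by rewrite lexx leab. Qed.
Let bab : a <= b <= b. Proof. by rewrite lexx leab. Qed.

Let action_y : JM m h a b x = JM m h a b y.
Proof. by apply: eq_action => // t /andP[at_ tb]; rewrite yE// (ltW at_) ltW. Qed.

Local Notation W := (coords m y).

Let Wlip j : exists2 L, 0 <= L & forall s t, `|W j s - W j t| <= L * `|s - t|.
Proof.
rewrite /coords; case: (val j) => [|[|[|[|k]]]].
- exact: lipon_clamp leab (lipon_X1 xL).
- exact: lipon_clamp leab (lipon_Y1 xL).
- exact: lipon_clamp leab (lipon_X2 m xL).
- exact: lipon_clamp leab (lipon_Y2 m xL).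
- exact: lipon_clamp leab (lipon_xinorm hm xL).
Qed.

Let Zlip i : exists2 L, 0 <= L & forall s t, `|hopf m (y s) i - hopf m (y t) i| <= L * `|s - t|.
Proof. exact: lipon_clamp leab (lipon_hopf m xL i). Qed.

Let Vlip i : exists2 L, 0 <= L & forall s t, `|xivec m (y s) i - xivec m (y t) i| <= L * `|s - t|.
Proof. exact: lipon_clamp leab (lipon_xivec m xL i). Qed.

Let common (n : nat) (F : 'I_n -> R -> R) :
 (forall i, exists2 L, 0 <= L & forall s t, `|F i s - F i t| <= L * `|s - t|) ->
 exists2 L, forall i s t, `|F i s - F i t| <= L * `|s - t| &
 forall j s t, `|W j s - W j t| <= L * `|s - t|.
Proof.
by move=> HF; exact: common_lipschitz2 HF Wlip.
Qed.

Lemma action_ge_hopf c : 0 <= c ->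
 (forall u, a <= u <= b -> ((4 * c ^+ 2 * inertia m (x u) + h)%:E <= U m (x u))%E) ->
 ((c * enorm (fun i => hopf m (x b) i - hopf m (x a) i)%R)%:E <= JM m h a b x)%E.
Proof.
move=> c0 H; have [L ZL WL] := common Zlip.
have := @arc_lower R 3 5 (fun i t => hopf m (y t) i) W L a b c (dens m h y) ab ZL WL c0 (dens_ge0 m h y).
rewrite (yE aab) (yE bab) -actionE -action_y; apply.
move=> t; rewrite in_itv/= => /andP[at_ tb] dW _.
have tab : a <= t <= b by rewrite (ltW at_) ltW.
have cU : ((4 * c ^+ 2 * inertia m (y t) + h)%:E <= U m (y t))%E.
 by rewrite (yE tab); exact: H.
exact: (dens_ge_hopf hm dW c0 cU).
Qed.

Let cont_y (F : conf R -> R) : lipon a b (fun t => F (x t)) -> continuous (fun t => F (y t)).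
Proof. by move=> hF; exact: lipon_near_continuous a leab hF. Qed.

Let cont_vk k : continuous (fun t => vk m h k (y t)).
Proof.
apply: continuous_vk => i j.
by apply: (cont_y (F := fun q => rdist q i j)); exact: lipon_rdist.
Qed.

Let cont_wk k : continuous (fun t => wk m h k (y t)).
Proof.
apply: continuous_wk => [i j|].
 by apply: (cont_y (F := fun q => rdist q i j)); exact: lipon_rdist.
by apply: cont_y; exact: lipon_inertia.
Qed.

(** With [action_ge_hopf] this characterizes the action by chords and values of [U]. In applications
    [D] is usually the action of another curve up to the corresponding time, for which
    [action_ge_hopf] supplies the required chord bound. *)
Lemma action_le_hopf (D : R -> R) :
 (forall s t, a <= s -> s <= t -> t <= b -> D s <= D t) ->
 (forall s t c, a <= s -> s <= t -> t <= b -> 0 < c ->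
 (forall u, s <= u <= t -> ((4 * c ^+ 2 * inertia m (x u) + h)%:E <= U m (x u))%E) ->
 c * enorm (fun i => hopf m (x t) i - hopf m (x s) i) <= D t - D s) ->
 (JM m h a b x <= (D b - D a)%:E)%E.
Proof.
move=> mD HD; have [L ZL WL] := common Zlip.
rewrite action_y actionE.
apply: (@arc_upper R 3 5 (fun i t => hopf m (y t) i) W L a b (fun k t => wk m h k (y t)) D
 (dens m h y) ab ZL WL).
- exact: cont_wk.
- by move=> k t; exact: wk_ge0.
- by move=> k t; exact: wk_mon.
- by move=> t; exact: dens_ge0.
- move=> t _ dW _; have [HK HN] := K0_hopf_coords hm dW.
 by rewrite (dens_wk_lim h hm (enorm_ge0 _) HN HK).
- move=> k s t c as_ st tb c0 Hc.
 have tab : a <= t <= b by rewrite tb (le_trans as_ st).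
 have sab : a <= s <= b by rewrite as_ (le_trans st tb).
 have [c0'|c0'] := leP c 0.
 have -> : c = 0 := le_anti (introT andP (conj c0' c0)).
 by rewrite mul0r subr_ge0; exact: mD as_ st tb.
 rewrite (yE tab) (yE sab); apply: (HD _ _ _ as_ st tb c0') => u /andP[su ut].
 have uab : a <= u <= b by rewrite (le_trans as_ su) (le_trans ut tb).
 apply: (wk_rate hm (k := k) c0').
 by rewrite -(yE uab); apply: Hc; rewrite su ut.
Qed.

Lemma action_le_xi (D : R -> R) :
 (forall s t, a <= s -> s <= t -> t <= b -> D s <= D t) ->
 (forall s t c, a <= s -> s <= t -> t <= b -> 0 < c ->
 (forall u, s <= u <= t -> ((c ^+ 2 + h)%:E <= U m (x u))%E) ->
 c * enorm (fun i => xivec m (x t) i - xivec m (x s) i) <= D t - D s) ->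
 (JM m h a b x <= (D b - D a)%:E)%E.
Proof.
move=> mD HD; have [L VL WL] := common Vlip.
rewrite action_y actionE.
apply: (@arc_upper R 4 5 (fun i t => xivec m (y t) i) W L a b (fun k t => vk m h k (y t)) D
 (dens m h y) ab VL WL).
- exact: cont_vk.
- by move=> k t; exact: vk_ge0.
- by move=> k t; exact: vk_mon.
- by move=> t; exact: dens_ge0.
- by move=> t _ dW dV; exact: (dens_le_xi h hm dW).
- move=> k s t c as_ st tb c0 Hc.
 have tab : a <= t <= b by rewrite tb (le_trans as_ st).
 have sab : a <= s <= b by rewrite as_ (le_trans st tb).
 have [c0'|c0'] := leP c 0.
 have -> : c = 0 := le_anti (introT andP (conj c0' c0)).
 by rewrite mul0r subr_ge0; exact: mD as_ st tb.
 rewrite (yE tab) (yE sab); apply: (HD _ _ _ as_ st tb c0') => u /andP[su ut].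
 have uab : a <= u <= b by rewrite (le_trans as_ su) (le_trans ut tb).
 apply: (vk_rate hm (k := k) c0').
 by rewrite -(yE uab); apply: Hc; rewrite su ut.
Qed.

(** Almost everywhere the density is the limit of the continuous [wk] times a measurable version of
    the speed. Additivity and absolute continuity of the action are deduced from this version. *)
Lemma dens_measurable : exists G : R -> \bar R,
 [/\ measurable_fun setT G, forall t, (0 <= G t)%E &
 {ae leb, forall t, t \in `]a, b[ -> dens m h x t = G t}].
Proof.
have [L ZL WL] := common Zlip.
have [z [mz dz]] := lipschitz_derivatives ab ZL.
pose g k t : \bar R := (wk m h k (y t) * enorm (z^~ t))%:E.
have mz2 : measurable_fun setT (fun t => enorm (z^~ t)).
 apply: measurableT_comp.
 by apply: continuous_measurable_fun; exact: sqrt_continuous.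
 by apply: measurable_sum => i; exact: measurable_funX.
have mg k : measurable_fun setT (g k).
 apply/measurable_EFinP; apply: measurable_funM; last exact: mz2.
 by apply: continuous_measurable_fun; exact: cont_wk.
have g0 k t : (0 <= g k t)%E.
 by rewrite lee_fin; exact: mulr_ge0 (wk_ge0 _ _ _ _) (enorm_ge0 _).
pose G t := limn (g ^~ t).
have cg t : cvgn (g ^~ t) by exact: (is_cvg_wk hm (enorm_ge0 _)).
exists G; split.
- by apply: (emeasurable_fun_cvg g G mg) => t _; exact: cg.
- by move=> t; apply: (lime_ge (cg t)); apply: nearW => k; exact: g0.
apply: ae_imp (ae_and dz (ae_derivable_family ab WL)) => t [h1 h2] tab.
have [HK HN] := K0_hopf_coords hm (h2 tab).
have -> : dens m h x t = dens m h y t.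
 apply: dens_near; have := near_in_itvoo tab; apply: filterS => s.
 by rewrite in_itv/= => /andP[sa sb]; rewrite yE ?(ltW sa) ?(ltW sb).
rewrite (dens_wk_lim h hm (enorm_ge0 _) HN HK) /G /g.
suff -> : (fun i => derive1 (fun s => hopf m (y s) i) t) = z^~ t by [].
by apply/funext => i; exact: isd_derive1 (h1 tab i).
Qed.

Lemma action_ge_isosceles c : 0 <= c ->
 (forall u, a <= u <= b -> X1 (x u) = 0 /\ Y2 m (x u) = 0) ->
 (forall u, a <= u <= b -> ((c ^+ 2 + h)%:E <= U m (x u))%E) ->
 ((c * enorm (fun i => xivec m (x b) i - xivec m (x a) i)%R)%:E <= JM m h a b x)%E.
Proof.
move=> c0 Hi H; have [L ZL WL] := common Vlip.
have := @arc_lower R 4 5 (fun i t => xivec m (y t) i) W L a b c (dens m h y) ab ZL WL c0 (dens_ge0 m h y).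
rewrite (yE aab) (yE bab) -actionE -action_y; apply.
move=> t tab0; have := tab0; rewrite in_itv/= => /andP[at_ tb] dW _.
have tab : a <= t <= b by rewrite (ltW at_) ltW.
have cU : ((c ^+ 2 + h)%:E <= U m (y t))%E by rewrite (yE tab); exact: H.
apply: (dens_ge_isosceles hm dW c0 _ cU).
have := near_in_itvoo tab0; apply: filterS => s.
rewrite in_itv/= => /andP[sa sb].
have sab : a <= s <= b by rewrite (ltW sa) (ltW sb).
by rewrite (yE sab); exact: Hi.
Qed.
End OneCurve.

Lemma action_split a b c x : a < b -> lipc a b x -> a <= c <= b ->
 (JM m h a b x = JM m h a c x + JM m h c b x)%E.
Proof.
move=> ab xL /andP[ac cb]; have [G [mG G0 dG]] := dens_measurable ab xL.
have E s t : a <= s -> t <= b -> JM m h s t x = (\int[leb]_(u in `[s, t]) G u)%E.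
 move=> as_ tb; rewrite actionE; apply: ae_eq_integral_ge0 => //.
 by move=> u _; exact: dens_ge0.
 apply: ae_itv_oo; apply: ae_imp dG => u Hu; rewrite in_itv/= => /andP[su ut].
 by apply: Hu; rewrite in_itv/= (le_lt_trans as_)// (lt_le_trans ut).
by rewrite !E//; exact: integral_itv_split.
Qed.
End ActionLength.

(** * Invariance of the action under reparametrization and change of representatives *)

Definition monotone_onto (R : realType) (s t a b : R) (phi : R -> R) : Prop :=
 [/\ forall u v, s <= u -> u <= v -> v <= t -> phi u <= phi v, phi s = a, phi t = b &
 forall u v w, s <= u -> u <= v -> v <= t -> phi u <= w <= phi v ->
 exists2 r, u <= r <= v & phi r = w].

Section Reparametrization.
Variables (R : realType) (m : 'I_3 -> R) (h : R).
Hypothesis hm : posm m.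
Implicit Types (x y g : R -> conf R) (phi psi : R -> R) (a b c s t : R).

(** The intermediate value theorem turns continuity into surjectivity onto subintervals, the only
    trace of it that the comparison of actions uses. *)
Lemma continuous_monotone_onto s t a b phi : {within `[s, t], continuous phi} ->
 {in `[s, t] &, {homo phi : u v / u <= v}} -> phi s = a -> phi t = b ->
 monotone_onto s t a b phi.
Proof.
move=> cphi hphi sa tb; have mphi u v : s <= u -> u <= v -> v <= t -> phi u <= phi v.
 by move=> su uv vt; apply: hphi; rewrite ?in_itv/= ?su ?vt ?(le_trans su uv) ?(le_trans uv vt).
split=> // u v w su uv vt uwv.
have cuv : {within `[u, v], continuous phi}.
 apply: continuous_subspaceW cphi => r /=; rewrite !in_itv/= => /andP[ur rv].
 by rewrite (le_trans su ur) (le_trans rv vt).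
have [|r] := @IVT R phi u v w uv cuv.
 by rewrite (min_idPl (mphi _ _ su uv vt)) (max_idPr (mphi _ _ su uv vt)).
by rewrite in_itv/= => ruv <-; exists r.
Qed.

Lemma id_monotone_onto a b : monotone_onto a b a b id.
Proof. by split=> // u v w au uv vb uwv; exists w. Qed.
Lemma shift_monotone_onto a b c : monotone_onto a b (a + c) (b + c) (fun t => t + c).
Proof.
split=> // [u v _ uv _|u v w au uv vb /andP[uw wv]]; first by rewrite lerD2r.
by exists (w - c); rewrite ?subrK// lerBrDr uw lerBlDr.
Qed.

Lemma reparametrizesP s t g a b x : s <= t -> reparametrizes s t g a b x ->
 exists2 phi, monotone_onto s t a b phi &
 forall r, s <= r <= t -> same_conf (x (phi r)) (g r).
Proof.
move=> st [phi [cphi hphi sa tb gx]]; exists phi; first exact: continuous_monotone_onto.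
by move=> r hr; apply: gx; rewrite in_itv.
Qed.

Lemma action_point a x : JM m h a a x = 0%E.
Proof.
rewrite actionE; transitivity (\int[leb]_(t in `[a, a]) (0 : \bar R))%E; last exact: integral0.
apply: ae_eq_integral_ge0 => //; first by move=> t _; exact: dens_ge0.
apply: ae_itv_oo; apply: nearW => t; rewrite in_itv/= => /andP[at_ /(lt_trans at_)].
by rewrite ltxx.
Qed.

Lemma arc_hopf_le_action a b x c : a <= b -> lipc a b x -> 0 <= c ->
 (forall u, a <= u <= b -> ((4 * c ^+ 2 * inertia m (x u) + h)%:E <= U m (x u))%E) ->
 ((c * enorm (fun i => hopf m (x b) i - hopf m (x a) i)%R)%:E <= JM m h a b x)%E.
Proof.
rewrite le_eqVlt => /predU1P[<- _ _ _|ab xL c0 H]; last exact: action_ge_hopf.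
rewrite action_point lee_fin; suff -> : enorm (fun i => hopf m (x a) i - hopf m (x a) i) = 0.
 by rewrite mulr0.
by rewrite /enorm big1 ?sqrtr0// => i _; rewrite subrr expr0n.
Qed.

Lemma action_cat a b c x : a <= c -> c <= b -> lipc a b x ->
 JM m h a b x = (JM m h a c x + JM m h c b x)%E.
Proof.
move=> ac cb xL; have := le_trans ac cb; rewrite le_eqVlt => /predU1P[ab|ab].
 have ca : c = a by apply/le_anti; rewrite ac {1}ab cb.
 by rewrite ca -ab !action_point adde0.
by apply: action_split; rewrite ?ac.
Qed.

Lemma action_mono a b s t x : a <= s -> s <= t -> t <= b -> lipc a b x ->
 (JM m h s t x <= JM m h a b x)%E.
Proof.
move=> as_ st tb xL; rewrite (action_cat as_ (le_trans st tb) xL).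
rewrite (action_cat st tb (lipc_sub as_ (lexx b) xL)).
rewrite -[leLHS]add0e leeD ?action_ge0//.
by rewrite -[leLHS]adde0 leeD ?action_ge0.
Qed.

(* The bounds of the action by the variation of the Hopf coordinates determine
 it, and they only involve the curve of classes. *)
Lemma action_le_reparam s t a b a' b' x y phi psi : s <= t ->
 lipc a b x -> lipc a' b' y ->
 monotone_onto s t a b phi -> monotone_onto s t a' b' psi ->
 (forall r, s <= r <= t -> same_conf (x (phi r)) (y (psi r))) ->
 (JM m h a b x <= JM m h a' b' y)%E.
Proof.
move=> st xL yL [mphi phis phit ophi] [mpsi psis psit opsi] xy.
have : a <= b by rewrite -phis -phit mphi.
rewrite le_eqVlt => /predU1P[<-|ab]; first by rewrite action_point action_ge0.
have [->|yfin] := eqVneq (JM m h a' b' y) +oo%E; first exact: leey.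
(* [p] picks a preimage under [phi]. The action of [y] up to the parameter [psi (p v)] will be the
   bounding function [D] for [x]. *)
have /choice[p pP] : forall v, exists r, a <= v <= b -> s <= r <= t /\ phi r = v.
 move=> v; have [/andP[av vb]|nv] := boolP (a <= v <= b); last by exists 0.
 have [|r sr rv] := ophi s t v (lexx s) st (lexx t); first by rewrite phis phit av.
 by exists r.
have pb v : a <= v <= b -> a' <= psi (p v) <= b'.
 move=> /pP[/andP[sp pt] _]; rewrite -psis -psit.
 by rewrite (mpsi _ _ (lexx s) sp pt) (mpsi _ _ sp pt (lexx t)).
have a'b' : a' <= b' by rewrite -psis -psit mpsi.
have fin c d : a' <= c -> c <= d -> d <= b' -> JM m h c d y \is a fin_num.
 move=> ac cd db; rewrite ge0_fin_numE ?action_ge0//.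
 by rewrite (le_lt_trans (action_mono ac cd db yL))// ltey.
pose D v := fine (JM m h a' (psi (p v)) y).
have DB u v : a <= u -> u < v -> v <= b -> psi (p u) <= psi (p v) /\
 D v - D u = fine (JM m h (psi (p u)) (psi (p v)) y).
 move=> au uv vb; have hu : a <= u <= b by rewrite au (le_trans (ltW uv)).
 have hv : a <= v <= b by rewrite vb (le_trans au (ltW uv)).
 have [/andP[su ut] pu] := pP _ hu; have [/andP[sv vt] pv] := pP _ hv.
 have puv : p u <= p v.
 rewrite leNgt; apply/negP => /ltW vu; have := mphi _ _ sv vu ut.
 by rewrite pu pv leNgt uv.
 have le1 := mpsi _ _ su puv vt; split=> //.
 have /andP[a1 _] := pb _ hu; have /andP[_ b1] := pb _ hv.
 rewrite /D (action_cat a1 le1 (lipc_sub (lexx _) b1 yL)).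
 rewrite fineD ?fin ?(le_trans le1)//.
 by rewrite addrC addKr.
have mD u v : a <= u -> u <= v -> v <= b -> D u <= D v.
 move=> au; rewrite le_eqVlt => /predU1P[->//|uv] vb.
 by rewrite -subr_ge0 (DB _ _ au uv vb).2 fine_ge0// action_ge0.
have hab : a <= b <= b by rewrite (ltW ab) lexx.
have haa : a <= a <= b by rewrite (ltW ab) lexx.
have : (JM m h a b x <= (D b - D a)%:E)%E.
 apply: (action_le_hopf hm ab xL mD) => u v c au uv vb c0 H.
 have [uv'|uv'] := eqVneq u v.
 suff -> : enorm (fun i => hopf m (x v) i - hopf m (x u) i) = 0.
 by rewrite mulr0 uv' subrr.
 by rewrite uv' /enorm big1 ?sqrtr0// => i _; rewrite subrr expr0n.
 have ltuv : u < v by rewrite lt_neqAle uv'.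
 have [le1 ->] := DB _ _ au ltuv vb.
 have hu : a <= u <= b by rewrite au (le_trans uv).
 have hv : a <= v <= b by rewrite vb (le_trans au).
 have [/andP[su ut] pu] := pP _ hu; have [/andP[sv vt] pv] := pP _ hv.
 have /andP[a1 _] := pb _ hu; have /andP[_ b1] := pb _ hv.
 have puv : p u <= p v.
 rewrite leNgt; apply/negP => /ltW vu; have := mphi _ _ sv vu ut.
 by rewrite pu pv leNgt ltuv.
 rewrite -lee_fin fineK ?fin//.
 have E w : a <= w <= b -> hopf m (x w) = hopf m (y (psi (p w))).
 move=> hw; have [h1 h2] := pP _ hw.
 by rewrite -{1}h2; apply/esym/(same_conf_hopf hm); exact: xy.
 rewrite (E _ hu) (E _ hv); apply: arc_hopf_le_action => //.
 - exact: lipc_sub a1 b1 yL.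
 - exact: ltW.
 move=> w hw; have [r /andP[ur rv] rw] := opsi _ _ _ su puv vt hw.
 have sr : s <= r <= t by rewrite (le_trans su ur) (le_trans rv vt).
 have sc := xy _ sr; rewrite -rw -(enorm_hopf hm) (same_conf_hopf hm sc) (enorm_hopf hm).
 rewrite (same_conf_U m sc); apply: H.
 have := mphi _ _ su ur (le_trans rv vt); have := mphi _ _ (le_trans su ur) rv vt.
 by rewrite pu pv => -> ->.
move=> /le_trans; apply; rewrite -[leRHS]fineK ?fin// lee_fin.
apply: (@le_trans _ _ (D b)); first by rewrite gerBl fine_ge0 ?action_ge0.
have /andP[a1 b1] := pb _ hab.
rewrite fine_le ?(fin _ _ (lexx _) a1 b1) ?(fin _ _ (lexx _) a'b' (lexx _))//.
exact: action_mono (lexx _) a1 b1 yL.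
Qed.

Lemma action_same_conf a b x y : a <= b -> lipc a b x -> lipc a b y ->
 (forall t, a <= t <= b -> same_conf (x t) (y t)) ->
 JM m h a b x = JM m h a b y.
Proof.
move=> ab xL yL xy; have I := id_monotone_onto a b.
apply/le_anti/andP; split; first exact: (action_le_reparam ab xL yL I I xy).
apply: (action_le_reparam ab yL xL I I) => r hr.
by apply: same_conf_sym; exact: xy.
Qed.

Lemma action_reparametrizes s t a b a' b' g x y : s <= t ->
 lipc a b x -> lipc a' b' y ->
 reparametrizes s t g a b x -> reparametrizes s t g a' b' y ->
 (JM m h a b x <= JM m h a' b' y)%E.
Proof.
move=> st xL yL /(reparametrizesP st)[phi ophi gx] /(reparametrizesP st)[psi opsi gy].
apply: (action_le_reparam st xL yL ophi opsi) => r hr.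
exact: same_conf_trans (gx _ hr) (same_conf_sym (gy _ hr)).
Qed.

Lemma A_JM_lift s t g a b x : s <= t -> a <= b -> lipc a b x ->
 reparametrizes s t g a b x -> A_JM m h s t g = JM m h a b x.
Proof.
move=> st ab xL gx; apply/le_anti/andP; split.
 by apply: ereal_inf_lbound; exists a, b, x.
apply: le_ereal_inf_tmp => _ [a' [b' [y [a'b' yL gy ->]]]].
exact: action_reparametrizes gx gy.
Qed.
End Reparametrization.

(** * Hitting times and gluing of curves *)

Lemma first_time (R : realType) (a b : R) (f : R -> R) : a <= b -> lipon a b f ->
 0 < f a -> f b <= 0 ->
 exists2 T, a < T <= b & f T = 0 /\ forall t, a <= t < T -> 0 < f t.
Proof.
move=> ab [L L0 fL] fa fb.
pose S := [set t | a <= t <= b /\ f t <= 0].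
have Sb : S b by split=> //; rewrite ab lexx.
have lbS : lbound S a by move=> t [/andP[]].
have iS : has_inf S by split; [exists b|exists a].
pose T := inf S.
have aT : a <= T by apply: lb_le_inf => //; exists b.
have Tb : T <= b by apply: ge_inf => //; exists a.
have before t : a <= t < T -> 0 < f t.
 move=> /andP[at_ tT]; rewrite ltNge; apply/negP => ft.
 have : T <= t by apply: ge_inf; [exists a|split=> //; rewrite at_ ltW// (lt_le_trans tT)].
 by rewrite leNgt tT.
have hT : a <= T <= b by rewrite aT.
have L1 : 0 < L + 1 by rewrite ltr_wpDl.
have fT : f T <= 0.
 rewrite leNgt; apply/negP => fT0.
 have [t [/andP[at_ tb] ft] tT] := inf_adherent (divr_gt0 fT0 L1) iS.
 have Tt : T <= t by apply: ge_inf; [exists a|split=> //; rewrite at_].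
 have := fL T t hT; rewrite at_ tb => /(_ isT); rewrite ler_norml => /andP[_].
 rewrite ler0_norm ?subr_le0// opprB => h1.
 have : (t - T) * (L + 1) < f T by rewrite -ltr_pdivlMr// ltrBlDl.
 have : 0 <= t - T by rewrite subr_ge0.
 by move: h1 ft; move: (f T) (f t) => u v; nra.
have aT' : a < T.
 rewrite lt_neqAle aT andbT; apply/eqP => aE.
 by move: fa; rewrite aE ltNge fT.
exists T; first by rewrite aT'.
split=> //; apply/le_anti; rewrite fT/= leNgt; apply/negP => fT0.
pose d := minr (T - a) (- f T / (L + 1)).
have d0 : 0 < d by rewrite lt_min subr_gt0 aT' divr_gt0// oppr_gt0.
have dL : d * (L + 1) <= - f T by rewrite -ler_pdivlMr// ge_min lexx orbT.
have ad : a <= T - d by rewrite lerBrDr -lerBrDl ge_min lexx.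
have h1 : 0 < f (T - d) by apply: before; rewrite ad gtrBl.
have := fL (T - d) T; rewrite ad hT lerBlDr (le_trans Tb) ?lerDl ?(ltW d0)// => /(_ isT isT).
rewrite ler_norml => /andP[_]; rewrite addrAC subrr add0r normrN gtr0_norm//.
by clear -h1 dL d0; nra.
Qed.

Section Gluing.
Variable R : realType.
Implicit Types (a b c : R) (f g : R -> R).

Lemma lipon_cat a c b f : a <= c -> c <= b -> lipon a c f -> lipon c b f -> lipon a b f.
Proof.
move=> ac cb [L L0 fL] [M M0 fM]; exists (L + M); first exact: addr_ge0.
have key s t : a <= s <= b -> a <= t <= b -> s <= t -> `|f s - f t| <= (L + M) * `|s - t|.
 move=> /andP[as_ sb] /andP[at_ tb] st; rewrite (@ler0_norm _ (s - t)) ?subr_le0// opprB.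
 have st0 : 0 <= t - s by rewrite subr_ge0.
 have [tc|ct] := leP t c.
 have := fL s t; rewrite as_ at_ tc (le_trans st tc) => /(_ isT isT) /le_trans; apply.
 by rewrite ler0_norm ?subr_le0// opprB ler_wpM2r// lerDl.
 have [cs|sc] := leP c s.
 have := fM s t; rewrite sb tb cs (ltW ct) => /(_ isT isT) /le_trans; apply.
 by rewrite ler0_norm ?subr_le0// opprB ler_wpM2r// lerDr.
 have := fL s c; rewrite as_ ac lexx (ltW sc) => /(_ isT isT) h1.
 have := fM c t; rewrite lexx cb (ltW ct) tb => /(_ isT isT) h2.
 rewrite (le_trans (ler_distD (f c) _ _))// (le_trans (lerD h1 h2))//.
 rewrite (@ler0_norm _ (s - c)) ?(@ler0_norm _ (c - t)) ?subr_le0 ?(ltW sc) ?(ltW ct)//.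
 by rewrite !opprB; move: sc ct L0 M0; nra.
move=> s t hs ht; have [st|/ltW ts] := leP s t; first exact: key.
by rewrite distrC (distrC s); exact: key.
Qed.

Lemma lipon_shift a b c f : lipon a b f -> lipon (a - c) (b - c) (fun t => f (t + c)).
Proof.
move=> [L L0 fL]; exists L => // s t; rewrite !lerBlDr !lerBrDr => hs ht.
have := fL _ _ hs ht; have -> // : s + c - (t + c) = s - t by ring.
Qed.

Lemma lipschitz_curve_shift a b c (x : R -> conf R) : lipc a b x ->
 lipc (a - c) (b - c) (fun t => x (t + c)).
Proof.
move=> /lipcP xL; apply/lipcP => i; have [h1 h2] := xL i.
by split; [exact: lipon_shift h1|exact: lipon_shift h2].
Qed.

Lemma lipschitz_curve_move a b (x : R -> conf R) (u v : R[i]) : lipc a b x ->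
 lipc a b (fun t i => u * x t i + v).
Proof.
move=> /lipcP xL; apply/lipcP => i; have [h1 h2] := xL i; split.
 apply: (@lipon_ext _ _ _ (fun t => (Re u * Re (x t i) -
 Im u * Im (x t i)) + Re v)); first by move=> t _; rewrite cReD cReM.
 apply: liponD; last exact: lipon_cst.
 by apply: liponB; apply: liponZ.
apply: (@lipon_ext _ _ _ (fun t => (Re u * Im (x t i) +
 Im u * Re (x t i)) + Im v)); first by move=> t _; rewrite cImD cImM.
apply: liponD; last exact: lipon_cst.
by apply: liponD; apply: liponZ.
Qed.

Lemma lipschitz_curve_cat a c b (x y : R -> conf R) : a <= c -> c <= b -> x c = y c ->
 lipc a c x -> lipc c b y ->
 lipc a b (fun t => if t <= c then x t else y t).
Proof.
move=> ac cb xyc /lipcP xL /lipcP yL; apply/lipcP => i.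
have [x1 x2] := xL i; have [y1 y2] := yL i.
split; apply: (lipon_cat ac cb).
- by apply: lipon_ext x1 => t /andP[_ ->].
- apply: lipon_ext y1 => t /andP[ct _]; case: ifPn => // tc.
 by rewrite (@le_anti _ _ t c) ?tc ?ct// xyc.
- by apply: lipon_ext x2 => t /andP[_ ->].
- apply: lipon_ext y2 => t /andP[ct _]; case: ifPn => // tc.
 by rewrite (@le_anti _ _ t c) ?tc ?ct// xyc.
Qed.
End Gluing.

Section ActionCat.
Variables (R : realType) (m : 'I_3 -> R) (h : R).
Hypothesis hm : posm m.

Lemma action_shift (a b c : R) x : a <= b -> lipc a b x ->
 JM m h (a - c) (b - c) (fun t => x (t + c)) = JM m h a b x.
Proof.
move=> ab xL; have I := id_monotone_onto (a - c) (b - c).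
have J : monotone_onto (a - c) (b - c) a b (fun t => t + c).
 by have := shift_monotone_onto (a - c) (b - c) c; rewrite !subrK.
have sc t : a - c <= t <= b - c -> same_conf (x (t + c)) (x (t + c)).
 by move=> _; exact: same_conf_refl.
have abc : a - c <= b - c by rewrite lerD2r.
have xL' := lipschitz_curve_shift c xL.
apply/le_anti/andP; split; first exact: (action_le_reparam h hm abc xL' xL I J).
exact: (action_le_reparam h hm abc xL xL' J I).
Qed.

(** The two representatives at the junction differ by a rigid motion and the parameters by a
    translation. Both are applied to [y] and leave its action unchanged. *)
Lemma action_glue (a b c d : R) x y : a <= b -> c <= d ->
 lipc a b x -> lipc c d y -> same_conf (x b) (y c) ->
 exists z e, [/\ a <= e, lipc a e z, z a = x a, same_conf (z e) (y d) &
 JM m h a e z = (JM m h a b x + JM m h c d y)%E].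
Proof.
move=> ab cd xL yL /same_conf_sym[u [v [u1 xb]]].
pose y' t : conf R := fun i => u * y (t + (c - b)) i + v.
have E1 : c - (c - b) = b by ring.
have be : b <= d - (c - b) by rewrite opprB addrA lerBrDr; lra.
have y'L : lipc b (d - (c - b)) y'.
 rewrite -E1; apply: lipschitz_curve_move.
 by have := lipschitz_curve_shift (c - b) yL; rewrite E1.
have y'b : x b = y' b.
 by apply/funext => i; rewrite /y' (_ : b + (c - b) = c) ?xb//; ring.
have sy t : same_conf (y (t + (c - b))) (y' t) by exists u, v.
have zL := lipschitz_curve_cat ab be y'b xL y'L.
exists (fun t => if t <= b then x t else y' t), (d - (c - b)); split.
- exact: le_trans be.
- exact: zL.
- by rewrite ab.
- apply: same_conf_sym; have := sy (d - (c - b)); rewrite subrK.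
 case: ifPn => // eb; suff -> : d - (c - b) = b by rewrite y'b.
 by apply/le_anti; rewrite eb be.
set z := (fun t => _) in zL *.
have zx : JM m h a b z = JM m h a b x.
 by apply: eq_action => t /andP[_ /ltW]; rewrite /z => ->.
have zy : JM m h b (d - (c - b)) z = JM m h b (d - (c - b)) y'.
 by apply: eq_action => t /andP[bt _]; rewrite /z leNgt bt.
rewrite (action_cat h hm ab be zL) zx zy -(action_shift (c - b) cd yL) E1.
suff -> : JM m h b (d - (c - b)) y' =
 JM m h b (d - (c - b)) (fun t => y (t + (c - b))) by [].
apply: (action_same_conf h hm be y'L).
 by have := lipschitz_curve_shift (c - b) yL; rewrite E1.
by move=> t _; exact/same_conf_sym.
Qed.
End ActionCat.

Local Notation hopfD m q q' := (enorm (fun i => hopf m q i - hopf m q' i)).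
Local Notation xiD m q q' := (enorm (fun i => xivec m q i - xivec m q' i)).

(** * From minimizers to Lipschitz curves of configurations *)

Section Rectifiable.
Variables (R : realType) (m : 'I_3 -> R).
Hypothesis hm : posm m.
Implicit Types (q : conf R) (x y : R -> conf R) (a b s t : R).

Lemma coords_lipschitz a b x : a <= b -> lipc a b x ->
 exists L, forall j s t, `|coords m (clampc a b x) j s - coords m (clampc a b x) j t| <= L * `|s - t|.
Proof.
move=> ab xL; apply: common_lipschitz => j; rewrite /coords; case: (val j) => [|[|[|[|k]]]].
- exact: lipon_clamp ab (lipon_X1 xL).
- exact: lipon_clamp ab (lipon_Y1 xL).
- exact: lipon_clamp ab (lipon_X2 m xL).
- exact: lipon_clamp ab (lipon_Y2 m xL).
- exact: lipon_clamp ab (lipon_xinorm hm xL).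
Qed.

Definition segment q q' s : conf R := fun i => q i + s%:C%C * (q' i - q i).

Lemma segmentRe q q' s i : Re (segment q q' s i) = Re (q i) + s * (Re (q' i) - Re (q i)).
Proof. by rewrite /segment cReD cReZ cReB. Qed.
Lemma segmentIm q q' s i : Im (segment q q' s i) = Im (q i) + s * (Im (q' i) - Im (q i)).
Proof. by rewrite /segment cImD cImZ cImB. Qed.
Lemma isd_affine (al be t : R) : isd (fun s => al + s * be) t be.
Proof.
have := isdD (isd_cst t al) (isdZ be (isd_id t)); rewrite add0r mulr1.
by apply: isd_ext => s; rewrite mulrC.
Qed.

Lemma isd_derivC_segment q q' i t :
 Defs.derivC (fun s => segment q q' s i) t = q' i - q i /\ derivableC (fun s => segment q q' s i) t.
Proof.
have e1 : (fun s => Re (segment q q' s i)) =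
 (fun s => Re (q i) + s * (Re (q' i) - Re (q i))).
 by apply/funext => s; exact: segmentRe.
have e2 : (fun s => Im (segment q q' s i)) =
 (fun s => Im (q i) + s * (Im (q' i) - Im (q i))).
 by apply/funext => s; exact: segmentIm.
split; last by split; rewrite ?e1 ?e2; exact: isd_derivable (isd_affine _ _ _).
rewrite /Defs.derivC e1 e2 !(isd_derive1 (isd_affine _ _ _)) -cReB -cImB.
by case: (q' i - q i).
Qed.

Lemma C1_segment q q' i : C1 (fun s => segment q q' s i).
Proof.
have E : Defs.derivC (fun s => segment q q' s i) = fun=> q' i - q i.
 by apply/funext => t; exact: (isd_derivC_segment q q' i t).1.
split; first by move=> t; exact: (isd_derivC_segment q q' i t).2.
by split; rewrite E => t; exact: cvg_cst.
Qed.

Lemma lipschitz_segment q q' : lipc 0 1 (segment q q').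
Proof.
apply/lipcP => i; split.
 apply: (@lipon_ext _ _ _ (fun s => Re (q i) + s * (Re (q' i) - Re (q i)))).
 by move=> s _; rewrite segmentRe.
 by apply: liponD; [exact: lipon_cst|apply: liponM; [exact: lipon_id|exact: lipon_cst]].
apply: (@lipon_ext _ _ _ (fun s => Im (q i) + s * (Im (q' i) - Im (q i)))).
 by move=> s _; rewrite segmentIm.
by apply: liponD; [exact: lipon_cst|apply: liponM; [exact: lipon_id|exact: lipon_cst]].
Qed.

Lemma xivec_segment q q' s i : xivec m (segment q q' s) i =
 xivec m q i + s * (xivec m q' i - xivec m q i).
Proof.
rewrite /xivec; case: (val i) => [|[|[|k]]].
- by rewrite !X1E !segmentRe; ring.
- by rewrite !Y1E !segmentIm; ring.
- by rewrite !X2E !segmentRe; ring.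
- by rewrite !Y2E !segmentIm; ring.
Qed.

(** The straight segment between the representatives is a [C1] path, and its reduced speed is at
    most its constant speed in mass-weighted coordinates. *)
Lemma dist_le q q' : (dist m q q' <= (enorm (fun i => xivec m q' i - xivec m q i)%R)%:E)%E.
Proof.
pose x := segment q q'; set E := enorm _.
have D : (dist m q q' <= \int[leb]_(t in `[0%R, 1%R]) (sqrt (2 * K0 m x t))%:E)%E.
 apply: ereal_inf_lbound; exists x => //; split; first by move=> i; exact: C1_segment.
 split; exists 1, 0; rewrite normc1; split=> // i; rewrite /x /segment mul1r addr0.
 by rewrite mul0r addr0.
 by rewrite mul1r subrKC.
apply: (le_trans D); have -> : E%:E = (\int[leb]_(t in `[0%R, 1%R]) E%:E)%E.
 by rewrite integral_cst//= lebesgue_measure_itv/= lte_fin ltr01 oppr0 adde0 mule1.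
have E0 : 0 <= E by exact: enorm_ge0.
apply: ae_le_integral_ge0 => //.
have [L WL] := coords_lipschitz ler01 (lipschitz_segment q q').
apply: ae_itv_oo; apply: ae_imp (ae_derivable_family ltr01 WL) => t dW t01.
have {}dW := dW t01; rewrite lee_fin.
have ny : \forall s \near t, clampc 0 1 x s = x s.
 have := near_in_itvoo t01; apply: filterS => s; rewrite in_itv/= => /andP[s0 s1].
 by rewrite /clampc clamp_id// (ltW s0) (ltW s1).
rewrite -(K0_near m ny) -[leRHS](ger0_norm E0) -sqrtr_sqr ler_wsqrtr//.
have [d1 d2 d3 d4 d5] := coords_derivable dW.
apply: (le_trans (K0_le_speed2 hm d1 d2 d3 d4 d5)); rewrite -(derive_xivec hm dW).
suff -> : (fun i => derive1 (fun s => xivec m (clampc 0 1 x s) i) t) =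
 (fun i => xivec m q' i - xivec m q i) by [].
apply/funext => i; rewrite derive1E.
rewrite (_ : 'D_1 _ t = 'D_1 (fun s => xivec m q i + s * (xivec m q' i - xivec m q i)) t).
 by rewrite -derive1E; exact: isd_derive1 (isd_affine _ _ _).
by apply: near_eq_derive; apply: filterS ny => s ->; exact: xivec_segment.
Qed.

Lemma lipschitz_enorm_xivec a b x : lipc a b x -> exists2 L, 0 <= L &
 forall s t, a <= s <= b -> a <= t <= b ->
 xiD m (x t) (x s) <= L * `|t - s|.
Proof.
move=> xL; have H i := lipon_xivec m xL i.
have /choice[L LP] : forall i, exists L, 0 <= L /\ forall s t, a <= s <= b -> a <= t <= b ->
 `|xivec m (x s) i - xivec m (x t) i| <= L * `|s - t|.
 by move=> i; have [L L0 HL] := H i; exists L.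
exists (\sum_i L i); first by apply: sumr_ge0 => i _; have [] := LP i.
move=> s t hs ht; apply: (le_trans (enorm_le_sum _)); rewrite mulr_suml.
by apply: ler_sum => i _; have [_] := LP i; apply.
Qed.

Lemma lipschitz_rectifiable a b x : a <= b -> lipc a b x -> rectifiable m a b x.
Proof.
move=> ab /lipschitz_enorm_xivec[L L0 xL]; split.
 move=> t; rewrite in_itv/= => ht e e0; rewrite near_withinE.
 have L1 : 0 < L + 1 by rewrite ltr_wpDl.
 near=> s => /=; rewrite in_itv/= => hs; apply: (le_lt_trans (dist_le _ _)).
 rewrite lte_fin (le_lt_trans (xL _ _ ht hs))//.
 have st : `|s - t| < e / (L + 1).
 by near: s; apply/nbhs_ballP; exists (e / (L + 1)); rewrite /= ?divr_gt0// => s; rewrite /ball/= distrC.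
 move: st; rewrite ltr_pdivlMr//; have := normr_ge0 (s - t).
 by move: `|s - t| => u; nra.
apply: (@le_lt_trans _ _ (L * (b - a))%:E); last exact: ltry.
apply: ge_ereal_sup => _ [s sp <-].
have nd : {in `[a, b] &, nondecreasing_fun (id : R -> R)} by [].
have <- := nondecreasing_variation nd sp.
rewrite /variation mulr_sumr -sumEFin !big_nat; apply: lee_sum => k /andP[_ ks].
have k1 : (k < (size s).+1)%N by rewrite ltnS ltnW.
have k2 : (k.+1 < (size s).+1)%N by rewrite ltnS.
apply: (le_trans (dist_le _ _)); rewrite lee_fin; apply: xL.
 by rewrite (itv_partition_nth_ge k1 sp) (itv_partition_nth_le k1 sp).
by rewrite (itv_partition_nth_ge k2 sp) (itv_partition_nth_le k2 sp).
Unshelve. all: by end_near. Qed.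
End Rectifiable.

Lemma lipon_inv (R : realType) (a b e : R) (f : R -> R) : 0 < e -> lipon a b f ->
 (forall t, a <= t <= b -> e <= f t) -> lipon a b (fun t => (f t)^-1).
Proof.
move=> e0 [L L0 fL] ef; exists (L / e ^+ 2); first by rewrite divr_ge0// sqr_ge0.
move=> s t hs ht; have := fL s t hs ht.
move: (f s) (f t) (ef _ hs) (ef _ ht) => u v eu ev uv.
have u0 : 0 < u := lt_le_trans e0 eu; have v0 : 0 < v := lt_le_trans e0 ev.
have -> : u^-1 - v^-1 = (v - u) / (u * v) by field; rewrite !gt_eqF.
have uv0 : 0 < u * v by rewrite mulr_gt0.
rewrite normrM (@gtr0_norm _ (u * v)^-1) ?invr_gt0// distrC mulrAC.
apply: ler_pM => //; first by rewrite invr_ge0 ltW.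
by rewrite lef_pV2 ?posrE ?exprn_gt0// expr2 ler_pM// ltW.
Qed.

Section Escape.
Variables (R : realType) (m : 'I_3 -> R) (h : R).
Hypotheses (hm : posm m) (hh : 0 < h).
Implicit Types (q : conf R) (x y g : R -> conf R) (a b s t : R).

Definition pair_mass : R := m b1 * m b2 + m b1 * m b3 + m b2 * m b3.

Lemma pair_mass_gt0 : 0 < pair_mass.
Proof. by rewrite !addr_gt0 ?mulr_gt0. Qed.
Lemma U_le_separation e q : 0 < e -> (forall i j, i != j -> e <= rdist q i j) ->
 (U m q <= (pair_mass / e)%:E)%E.
Proof.
move=> e0 H; rewrite (pot3_eq m e0 H) lee_fin /pot3 /pair_mass !mulrDl.
have p (k r : R) : 0 < k -> k / maxr r e <= k / e.
 move=> k0; rewrite ler_wpM2l ?(ltW k0)// lef_pV2 ?posrE ?lt_max ?e0 ?orbT//.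
 by rewrite le_max lexx orbT.
by rewrite !lerD// p ?mulr_gt0.
Qed.

Variable q0 : conf R.

(** Ties between abscissae are broken by the labels, so that any two bodies are ordered even at a
    collision. *)
Definition left_of (i j : 'I_3) : bool :=
 (Re (q0 i) < Re (q0 j)) ||
 ((Re (q0 i) == Re (q0 j)) && (i < j)%N).

Definition rank (i : 'I_3) : R := #|[pred k | left_of k i]|%:R.

Lemma left_of_rank i j : left_of i j -> rank i + 1 <= rank j.
Proof.
move=> ij; rewrite /rank natr1 ler_nat; apply: proper_card; apply/properP; split.
 apply/fintype.subsetP => k; rewrite !inE /left_of => /orP[ki|/andP[/eqP -> ki]].
 case/orP : ij => [ij|/andP[/eqP <- _]]; first by rewrite (lt_trans ki).
 by rewrite ki.
 case/orP : ij => [->//|/andP[-> ij]]; by rewrite (ltn_trans ki ij) orbT.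
by exists i; rewrite inE//= /left_of ltxx ltnn andbF.
Qed.

Lemma left_of_total i j : i != j -> left_of i j || left_of j i.
Proof.
move=> ij; rewrite /left_of; have [//|//|e] := ltgtP (Re (q0 i)) (Re (q0 j)).
by rewrite -neq_ltn.
Qed.

(** The bodies are driven apart along the real axis. The exponent 2 keeps the action finite when
    [q0] is a collision: distances grow at least like [t^2], so [sqrt U] is [O(1 / t)], while the
    speed is [O(t)]. *)
Definition escape (t : R) : conf R := fun i => q0 i + (t ^+ 2 * rank i)%:C%C.

Lemma escape_separation i j t : i != j -> t ^+ 2 <= rdist (escape t) i j.
Proof.
wlog ij : i j / left_of i j => [H ij|_].
 have /orP[l|l] := left_of_total ij; first exact: H.
 by rewrite rdistC; apply: H => //; rewrite eq_sym.
apply: (@le_trans _ _ `|Re (escape t i - escape t j)|).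
 rewrite cReB /escape !cReD /= distrC.
 have h1 := left_of_rank ij.
 have h2 : Re (q0 i) <= Re (q0 j).
 by case/orP : ij => [/ltW//|/andP[/eqP ->]].
 apply: le_trans (ler_norm _); have := sqr_ge0 t.
 by move: (t ^+ 2) (rank i) (rank j) h1 h2 => u ri rj; nra.
rewrite /rdist normc_sqrt -sqrtr_sqr ler_wsqrtr//.
by rewrite lerDl sqr_ge0.
Qed.

Lemma escape_lipschitz T : lipc 0 T escape.
Proof.
apply/lipcP => i; split.
 apply: (@lipon_ext _ _ _ (fun t => Re (q0 i) + t * t * rank i)).
 by move=> t _; rewrite /escape cReD expr2.
 apply: liponD; first exact: lipon_cst.
 apply: liponM; last exact: lipon_cst.
 by apply: liponM; exact: lipon_id.
apply: (@lipon_ext _ _ _ (fun t => Im (q0 i))); last exact: lipon_cst.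
by move=> t _; rewrite /escape cImD /= addr0.
Qed.

Lemma xivec_escape t i : xivec m (escape t) i =
 xivec m q0 i + t ^+ 2 * xivec m (fun i => (rank i)%:C%C) i.
Proof.
rewrite /xivec; case: (val i) => [|[|[|k]]].
- by rewrite !X1E /escape !cReD/=; ring.
- by rewrite !Y1E /escape !cImD/=; ring.
- by rewrite !X2E /escape !cReD/=; ring.
- by rewrite !Y2E /escape !cImD/=; ring.
Qed.

Lemma escape_finite T : 0 < T -> (JM m h 0 T escape < +oo)%E.
Proof.
move=> T0; pose B := enorm (xivec m (fun i => (rank i)%:C%C)).
have B0 : 0 <= B by exact: enorm_ge0.
pose c0 := sqrt pair_mass; have c00 : 0 <= c0 by exact: sqrtr_ge0.
pose D t : R := 2 * c0 * B * t.
have cB : 0 <= 2 * c0 * B by rewrite !mulr_ge0.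
apply: (@le_lt_trans _ _ (D T - D 0)%:E); last exact: ltry.
apply: (action_le_xi hm T0 (escape_lipschitz T)).
 by move=> s t _ st _; rewrite /D ler_wpM2l.
move=> s t c s0 st tT cc H.
have -> : xiD m (escape t) (escape s) =
 (t ^+ 2 - s ^+ 2) * B.
 rewrite -[t ^+ 2 - s ^+ 2]ger0_norm; last by rewrite subr_ge0 lerXn2r// nnegrE (le_trans s0).
 by rewrite /B -enormZ; congr enorm; apply/funext => i; rewrite !xivec_escape; ring.
have [->|tn0] := eqVneq t s; first by rewrite !subrr mul0r mulr0.
have t0 : 0 < t by rewrite (le_lt_trans s0)// lt_neqAle eq_sym tn0.
have t2 : 0 < t ^+ 2 by rewrite exprn_gt0.
have : c * t <= c0.
 rewrite /c0 -[leLHS]ger0_norm ?mulr_ge0 ?(ltW cc) ?(ltW t0)// -sqrtr_sqr ler_wsqrtr//.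
 have := H t; rewrite lexx st => /(_ isT) h1.
 have := le_trans h1 (U_le_separation t2 (fun i j => @escape_separation i j t)).
 rewrite lee_fin ler_pdivlMr// exprMn => /(le_trans _); apply.
 by rewrite ler_wpM2r ?(ltW t2)// lerDl ltW.
have st0 : 0 <= t - s by rewrite subr_ge0.
have st2 : t + s <= 2 * t by lra.
move=> ct; rewrite /D -mulrBr mulrA.
have -> : c * (t ^+ 2 - s ^+ 2) * B = B * (t - s) * (c * (t + s)) by ring.
have -> : 2 * c0 * B * (t - s) = B * (t - s) * (2 * c0) by ring.
apply: ler_wpM2l; first by rewrite mulr_ge0.
by nra.
Qed.

Lemma escape_end : exists2 T, 0 < T & (U m (escape T) <= h%:E)%E.
Proof.
have p0 := pair_mass_gt0; exists (sqrt (pair_mass / h)).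
 by rewrite sqrtr_gt0 divr_gt0.
have T2 : 0 < sqrt (pair_mass / h) ^+ 2 by rewrite exprn_gt0// sqrtr_gt0 divr_gt0.
apply: le_trans (U_le_separation T2 (fun i j => @escape_separation i j _)) _.
rewrite (sqr_sqrtr (ltW (divr_gt0 p0 hh))) lee_fin invf_div mulrCA divff ?mulr1//.
by rewrite gt_eqF.
Qed.
End Escape.

(** What is retained of a minimizer. Competitors may end anywhere in [U <= h], since such a curve
    has met the Hill boundary before at no larger action. The Hill region and rectifiability no
    longer appear. *)
Record lip_min (R : realType) (m : 'I_3 -> R) (h : R) (q0 : conf R) (a b : R)
 (x : R -> conf R) : Prop := LipMin {
 lm_lt : a < b;
 lm_lip : lipc a b x;
 lm_start : same_conf (x a) q0;
 lm_before : forall t, a <= t < b -> (h%:E < U m (x t))%E;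
 lm_end : U m (x b) = h%:E;
 lm_fin : (JM m h a b x < +oo)%E;
 lm_min : forall c d y, c <= d -> lipc c d y -> same_conf (y c) q0 ->
 (U m (y d) <= h%:E)%E -> (JM m h a b x <= JM m h c d y)%E }.

Section Lift.
Variables (R : realType) (m : 'I_3 -> R) (h : R).
Hypotheses (hm : posm m) (hh : 0 < h).
Implicit Types (q : conf R) (x y g : R -> conf R) (a b s t : R).

Lemma lipon_potential3 a b e x : 0 < e -> lipc a b x ->
 lipon a b (fun t => pot3 m e (x t)).
Proof.
move=> e0 xL; have H i j (k : R) : lipon a b (fun t => k / maxr (rdist (x t) i j) e).
 apply: liponZ; apply: (lipon_inv e0); last by move=> t _; rewrite le_max lexx orbT.
 by apply: lipon_max; [exact: lipon_rdist|exact: lipon_cst].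
by rewrite /pot3; apply: liponD; first apply: liponD; exact: H.
Qed.

(** The competitor is stopped when the truncated potential, which is Lipschitz along it, first
    equals [h]. Up to that time it lies in the Hill region, and the rest of it has nonnegative
    action. *)
Lemma competitor_le q0 t0 t1 g c d y : (h%:E < U m q0)%E ->
 (forall s0 s1 g', curve_to_boundary m h q0 s0 s1 g' ->
 (A_JM m h t0 t1 g <= A_JM m h s0 s1 g')%E) ->
 c <= d -> lipc c d y -> same_conf (y c) q0 -> (U m (y d) <= h%:E)%E ->
 (A_JM m h t0 t1 g <= JM m h c d y)%E.
Proof.
move=> Uq0 gmin cd yL yq0 Ud; have e0 := ereg_gt0 hm hh.
pose f t := pot3 m (ereg m h) (y t) - h.
have fL : lipon c d f.
 by apply: liponB; [exact: lipon_potential3|exact: lipon_cst].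
have fc : 0 < f c.
 rewrite subr_gt0 ltNge; apply/negP => /(U_leP hm _ hh).
 by rewrite -(same_conf_U m yq0) leNgt Uq0.
have fd : f d <= 0 by rewrite subr_le0; exact/(U_leP hm _ hh).
have [T /andP[cT Td] [fT bT]] := first_time cd fL fc fd.
have yT : lipc c T y by exact: lipc_sub (lexx _) Td yL.
apply: (@le_trans _ _ (A_JM m h c T y)).
 apply: gmin; split=> //; first exact: lipschitz_rectifiable (ltW cT) yT.
 move=> t; rewrite in_itv/= => /andP[ct tT]; apply/(hillP hm _ hh).
 rewrite -subr_ge0 -/(f t); move: tT; rewrite le_eqVlt => /predU1P[->|tT].
 by rewrite fT.
 by apply/ltW/bT; rewrite ct.
 by apply/(hill_boundaryP hm _ hh)/eqP; rewrite -subr_eq0 -/(f T) fT.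
apply: le_trans (action_mono h hm (lexx c) (ltW cT) Td yL).
apply: ereal_inf_lbound; exists c, T, y; split=> //; first exact: ltW.
exists id; split=> // [|t _]; last exact: same_conf_refl.
by apply: continuous_subspaceT => r; exact: cvg_id.
Qed.

(** The escape curve has finite action, hence so has the minimizer. The infimum that defines its
    action is therefore not over an empty set, and a Lipschitz lift exists. *)
Lemma minimizer_lift q0 t0 t1 g : JM_minimizer m h q0 t0 t1 g ->
 exists a b x, lip_min m h q0 a b x /\ reparametrizes t0 t1 g a b x.
Proof.
move=> [[t01 _ gh g0 g1] gn gmin].
have Uq0 : (h%:E < U m q0)%E.
 rewrite lt_neqAle; apply/andP; split.
 apply/eqP => e; have : t0 \in `[t0, t1[ by rewrite in_itv/= lexx.
 by move=> /gn; apply; rewrite /hill_boundary/= -(same_conf_U m g0).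
 by rewrite (same_conf_U m g0); apply: gh; rewrite in_itv/= lexx ltW.
have [T T0 UT] := escape_end hm hh q0.
have : (A_JM m h t0 t1 g < +oo)%E.
 apply: le_lt_trans (escape_finite hm hh q0 T0).
 apply: (competitor_le Uq0 gmin (ltW T0) (escape_lipschitz q0 T) _ UT).
 suff -> : escape q0 0 = q0 by exact: same_conf_refl.
 by apply/funext => i; rewrite /escape expr0n mul0r addr0.
move=> /ereal_inf_lt[_ [a [b [x [ab xL gx ->]]]] xfin].
have gA := A_JM_lift h hm (ltW t01) ab xL gx.
have [phi [mphi p0 p1 ophi] xg] := reparametrizesP (ltW t01) gx.
have xa : same_conf (x a) (g t0) by rewrite -p0; apply: xg; rewrite lexx ltW.
have xb : same_conf (x b) (g t1) by rewrite -p1; apply: xg; rewrite lexx ltW.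
have Ua : (h%:E < U m (x a))%E by rewrite -(same_conf_U m xa) -(same_conf_U m g0).
have Ub : U m (x b) = h%:E by rewrite -(same_conf_U m xb).
exists a, b, x; split; last exact: gx.
split; [|exact: xL|exact: same_conf_trans xa g0| |exact: Ub|exact: xfin|].
- rewrite lt_neqAle ab andbT; apply/eqP => abE.
 by move: Ua; rewrite abE Ub ltxx.
- move=> t /andP[at_ tb].
 have [|r /andP[r0 r1] rt] := ophi t0 t1 t (lexx _) (ltW t01) (lexx _).
 by rewrite p0 p1 at_ ltW.
 have r1' : r < t1.
 by rewrite lt_neqAle r1 andbT; apply/eqP => re; move: tb; rewrite -rt re p1 ltxx.
 have sc : same_conf (x t) (g r) by rewrite -rt; apply: xg; rewrite r0.
 rewrite -(same_conf_U m sc) lt_neqAle; apply/andP; split.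
 by apply/eqP => e; apply: (gn r); rewrite ?in_itv/= ?r0.
 by apply: gh; rewrite in_itv/= r0.
- move=> c d y cd yL yq Uy; rewrite -gA; exact: competitor_le Uq0 gmin cd yL yq Uy.
Qed.

(** Glue the competitor to the initial arc of the minimizer and cancel the finite action of that
    arc. *)
Lemma lip_min_tail q0 a b x s c d y : lip_min m h q0 a b x -> a <= s <= b ->
 c <= d -> lipc c d y -> same_conf (x s) (y c) -> (U m (y d) <= h%:E)%E ->
 (JM m h s b x <= JM m h c d y)%E.
Proof.
move=> [ab xL xq _ _ xfin xmin] /andP[as_ sb] cd yL xy Uy.
have xLs := lipc_sub (lexx a) sb xL.
have [z [e [ae zL za ze zA]]] := action_glue h hm as_ cd xLs yL xy.
have Uz : (U m (z e) <= h%:E)%E by rewrite -(same_conf_U m ze).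
have zq : same_conf (z a) q0 by rewrite za.
have := xmin _ _ _ ae zL zq Uz; rewrite zA (action_cat h hm as_ sb xL).
rewrite leeD2lE// ge0_fin_numE ?action_ge0//.
exact: le_lt_trans (action_mono h hm (lexx a) as_ sb xL) xfin.
Qed.
End Lift.

(** * Distances in Jacobi coordinates and the potential for two equal masses *)

Section PotentialBounds.
Variables (R : realType) (m : 'I_3 -> R).
Hypothesis hm : posm m.
Implicit Types (q : conf R).

Lemma div_ereal_anti (k r r' : R) : 0 <= k -> 0 <= r -> r <= r' ->
 (k%:E / r'%:E <= k%:E / r%:E)%E.
Proof.
move=> k0 r0 rr'; have [r_eq0|rn0] := eqVneq r 0.
 have [->|kn0] := eqVneq k 0; first by rewrite !mul0e.
 by rewrite r_eq0 inve0 gt0_muley ?leey// lte_fin lt_def kn0.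
have rp : 0 < r by rewrite lt_def rn0.
have rp' : 0 < r' := lt_le_trans rp rr'.
by rewrite !inver !gt_eqF// -!EFinM lee_fin ler_wpM2l// lef_pV2 ?posrE.
Qed.

Lemma U_anti q q' : (forall i j, rdist q i j <= rdist q' i j) -> (U m q' <= U m q)%E.
Proof.
move=> H; rewrite !potentialE.
by rewrite !leeD// div_ereal_anti ?rdist_ge0// mulr_ge0// ltW.
Qed.

Lemma ord3_cases (i : 'I_3) : [\/ i = b1, i = b2 | i = b3].
Proof. by case: i => [[|[|[|//]]] Hi]; [apply: Or31|apply: Or32|apply: Or33]; exact/val_inj. Qed.
Lemma U_real q : 0 < rdist q b1 b2 -> 0 < rdist q b1 b3 -> 0 < rdist q b2 b3 ->
 U m q = (m b1 * m b2 / rdist q b1 b2 + m b1 * m b3 / rdist q b1 b3 +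
 m b2 * m b3 / rdist q b2 b3)%:E.
Proof.
by move=> r12 r13 r23; rewrite potentialE !inver !gt_eqF// -!EFinM -!EFinD.
Qed.

Lemma U_collision q : (rdist q b1 b2 = 0) \/ (rdist q b1 b3 = 0) \/ (rdist q b2 b3 = 0) ->
 U m q = +oo%E.
Proof.
have [k12 k13 k23] : [/\ 0 < m b1 * m b2, 0 < m b1 * m b3 & 0 < m b2 * m b3] by rewrite !mulr_gt0.
have p (k r : R) : 0 < k -> 0 <= r -> (0 <= k%:E / r%:E)%E.
 by move=> k0 r0; rewrite mule_ge0 ?lee_fin ?(ltW k0)// inve_ge0 lee_fin.
have oo (k : R) : 0 < k -> (k%:E / 0%:E)%E = +oo%E by move=> k0; rewrite inve0 gt0_muley// lte_fin.
have ay (x y : \bar R) : (0 <= x)%E -> (0 <= y)%E -> x = +oo%E \/ y = +oo%E -> (x + y)%E = +oo%E.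
 by move=> x0 y0 [->|->]; rewrite ?addye ?addey// gt_eqF// (lt_le_trans (ltNyr 0%R)).
rewrite potentialE; move: (p _ _ k12 (rdist_ge0 q b1 b2)) (p _ _ k13 (rdist_ge0 q b1 b3))
 (p _ _ k23 (rdist_ge0 q b2 b3)) => p1 p2 p3.
move=> [H|[H|H]]; rewrite H oo// in p1 p2 p3 *.
- by rewrite ay ?adde_ge0//; left; rewrite ay//; left.
- by rewrite ay ?adde_ge0//; left; rewrite ay//; right.
- by rewrite ay ?adde_ge0//; right.
Qed.
End PotentialBounds.

Section Frame.
Variables (R : realType) (m : 'I_3 -> R).
Hypothesis hm : posm m.
Implicit Types (q : conf R).

Let M := m b1 + m b2 + m b3.
Let M12n0 : m b1 + m b2 != 0. Proof. by rewrite gt_eqF ?addr_gt0. Qed.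
Let Mn0 : M != 0. Proof. by rewrite gt_eqF ?addr_gt0. Qed.

(* The configuration with centre of mass 0 and [xi1 = a + i b], [xi2 = c + i d]. *)
Definition of_xi (a b c d : R) : conf R := fun i => match val i with
 | 0 => Complex (- (m b2 / (m b1 + m b2)) * a - m b3 / M * c) (- (m b2 / (m b1 + m b2)) * b - m b3 / M * d)
 | 1 => Complex (m b1 / (m b1 + m b2) * a - m b3 / M * c) (m b1 / (m b1 + m b2) * b - m b3 / M * d)
 | _ => Complex ((m b1 + m b2) / M * c) ((m b1 + m b2) / M * d)
 end.

Lemma of_xiE a b c d : [/\ X1 (of_xi a b c d) = a, Y1 (of_xi a b c d) = b,
 X2 m (of_xi a b c d) = c & Y2 m (of_xi a b c d) = d].
Proof.
have M0 : m b1 + m b2 + m b3 != 0 by [].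
by rewrite X1E Y1E X2E Y2E /of_xi /M/=; split; field; rewrite ?M0 ?M12n0.
Qed.

Lemma of_xi_centre a b c d : \sum_(i < 3) (m i)%:C%C * of_xi a b c d i = 0.
Proof.
have -> (F : 'I_3 -> R[i]) : \sum_i F i = F b1 + F b2 + F b3.
 rewrite !big_ord_recl big_ord0 addr0 addrA.
 by congr (_ + _ + _); congr F; exact/val_inj.
rewrite /of_xi/=.
have M0 : m b1 + m b2 + m b3 != 0 by [].
apply: complex_eq; rewrite !(cReD, cImD, cReZ, cImZ)/= /M; field; by rewrite M0 M12n0.
Qed.

Lemma lipschitz_of_xi s t (a b c d : R -> R) : lipon s t a -> lipon s t b ->
 lipon s t c -> lipon s t d -> lipc s t (fun u => of_xi (a u) (b u) (c u) (d u)).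
Proof.
move=> La Lb Lc Ld; apply/lipcP => i; rewrite /of_xi.
case: (val i) => [|[|k]]; split => /=; do ?apply: liponZ => //; by apply: liponB; apply: liponZ.
Qed.

Lemma rdist_sqrt q i j : rdist q i j = sqrt
 ((Re (q i) - Re (q j)) ^+ 2 + (Im (q i) - Im (q j)) ^+ 2).
Proof. by rewrite /rdist normc_sqrt cReB cImB. Qed.
Lemma rdist12 q : rdist q b1 b2 = sqrt (xi1sq q).
Proof. by rewrite rdist_sqrt X1E Y1E; congr sqrt; ring. Qed.
Lemma rdist13 q : let be := m b2 / (m b1 + m b2) in
 rdist q b1 b3 = sqrt ((X2 m q + be * X1 q) ^+ 2 + (Y2 m q + be * Y1 q) ^+ 2).
Proof. by rewrite rdist_sqrt X1E Y1E X2E Y2E /=; congr sqrt; field. Qed.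
Lemma rdist23 q : let al := m b1 / (m b1 + m b2) in
 rdist q b2 b3 = sqrt ((X2 m q - al * X1 q) ^+ 2 + (Y2 m q - al * Y1 q) ^+ 2).
Proof. by rewrite rdist_sqrt X1E Y1E X2E Y2E /=; congr sqrt; field. Qed.
End Frame.

Section EqualMasses.
Variables (R : realType) (m : 'I_3 -> R).
Hypothesis hm : posm m.
Hypothesis m12 : m b1 = m b2.
Implicit Types (q : conf R).

(** When [m1 = m2], [skew] and [spread] are half the difference and half the sum of [r23^2] and
    [r13^2]. *)
Definition skew q : R := - (X1 q * X2 m q + Y1 q * Y2 m q).
Definition spread q : R := X2 m q ^+ 2 + Y2 m q ^+ 2 + (xi1sq q) / 4.

Lemma hopf_skew q : hopf m q b2 = 2 * kappa m * skew q.
Proof. by rewrite /hopf /skew/=; ring. Qed.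

Let half : m b2 / (m b1 + m b2) = 2^-1.
Proof.
have n0 : m b2 != 0 by rewrite gt_eqF.
have -> : m b1 + m b2 = m b2 * 2 by rewrite m12; ring.
by rewrite invfM mulrA divff// mul1r.
Qed.
Let half' : m b1 / (m b1 + m b2) = 2^-1.
Proof. by rewrite -half m12. Qed.
Lemma rdist13_skew q : rdist q b1 b3 = sqrt (spread q - skew q).
Proof. by rewrite (rdist13 hm)/= half /spread /skew; congr sqrt; field. Qed.
Lemma rdist23_skew q : rdist q b2 b3 = sqrt (spread q + skew q).
Proof. by rewrite (rdist23 hm)/= half' /spread /skew; congr sqrt; field. Qed.
Lemma skew_le_spread q : `|skew q| <= spread q.
Proof.
rewrite ler_norml; apply/andP; split; rewrite /skew /spread.
 rewrite lerN2 -subr_ge0.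
 have -> : X2 m q ^+ 2 + Y2 m q ^+ 2 + (xi1sq q) / 4 -
 (X1 q * X2 m q + Y1 q * Y2 m q) = (X2 m q - X1 q / 2) ^+ 2 + (Y2 m q - Y1 q / 2) ^+ 2 by field.
 by rewrite addr_ge0 ?sqr_ge0.
rewrite -subr_ge0; have -> : X2 m q ^+ 2 + Y2 m q ^+ 2 + (xi1sq q) / 4 -
 - (X1 q * X2 m q + Y1 q * Y2 m q) = (X2 m q + X1 q / 2) ^+ 2 + (Y2 m q + Y1 q / 2) ^+ 2 by field.
by rewrite addr_ge0 ?sqr_ge0.
Qed.

Lemma skew_gt0 q : (rdist q b1 b3 < rdist q b2 b3) = (0 < hopf m q b2).
Proof.
rewrite rdist13_skew rdist23_skew hopf_skew pmulr_rgt0 ?mulr_gt0 ?kappa_gt0//.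
have /ler_normlP[h1 h2] := skew_le_spread q.
have [c0|c0] := ltP 0 (skew q).
 by rewrite ltr_sqrt ?ltrD2l; lra.
by apply/negbTE; rewrite -leNgt ler_wsqrtr//; lra.
Qed.

Lemma skew_eq0 q : hopf m q b2 = 0 -> rdist q b1 b3 = rdist q b2 b3.
Proof.
rewrite rdist13_skew rdist23_skew hopf_skew => /eqP; rewrite mulf_eq0 gt_eqF ?mulr_gt0 ?kappa_gt0//=.
by move=> /eqP ->; rewrite subr0 addr0.
Qed.
End EqualMasses.

Section InverseDistances.
Variable R : realType.
Implicit Types (A c : R).

(** For [m1 = m2] this is [1 / r13 + 1 / r23], with [A] the spread and [c] the skew. *)
Definition invsum A c : R := (sqrt (A - c))^-1 + (sqrt (A + c))^-1.

(** Squaring leaves a function of [A] and [A^2 - c^2] alone, from which the dependence on [c] can be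
    read. *)
Lemma sqr_invsum A c : `|c| < A ->
 invsum A c ^+ 2 = 2 * A / (A ^+ 2 - c ^+ 2) + 2 / sqrt (A ^+ 2 - c ^+ 2).
Proof.
rewrite ltr_norml => /andP[h1 h2]; have p1 : 0 < A - c by lra.
have p2 : 0 < A + c by lra.
have -> : A ^+ 2 - c ^+ 2 = (A - c) * (A + c) by ring.
rewrite sqrtrM ?(ltW p1)//; have s1 : 0 < sqrt (A - c) by rewrite sqrtr_gt0.
have s2 : 0 < sqrt (A + c) by rewrite sqrtr_gt0.
have e1 := sqr_sqrtr (ltW p1); have e2 := sqr_sqrtr (ltW p2).
rewrite /invsum; move: s1 s2 e1 e2; move: (sqrt _) (sqrt _) => u v u0 v0 e1 e2.
have -> : 2 * A = u ^+ 2 + v ^+ 2 by rewrite e1 e2; ring.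
by rewrite -e1 -e2; field; rewrite !gt_eqF.
Qed.

Lemma invsum_ge0 A c : 0 <= invsum A c.
Proof. by rewrite addr_ge0// invr_ge0 sqrtr_ge0. Qed.
Lemma invsum_anti A A' c : `|c| < A -> A <= A' -> invsum A' c <= invsum A c.
Proof.
rewrite ltr_norml => /andP[h1 h2] AA'.
by rewrite lerD// lef_pV2 ?posrE ?sqrtr_gt0 ?ler_wsqrtr//; lra.
Qed.

(** [4 / A] is the value of the square at [c = 0]; the second factor measures how much asymmetry
    raises the potential. *)
Lemma invsum0_le A c : `|c| < A -> 
 4 / A * (1 + c ^+ 2 / (2 * A ^+ 2)) <= invsum A c ^+ 2.
Proof.
move=> cA; rewrite sqr_invsum//; have A0 : 0 < A := le_lt_trans (normr_ge0 c) cA.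
have D0 : 0 < A ^+ 2 - c ^+ 2.
 by rewrite subr_gt0 -(real_normK (num_real c)) ltrXn2r// ?nnegrE ltW.
have sA : sqrt (A ^+ 2 - c ^+ 2) <= A.
 by rewrite -[leRHS](gtr0_norm A0) -sqrtr_sqr ler_wsqrtr// gerBl sqr_ge0.
have -> : 4 / A * (1 + c ^+ 2 / (2 * A ^+ 2)) = 2 / A * (1 + c ^+ 2 / A ^+ 2) + 2 / A.
 by field; rewrite gt_eqF.
apply: lerD; last first.
 by apply: ler_wpM2l => //; rewrite lef_pV2 ?posrE ?sqrtr_gt0.
rewrite ler_pdivlMr//.
have -> : 2 / A * (1 + c ^+ 2 / A ^+ 2) * (A ^+ 2 - c ^+ 2) = 2 * A - 2 * c ^+ 4 / A ^+ 3.
 by field; rewrite gt_eqF.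
by rewrite gerBl mulr_ge0 ?invr_ge0 ?exprn_ge0 ?(ltW A0)// mulr_ge0// (exprM c 2 2) sqr_ge0.
Qed.

Lemma invsum0 A : 0 < A -> invsum A 0 = 2 / sqrt A.
Proof. by move=> A0; rewrite /invsum subr0 addr0; field; rewrite gt_eqF ?sqrtr_gt0. Qed.
(** Passing from [c] to [c'] divides [A^2 - c^2] by [1 + eta], and this raises the sum at most by
    the same factor. The factor will be absorbed by a dilation. *)
Lemma invsum_shift A c c' : 0 <= c -> c <= c' -> c' < A ->
 invsum A c' <= (1 + (c' ^+ 2 - c ^+ 2) / (A ^+ 2 - c' ^+ 2)) * invsum A c.
Proof.
move=> c0 cc c'A; have A0 : 0 < A by lra.
have D' : 0 < A ^+ 2 - c' ^+ 2 by nra.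
set eta := _ / _; have eta0 : 0 <= eta by rewrite divr_ge0 ?(ltW D')//; nra.
have DE : A ^+ 2 - c ^+ 2 = (1 + eta) * (A ^+ 2 - c' ^+ 2) by rewrite /eta; field; rewrite gt_eqF.
have D0 : 0 < A ^+ 2 - c ^+ 2 by rewrite DE mulr_gt0//; lra.
have e1 : 0 < 1 + eta by lra.
rewrite -ler_sqr ?nnegrE ?mulr_ge0 ?invsum_ge0 ?(ltW e1)//.
rewrite exprMn !sqr_invsum ?ger0_norm//; try lra.
rewrite DE sqrtrM ?(ltW e1)//.
have s1 : 1 <= sqrt (1 + eta) by rewrite -[leLHS]sqrtr1 ler_wsqrtr//; lra.
have s2 := sqr_sqrtr (ltW e1).
have sD : 0 < sqrt (A ^+ 2 - c' ^+ 2) by rewrite sqrtr_gt0.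
rewrite mulrDr; apply: lerD.
 have -> : (1 + eta) ^+ 2 * (2 * A / ((1 + eta) * (A ^+ 2 - c' ^+ 2))) =
 (1 + eta) * (2 * A / (A ^+ 2 - c' ^+ 2)) by field; rewrite !gt_eqF.
 by rewrite ler_peMl// ?mulr_ge0 ?invr_ge0 ?(ltW D') ?(ltW A0)//; lra.
have -> : (1 + eta) ^+ 2 * (2 / (sqrt (1 + eta) * sqrt (A ^+ 2 - c' ^+ 2))) =
 (1 + eta) ^+ 2 / sqrt (1 + eta) * (2 / sqrt (A ^+ 2 - c' ^+ 2)).
 by field; rewrite !gt_eqF//; lra.
rewrite ler_peMl ?divr_ge0 ?(ltW sD)//.
rewrite ler_pdivlMr ?mul1r; last lra.
by move: s1 s2; move: (sqrt _) => s; nra.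
Qed.
End InverseDistances.

Lemma lt_add3 (R : realType) (x y z x' y' z' : \bar R) : (0 <= x -> 0 <= y -> 0 <= z ->
 x <= x' -> y < y' -> z <= z' -> x' \is a fin_num -> y' \is a fin_num -> z' \is a fin_num ->
 x + (y + z) < x' + (y' + z'))%E.
Proof.
case: x y z x' y' z' => [x| |] [y| |] [z| |] [x'| |] [y'| |] [z'| |] //=.
rewrite !lee_fin !lte_fin => _ _ _ h1 h2 h3 _ _ _.
by lra.
Qed.

(** * Comparison of the actions of two curves; dilations *)

Section Compactness.
Variables (R : realType) (m : 'I_3 -> R) (h : R).
Hypotheses (hm : posm m) (hh : 0 < h).

Lemma lipon_pos_min (a b : R) (f : R -> R) : a <= b -> lipon a b f ->
 (forall t, a <= t <= b -> 0 < f t) -> exists2 e, 0 < e & forall t, a <= t <= b -> e <= f t.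
Proof.
move=> ab fL f0; have cf : {within `[a, b], continuous (fun t => f (clamp a b t))}.
 by apply: continuous_subspaceT; exact: lipon_near_continuous a ab fL.
have [c] := EVT_min ab cf; rewrite in_itv/= => cab cmin.
exists (f c); first exact: f0.
by move=> t tab; have := cmin t; rewrite in_itv/= !clamp_id//; apply.
Qed.

Lemma min_rate (a b : R) (x : R -> conf R) : a <= b -> lipc a b x ->
 (forall t, a <= t <= b -> (h%:E < U m (x t))%E) ->
 exists2 e, 0 < e & forall t, a <= t <= b -> ((e + h)%:E <= U m (x t))%E.
Proof.
move=> ab xL Ux; have e0 := ereg_gt0 hm hh.
have pL : lipon a b (fun t => pot3 m (ereg m h) (x t) - h).
 by apply: liponB; [exact: lipon_potential3|exact: lipon_cst].
have [t tab|e e1 eP] := lipon_pos_min ab pL.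
 rewrite subr_gt0 ltNge; apply/negP => /(U_leP hm _ hh).
 by rewrite leNgt Ux.
exists e => // t tab; apply: le_trans (pot3_le hm (x t) e0).
by rewrite lee_fin -lerBrDr eP.
Qed.
End Compactness.

Section Comparison.
Variables (R : realType) (m : 'I_3 -> R) (h : R).
Hypothesis hm : posm m.
Variables (a b : R) (x y : R -> conf R) (k : R -> R) (dx dy : R -> R -> R).
Hypotheses (xL : lipc a b x) (yL : lipc a b y).
Hypothesis Hx : forall s t c, a <= s -> s <= t -> t <= b -> 0 <= c ->
 (forall u, s <= u <= t -> ((c ^+ 2 * k u + h)%:E <= U m (x u))%E) ->
 ((c * dx s t)%:E <= JM m h s t x)%E.
Hypothesis Hy : forall s t (D : R -> R), a <= s -> s < t -> t <= b ->
 (forall u v, s <= u -> u <= v -> v <= t -> D u <= D v) ->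
 (forall u v c, s <= u -> u <= v -> v <= t -> 0 < c ->
 (forall w, u <= w <= v -> ((c ^+ 2 * k w + h)%:E <= U m (y w))%E) ->
 c * dy u v <= D v - D u) ->
 (JM m h s t y <= (D t - D s)%:E)%E.
Hypothesis dyx : forall s t, a <= s -> s <= t -> t <= b -> dy s t <= dx s t.
Hypothesis xfin : (JM m h a b x < +oo)%E.

Lemma action_fin s t : a <= s -> s <= t -> t <= b -> JM m h s t x \is a fin_num.
Proof.
move=> as_ st tb; rewrite ge0_fin_numE ?action_ge0//.
exact: le_lt_trans (action_mono h hm as_ st tb xL) xfin.
Qed.

(** In this section [k] is 4 times an inertia when [dx] and [dy] are chords in Hopf coordinates, and
    1 for chords in mass-weighted coordinates. The bounding function for [y] is [th] times the
    action of [x]: an admissible constant [c] for [y] gives the admissible constant [c / th] for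
    [x]. *)
Lemma compare_scaled s t th : a <= s -> s <= t -> t <= b -> 0 < th ->
 (forall u c, s <= u <= t -> 0 < c -> ((c ^+ 2 * k u + h)%:E <= U m (y u))%E ->
 (((c / th) ^+ 2 * k u + h)%:E <= U m (x u))%E) ->
 (JM m h s t y <= th%:E * JM m h s t x)%E.
Proof.
move=> as_; rewrite le_eqVlt => /predU1P[<- _ _ _|st tb th0 H].
 by rewrite !action_point mule0.
pose D u := th * fine (JM m h s u x).
have fin u v : s <= u -> u <= v -> v <= t -> JM m h u v x \is a fin_num.
 by move=> su uv vt; rewrite action_fin ?(le_trans as_)// (le_trans vt).
have DB u v : s <= u -> u <= v -> v <= t -> D v - D u = th * fine (JM m h u v x).
 move=> su uv vt; rewrite /D -mulrBr; congr (_ * _).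
 have xLv : lipc s v x by apply: lipc_sub xL; rewrite ?(le_trans vt).
 rewrite (action_cat h hm su uv xLv) fineD ?fin//; first by rewrite addrC addKr.
 exact: le_trans vt.
have -> : (th%:E * JM m h s t x)%E = (D t - D s)%:E.
 by rewrite DB ?lexx ?(ltW st)// EFinM fineK// fin ?lexx ?(ltW st).
apply: Hy => // [u v su uv vt|u v c su uv vt c0 Hc].
 by rewrite -subr_ge0 DB// mulr_ge0 ?(ltW th0)// fine_ge0 ?action_ge0.
rewrite DB//; have au := le_trans as_ su; have vb := le_trans vt tb.
apply: (@le_trans _ _ (c * dx u v)); first by rewrite ler_wpM2l ?(ltW c0)// dyx.
have -> : c * dx u v = th * (c / th * dx u v) by field; rewrite gt_eqF.
rewrite ler_wpM2l ?(ltW th0)// -lee_fin fineK ?fin//.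
apply: Hx => // [|w /andP[uw wv]]; first by rewrite divr_ge0 ?ltW.
by apply: H; [rewrite (le_trans su uw) (le_trans wv vt)|exact: c0|apply: Hc; rewrite uw].
Qed.

Lemma compare_le s t : a <= s -> s <= t -> t <= b ->
 (forall u, s <= u <= t -> (U m (y u) <= U m (x u))%E) ->
 (JM m h s t y <= JM m h s t x)%E.
Proof.
move=> as_ st tb H; rewrite -[leRHS]mul1e; apply: compare_scaled => // u c hu c0 hc.
by rewrite divr1; apply: le_trans hc (H _ hu).
Qed.

(** As long as [U - h] along [y] is at most [F'], a gap [e] is a fixed proportion of it, so the
    action shrinks by the factor [th = sqrt (F' / (F' + e)) < 1]. *)
Lemma compare_lt s t e F : a <= s -> s <= t -> t <= b -> 0 < e ->
 (forall u, s <= u <= t -> (U m (y u) <= F%:E)%E /\ (U m (y u) + e%:E <= U m (x u))%E) ->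
 (0 < JM m h s t x)%E ->
 (JM m h s t y < JM m h s t x)%E.
Proof.
move=> as_ st tb e0 H A0; pose F' := maxr (F - h) e.
have F'0 : 0 < F' by rewrite lt_max e0 orbT.
have Fe : 0 < F' + e by rewrite addr_gt0.
pose th := sqrt (F' / (F' + e)).
have th0 : 0 < th by rewrite sqrtr_gt0 divr_gt0.
have th2 : th ^+ 2 = F' / (F' + e) by rewrite sqr_sqrtr// divr_ge0 ?ltW.
have th1 : th < 1.
 by rewrite -[ltRHS]sqrtr1 ltr_sqrt// ltr_pdivrMr// mul1r ltrDl.
apply: (@le_lt_trans _ _ (th%:E * JM m h s t x)%E).
 apply: compare_scaled => // u c hu c0 hc; have [UF Ue] := H _ hu.
 apply: (le_trans _ Ue).
 have cF : c ^+ 2 * k u <= F'.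
 by have := le_trans hc UF; rewrite lee_fin -lerBrDr => /le_trans; apply; rewrite le_max lexx.
 apply: (@le_trans _ _ ((c ^+ 2 * k u + h)%:E + e%:E)%E); last exact: leeD.
 rewrite -EFinD lee_fin expr_div_n th2.
 have -> : c ^+ 2 / (F' / (F' + e)) * k u + h = c ^+ 2 * k u + (c ^+ 2 * k u) / F' * e + h.
 by field; rewrite !gt_eqF.
 have cFe : c ^+ 2 * k u / F' * e <= e by rewrite ler_piMl ?(ltW e0)// ler_pdivrMr// mul1r.
 by rewrite addrAC lerD2l.
have := action_fin as_ st tb; move: A0; case: (JM _ _ _ _ _) => // A A0 _.
by rewrite -EFinM lte_fin gtr_pMl.
Qed.

Lemma compare_total_lt s t e F : a <= s -> s <= t -> t <= b -> 0 < e ->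
 (forall u, a <= u <= b -> (U m (y u) <= U m (x u))%E) ->
 (forall u, s <= u <= t -> (U m (y u) <= F%:E)%E /\ (U m (y u) + e%:E <= U m (x u))%E) ->
 (0 < JM m h s t x)%E ->
 (JM m h a b y < JM m h a b x)%E.
Proof.
move=> as_ st tb e0 Hle H A0; have sb := le_trans st tb.
rewrite (action_cat h hm as_ sb xL) (action_cat h hm as_ sb yL).
rewrite (action_cat h hm st tb (lipc_sub as_ (lexx b) xL)).
rewrite (action_cat h hm st tb (lipc_sub as_ (lexx b) yL)).
have l1 : (JM m h a s y <= JM m h a s x)%E.
 by apply: compare_le => // u /andP[au us]; apply: Hle; rewrite au (le_trans us).
have l2 : (JM m h t b y <= JM m h t b x)%E.
 apply: compare_le => // [|u /andP[tu ub]]; first exact: le_trans st.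
 by apply: Hle; rewrite ub (le_trans (le_trans as_ st)).
have l3 := compare_lt as_ st tb e0 H A0.
have f1 := action_fin (lexx a) as_ sb; have f2 := action_fin (le_trans as_ st) tb (lexx b).
have f3 := action_fin as_ st tb.
exact: (lt_add3 (action_ge0 _ _ _ _ _) (action_ge0 _ _ _ _ _) (action_ge0 _ _ _ _ _)
 l1 l3 l2 f1 f3 f2).
Qed.
End Comparison.

Section Scaling.
Variables (R : realType) (m : 'I_3 -> R) (h : R).
Hypotheses (hm : posm m) (hh : 0 < h).

Lemma enorm_xivec (q : conf R) : enorm (xivec m q) = xinorm m q.
Proof.
rewrite xinormE /enorm; congr sqrt; rewrite !big_ord_recl big_ord0 addr0 /xivec/= !exprMn.
by rewrite (sqr_sqrtr (ltW (mu1_gt0 hm))) (sqr_sqrtr (ltW (mu2_gt0 hm))) /inertia; ring.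
Qed.

Definition dilate (l : R) (q : conf R) : conf R := fun i => l%:C%C * q i.

Lemma rdist_dilate l q i j : 0 <= l -> rdist (dilate l q) i j = l * rdist q i j.
Proof.
move=> l0; rewrite /rdist /dilate -mulrBr normcM; congr (_ * _).
by rewrite /normc /= expr0n addr0 sqrtr_sqr ger0_norm.
Qed.

Lemma U_dilate l q u : 0 < l -> U m q = u%:E -> U m (dilate l q) = (u / l)%:E.
Proof.
move=> l0 Uq; have r0 i j : i != j -> 0 < rdist q i j.
 move=> ij; rewrite lt_def rdist_ge0 andbT; apply/eqP => r0.
 suff Uoo : U m q = +oo%E by rewrite Uoo in Uq.
 apply: (U_collision hm); move: ij r0.
 by case: (ord3_cases i) => ->; case: (ord3_cases j) => -> //= _; rewrite ?(rdistC _ b2 b1)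
 ?(rdistC _ b3 b1) ?(rdistC _ b3 b2) => ->; auto.
have [r12 r13 r23] : [/\ 0 < rdist q b1 b2, 0 < rdist q b1 b3 & 0 < rdist q b2 b3].
 by split; exact: r0.
rewrite U_real ?rdist_dilate ?mulr_gt0 ?(ltW l0)//.
move: Uq; rewrite U_real// => Uq; rewrite -(EFin_inj Uq); congr EFin.
by field; rewrite !gt_eqF.
Qed.

Lemma xivec_dilate l q i : xivec m (dilate l q) i = l * xivec m q i.
Proof.
rewrite /xivec /dilate; case: (val i) => [|[|[|n]]].
- by rewrite !X1E !cReZ; ring.
- by rewrite !Y1E !cImZ; ring.
- by rewrite !X2E !cReZ; ring.
- by rewrite !Y2E !cImZ; ring.
Qed.

(** Dilating [x t] by the factor [1 + f / h] brings the potential from [h + f] down to [h]. On this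
    ray [U - h] is at most [f] and the length is [xinorm m (x t) * f / h]. *)
Lemma remaining_action q0 a b x t f : lip_min m h q0 a b x -> a <= t <= b -> 0 <= f ->
 U m (x t) = (h + f)%:E ->
 (JM m h t b x <= (xinorm m (x t) * f * sqrt f / h)%:E)%E.
Proof.
move=> xm /andP[at_ tb]; rewrite le_eqVlt => /predU1P[<-|f0] Ux.
 have [tltb|] := boolP (t < b); last first.
 rewrite -leNgt => bt; have -> : t = b by apply/le_anti; rewrite tb.
 by rewrite action_point mulr0 !mul0r.
 by have := lm_before xm (introT andP (conj at_ tltb)); rewrite Ux addr0 ltxx.
set r := xinorm m (x t); have r0 : 0 <= r by rewrite sqrtr_ge0.
pose D l := sqrt f * r * l.
pose T := 1 + f / h; have T1 : 1 < T by rewrite ltrDl divr_gt0.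
pose y l := dilate l (x t).
have yL : lipc 1 T y.
 apply/lipcP => i; split.
 apply: (@lipon_ext _ _ _ (fun l => l * Re (x t i))); first by move=> l _; rewrite /y /dilate cReZ.
 by apply: liponM; [exact: lipon_id|exact: lipon_cst].
 apply: (@lipon_ext _ _ _ (fun l => l * Im (x t i))); first by move=> l _; rewrite /y /dilate cImZ.
 by apply: liponM; [exact: lipon_id|exact: lipon_cst].
have hf : 0 < h + f by rewrite addr_gt0.
have tab : a <= t <= b by rewrite at_.
have y1 : y 1 = x t by apply/funext => i; rewrite /y /dilate mul1r.
have sc : same_conf (x t) (y 1) by rewrite y1; exact: same_conf_refl.
have UyT : (U m (y T) <= h%:E)%E.
 rewrite (U_dilate (lt_trans ltr01 T1) Ux) lee_fin /T le_eqVlt; apply/orP; left; apply/eqP.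
 by field; rewrite !gt_eqF.
apply: (le_trans (lip_min_tail hm xm tab (ltW T1) yL sc UyT)).
have -> : r * f * sqrt f / h = D T - D 1 by rewrite /D /T; field; rewrite gt_eqF.
have c0 : 0 <= sqrt f * r by rewrite mulr_ge0 ?sqrtr_ge0.
apply: (action_le_xi hm T1 yL) => [u v _ uv _|u v c u1 uv vT cc Hc].
 by rewrite /D ler_wpM2l.
have -> : xiD m (y v) (y u) = (v - u) * r.
 rewrite /r -enorm_xivec -(ger0_norm (_ : 0 <= v - u)) ?subr_ge0// -enormZ.
 by congr enorm; apply/funext => i; rewrite !xivec_dilate; ring.
have -> : D v - D u = sqrt f * ((v - u) * r) by rewrite /D; ring.
apply: ler_wpM2r; first by rewrite mulr_ge0 ?subr_ge0.
rewrite -[leLHS](ger0_norm (ltW cc)) -sqrtr_sqr ler_wsqrtr//.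
have u0 : 0 < u := lt_le_trans ltr01 u1.
have := Hc u; rewrite lexx uv => /(_ isT); rewrite (U_dilate u0 Ux) lee_fin.
have H2 : (h + f) / u <= h + f by rewrite ler_pdivrMr//; nra.
by move=> H; have := le_trans H H2; lra.
Qed.
End Scaling.

Lemma last_time (R : realType) (a b : R) (f : R -> R) : a <= b -> lipon a b f ->
 f a <= 0 -> 0 < f b ->
 exists2 T, a <= T < b & f T = 0 /\ forall t, T < t <= b -> 0 < f t.
Proof.
move=> ab fL fa fb; pose g t := f (a + b - t).
have gL : lipon a b g.
 have [L L0 hL] := fL; exists L => // s t /andP[as_ sb] /andP[at_ tb].
 have := hL (a + b - s) (a + b - t); rewrite /g.
 have -> : a + b - s - (a + b - t) = - (s - t) by ring.
 by rewrite normrN; apply; apply/andP; split; lra.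
have ga : 0 < g a by rewrite /g (_ : a + b - a = b)//; ring.
have gb : g b <= 0 by rewrite /g (_ : a + b - b = a)//; ring.
have [T /andP[aT Tb] [gT hT]] := first_time ab gL ga gb.
exists (a + b - T); first by apply/andP; split; lra.
split=> // t /andP[Tt tb]; have := hT (a + b - t).
by rewrite /g (_ : a + b - (a + b - t) = t); [apply; apply/andP; split; lra|ring].
Qed.

Section PositiveAction.
Variables (R : realType) (m : 'I_3 -> R) (h : R).
Hypotheses (hm : posm m) (hh : 0 < h).

Lemma inertia_bounded (a b : R) x : lipc a b x ->
 exists2 M, 0 < M & forall t, a <= t <= b -> inertia m (x t) <= M.
Proof.
move=> xL; have [M M0 MP] := lipon_bounded (lipon_inertia hm xL).
exists (M + 1) => [|t tab]; first by rewrite ltr_wpDl.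
by rewrite (le_trans (ler_norm _))// (le_trans (MP _ tab))// lerDl.
Qed.

Lemma action_gt0 (s t : R) x i : s <= t -> lipc s t x ->
 (forall u, s <= u <= t -> (h%:E < U m (x u))%E) -> hopf m (x s) i != hopf m (x t) i ->
 (0 < JM m h s t x)%E.
Proof.
move=> st xL Ux ne; have [e e0 eP] := min_rate hm hh st xL Ux.
have [M M0 MP] := inertia_bounded xL.
pose c := sqrt (e / (4 * M)); have eM : 0 < e / (4 * M) by rewrite divr_gt0 ?mulr_gt0.
have c0 : 0 < c by rewrite sqrtr_gt0.
apply: (@lt_le_trans _ _ (c * hopfD m (x t) (x s))%:E).
 rewrite lte_fin mulr_gt0//; apply: (@lt_le_trans _ _ `|hopf m (x t) i - hopf m (x s) i|).
 by rewrite normr_gt0 subr_eq0 eq_sym.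
 exact: (enorm_ge (fun i => hopf m (x t) i - hopf m (x s) i)).
apply: arc_hopf_le_action => //; first exact: ltW.
move=> u hu; apply: le_trans (eP _ hu); rewrite lee_fin lerD2r.
rewrite /c sqr_sqrtr ?(ltW eM)//.
have -> : 4 * (e / (4 * M)) * inertia m (x u) = e * (inertia m (x u) / M) by field; rewrite gt_eqF.
by rewrite ler_piMr ?(ltW e0)// ler_pdivrMr// mul1r MP.
Qed.
End PositiveAction.

(** * Folding on isosceles shapes; minimizers from a collision [r12 = 0] *)

Section Isosceles.
Variables (R : realType) (m : 'I_3 -> R) (h : R).
Hypotheses (hm : posm m) (hh : 0 < h).
Implicit Types (q : conf R) (x : R -> conf R).

(** The representative with [xi1] vertical and [xi2] horizontal. Along Lipschitz curves it is
    Lipschitz even through collisions, and its frame does not rotate. *)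
Definition iso q : conf R :=
 of_xi m 0 (sqrt (xi1sq q)) (sqrt (xi2sq m q)) 0.

Let P0 q : 0 <= X1 q ^+ 2 + Y1 q ^+ 2. Proof. by rewrite addr_ge0 ?sqr_ge0. Qed.
Let S0 q : 0 <= X2 m q ^+ 2 + Y2 m q ^+ 2. Proof. by rewrite addr_ge0 ?sqr_ge0. Qed.

Lemma inertia_iso q : inertia m (iso q) = inertia m q.
Proof.
rewrite /inertia /iso; have [-> -> -> ->] := of_xiE hm 0 (sqrt (xi1sq q))
 (sqrt (xi2sq m q)) 0.
by rewrite (sqr_sqrtr (P0 q)) (sqr_sqrtr (S0 q)); ring.
Qed.

Lemma hopf_iso q : [/\ hopf m (iso q) b1 = hopf m q b1, hopf m (iso q) b2 = 0 &
 hopf m (iso q) b3 = sqrt (hopf m q b2 ^+ 2 + hopf m q b3 ^+ 2)].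
Proof.
rewrite /hopf /iso /=; have [-> -> -> ->] := of_xiE hm 0 (sqrt (xi1sq q))
 (sqrt (xi2sq m q)) 0.
rewrite (sqr_sqrtr (P0 q)) (sqr_sqrtr (S0 q)); split; [by ring|by ring|].
have k0 := ltW (kappa_gt0 hm).
rewrite mul0r subr0 -[LHS]ger0_norm ?mulr_ge0 ?sqrtr_ge0// -sqrtr_sqr; congr sqrt.
by rewrite !exprMn (sqr_sqrtr (P0 q)) (sqr_sqrtr (S0 q)); ring.
Qed.

(** The fold replaces [(w2, w3)] by its length, and a difference of lengths is at most the length of
    the difference. *)
Lemma enorm_hopf_iso q q' :
 hopfD m (iso q') (iso q) <=
 enorm (fun i => hopf m q' i - hopf m q i).
Proof.
rewrite -ler_sqr ?nnegrE ?enorm_ge0// !sqr_enorm !big_ord3.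
have [-> -> ->] := hopf_iso q; have [-> -> ->] := hopf_iso q'.
move: (hopf m q) (hopf m q') => w w'; rewrite subrr expr0n addr0 -addrA lerD2l.
have ge0 (u v : R) : 0 <= u ^+ 2 + v ^+ 2 by rewrite addr_ge0 ?sqr_ge0.
have e1 := sqr_sqrtr (ge0 (w b2) (w b3)); have e2 := sqr_sqrtr (ge0 (w' b2) (w' b3)).
have cs : w b2 * w' b2 + w b3 * w' b3 <=
 sqrt (w b2 ^+ 2 + w b3 ^+ 2) * sqrt (w' b2 ^+ 2 + w' b3 ^+ 2).
 rewrite -sqrtrM ?ge0// (le_trans (ler_norm _))// -sqrtr_sqr ler_wsqrtr// -subr_ge0.
 have -> : (w b2 ^+ 2 + w b3 ^+ 2) * (w' b2 ^+ 2 + w' b3 ^+ 2) -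
 (w b2 * w' b2 + w b3 * w' b3) ^+ 2 = (w b2 * w' b3 - w b3 * w' b2) ^+ 2 by ring.
 exact: sqr_ge0.
by move: cs e1 e2; move: (sqrt _) (sqrt _) => u v; nra.
Qed.

Lemma lipschitz_iso a b x : lipc a b x -> lipc a b (fun t => iso (x t)).
Proof.
move=> xL; apply: lipschitz_of_xi; [exact: lipon_cst| | |exact: lipon_cst]; apply: lipon_sqrt2.
- exact: lipon_X1.
- exact: lipon_Y1.
- exact: lipon_X2.
- exact: lipon_Y2.
Qed.

Hypothesis m12 : m b1 = m b2.

Lemma spread_iso q : spread m (iso q) = spread m q.
Proof.
rewrite /spread /iso; have [-> -> -> ->] := of_xiE hm 0 (sqrt (xi1sq q))
 (sqrt (xi2sq m q)) 0.
by rewrite (sqr_sqrtr (P0 q)) (sqr_sqrtr (S0 q)); ring.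
Qed.

Lemma skew_iso q : skew m (iso q) = 0.
Proof. by rewrite /skew /iso; have [-> -> -> ->] := of_xiE hm 0 (sqrt (xi1sq q))
 (sqrt (xi2sq m q)) 0; ring. Qed.

Lemma rdist12_iso q : rdist (iso q) b1 b2 = rdist q b1 b2.
Proof.
rewrite !rdist12 /iso; have [-> -> _ _] := of_xiE hm 0 (sqrt (xi1sq q))
 (sqrt (xi2sq m q)) 0.
by rewrite (sqr_sqrtr (P0 q)); congr sqrt; ring.
Qed.

Lemma U_skew q : 0 < rdist q b1 b2 -> `|skew m q| < spread m q ->
 U m q = (m b1 * m b2 / rdist q b1 b2 + m b1 * m b3 * invsum (spread m q) (skew m q))%:E.
Proof.
move=> r0; rewrite ltr_norml => /andP[h1 h2].
have p1 : 0 < spread m q - skew m q by rewrite subr_gt0.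
have p2 : 0 < spread m q + skew m q by rewrite addrC -ltrBlDr sub0r.
rewrite U_real ?(rdist13_skew hm m12) ?(rdist23_skew hm m12) ?sqrtr_gt0//.
by congr EFin; rewrite /invsum -m12; ring.
Qed.

Lemma U_skew_oo q : ~ (0 < rdist q b1 b2 /\ `|skew m q| < spread m q) -> U m q = +oo%E.
Proof.
move=> H; apply: (U_collision hm).
have [r0|r0] := ltP 0 (rdist q b1 b2); last first.
 by left; apply/le_anti; rewrite r0 rdist_ge0.
right; have := skew_le_spread m q; rewrite le_eqVlt => /predU1P[sE|sl]; last by exfalso; apply: H.
have [c0|c0] := leP 0 (skew m q).
 left; rewrite (rdist13_skew hm m12) -sE ger0_norm// subrr; exact: sqrtr0.
right; rewrite (rdist23_skew hm m12) -sE ltr0_norm// addNr; exact: sqrtr0.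
Qed.

(** Folding preserves [r12] and the spread and removes the skew. By [invsum0_le] the removed skew is
    worth at least a proportion [e] of the two remaining terms of the folded potential. *)
Lemma U_iso_gap q e : 0 <= e -> 0 < spread m q ->
 (1 + e) ^+ 2 <= 1 + skew m q ^+ 2 / (2 * spread m q ^+ 2) ->
 (U m (iso q) + (e * (2 * (m b1 * m b3) / sqrt (spread m q)))%:E <= U m q)%E.
Proof.
move=> e0 A0 he; have [[r0 sl]|H] := pselect (0 < rdist q b1 b2 /\ `|skew m q| < spread m q); last first.
 by rewrite (U_skew_oo H) leey.
rewrite (U_skew r0 sl) U_skew ?rdist12_iso ?skew_iso ?spread_iso ?normr0// invsum0//.
rewrite -EFinD lee_fin -addrA lerD2l.
have M0 : 0 < m b1 * m b3 by rewrite mulr_gt0.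
have sA : 0 < sqrt (spread m q) by rewrite sqrtr_gt0.
have -> : m b1 * m b3 * (2 / sqrt (spread m q)) + e * (2 * (m b1 * m b3) / sqrt (spread m q)) =
 m b1 * m b3 * ((1 + e) * 2 / sqrt (spread m q)) by ring.
apply: ler_wpM2l; first exact: ltW.
rewrite -ler_sqr ?nnegrE ?invsum_ge0 ?divr_ge0 ?mulr_ge0 ?(ltW sA)//; try lra.
apply: (le_trans _ (invsum0_le sl)).
rewrite !exprMn exprVn sqr_sqrtr ?(ltW A0)//.
have -> : (1 + e) ^+ 2 * 2 ^+ 2 / spread m q = 4 / spread m q * (1 + e) ^+ 2 by ring.
by apply: ler_wpM2l => //; rewrite divr_ge0 ?ltW.
Qed.

Lemma U_iso q : (U m (iso q) <= U m q)%E.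
Proof.
have [[r0 sl]|H] := pselect (0 < rdist q b1 b2 /\ `|skew m q| < spread m q); last first.
 by rewrite (U_skew_oo H) leey.
have A0 : 0 < spread m q := le_lt_trans (normr_ge0 _) sl.
have := @U_iso_gap q 0 (lexx 0) A0; rewrite mul0r adde0; apply.
rewrite addr0 expr1n lerDl; apply: divr_ge0; first exact: sqr_ge0.
by apply: mulr_ge0 => //; exact: sqr_ge0.
Qed.

Lemma lipon_spread a b x : lipc a b x -> lipon a b (fun t => spread m (x t)).
Proof.
move=> xL; have sq f : lipon a b f -> lipon a b (fun t => f t ^+ 2).
 by move=> fL; apply: (lipon_ext (f := fun t => f t * f t)) => [t _|]; [rewrite expr2|exact: liponM].
apply: liponD; first by apply: liponD; apply: sq; [exact: lipon_X2|exact: lipon_Y2].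
apply: liponM; last exact: lipon_cst.
by apply: liponD; apply: sq; [exact: lipon_X1|exact: lipon_Y1].
Qed.

Lemma sqr_skew_le q : skew m q ^+ 2 <= (xi1sq q) * spread m q.
Proof.
rewrite -subr_ge0 /skew /spread.
have -> : (xi1sq q) * (X2 m q ^+ 2 + Y2 m q ^+ 2 + (xi1sq q) / 4) -
 (- (X1 q * X2 m q + Y1 q * Y2 m q)) ^+ 2 =
 (X1 q * Y2 m q - Y1 q * X2 m q) ^+ 2 + (xi1sq q) ^+ 2 / 4 by field.
by rewrite addr_ge0 ?divr_ge0 ?sqr_ge0.
Qed.

(** The gap is uniform because the spread is bounded above on a compact interval. The lower bound on
    the skew also keeps [r12] away from 0, since [skew^2 <= |xi1|^2 * spread]; this bounds the
    potential of the folded curve. *)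
Lemma iso_strict s t x k0 : s <= t -> lipc s t x -> 0 < k0 ->
 (forall u, s <= u <= t -> k0 <= `|skew m (x u)|) ->
 exists e F, 0 < e /\ forall u, s <= u <= t ->
 (U m (iso (x u)) <= F%:E)%E /\ (U m (iso (x u)) + e%:E <= U m (x u))%E.
Proof.
move=> st xL k00 Hk; have [A1 A10 HA1] := lipon_bounded (lipon_spread xL).
pose A := A1 + 1; have A0 : 0 < A by rewrite ltr_wpDl.
have HA u : s <= u <= t -> spread m (x u) <= A.
 by move=> hu; rewrite (le_trans (ler_norm _))// (le_trans (HA1 _ hu))// lerDl.
have spos u : s <= u <= t -> k0 <= spread m (x u).
 by move=> hu; rewrite (le_trans (Hk _ hu))// skew_le_spread.
pose E0 := k0 ^+ 2 / (2 * A ^+ 2); have E00 : 0 < E0 by rewrite divr_gt0 ?mulr_gt0 ?exprn_gt0.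
(* For [e <= 1] one has [(1 + e)^2 <= 1 + 3 e], whence the division by 3. *)
pose e := minr 1 (E0 / 3); have e0 : 0 < e by rewrite lt_min ltr01 divr_gt0.
have e1 : e <= 1 by rewrite ge_min lexx.
have e3 : 3 * e <= E0 by rewrite -ler_pdivlMl// mulrC ge_min lexx orbT.
have M0 : 0 < m b1 * m b3 by rewrite mulr_gt0.
have sA : 0 < sqrt A by rewrite sqrtr_gt0.
exists (e * (2 * (m b1 * m b3) / sqrt A)).
exists (m b1 * m b2 / sqrt (k0 ^+ 2 / A) + m b1 * m b3 * (2 / sqrt k0)).
split; first by rewrite mulr_gt0// divr_gt0// mulr_gt0.
move=> u hu; have q0 := spos _ hu; have sp : 0 < spread m (x u) := lt_le_trans k00 q0.
have P1 : k0 ^+ 2 / A <= X1 (x u) ^+ 2 + Y1 (x u) ^+ 2.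
 rewrite ler_pdivrMr//; apply: (@le_trans _ _ ((xi1sq (x u)) * spread m (x u))).
 apply: le_trans (sqr_skew_le _); rewrite -(real_normK (num_real (skew m (x u)))).
 by rewrite lerXn2r ?nnegrE ?(ltW k00) ?Hk.
 by apply: ler_wpM2l; [exact: P0|exact: HA].
have kA : 0 < k0 ^+ 2 / A by rewrite divr_gt0// exprn_gt0.
have r12 : sqrt (k0 ^+ 2 / A) <= rdist (x u) b1 b2 by rewrite rdist12 ler_wsqrtr.
have r0 : 0 < sqrt (k0 ^+ 2 / A) by rewrite sqrtr_gt0.
split.
 rewrite U_skew ?rdist12_iso ?skew_iso ?spread_iso ?normr0// ?(lt_le_trans r0 r12)// invsum0//.
 rewrite lee_fin lerD// ler_wpM2l ?mulr_ge0 ?(ltW (hm _))//.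
 by rewrite lef_pV2 ?posrE// (lt_le_trans r0).
 by rewrite ler_wpM2l// lef_pV2 ?posrE ?sqrtr_gt0// ler_wsqrtr.
apply: (le_trans _ (@U_iso_gap _ e (ltW e0) sp _)).
 rewrite leeD2l// lee_fin ler_wpM2l ?(ltW e0)// ler_wpM2l ?mulr_ge0 ?(ltW (hm _))//.
 by rewrite lef_pV2 ?posrE ?sqrtr_gt0// ler_wsqrtr// HA.
apply: (@le_trans _ _ (1 + E0)); first by clear -e0 e1 e3; nra.
have A2 : 0 < 2 * A ^+ 2 by rewrite mulr_gt0// exprn_gt0.
rewrite lerD2l /E0; apply: ler_pM; [exact: sqr_ge0|by rewrite invr_ge0 ltW| |].
 by rewrite -(real_normK (num_real (skew m (x u)))) lerXn2r ?nnegrE ?(ltW k00) ?Hk.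
rewrite lef_pV2 ?posrE ?mulr_gt0 ?exprn_gt0// ler_wpM2l// lerXn2r ?nnegrE ?(ltW sp) ?(ltW A0)//.
exact: HA.
Qed.

(** At [r12 = 0] both [w2] and [w3] vanish, so the folded curve starts at the same class and is a
    competitor. If [w2] were not identically zero, an arc with skew bounded below would make it
    strictly better. *)
Lemma lip_min_isosceles q0 a b x : rdist q0 b1 b2 = 0 -> lip_min m h q0 a b x ->
 forall t, a <= t <= b -> hopf m (x t) b2 = 0.
Proof.
move=> r0 xm; have xL := lm_lip xm; have ab := ltW (lm_lt xm).
have P00 : X1 (x a) ^+ 2 + Y1 (x a) ^+ 2 = 0.
 have := same_conf_rdist b1 b2 (lm_start xm); rewrite r0 rdist12 => /esym/eqP.
 by rewrite sqrtr_eq0 => P1; apply/le_anti; rewrite P1 P0.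
have [x10 y10] : X1 (x a) = 0 /\ Y1 (x a) = 0.
 by move/eqP: P00; rewrite paddr_eq0 ?sqr_ge0// !sqrf_eq0 => /andP[/eqP -> /eqP ->].
have ha2 : hopf m (x a) b2 = 0 by rewrite /hopf/= x10 y10; ring.
have ha3 : hopf m (x a) b3 = 0 by rewrite /hopf/= x10 y10; ring.
pose y t := iso (x t).
have ya : same_conf (y a) q0.
 apply: same_conf_trans (lm_start xm); apply: (hopf_inj hm).
 have [e1 e2 e3] := hopf_iso (x a); apply/funext => i.
 case: (ord3_cases i) => ->; rewrite ?e1 ?e2 ?e3 ?ha2 ?ha3//.
 by rewrite expr0n addr0 sqrtr0.
have yL : lipc a b y by exact: lipschitz_iso.
have Uyb : (U m (y b) <= h%:E)%E by rewrite -(lm_end xm); exact: U_iso.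
have key := lm_min xm ab yL ya Uyb.
suff pos sg : sg * sg = 1 -> forall t, a <= t <= b -> sg * hopf m (x t) b2 <= 0.
 move=> t tab; apply/le_anti; have := pos 1 (mulr1 _) t tab; rewrite mul1r => ->.
 by have := pos (-1) (etrans (mulrNN 1 1) (mulr1 1)) t tab; rewrite mulN1r oppr_le0 => ->.
move=> sg2 t0 /andP[at0 t0b]; rewrite leNgt; apply/negP => pos.
pose f t := sg * hopf m (x t) b2; pose M := f t0.
have fL : lipon a t0 f.
 by apply: liponZ; apply: lipon_sub (lexx a) t0b (lipon_hopf m xL b2).
have fa : f a = 0 by rewrite /f ha2 mulr0.
have M0 : 0 < M by [].
(* The arc runs between the levels [M / 2] and [3 M / 4]. Since it ends before [t0], the potential
   is above [h] on it; since [w2] varies on it, its action is positive. *)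
have [|||T2 /andP[aT2 T2t] [fT2 _]] := @first_time _ a t0 (fun t => 3 / 4 * M - f t) at0.
- by apply: liponB => //; exact: lipon_cst.
- by rewrite fa; lra.
- by rewrite -/M; lra.
have {}fT2 : f T2 = 3 / 4 * M by lra.
have [|||T1 /andP[aT1 T1T2] [fT1 fT12]] := @last_time _ a T2 (fun t => f t - M / 2) (ltW aT2).
- by apply: liponB; [exact: lipon_sub (lexx a) T2t fL|exact: lipon_cst].
- by rewrite fa; lra.
- by rewrite fT2; lra.
have {}fT1 : f T1 = M / 2 by lra.
have T2t0 : T2 < t0.
 by rewrite lt_neqAle T2t andbT; apply/eqP => e; move: fT2; rewrite e -/M; lra.
have T2b : T2 <= b := le_trans T2t t0b.
have xL12 : lipc T1 T2 x := lipc_sub aT1 T2b xL.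
have kap := kappa_gt0 hm.
have sgn : `|sg| = 1 by apply/eqP; rewrite -(@eqrXn2 _ 2)// expr1n -normrX expr2 sg2 normr1.
have Hk u : T1 <= u <= T2 -> M / (4 * kappa m) <= `|skew m (x u)|.
 move=> /andP[T1u uT2]; have fu : M / 2 <= f u.
 move: T1u; rewrite le_eqVlt => /predU1P[<-|T1u]; first by rewrite fT1.
 by rewrite -subr_ge0 ltW// fT12// T1u.
 have : M / 2 <= `|f u| := le_trans fu (ler_norm _).
 rewrite /f normrM sgn mul1r hopf_skew normrM (gtr0_norm (mulr_gt0 _ kap))//.
 have -> : M / 2 = 2 * kappa m * (M / (4 * kappa m)) by field; rewrite gt_eqF.
 by rewrite ler_pM2l// mulr_gt0.
have k00 : 0 < M / (4 * kappa m) by rewrite divr_gt0// mulr_gt0.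
have [e [F [e0 HeF]]] := iso_strict (ltW T1T2) xL12 k00 Hk.
have A0 : (0 < JM m h T1 T2 x)%E.
 apply: (action_gt0 hm hh (i := b2) (ltW T1T2) xL12).
 move=> u /andP[T1u uT2]; apply: (lm_before xm).
 by rewrite (le_trans aT1)// (le_lt_trans uT2)// (lt_le_trans T2t0).
 by apply/eqP => E; move: fT1 fT2; rewrite /f E; lra.
suff : (JM m h a b y < JM m h a b x)%E by rewrite ltNge key.
have HJ2 s t c : a <= s -> s <= t -> t <= b -> 0 <= c ->
 (forall u, s <= u <= t -> ((c ^+ 2 * (4 * inertia m (x u)) + h)%:E <= U m (x u))%E) ->
 ((c * hopfD m (x t) (x s)%R)%:E <= JM m h s t x)%E.
 move=> as_ st tb c0 H; apply: arc_hopf_le_action => //.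
 exact: lipc_sub xL.
 by move=> u hu; rewrite -mulrA mulrCA; exact: H.
have HJ3 s t (D : R -> R) : a <= s -> s < t -> t <= b ->
 (forall u v, s <= u -> u <= v -> v <= t -> D u <= D v) ->
 (forall u v c, s <= u -> u <= v -> v <= t -> 0 < c ->
 (forall w, u <= w <= v -> ((c ^+ 2 * (4 * inertia m (x w)) + h)%:E <= U m (y w))%E) ->
 c * hopfD m (y v) (y u) <= D v - D u) ->
 (JM m h s t y <= (D t - D s)%:E)%E.
 move=> as_ st tb mD HD; apply: (action_le_hopf hm st (lipc_sub as_ tb yL) mD).
 move=> u v c su uv vt c0 H; apply: HD => // w hw.
 by have := H w hw; rewrite inertia_iso -mulrA mulrCA.
apply: (compare_total_lt hm xL yL HJ2 HJ3 _ (lm_fin xm) aT1 (ltW T1T2) T2b e0 _ HeF A0).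
- by move=> s t _ _ _; exact: enorm_hopf_iso.
- by move=> u _; exact: U_iso.
Qed.
End Isosceles.

Lemma lipon_sqrt (R : realType) (a b e : R) (f : R -> R) : 0 < e -> lipon a b f ->
 (forall t, a <= t <= b -> e <= f t) -> lipon a b (fun t => sqrt (f t)).
Proof.
move=> e0 [L L0 fL] ef; have se : 0 < sqrt e by rewrite sqrtr_gt0.
exists (L / sqrt e); first by rewrite divr_ge0 ?(ltW se).
move=> s t hs ht; have := fL s t hs ht.
have u0 := lt_le_trans e0 (ef _ hs); have v0 := lt_le_trans e0 (ef _ ht).
have us : sqrt e <= sqrt (f s) by rewrite ler_wsqrtr// ef.
have h1 : f s - f t = (sqrt (f s) - sqrt (f t)) * (sqrt (f s) + sqrt (f t)).
 by rewrite -subr_sqr !sqr_sqrtr ?ltW.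
rewrite mulrAC ler_pdivlMr// h1 normrM; apply: le_trans; apply: ler_wpM2l => //.
by rewrite ger0_norm ?addr_ge0 ?sqrtr_ge0// (le_trans us)// lerDl sqrtr_ge0.
Qed.

(** * Lifts from Hopf coordinates, and avoidance of the triple collision *)

Section HopfSections.
Variables (R : realType) (m : 'I_3 -> R).
Hypothesis hm : posm m.
Implicit Types (w : R) (q : conf R).

Definition norm3 w1 w2 w3 : R := sqrt (w1 ^+ 2 + w2 ^+ 2 + w3 ^+ 2).

Let n0 w1 w2 w3 : 0 <= w1 ^+ 2 + w2 ^+ 2 + w3 ^+ 2.
Proof. by rewrite !addr_ge0 ?sqr_ge0. Qed.
Lemma inertia_norm3 q : inertia m q = norm3 (hopf m q b1) (hopf m q b2) (hopf m q b3).
Proof. by rewrite -(enorm_hopf hm) /enorm big_ord3. Qed.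
Lemma sqr_norm3 w1 w2 w3 : norm3 w1 w2 w3 ^+ 2 = w1 ^+ 2 + w2 ^+ 2 + w3 ^+ 2.
Proof. by rewrite sqr_sqrtr. Qed.
Lemma ler_norm3 w1 w2 w3 : [/\ `|w1| <= norm3 w1 w2 w3, `|w2| <= norm3 w1 w2 w3 &
 `|w3| <= norm3 w1 w2 w3].
Proof.
rewrite -!sqrtr_sqr /norm3; have := sqr_ge0 w1; have := sqr_ge0 w2; have := sqr_ge0 w3.
by move=> h1 h2 h3; split; rewrite ler_wsqrtr//; lra.
Qed.

(* Lifts with [xi2], respectively [xi1], real: the first one is smooth away from
 the half-line of shapes with [xi2 = 0]. *)
Definition lift2 w1 w2 w3 : conf R :=
 let v := sqrt ((norm3 w1 w2 w3 - w1) / (2 * mu2 m)) in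
 of_xi m (- w2 / (2 * kappa m) * v^-1) (w3 / (2 * kappa m) * v^-1) v 0.

Definition lift1 w1 w2 w3 : conf R :=
 let u := sqrt ((norm3 w1 w2 w3 + w1) / (2 * mu1 m)) in
 of_xi m u 0 (- w2 / (2 * kappa m) * u^-1) (- w3 / (2 * kappa m) * u^-1).

Lemma hopf_lift2 w1 w2 w3 : 0 < norm3 w1 w2 w3 - w1 ->
 [/\ hopf m (lift2 w1 w2 w3) b1 = w1, hopf m (lift2 w1 w2 w3) b2 = w2 &
 hopf m (lift2 w1 w2 w3) b3 = w3].
Proof.
move=> pos; have sn := sqr_norm3 w1 w2 w3.
have sk := sqr_kappa hm; have k0 := kappa_gt0 hm; have p1 := mu1_gt0 hm; have p2 := mu2_gt0 hm.
have vpos : 0 < (norm3 w1 w2 w3 - w1) / (2 * mu2 m) by rewrite divr_gt0// mulr_gt0.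
have sv := sqr_sqrtr (ltW vpos); rewrite /hopf/= /lift2.
have v0 : 0 < sqrt ((norm3 w1 w2 w3 - w1) / (2 * mu2 m)) by rewrite sqrtr_gt0.
have [-> -> -> ->] := of_xiE hm (- w2 / (2 * kappa m) * (sqrt ((norm3 w1 w2 w3 - w1) / (2 * mu2 m)))^-1)
 (w3 / (2 * kappa m) * (sqrt ((norm3 w1 w2 w3 - w1) / (2 * mu2 m)))^-1)
 (sqrt ((norm3 w1 w2 w3 - w1) / (2 * mu2 m))) 0.
move: (sqrt ((norm3 w1 w2 w3 - w1) / (2 * mu2 m))) v0 sv => v v0 sv.
move: (norm3 w1 w2 w3) sn pos vpos sv => n sn pos vpos sv.
move: (kappa m) (mu1 m) (mu2 m) sk k0 p1 p2 vpos sv => k u1 u2 sk k0 p1 p2 vpos sv.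
have e1 : u2 * v ^+ 2 = (n - w1) / 2 by rewrite sv; field; rewrite gt_eqF.
split; [|by field; rewrite !gt_eqF|by field; rewrite !gt_eqF].
have -> : u1 * ((- w2 / (2 * k) * v^-1) ^+ 2 + (w3 / (2 * k) * v^-1) ^+ 2) =
 u1 * (w2 ^+ 2 + w3 ^+ 2) / (4 * k ^+ 2 * v ^+ 2) by field; rewrite !gt_eqF.
rewrite sk expr0n addr0 e1.
have -> : u1 * (w2 ^+ 2 + w3 ^+ 2) / (4 * (u1 * u2) * v ^+ 2) = (w2 ^+ 2 + w3 ^+ 2) / (4 * (u2 * v ^+ 2)).
 by field; rewrite !gt_eqF.
rewrite e1 (_ : w2 ^+ 2 + w3 ^+ 2 = (n - w1) * (n + w1)); last first.
 by rewrite -subr_sqr sn; ring.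
by field; rewrite gt_eqF.
Qed.

Lemma hopf_lift1 w1 w2 w3 : 0 < norm3 w1 w2 w3 + w1 ->
 [/\ hopf m (lift1 w1 w2 w3) b1 = w1, hopf m (lift1 w1 w2 w3) b2 = w2 &
 hopf m (lift1 w1 w2 w3) b3 = w3].
Proof.
move=> pos; have sn := sqr_norm3 w1 w2 w3.
have sk := sqr_kappa hm; have k0 := kappa_gt0 hm; have p1 := mu1_gt0 hm; have p2 := mu2_gt0 hm.
have vpos : 0 < (norm3 w1 w2 w3 + w1) / (2 * mu1 m) by rewrite divr_gt0// mulr_gt0.
have sv := sqr_sqrtr (ltW vpos); rewrite /hopf/= /lift1.
have v0 : 0 < sqrt ((norm3 w1 w2 w3 + w1) / (2 * mu1 m)) by rewrite sqrtr_gt0.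
have [-> -> -> ->] := of_xiE hm (sqrt ((norm3 w1 w2 w3 + w1) / (2 * mu1 m))) 0
 (- w2 / (2 * kappa m) * (sqrt ((norm3 w1 w2 w3 + w1) / (2 * mu1 m)))^-1)
 (- w3 / (2 * kappa m) * (sqrt ((norm3 w1 w2 w3 + w1) / (2 * mu1 m)))^-1).
move: (sqrt ((norm3 w1 w2 w3 + w1) / (2 * mu1 m))) v0 sv => v v0 sv.
move: (norm3 w1 w2 w3) sn pos vpos sv => n sn pos vpos sv.
move: (kappa m) (mu1 m) (mu2 m) sk k0 p1 p2 vpos sv => k u1 u2 sk k0 p1 p2 vpos sv.
have e1 : u1 * v ^+ 2 = (n + w1) / 2 by rewrite sv; field; rewrite gt_eqF.
split; [|by field; rewrite !gt_eqF|by field; rewrite !gt_eqF].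
have -> : u2 * ((- w2 / (2 * k) * v^-1) ^+ 2 + (- w3 / (2 * k) * v^-1) ^+ 2) =
 u2 * (w2 ^+ 2 + w3 ^+ 2) / (4 * k ^+ 2 * v ^+ 2) by field; rewrite !gt_eqF.
rewrite sk expr0n addr0 e1.
have -> : u2 * (w2 ^+ 2 + w3 ^+ 2) / (4 * (u1 * u2) * v ^+ 2) = (w2 ^+ 2 + w3 ^+ 2) / (4 * (u1 * v ^+ 2)).
 by field; rewrite !gt_eqF.
rewrite e1 (_ : w2 ^+ 2 + w3 ^+ 2 = (n - w1) * (n + w1)); last first.
 by rewrite -subr_sqr sn; ring.
by field; rewrite gt_eqF.
Qed.

Lemma lipon_norm3 a b (f g k : R -> R) : lipon a b f -> lipon a b g -> lipon a b k ->
 lipon a b (fun t => norm3 (f t) (g t) (k t)).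
Proof.
move=> fL gL kL; have H := lipon_sqrt2 (lipon_sqrt2 fL gL) kL.
apply: lipon_ext H => t _; rewrite /norm3 sqr_sqrtr// addr_ge0 ?sqr_ge0//.
Qed.

Lemma lipschitz_lift2 a b e (f g k : R -> R) : 0 < e ->
 lipon a b f -> lipon a b g -> lipon a b k ->
 (forall t, a <= t <= b -> e <= norm3 (f t) (g t) (k t) - f t) ->
 lipc a b (fun t => lift2 (f t) (g t) (k t)).
Proof.
move=> e0 fL gL kL H; have p2 : 0 < 2 * mu2 m by rewrite pmulr_rgt0 ?(mu2_gt0 hm).
have vL : lipon a b (fun t => sqrt ((norm3 (f t) (g t) (k t) - f t) / (2 * mu2 m))).
 apply: (@lipon_sqrt _ _ _ (e / (2 * mu2 m))); first exact: divr_gt0.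
 by apply: liponM; [apply: liponB => //; exact: lipon_norm3|exact: lipon_cst].
 by move=> t tab; rewrite ler_wpM2r ?invr_ge0 ?(ltW p2)// H.
have viL : lipon a b (fun t => (sqrt ((norm3 (f t) (g t) (k t) - f t) / (2 * mu2 m)))^-1).
 apply: (@lipon_inv _ _ _ (sqrt (e / (2 * mu2 m)))) => //.
 by rewrite sqrtr_gt0 divr_gt0.
 by move=> t tab; rewrite ler_wsqrtr// ler_wpM2r ?invr_ge0 ?(ltW p2)// H.
apply: lipschitz_of_xi => //; last exact: lipon_cst.
- by apply: liponM => //; apply: liponM; [exact: liponN|exact: lipon_cst].
- by apply: liponM => //; apply: liponM => //; exact: lipon_cst.
Qed.

Lemma lipschitz_lift1 a b e (f g k : R -> R) : 0 < e ->
 lipon a b f -> lipon a b g -> lipon a b k ->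
 (forall t, a <= t <= b -> e <= norm3 (f t) (g t) (k t) + f t) ->
 lipc a b (fun t => lift1 (f t) (g t) (k t)).
Proof.
move=> e0 fL gL kL H; have p2 : 0 < 2 * mu1 m by rewrite pmulr_rgt0 ?(mu1_gt0 hm).
have vL : lipon a b (fun t => sqrt ((norm3 (f t) (g t) (k t) + f t) / (2 * mu1 m))).
 apply: (@lipon_sqrt _ _ _ (e / (2 * mu1 m))); first exact: divr_gt0.
 by apply: liponM; [apply: liponD => //; exact: lipon_norm3|exact: lipon_cst].
 by move=> t tab; rewrite ler_wpM2r ?invr_ge0 ?(ltW p2)// H.
have viL : lipon a b (fun t => (sqrt ((norm3 (f t) (g t) (k t) + f t) / (2 * mu1 m)))^-1).
 apply: (@lipon_inv _ _ _ (sqrt (e / (2 * mu1 m)))) => //.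
 by rewrite sqrtr_gt0 divr_gt0.
 by move=> t tab; rewrite ler_wsqrtr// ler_wpM2r ?invr_ge0 ?(ltW p2)// H.
apply: lipschitz_of_xi => //; first exact: lipon_cst.
- by apply: liponM => //; apply: liponM; [exact: liponN|exact: lipon_cst].
- by apply: liponM => //; apply: liponM; [exact: liponN|exact: lipon_cst].
Qed.
End HopfSections.

Section ShapeBounds.
Variables (R : realType) (m : 'I_3 -> R) (h : R).
Hypotheses (hm : posm m) (hh : 0 < h).
Implicit Types (q : conf R) (x : R -> conf R).

(** With [w1] and [w2] fixed, the inner product of [xi1] and [xi2] is fixed while [|xi1|] and
    [|xi2|] grow with the inertia, and hence so do all three distances. *)
Lemma U_anti_hopf q q' : hopf m q' b1 = hopf m q b1 -> hopf m q' b2 = hopf m q b2 ->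
 inertia m q <= inertia m q' -> (U m q' <= U m q)%E.
Proof.
move=> e1 e2 N; have p1 := mu1_gt0 hm; have p2 := mu2_gt0 hm; have k0 := kappa_gt0 hm.
have P : X1 q ^+ 2 + Y1 q ^+ 2 <= X1 q' ^+ 2 + Y1 q' ^+ 2.
 by rewrite -(ler_pM2l p1) !hopf_P e1; lra.
have S : X2 m q ^+ 2 + Y2 m q ^+ 2 <= X2 m q' ^+ 2 + Y2 m q' ^+ 2.
 by rewrite -(ler_pM2l p2) !hopf_S e1; lra.
have C : X1 q * X2 m q + Y1 q * Y2 m q = X1 q' * X2 m q' + Y1 q' * Y2 m q'.
 move/eqP: e2; rewrite /hopf/= eqr_opp => /eqP H.
 by apply: (@mulfI _ (2 * kappa m)) => //; rewrite mulf_neq0 ?pnatr_eq0 ?gt_eqF.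
have be0 : 0 <= m b2 / (m b1 + m b2) by rewrite divr_ge0 ?addr_ge0 ?ltW.
have al0 : 0 <= m b1 / (m b1 + m b2) by rewrite divr_ge0 ?addr_ge0 ?ltW.
have r12 : rdist q b1 b2 <= rdist q' b1 b2 by rewrite !rdist12 ler_wsqrtr.
have r13 : rdist q b1 b3 <= rdist q' b1 b3.
 rewrite !(rdist13 hm) ler_wsqrtr//; move: (m b2 / _) be0 => be be0.
 have E q1 : (X2 m q1 + be * X1 q1) ^+ 2 + (Y2 m q1 + be * Y1 q1) ^+ 2 =
 (xi2sq m q1) + be ^+ 2 * (xi1sq q1) +
 2 * be * (X1 q1 * X2 m q1 + Y1 q1 * Y2 m q1) by ring.
 by rewrite !E C lerD2r lerD// ler_wpM2l// sqr_ge0.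
have r23 : rdist q b2 b3 <= rdist q' b2 b3.
 rewrite !(rdist23 hm) ler_wsqrtr//; move: (m b1 / _) al0 => be al0.
 have E q1 : (X2 m q1 - be * X1 q1) ^+ 2 + (Y2 m q1 - be * Y1 q1) ^+ 2 =
 (xi2sq m q1) + be ^+ 2 * (xi1sq q1) -
 2 * be * (X1 q1 * X2 m q1 + Y1 q1 * Y2 m q1) by ring.
 by rewrite !E C lerD2r lerD// ler_wpM2l// sqr_ge0.
have d0 q1 i : rdist q1 i i = 0.
 by rewrite rdist_sqrt !subrr expr0n addr0 sqrtr0.
apply: (U_anti hm) => i j.
by case: (ord3_cases i) => ->; case: (ord3_cases j) => ->;
 rewrite ?d0// ?(rdistC q b2 b1) ?(rdistC q' b2 b1) ?(rdistC q b3 b1) ?(rdistC q' b3 b1)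
 ?(rdistC q b3 b2) ?(rdistC q' b3 b2).
Qed.

Definition mumin : R := minr (mu1 m) (mu2 m).

Lemma mumin_gt0 : 0 < mumin.
Proof. by rewrite lt_min (mu1_gt0 hm) (mu2_gt0 hm). Qed.
(** Up to a factor, [w3] is the determinant of [xi1] and [xi2]. It is unchanged when [xi2] is
    replaced by [q3 - q1] or [q3 - q2], so it is at most a side times the length of a Jacobi vector,
    which the inertia controls. *)
Lemma area_le_rdist q i j : i != j ->
 hopf m q b3 ^+ 2 * mumin <= 4 * kappa m ^+ 2 * inertia m q * rdist q i j ^+ 2.
Proof.
have p1 := mu1_gt0 hm; have p2 := mu2_gt0 hm; have m0 := mumin_gt0.
have P0 : 0 <= X1 q ^+ 2 + Y1 q ^+ 2 by rewrite addr_ge0 ?sqr_ge0.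
have S0 : 0 <= X2 m q ^+ 2 + Y2 m q ^+ 2 by rewrite addr_ge0 ?sqr_ge0.
have nP : mumin * (xi1sq q) <= inertia m q.
 rewrite /inertia -[leLHS]addr0 lerD ?(mulr_ge0 (ltW p2))//.
 by rewrite ler_wpM2r// ge_min lexx.
have nS : mumin * (xi2sq m q) <= inertia m q.
 rewrite /inertia -[leLHS]add0r lerD ?(mulr_ge0 (ltW p1))//.
 by rewrite ler_wpM2r// ge_min lexx orbT.
have k2 : 0 <= 4 * kappa m ^+ 2 by rewrite mulr_ge0 ?sqr_ge0.
have key (A B : R) : 0 <= B -> (Y1 q * X2 m q - X1 q * Y2 m q) ^+ 2 <= A * B ->
 mumin * A <= inertia m q -> 
 hopf m q b3 ^+ 2 * mumin <= 4 * kappa m ^+ 2 * inertia m q * B.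
 move=> B0 H1 H2; rewrite /hopf/=.
 have -> : (2 * kappa m * (Y1 q * X2 m q - X1 q * Y2 m q)) ^+ 2 * mumin =
 4 * kappa m ^+ 2 * (mumin * (Y1 q * X2 m q - X1 q * Y2 m q) ^+ 2) by ring.
 rewrite -(mulrA _ (inertia m q)); apply: ler_wpM2l => //; apply: (@le_trans _ _ (mumin * (A * B))).
 by rewrite ler_wpM2l ?(ltW m0).
 by rewrite mulrA ler_wpM2r.
have lag (x1 y1 x2 y2 : R) : (y1 * x2 - x1 * y2) ^+ 2 <= (x1 ^+ 2 + y1 ^+ 2) * (x2 ^+ 2 + y2 ^+ 2).
 rewrite -subr_ge0; have -> : (x1 ^+ 2 + y1 ^+ 2) * (x2 ^+ 2 + y2 ^+ 2) - (y1 * x2 - x1 * y2) ^+ 2 =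
 (x1 * x2 + y1 * y2) ^+ 2 by ring.
 exact: sqr_ge0.
have ss (u v : R) : 0 <= u ^+ 2 + v ^+ 2 by rewrite addr_ge0 ?sqr_ge0.
have r12 : hopf m q b3 ^+ 2 * mumin <= 4 * kappa m ^+ 2 * inertia m q * rdist q b1 b2 ^+ 2.
 rewrite rdist12 (sqr_sqrtr (ss _ _)); apply: (key _ _ _ _ nS) => //.
 by rewrite [leRHS]mulrC; exact: lag.
have r13 : hopf m q b3 ^+ 2 * mumin <= 4 * kappa m ^+ 2 * inertia m q * rdist q b1 b3 ^+ 2.
 rewrite (rdist13 hm) (sqr_sqrtr (ss _ _)); apply: (key _ _ _ _ nP) => //; move: (m b2 / _) => be.
 have := lag (X1 q) (Y1 q) (X2 m q + be * X1 q) (Y2 m q + be * Y1 q); apply: le_trans.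
 by apply: le_of_eq; ring.
have r23 : hopf m q b3 ^+ 2 * mumin <= 4 * kappa m ^+ 2 * inertia m q * rdist q b2 b3 ^+ 2.
 rewrite (rdist23 hm) (sqr_sqrtr (ss _ _)); apply: (key _ _ _ _ nP) => //; move: (m b1 / _) => be.
 have := lag (X1 q) (Y1 q) (X2 m q - be * X1 q) (Y2 m q - be * Y1 q); apply: le_trans.
 by apply: le_of_eq; ring.
by case: (ord3_cases i) => ->; case: (ord3_cases j) => -> //= _; rewrite ?(rdistC q b2 b1)
 ?(rdistC q b3 b1) ?(rdistC q b3 b2).
Qed.

Lemma U_le_area q d M : 0 < d -> 0 < M -> d <= `|hopf m q b3| -> inertia m q <= M ->
 (U m q <= (pair_mass m / (d * sqrt (mumin / (4 * kappa m ^+ 2 * M))))%:E)%E.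
Proof.
move=> d0 M0 hd NM; have k0 := kappa_gt0 hm; have m0 := mumin_gt0.
have p : 0 < 4 * kappa m ^+ 2 * M by rewrite !mulr_gt0// exprn_gt0.
have q0 : 0 < mumin / (4 * kappa m ^+ 2 * M) by rewrite divr_gt0.
have e0 : 0 < d * sqrt (mumin / (4 * kappa m ^+ 2 * M)) by rewrite mulr_gt0// sqrtr_gt0.
apply: (U_le_separation hm e0) => i j ij.
rewrite -ler_sqr ?nnegrE ?rdist_ge0 ?(ltW e0)// exprMn sqr_sqrtr ?(ltW q0)//.
rewrite mulrA ler_pdivrMr//; apply: (@le_trans _ _ (hopf m q b3 ^+ 2 * mumin)).
 rewrite ler_wpM2r ?(ltW m0)// -(real_normK (num_real (hopf m q b3))).
 by rewrite lerXn2r ?nnegrE ?(ltW d0).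
apply: (le_trans (area_le_rdist q ij)); rewrite mulrC ler_wpM2l ?sqr_ge0//.
by rewrite ler_wpM2l// mulr_ge0 ?sqr_ge0.
Qed.

(** Only the pair 1, 2 is kept: its distance is at most [n / sqrt (mu1 m)]. *)
Lemma U_ge_inertia q n : 0 < n -> inertia m q <= n ^+ 2 ->
 ((m b1 * m b2 * sqrt (mu1 m) / n)%:E <= U m q)%E.
Proof.
move=> n0 Nn; have p1 := mu1_gt0 hm; have p2 := mu2_gt0 hm.
have s0 : 0 < sqrt (mu1 m) by rewrite sqrtr_gt0.
have S0 : 0 <= X2 m q ^+ 2 + Y2 m q ^+ 2 by rewrite addr_ge0 ?sqr_ge0.
have r12 : rdist q b1 b2 <= n / sqrt (mu1 m).
 rewrite ler_pdivlMr// rdist12 -sqrtrM ?addr_ge0 ?sqr_ge0// -[leRHS](gtr0_norm n0) -sqrtr_sqr.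
 rewrite ler_wsqrtr// (le_trans _ Nn)// /inertia mulrC lerDl.
 by apply: mulr_ge0 => //; exact: ltW.
rewrite potentialE -[leLHS]adde0 -[leLHS]adde0; apply: leeD; first apply: leeD.
- have -> : (m b1 * m b2 * sqrt (mu1 m) / n)%:E =
 ((m b1 * m b2)%:E / (n / sqrt (mu1 m))%:E)%E.
 rewrite inver gt_eqF ?divr_gt0// -EFinM; congr EFin.
 by rewrite invf_div; ring.
 by apply: div_ereal_anti => //; rewrite ?rdist_ge0// mulr_ge0 ?(ltW (hm _)).
- by rewrite mule_ge0 ?inve_ge0 ?lee_fin ?rdist_ge0// mulr_ge0 ?(ltW (hm _)).
- by rewrite mule_ge0 ?inve_ge0 ?lee_fin ?rdist_ge0// mulr_ge0 ?(ltW (hm _)).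
Qed.
End ShapeBounds.

Lemma ereal_gain (R : realType) (r1 r2 r3 r4 s1 s2 s3 : \bar R) (g k : R) :
 (0 <= r1 -> 0 <= r2 -> 0 <= r3 -> 0 <= r4 -> r1 <= s1 -> r3 <= s3 ->
 r2 <= 2^-1%:E * s2 -> g%:E <= s2 -> r4 <= k%:E ->
 s1 \is a fin_num -> s2 \is a fin_num -> s3 \is a fin_num -> (k < 2^-1 * g)%R ->
 r4 + (r1 + (r2 + r3)) < s1 + (s2 + s3))%E.
Proof.
case: s1 => [s1| |] //; case: s2 => [s2| |] //; case: s3 => [s3| |] //.
case: r1 => [r1| |] //; case: r3 => [r3| |] //; case: r4 => [r4| |] //; case: r2 => [r2| |] //.
by rewrite -EFinM !lee_fin lte_fin => _ _ _ _ h1 h2 h3 h4 h5 _ _ _ h6; lra.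
Qed.

Section TripleCollision.
Variables (R : realType) (m : 'I_3 -> R) (h : R).
Hypotheses (hm : posm m) (hh : 0 < h).
Implicit Types (q : conf R) (x : R -> conf R).

Lemma enorm3E (u : 'I_3 -> R) : enorm u = norm3 (u b1) (u b2) (u b3).
Proof. by rewrite /enorm big_ord3. Qed.
Lemma norm3_third (w1 w2 w3 w3' : R) : `|w3| <= `|w3'| -> norm3 w1 w2 w3 <= norm3 w1 w2 w3'.
Proof.
move=> H; rewrite ler_wsqrtr// lerD2l -(real_normK (num_real w3)) -(real_normK (num_real w3')).
by rewrite lerXn2r ?nnegrE.
Qed.

Lemma norm3_third_le (w1 w2 w3 d : R) : 0 <= d ->
 norm3 w1 w2 (`|w3| + d) <= norm3 w1 w2 w3 + d.
Proof.
move=> d0; have n0 : 0 <= norm3 w1 w2 w3 by exact: sqrtr_ge0.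
rewrite -ler_sqr ?nnegrE ?addr_ge0 ?sqrtr_ge0// sqr_norm3 [leRHS]sqrrD sqr_norm3.
have [_ _ h3] := ler_norm3 w1 w2 w3.
have e3 : `|w3| ^+ 2 = w3 ^+ 2 by rewrite real_normK ?num_real.
rewrite sqrrD e3; move: h3 d0; move: (norm3 _ _ _) `|w3| => n u.
by move=> un d0'; have := ler_wpM2r d0' un; rewrite !mulr2n; lra.
Qed.

(** The starting point may be a collision, but by the area bound [U] is [O(1 / t)] once [|w3|] has
    been raised by [t]. The cost is thus the integral of [t^(-1/2)], that is [O(sqrt d)]. *)
Lemma connecting_path q sg : 0 < inertia m q -> sg * sg = 1 -> hopf m q b3 = sg * `|hopf m q b3| ->
 exists2 K, 0 <= K & forall d, 0 < d <= 1 -> exists p, [/\ lipc 0 d p,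
 hopf m (p 0) = hopf m q,
 [/\ hopf m (p d) b1 = hopf m q b1, hopf m (p d) b2 = hopf m q b2 &
 hopf m (p d) b3 = sg * (`|hopf m q b3| + d)] &
 (JM m h 0 d p <= (K * sqrt d)%:E)%E].
Proof.
set w1 := hopf m q b1; set w2 := hopf m q b2; set w3 := hopf m q b3.
move=> N0 sg2 w3E; have NE : inertia m q = norm3 w1 w2 w3 by exact: inertia_norm3.
have sgn : `|sg| = 1 by apply/eqP; rewrite -(@eqrXn2 _ 2)// expr1n -normrX expr2 sg2 normr1.
pose z t := sg * (`|w3| + t).
have zn t : 0 <= t -> `|z t| = `|w3| + t.
 by move=> t0; rewrite /z normrM sgn mul1r ger0_norm// addr_ge0.
have nge t : 0 <= t -> inertia m q <= norm3 w1 w2 (z t).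
 by move=> t0; rewrite NE norm3_third// zn// lerDl.
have nle t : 0 <= t -> norm3 w1 w2 (z t) <= inertia m q + t.
 move=> t0; rewrite NE; apply: le_trans (norm3_third_le w1 w2 w3 t0).
 by rewrite norm3_third// zn// ler_norm.
pose M := inertia m q + 1; have M0 : 0 < M by rewrite addr_gt0.
pose B := sqrt (mumin m / (4 * kappa m ^+ 2 * M)).
have B0 : 0 < B by rewrite sqrtr_gt0 divr_gt0 ?mumin_gt0// mulr_gt0// mulr_gt0// exprn_gt0// kappa_gt0.
have pm0 := pair_mass_gt0 hm.
pose K := sqrt (pair_mass m / (4 * inertia m q * B)).
have K2 : K ^+ 2 = pair_mass m / (4 * inertia m q * B).
 by rewrite sqr_sqrtr// divr_ge0 ?(ltW pm0)// mulr_ge0 ?(ltW B0)// mulr_ge0// ltW.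
have K0 : 0 <= K by exact: sqrtr_ge0.
exists (2 * K) => [|d /andP[d0 d1]]; first by rewrite mulr_ge0.
have zL : lipon 0 d z by apply: liponZ; apply: liponD; [exact: lipon_cst|exact: lipon_id].
have w1L : lipon 0 d (fun=> w1) := lipon_cst _ _ _.
have w2L : lipon 0 d (fun=> w2) := lipon_cst _ _ _.
have [p [pL ph]] : exists p : R -> conf R, lipc 0 d p /\ forall t, 0 <= t <= d ->
 [/\ hopf m (p t) b1 = w1, hopf m (p t) b2 = w2 & hopf m (p t) b3 = z t].
 (* Each lift is singular on one half of the [w1] axis, so the sign of [w1] selects the lift that is
    Lipschitz here. *)
 have [w10|w10] := leP w1 0.
 have H t : 0 <= t <= d -> inertia m q <= norm3 w1 w2 (z t) - w1.
 by move=> /andP[t0 _]; rewrite (le_trans (nge t t0))// lerBrDr gerDl.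
 exists (fun t => lift2 m w1 w2 (z t)); split; first exact: (lipschitz_lift2 hm N0).
 by move=> t /H ht; apply: (hopf_lift2 hm); exact: lt_le_trans ht.
 have H t : 0 <= t <= d -> inertia m q <= norm3 w1 w2 (z t) + w1.
 by move=> /andP[t0 _]; rewrite (le_trans (nge t t0))// lerDl ltW.
 exists (fun t => lift1 m w1 w2 (z t)); split; first exact: (lipschitz_lift1 hm N0).
 by move=> t /H ht; apply: (hopf_lift1 hm); exact: lt_le_trans ht.
have h0 : (0 : R) <= 0 <= d by rewrite lexx ltW.
have hd : (0 : R) <= d <= d by rewrite lexx ltW.
have iE t : 0 <= t <= d -> inertia m (p t) = norm3 w1 w2 (z t).
 by move=> ht; rewrite (inertia_norm3 hm); have [-> -> ->] := ph _ ht.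
exists p; split=> //.
- apply/funext => i; have [e1 e2 e3] := ph _ h0.
 by case: (ord3_cases i) => ->; rewrite ?e1 ?e2 ?e3// /z addr0 -w3E.
- exact: ph.
pose D t := 2 * K * sqrt t.
have -> : 2 * K * sqrt d = D d - D 0 by rewrite /D sqrtr0 mulr0 subr0.
apply: (action_le_hopf hm d0 pL) => [s t s0 st td|s t c s0 st td c0 H].
 by rewrite /D ler_wpM2l ?mulr_ge0// ler_wsqrtr.
have t0 : 0 <= t := le_trans s0 st.
have hs : 0 <= s <= d by rewrite s0 (le_trans st).
have ht : 0 <= t <= d by rewrite t0.
have [e1 e2 e3] := ph _ hs; have [f1 f2 f3] := ph _ ht.
have -> : hopfD m (p t) (p s) = t - s.
 rewrite enorm3E e1 e2 e3 f1 f2 f3 !subrr /norm3 expr0n !add0r sqrtr_sqr.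
 have -> : z t - z s = sg * (t - s) by rewrite /z; ring.
 by rewrite normrM sgn mul1r ger0_norm// subr_ge0.
have [tE|tn0] := eqVneq t 0.
 have sE : s = 0 by apply/le_anti; rewrite s0 -tE st.
 by rewrite tE sE !subrr mulr0.
have tp : 0 < t by rewrite lt_def tn0.
have st1 : 0 < sqrt t by rewrite sqrtr_gt0.
have cK : c * sqrt t <= K.
 rewrite -ler_sqr ?nnegrE ?mulr_ge0 ?(ltW c0) ?(ltW st1)// exprMn sqr_sqrtr// K2.
 have zt : t <= `|hopf m (p t) b3| by rewrite f3 zn// lerDr.
 have pM : inertia m (p t) <= M.
 by rewrite iE// (le_trans (nle t t0))// lerD2l (le_trans td).
 have := H t; rewrite lexx st => /(_ isT) /le_trans /(_ (U_le_area hm tp M0 zt pM)).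
 rewrite lee_fin -/B => H1.
 have c4 : 0 <= 4 * c ^+ 2 by rewrite mulr_ge0 ?sqr_ge0.
 have H2 : 4 * c ^+ 2 * inertia m q <= pair_mass m / (t * B).
 apply: le_trans (le_trans _ H1).
 - exact: (lexx (4 * c ^+ 2 * inertia m q)).
 - rewrite -[leLHS]addr0 lerD ?(ltW hh)// ler_wpM2l// iE// nge//.
 rewrite ler_pdivlMr ?mulr_gt0//.
 have -> : c ^+ 2 * t * (4 * inertia m q * B) = 4 * c ^+ 2 * inertia m q * (t * B) by ring.
 by rewrite -ler_pdivlMr// mulr_gt0.
have ss : 0 <= sqrt s by exact: sqrtr_ge0.
have sst : sqrt s <= sqrt t by rewrite ler_wsqrtr.
have -> : t - s = (sqrt t - sqrt s) * (sqrt t + sqrt s).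
 by rewrite -subr_sqr !sqr_sqrtr.
rewrite /D -mulrBr; move: cK st1 ss sst c0; move: (sqrt t) (sqrt s) => u v cK u0 v0 vu c0.
have : c * (u + v) <= 2 * K.
 apply: (@le_trans _ _ (c * (2 * u))); last by lra.
 by rewrite ler_pM2l//; lra.
have uv : 0 <= u - v by rewrite subr_ge0.
by move=> H1; rewrite mulrCA [leRHS]mulrC; apply: ler_wpM2l.
Qed.

(** Replacing [w3] by [sg * (|w3| + d)] does not lengthen any chord, raises the inertia and does not
    raise [U], so the action does not grow on any arc. Just before the triple collision it is at
    least halved. With [d = z^4] the connecting path costs at most [K z^2], while the gain is of
    order [z]. *)
Lemma lip_min_no_triple q0 a b x : lip_min m h q0 a b x -> 0 < inertia m q0 ->
 forall t, a <= t <= b -> 0 < inertia m (x t).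
Proof.
move=> xm N0 t1 /andP[at1 t1b]; have xL := lm_lip xm; have ab := ltW (lm_lt xm).
have NqE : inertia m (x a) = inertia m q0.
 by rewrite -!(enorm_hopf hm) (same_conf_hopf hm (lm_start xm)).
rewrite ltNge; apply/negP => Nt1.
have NL : lipon a b (fun t => inertia m (x t)) := lipon_inertia hm xL.
have Na : 0 < inertia m (x a) by rewrite NqE.
have [T /andP[aT Tt1] [NT _]] := first_time at1 (lipon_sub (lexx a) t1b NL) Na Nt1.
have Tb : T <= b := le_trans Tt1 t1b.
have [sg sg2 sgE] : exists2 sg : R, sg * sg = 1 & hopf m (x a) b3 = sg * `|hopf m (x a) b3|.
 have [w0|w0] := leP 0 (hopf m (x a) b3).
 by exists 1; rewrite ?mulr1// ger0_norm// mul1r.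
 by exists (-1); rewrite ?mulrNN ?mulr1// ltr0_norm// mulN1r opprK.
have sgn : `|sg| = 1 by apply/eqP; rewrite -(@eqrXn2 _ 2)// expr1n -normrX expr2 sg2 normr1.
have [K K0 HK] := connecting_path Na sg2 sgE.
have pm0 := pair_mass_gt0 hm; have p1 := mu1_gt0 hm; have kap := kappa_gt0 hm.
pose V := m b1 * m b2 * sqrt (mu1 m).
have V0 : 0 < V by rewrite mulr_gt0 ?sqrtr_gt0// mulr_gt0.
pose B2 := sqrt (mumin m / (4 * kappa m ^+ 2 * 2)).
have B20 : 0 < B2 by rewrite sqrtr_gt0 divr_gt0 ?mumin_gt0// mulr_gt0// mulr_gt0// exprn_gt0.
(* Chosen so that near the collision the lower bound [V / n] for the potential of the original
   curve, with [n = (ee z)^2], is at least four times the upper bound for the shifted one; the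
   factor 4 halves the action. *)
pose ee := minr 1 (V * B2 / (4 * pair_mass m)).
have pm4 : 0 < 4 * pair_mass m by rewrite pmulr_rgt0.
have VB : 0 < V * B2 := mulr_gt0 V0 B20.
have ee0 : 0 < ee by rewrite lt_min ltr01 divr_gt0.
have ee1 : ee <= 1 by rewrite ge_min lexx.
have eeV : ee * (4 * pair_mass m) <= V * B2.
 by rewrite -ler_pdivlMr// ge_min lexx orbT.
pose G := sqrt (V / 8); have G0 : 0 < G by rewrite sqrtr_gt0 divr_gt0.
(* The bound by the initial inertia places the threshold [ed] after the start; [V / (2 h)] makes [h]
   at most half of [V / n]; the last bound makes the connecting path cheaper than the gain. *)
pose z := minr (minr (1 / 2) (inertia m (x a) / 2)) (minr (V / (2 * h)) (G * ee / (8 * (K + 1)))).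
have K1 : 0 < K + 1 by rewrite ltr_wpDl.
have K8 : 0 < 8 * (K + 1) by rewrite pmulr_rgt0.
have hh2 : 0 < 2 * h by rewrite pmulr_rgt0.
have Gee : 0 < G * ee := mulr_gt0 G0 ee0.
have z0 : 0 < z by rewrite !lt_min (divr_gt0 _ hh2)// (divr_gt0 Gee)// !divr_gt0.
have z1 : z <= 1 / 2 by rewrite !ge_min lexx.
have zle1 : z <= 1 by apply: (le_trans z1); rewrite ler_pdivrMr// mul1r ler1n.
have zN : z <= inertia m (x a) / 2 by rewrite !ge_min lexx orbT.
have zV : z <= V / (2 * h) by rewrite !ge_min lexx !orbT.
have zG : z * (8 * (K + 1)) <= G * ee.
 by rewrite -ler_pdivlMr// !ge_min lexx !orbT.
pose d := z ^+ 4; have d0 : 0 < d by rewrite exprn_gt0.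
have dz : d <= z.
 by rewrite /d exprS ler_piMr ?(ltW z0)// exprn_ile1 ?(ltW z0).
have d1 : d <= 1 := le_trans dz zle1.
have sqd : sqrt d = z ^+ 2.
 by rewrite /d (exprM z 2 2) sqrtr_sqr ger0_norm// sqr_ge0.
pose n := (ee * z) ^+ 2; have n0 : 0 < n by rewrite exprn_gt0// mulr_gt0.
pose ed := n ^+ 2; have ed0 : 0 < ed by rewrite exprn_gt0.
have ezz : ee * z <= z by rewrite ler_piMl ?(ltW z0).
have nz2 : n <= z ^+ 2 by rewrite lerXn2r ?nnegrE ?mulr_ge0 ?(ltW ee0) ?(ltW z0).
have edd : ed <= d.
 by rewrite /ed /d (exprM z 2 2) lerXn2r ?nnegrE ?(ltW n0) ?sqr_ge0.
have [|||T1 /andP[aT1 T1T] [NT1 NT1T]] := @last_time _ a T (fun t => ed - inertia m (x t)) (ltW aT).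
- by apply: liponB; [exact: lipon_cst|exact: lipon_sub (lexx a) Tb NL].
- by rewrite subr_le0; lra.
- by rewrite NT subr0.
have {}NT1 : inertia m (x T1) = ed by apply/esym/eqP; rewrite -subr_eq0 NT1.
have Nwin u : T1 <= u <= T -> inertia m (x u) <= ed.
 move=> /andP[T1u uT]; move: T1u; rewrite le_eqVlt => /predU1P[<-|T1u]; first by rewrite NT1.
 by rewrite -subr_ge0 ltW// NT1T// T1u.
pose om t := sg * (`|hopf m (x t) b3| + d).
have omn t : `|om t| = `|hopf m (x t) b3| + d.
 by rewrite /om normrM sgn mul1r ger0_norm// addr_ge0 ?(ltW d0).
pose y t := lift2 m (hopf m (x t) b1) (hopf m (x t) b2) (om t).
have hL i : lipon a b (fun t => hopf m (x t) i) by exact: lipon_hopf.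
have omL : lipon a b om.
 apply: liponZ; apply: liponD; last exact: lipon_cst.
 have [L L0 HL] := hL b3; exists L => // s t hs ht.
 by apply: (le_trans (ler_dist_dist _ _)); exact: HL.
have [M M0 HM] := inertia_bounded hm xL.
have iy t : norm3 (hopf m (x t) b1) (hopf m (x t) b2) (om t) <= inertia m (x t) + d.
 rewrite (inertia_norm3 hm); apply: le_trans (norm3_third_le _ _ _ (ltW d0)).
 by rewrite norm3_third// omn ler_norm.
have yi t : inertia m (x t) <= norm3 (hopf m (x t) b1) (hopf m (x t) b2) (om t).
 by rewrite (inertia_norm3 hm) norm3_third// omn lerDl (ltW d0).
have posy t : a <= t <= b -> d ^+ 2 / (2 * (M + d)) <=
 norm3 (hopf m (x t) b1) (hopf m (x t) b2) (om t) - hopf m (x t) b1.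
 move=> tab; have Md : 0 < M + d by rewrite addr_gt0.
 have nM := le_trans (iy t) (lerD (HM _ tab) (lexx d)).
 have [h1 _ _] := ler_norm3 (hopf m (x t) b1) (hopf m (x t) b2) (om t).
 have sn := sqr_norm3 (hopf m (x t) b1) (hopf m (x t) b2) (om t).
 have od : d ^+ 2 <= om t ^+ 2.
 rewrite -(real_normK (num_real (om t))) omn lerXn2r ?nnegrE ?(ltW d0) ?addr_ge0 ?(ltW d0)//.
 by rewrite lerDr.
 move: nM h1 sn od; move: (norm3 _ _ _) => nn nM; rewrite ler_norml => /andP[h1 h2] sn od.
 rewrite ler_pdivrMr ?mulr_gt0//.
 have w2 := sqr_ge0 (hopf m (x t) b2); apply: (@le_trans _ _ ((nn - hopf m (x t) b1) * (nn + hopf m (x t) b1))).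
 by rewrite -subr_sqr sn; lra.
 by rewrite ler_wpM2l ?subr_ge0//; lra.
have ey0 : 0 < d ^+ 2 / (2 * (M + d)) by rewrite divr_gt0 ?exprn_gt0// mulr_gt0// addr_gt0.
have yL : lipc a b y by exact: (lipschitz_lift2 hm ey0).
have yh t : a <= t <= b -> [/\ hopf m (y t) b1 = hopf m (x t) b1, hopf m (y t) b2 = hopf m (x t) b2 &
 hopf m (y t) b3 = om t].
 by move=> tab; apply: (hopf_lift2 hm); exact: lt_le_trans ey0 (posy _ tab).
have yN t : a <= t <= b -> inertia m (y t) = norm3 (hopf m (x t) b1) (hopf m (x t) b2) (om t).
 by move=> tab; rewrite (inertia_norm3 hm); have [-> -> ->] := yh _ tab.
have Uy t : a <= t <= b -> (U m (y t) <= U m (x t))%E.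
 by move=> tab; have [e1 e2 e3] := yh _ tab; apply: (U_anti_hopf hm) => //; rewrite yN.
have [|p [pL ph0 [ph1 ph2 ph3] pA]] := HK d; first by rewrite d0.
have haa : a <= a <= b by rewrite lexx.
have hbb : a <= b <= b by rewrite lexx ab.
have py : same_conf (p d) (y a).
 apply: (hopf_inj hm); have [e1 e2 e3] := yh _ haa; apply/funext => i.
 by case: (ord3_cases i) => ->; rewrite ?ph1 ?ph2 ?ph3 ?e1 ?e2 ?e3.
have [c [e [ce cL c0 ee' cA]]] := action_glue h hm (ltW d0) ab pL yL py.
have pq : same_conf (p 0) q0.
 by apply: same_conf_trans (lm_start xm); apply: (hopf_inj hm).
have cq : same_conf (c 0) q0 by rewrite c0.
have Uc : (U m (c e) <= h%:E)%E.
 by rewrite -(same_conf_U m ee') -(lm_end xm); exact: Uy.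
have := lm_min xm ce cL cq Uc; rewrite cA leNgt => /negP; apply.
have HJ2 s t c' : a <= s -> s <= t -> t <= b -> 0 <= c' ->
 (forall u, s <= u <= t -> ((c' ^+ 2 * (4 * inertia m (y u)) + h)%:E <= U m (x u))%E) ->
 ((c' * hopfD m (x t) (x s)%R)%:E <= JM m h s t x)%E.
 move=> as_ st tb c'0 H; apply: arc_hopf_le_action => //.
 exact: lipc_sub xL.
 move=> u /andP[su ut]; have uab : a <= u <= b by rewrite (le_trans as_) ?(le_trans ut).
 have := H u; rewrite su ut => /(_ isT); apply: le_trans; rewrite lee_fin lerD2r.
 rewrite [4 * _]mulrC -mulrA ler_wpM2l ?sqr_ge0// ler_wpM2l// yN//.
have HJ3 s t (D : R -> R) : a <= s -> s < t -> t <= b ->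
 (forall u v, s <= u -> u <= v -> v <= t -> D u <= D v) ->
 (forall u v c', s <= u -> u <= v -> v <= t -> 0 < c' ->
 (forall w, u <= w <= v -> ((c' ^+ 2 * (4 * inertia m (y w)) + h)%:E <= U m (y w))%E) ->
 c' * hopfD m (y v) (y u) <= D v - D u) ->
 (JM m h s t y <= (D t - D s)%:E)%E.
 move=> as_ st tb mD HD; apply: (action_le_hopf hm st (lipc_sub as_ tb yL) mD).
 move=> u v c' su uv vt c'0 H; apply: HD => // w hw.
 by have := H w hw; rewrite -mulrA mulrCA.
have dyx s t : a <= s -> s <= t -> t <= b ->
 hopfD m (y t) (y s) <= hopfD m (x t) (x s).
 move=> as_ st tb; apply: le_enorm => i.
 have hs : a <= s <= b by rewrite as_ (le_trans st).
 have ht : a <= t <= b by rewrite tb (le_trans as_).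
 have [e1 e2 e3] := yh s hs; have [f1 f2 f3] := yh t ht.
 case: (ord3_cases i) => ->; rewrite ?e1 ?e2 ?e3 ?f1 ?f2 ?f3//.
 rewrite /om -mulrBr normrM sgn mul1r (_ : _ + d - (_ + d) = `|hopf m (x t) b3| - `|hopf m (x s) b3|).
 exact: ler_dist_dist.
 by ring.
have xfin := lm_fin xm.
have le2 s t : a <= s -> s <= t -> t <= b -> (JM m h s t y <= JM m h s t x)%E.
 move=> as_ st tb; apply: (compare_le hm xL HJ2 HJ3 dyx xfin as_ st tb) => u /andP[su ut].
 by apply: Uy; rewrite (le_trans as_) ?(le_trans ut).
have half0 : 0 < 2^-1 :> R by rewrite invr_gt0.
(* On this window the shifted curve has [|w3| >= d] and inertia at most [2 d], so by the area bound
   its potential is at most [pair_mass m / (z^2 B2)]. *)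
have mid : (JM m h T1 T y <= 2^-1%:E * JM m h T1 T x)%E.
 apply: (compare_scaled hm xL HJ2 HJ3 dyx xfin aT1 (ltW T1T) Tb half0) => u c' hu c'0 H.
 have /andP[T1u uT] := hu; have uab : a <= u <= b by rewrite (le_trans aT1) ?(le_trans uT).
 have Ux1 : ((V / n)%:E <= U m (x u))%E by apply: (U_ge_inertia hm n0); exact: Nwin.
 apply: le_trans Ux1; rewrite lee_fin.
 have yN2 : inertia m (y u) <= d * 2.
 by rewrite yN// (le_trans (iy u))// (le_trans (lerD (Nwin _ hu) (lexx d)))// mulr_natr mulr2n lerD2r.
 have d20 : 0 < d * 2 by rewrite mulr_gt0.
 have yd : d <= `|hopf m (y u) b3|.
 by have [_ _ ->] := yh _ uab; rewrite omn lerDr.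
 have U1 := U_le_area hm d0 d20 yd yN2.
 have E1 : d * sqrt (mumin m / (4 * kappa m ^+ 2 * (d * 2))) = z ^+ 2 * B2.
 have dsq : sqrt (d ^+ 2) = d by rewrite sqrtr_sqr (ger0_norm (ltW d0)).
 rewrite -{1}dsq -sqrtrM ?sqr_ge0//.
 have -> : d ^+ 2 * (mumin m / (4 * kappa m ^+ 2 * (d * 2))) = d * (mumin m / (4 * kappa m ^+ 2 * 2)).
 by field; rewrite !gt_eqF.
 by rewrite sqrtrM ?(ltW d0)// sqd.
 rewrite E1 in U1; have := le_trans H U1; rewrite lee_fin => H1.
 have z2B : 0 < z ^+ 2 * B2 by rewrite mulr_gt0// exprn_gt0.
 have -> : (c' / 2^-1) ^+ 2 * (4 * inertia m (y u)) + h =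
 4 * (c' ^+ 2 * (4 * inertia m (y u)) + h) - 3 * h by rewrite invrK; ring.
 apply: (@le_trans _ _ (4 * (pair_mass m / (z ^+ 2 * B2)))).
 rewrite lerBlDr; apply: ler_wpDr; first exact: mulr_ge0 (ler0n _ 3) (ltW hh).
 by apply: ler_wpM2l; [exact: ler0n|exact: H1].
 rewrite ler_pdivlMr// [4 * _]mulrC -mulrA -mulrA mulrA -[leLHS]mulrA.
 rewrite mulrCA ler_pdivrMl//.
 have -> : pair_mass m * (4 * n) = (ee * (4 * pair_mass m)) * (ee * z ^+ 2) by rewrite /n; ring.
 have -> : z ^+ 2 * B2 * V = V * B2 * (z ^+ 2) by ring.
 apply: ler_pM; [exact: mulr_ge0 (ltW ee0) (ltW pm4)|exact: mulr_ge0 (ltW ee0) (sqr_ge0 z)|exact: eeV|].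
 by rewrite ler_piMl ?sqr_ge0.
(* On the window [U - h >= V / (2 n)] and the inertia is at most [n^2], so the weight is at least
   [sqrt (V / (8 n^3))]. The chord has length [n^2], which gives [G sqrt n = G (ee z)]. *)
pose c1 := G / (ee * z) ^+ 3; have ez0 : 0 < ee * z by rewrite mulr_gt0.
have c10 : 0 < c1 by rewrite divr_gt0// exprn_gt0.
have c12 : c1 ^+ 2 = V / (8 * n ^+ 3).
 by rewrite /c1 expr_div_n /G sqr_sqrtr ?divr_ge0 ?(ltW V0)// /n; field; rewrite !gt_eqF.
have gain : ((G * (ee * z))%:E <= JM m h T1 T x)%E.
 apply: (@le_trans _ _ (c1 * hopfD m (x T) (x T1))%:E).
 rewrite lee_fin; have -> : hopfD m (x T) (x T1) = ed.
 have hT i : hopf m (x T) i = 0.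
 have := enorm_ge (hopf m (x T)) i; rewrite (enorm_hopf hm) NT normr_le0 => /eqP //.
 rewrite -NT1 -(enorm_hopf hm) /enorm; congr sqrt; apply: eq_bigr => i _.
 by rewrite hT sub0r sqrrN.
 apply: le_of_eq.
 by rewrite /c1 /ed /n; field; rewrite !gt_eqF.
 apply: arc_hopf_le_action; [exact: hm|exact: ltW|exact: lipc_sub aT1 Tb xL|exact: ltW|].
 move=> u hu; apply: le_trans (U_ge_inertia hm n0 (Nwin _ hu)); rewrite lee_fin -/V c12.
 have hn : h <= V / n / 2.
 have zz : n <= z by apply: (le_trans nz2); rewrite expr2; exact: ler_piMl (ltW z0) zle1.
 have : z * (2 * h) <= V by rewrite -ler_pdivlMr.
 have := ler_wpM2r (ltW hh2) zz.
 by rewrite ler_pdivlMr// ler_pdivlMr//; clear; lra.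
 have : 4 * (V / (8 * n ^+ 3)) * inertia m (x u) <= V / n / 2.
 have -> : 4 * (V / (8 * n ^+ 3)) * inertia m (x u) = V / n / 2 * (inertia m (x u) / n ^+ 2).
 by field; rewrite gt_eqF.
 rewrite ler_piMr ?divr_ge0 ?(ltW V0) ?(ltW n0)//.
 by rewrite ler_pdivrMr ?exprn_gt0// mul1r Nwin.
 have VE : V / n = V / n / 2 + V / n / 2 by field; rewrite gt_eqF.
 by move=> H; rewrite VE; exact: lerD H hn.
have fin1 : JM m h a T1 x \is a fin_num.
 by rewrite (action_fin hm xL xfin)// (le_trans (ltW T1T)).
have fin2 : JM m h T1 T x \is a fin_num.
 by rewrite (action_fin hm xL xfin)// ltW.
have fin3 : JM m h T b x \is a fin_num.
 by rewrite (action_fin hm xL xfin)// ltW.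
have T1b : T1 <= b := le_trans (ltW T1T) Tb.
rewrite (action_cat h hm aT1 T1b xL) (action_cat h hm aT1 T1b yL).
rewrite (action_cat h hm (ltW T1T) Tb (lipc_sub aT1 (lexx b) xL)).
rewrite (action_cat h hm (ltW T1T) Tb (lipc_sub aT1 (lexx b) yL)).
have l1 := le2 a T1 (lexx a) aT1 T1b; have l3 := le2 T b (ltW aT) Tb (lexx b).
have zK : K * z ^+ 2 < 2^-1 * (G * (ee * z)).
 have : z * (z * (8 * (K + 1))) <= z * (G * ee) by rewrite ler_pM2l.
 have : 0 <= K * z ^+ 2 by rewrite mulr_ge0 ?sqr_ge0.
 have : 0 < z ^+ 2 by rewrite exprn_gt0.
 by clear; rewrite expr2; lra.
rewrite sqd in pA.
exact: (ereal_gain (action_ge0 _ _ _ _ _) (action_ge0 _ _ _ _ _) (action_ge0 _ _ _ _ _)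
 (action_ge0 _ _ _ _ _) l1 l3 mid gain pA fin1 fin2 fin3 zK).
Qed.
End TripleCollision.

(** * Minimizers stay on one side of the isosceles shapes *)

Section SmallAction.
Variables (R : realType) (m : 'I_3 -> R) (h : R).
Hypothesis hm : posm m.

(** Absolute continuity of the integral, applied to the measurable version of the density. *)
Lemma action_small (a b : R) x e : a < b -> lipc a b x ->
 (JM m h a b x < +oo)%E -> 0 < e ->
 exists2 d, 0 < d & forall s t, a <= s -> s <= t -> t <= b -> t - s < d ->
 (JM m h s t x < e%:E)%E.
Proof.
move=> ab xL xfin e0; have [G [mG G0 dG]] := dens_measurable h hm ab xL.
have E s t : a <= s -> t <= b -> JM m h s t x = (\int[leb]_(u in `[s, t]) G u)%E.
 move=> as_ tb; rewrite actionE; apply: ae_eq_integral_ge0 => //.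
 by move=> u _; exact: dens_ge0.
 apply: ae_itv_oo; apply: ae_imp dG => u Hu; rewrite in_itv/= => /andP[su ut].
 by apply: Hu; rewrite in_itv/= (le_lt_trans as_)// (lt_le_trans ut).
have mGI (I : set R) : measurable_fun I G by exact: measurable_funTS.
have iG : leb.-integrable `[a, b] G.
 apply/integrableP; split; first exact: mGI.
 have -> : (\int[leb]_(u in `[a, b]) `|G u| = \int[leb]_(u in `[a, b]) G u)%E.
 by apply: eq_integral => u _; rewrite gee0_abs.
 by rewrite -E.
have Gfin : {ae leb, forall u, u \in `[a, b] -> G u \is a fin_num}.
 have : {ae leb, forall u, `[a, b]%classic u -> G u \is a fin_num}.
 by apply: (integrable_ae _ iG); exact: measurable_itv.
 by apply: ae_imp => u H ui; exact: H.
pose f u := fine (G u) * \1_(`[a, b]) u.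
have mf : measurable_fun setT (fun u => fine (G u)).
 apply: (measurable_comp (F := setT)) => //; exact: fine_measurable.
have f0 u : 0 <= f u by rewrite /f mulr_ge0 ?fine_ge0.
have mff : measurable_fun setT f by apply: measurable_funM => //; exact: measurable_indic.
have fG s t : a <= s -> t <= b -> (\int[leb]_(u in `[s, t]) (f u)%:E = \int[leb]_(u in `[s, t]) G u)%E.
 move=> as_ tb; apply: ae_eq_integral_ge0 => //; first by move=> u _; rewrite lee_fin.
 apply: ae_imp Gfin => u Hu /=; rewrite in_itv/= => /andP[su ut].
 have uab : u \in `[a, b] by rewrite in_itv/= (le_trans as_) ?(le_trans ut).
 by rewrite /f indicE mem_set// mulr1 fineK// Hu.
have fi : leb.-integrable setT (EFin \o f).
 apply/integrableP; split; first exact/measurable_EFinP.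
 have -> : (\int[leb]_(u in setT) `|(EFin \o f) u| = \int[leb]_(u in `[a, b]) (f u)%:E)%E.
 rewrite [RHS]integral_mkcond; apply: eq_integral => u _.
 rewrite patchE /= ger0_norm//; case: ifPn => // unab.
 by rewrite /f indicE (negbTE unab) mulr0.
 by rewrite fG// -E.
have [d [d0 dP]] := integral_normr_continuous fi e0.
exists d => // s t as_ st tb std; rewrite (E _ _ as_ tb) -(fG _ _ as_ tb).
have fin : (\int[leb]_(u in `[s, t]) (f u)%:E \is a fin_num)%E.
 rewrite fG// -E// ge0_fin_numE ?action_ge0//.
 exact: le_lt_trans (action_mono h hm as_ st tb xL) xfin.
have ms : (leb `[s, t]%classic < d%:E)%E.
 by rewrite lebesgue_measure_itv/= lte_fin; case: ifP => _; rewrite lte_fin.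
have := dP `[s, t]%classic (measurable_itv _) ms; rewrite -(fineK fin) lte_fin /Rintegral.
apply: le_lt_trans; apply: le_of_eq; congr fine.
by apply: eq_integral => u _; rewrite /= ger0_norm.
Qed.
End SmallAction.

(** Subdivision into steps of length [eta / 2]. Applied to weighted chords, it allows estimates to
    be made only on intervals where [U] is nearly constant. *)
Lemma local_to_global (R : realType) (s t eta : R) (E : R -> R -> R) (D : R -> R) :
 s <= t -> 0 < eta -> (forall u v w, E u w <= E u v + E v w) ->
 (forall u v, s <= u -> u <= v -> v <= t -> v - u < eta -> E u v <= D v - D u) ->
 E s t <= D t - D s.
Proof.
move=> st eta0 tri loc.
have key n : forall u v, s <= u -> u <= v -> v <= t -> v - u < eta / 2 * n.+1%:R -> E u v <= D v - D u.
 elim: n => [|n IH] u v su uv vt h1; first by apply: loc => //; move: h1; rewrite mulr1; lra.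
 have [h2|h2] := ltP (v - u) (eta / 2); first by apply: loc => //; lra.
 have := tri u (u + eta / 2) v; have := loc u (u + eta / 2) su.
 have en : n.+2%:R = n.+1%:R + 1 :> R by rewrite natr1.
 have := IH (u + eta / 2) v; rewrite en mulrDr mulr1 in h1.
 have a1 : s <= u + eta / 2 by lra.
 have a2 : u + eta / 2 <= v by lra.
 have a3 : v - (u + eta / 2) < eta / 2 * n.+1%:R by lra.
 have a4 : u <= u + eta / 2 by lra.
 have a5 : u + eta / 2 - u < eta by lra.
 by move=> /(_ a1 a2 vt a3) b1 /(_ a4 (le_trans a2 vt) a5) b2 b3; lra.
apply: (key (Num.truncn ((t - s) / (eta / 2)))) => //.
by rewrite mulrC -ltr_pdivrMr ?divr_gt0// truncnS_gt.
Qed.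

Section FourthRoot.
Variable R : realType.
Implicit Types (A B : R).

Definition root4 A : R := sqrt (sqrt A).

Lemma root4_ge0 A : 0 <= root4 A. Proof. exact: sqrtr_ge0. Qed.

Lemma root4K A : 0 <= A -> root4 A ^+ 4 = A.
Proof. by move=> A0; rewrite (exprM _ 2 2) !sqr_sqrtr ?sqrtr_ge0. Qed.
Lemma ler_root4 A B : A <= B -> root4 A <= root4 B.
Proof. by move=> AB; rewrite !ler_wsqrtr. Qed.
Lemma root4_gt0 A : 0 < A -> 0 < root4 A.
Proof. by move=> A0; rewrite !sqrtr_gt0. Qed.
Lemma root4D A B : 0 <= A -> 0 <= B -> root4 (A + B) <= root4 A + root4 B.
Proof.
have sD u v : 0 <= u -> 0 <= v -> sqrt (u + v) <= sqrt u + sqrt v :> R.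
 move=> u0 v0; rewrite -ler_sqr ?nnegrE ?addr_ge0 ?sqrtr_ge0// sqrrD !sqr_sqrtr ?addr_ge0//.
 by rewrite addrAC lerDl mulrn_wge0// mulr_ge0 ?sqrtr_ge0.
by move=> A0 B0; rewrite (le_trans (ler_wsqrtr (sD _ _ A0 B0)))// sD ?sqrtr_ge0.
Qed.

(** The finite-increment form of [dA / A^(3/4) = 4 d(A^(1/4))]. *)
Lemma root4_concave A B : 0 <= A -> A <= B ->
 B - A <= 4 * root4 B ^+ 3 * (root4 B - root4 A).
Proof.
move=> A0 AB; have B0 := le_trans A0 AB; rewrite -{1}(root4K A0) -{1}(root4K B0).
have := ler_root4 AB; have := root4_ge0 A; move: (root4 A) (root4 B) => u v u0 uv.
have v0 := le_trans u0 uv; have p : 0 <= v - u by rewrite subr_ge0.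
have -> : v ^+ 4 - u ^+ 4 = (v ^+ 3 + v ^+ 2 * u + v * u ^+ 2 + u ^+ 3) * (v - u) by ring.
apply: ler_wpM2r => //; have h1 : v ^+ 2 * u <= v ^+ 2 * v by rewrite ler_wpM2l ?sqr_ge0.
have h2 : u ^+ 2 <= v ^+ 2 by rewrite lerXn2r.
have h3 : v * u ^+ 2 <= v * v ^+ 2 by rewrite ler_wpM2l.
have h4 : u ^+ 3 <= v ^+ 3 by rewrite lerXn2r.
have e1 : v ^+ 2 * v = v ^+ 3 by ring.
have e2 : v * v ^+ 2 = v ^+ 3 by ring.
by rewrite e1 in h1; rewrite e2 in h3; clear -h1 h3 h4; lra.
Qed.
End FourthRoot.

Section RemainingAction.
Variables (R : realType) (m : 'I_3 -> R) (h : R).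
Hypotheses (hm : posm m) (hh : 0 < h).

(* [2 h] in the regularization makes the truncated potential exact up to [2 h]. *)
Definition trunc_rate (q : conf R) : R := pot3 m (ereg m (2 * h)) q - h.

Lemma trunc_rateP q : ((trunc_rate q + h)%:E <= U m q)%E.
Proof. by rewrite subrK; apply: (pot3_le hm); apply: (ereg_gt0 hm); rewrite mulr_gt0. Qed.

(* The exponent 3 is a weakening of 8/3, which is what scaling gives; anything
 below 4 makes [dA / f] integrable at the end of the minimizer. *)
Lemma rate_ge_root4 q0 a b x : lip_min m h q0 a b x ->
 exists2 k, 0 < k & forall t, a <= t <= b ->
 k * root4 (fine (JM m h t b x)) ^+ 3 <= trunc_rate (x t).
Proof.
move=> xm; have xL := lm_lip xm; have [M M0 HM] := inertia_bounded hm xL.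
have fin t : a <= t <= b -> JM m h t b x \is a fin_num.
 move=> /andP[at_ tb]; exact: (action_fin hm xL (lm_fin xm) at_ tb (lexx b)).
pose A t := fine (JM m h t b x); pose g t := root4 (A t).
have g0 t : 0 <= g t by exact: root4_ge0.
have A0 t : 0 <= A t by rewrite fine_ge0 ?action_ge0.
have gab t : a <= t <= b -> g t <= g a.
 move=> tab; have /andP[at_ tb] := tab; apply: ler_root4; apply: fine_le.
 - exact: fin.
 - by apply: fin; rewrite lexx (le_trans at_).
 - exact: action_mono at_ tb (lexx b) xL.
(* The second bound settles the case of truncated potential at least [2 h]; the third pays for
   weakening the exponent 8/3 to 3, which costs a factor [g a]. *)
pose k := minr 1 (minr (h / (g a ^+ 3 + 1)) (h ^+ 2 / (g a * M + 1))).
have p1 : 0 < g a ^+ 3 + 1 by rewrite ltr_wpDl// exprn_ge0.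
have p2 : 0 < g a * M + 1 by rewrite ltr_wpDl// mulr_ge0// ltW.
have k0 : 0 < k by rewrite !lt_min ltr01 !divr_gt0// exprn_gt0.
have k1 : k <= 1 by rewrite ge_min lexx.
have k2 : k * (g a ^+ 3 + 1) <= h by rewrite -ler_pdivlMr// !ge_min lexx !orbT.
have k3 : k * (g a * M + 1) <= h ^+ 2 by rewrite -ler_pdivlMr// !ge_min lexx !orbT.
exists k => // t tab; rewrite -/(A t) -/(g t); have /andP[at_ tb] := tab.
have gt3 : g t ^+ 3 <= g a ^+ 3 by rewrite lerXn2r ?nnegrE// gab.
have h2 : 0 < 2 * h by rewrite mulr_gt0.
have kh : k * g t ^+ 3 <= h.
 apply: (le_trans _ k2); rewrite ler_wpM2l ?(ltW k0)//; clear -gt3; lra.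
have [big|small] := leP (2 * h) (pot3 m (ereg m (2 * h)) (x t)).
 by rewrite (le_trans kh)// /trunc_rate; clear -big; lra.
have Ux := pot3_le_U hm h2 (ltW small).
have hU : (h%:E <= U m (x t))%E.
 have [tltb|] := ltP t b; first by apply: ltW; apply: (lm_before xm); rewrite at_.
 by move=> bt; rewrite (@le_anti _ _ t b) ?tb ?bt// (lm_end xm).
pose f := trunc_rate (x t); have f0 : 0 <= f by move: hU; rewrite Ux lee_fin subr_ge0.
have Uf : U m (x t) = (h + f)%:E by rewrite Ux /f /trunc_rate; congr EFin; ring.
have := remaining_action hm hh xm tab f0 Uf; rewrite -(fineK (fin _ tab)) lee_fin -/(A t) => HA.
have r0 : 0 <= xinorm m (x t) by exact: sqrtr_ge0.
have s0 : 0 <= sqrt f by exact: sqrtr_ge0.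
have A2 : A t ^+ 2 <= M * f ^+ 3 / h ^+ 2.
 apply: (@le_trans _ _ ((xinorm m (x t) * f * sqrt f / h) ^+ 2)).
 by rewrite lerXn2r ?nnegrE// ?A0// !mulr_ge0// invr_ge0 ltW.
 have -> : (xinorm m (x t) * f * sqrt f / h) ^+ 2 =
 xinorm m (x t) ^+ 2 * (f ^+ 2 * sqrt f ^+ 2 / h ^+ 2) by field; rewrite gt_eqF.
 rewrite (sqr_xinorm hm) sqr_sqrtr//.
 have -> : M * f ^+ 3 / h ^+ 2 = M * (f ^+ 2 * f / h ^+ 2) by rewrite (exprS f 2); ring.
 by apply: ler_wpM2r (HM _ tab); exact: divr_ge0 (mulr_ge0 (sqr_ge0 _) f0) (sqr_ge0 _).
rewrite -/f -(@ler_pXn2r _ 3)// ?nnegrE// ?mulr_ge0 ?exprn_ge0 ?(ltW k0)//.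
have -> : (k * g t ^+ 3) ^+ 3 = k ^+ 3 * g t * (g t ^+ 4) ^+ 2 by ring.
rewrite (root4K (A0 t)).
have kk : k ^+ 3 <= k by rewrite exprS ler_piMr ?(ltW k0)// exprn_ile1// ltW.
have k3' : k * g a * M <= h ^+ 2.
 by apply: le_trans k3; rewrite -mulrA ler_wpM2l ?(ltW k0)//; clear; lra.
have ge0 : 0 <= k ^+ 3 * g t by rewrite mulr_ge0// exprn_ge0// ltW.
apply: (le_trans (ler_wpM2l ge0 A2)).
have -> : k ^+ 3 * g t * (M * f ^+ 3 / h ^+ 2) = f ^+ 3 * (k ^+ 3 * g t * M / h ^+ 2) by ring.
rewrite ler_piMr ?exprn_ge0// ler_pdivrMr ?exprn_gt0// mul1r; apply: le_trans k3'.
apply: ler_wpM2r (ltW M0) _ _ _; apply: (ler_pM _ (g0 t) kk (gab _ tab)).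
by rewrite exprn_ge0// ltW.
Qed.
End RemainingAction.

Section Vectors.
Variable R : realType.
Implicit Types (a b c d : R).

Definition vec3 a b c : 'I_3 -> R := fun i => match val i with 0 => a | 1 => b | _ => c end.

Lemma norm3E a b c : norm3 a b c = enorm (vec3 a b c).
Proof. by rewrite enorm3E. Qed.
Lemma norm3_ge0 a b c : 0 <= norm3 a b c. Proof. exact: sqrtr_ge0. Qed.

Lemma norm3D a b c a' b' c' : norm3 (a + a') (b + b') (c + c') <= norm3 a b c + norm3 a' b' c'.
Proof.
rewrite !norm3E; apply: le_trans (enormD _ _); apply: le_of_eq.
by congr enorm; apply/funext => i; rewrite /vec3; case: (val i) => [|[|n]].
Qed.

Lemma norm3Z k a b c : norm3 (k * a) (k * b) (k * c) = `|k| * norm3 a b c.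
Proof.
rewrite !norm3E -enormZ; congr enorm; apply/funext => i; rewrite /vec3.
by case: (val i) => [|[|n]].
Qed.

Lemma norm3_sub_ge w1 w2 w3 d M : 0 < M -> norm3 w1 w2 w3 <= M -> d ^+ 2 <= w2 ^+ 2 + w3 ^+ 2 ->
 d ^+ 2 / (2 * M) <= norm3 w1 w2 w3 - w1.
Proof.
move=> M0 nM dw; have [+ _ _] := ler_norm3 w1 w2 w3; have := sqr_norm3 w1 w2 w3.
move: (norm3 w1 w2 w3) nM => n nM sn; rewrite ler_norml => /andP[h1 h2].
rewrite ler_pdivrMr ?mulr_gt0//; apply: (@le_trans _ _ ((n - w1) * (n + w1))).
 by rewrite -subr_sqr sn; lra.
by rewrite ler_wpM2l ?subr_ge0//; lra.
Qed.

(** The dilation, equal to 1 at [c = d], that makes up for the rise of the potential when [w2] is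
    raised from [c] to [d]. *)
Definition shift_factor (C d c : R) : R := 1 + C * d * (d - c).

(** Setting [w2] to the constant [d] removes the component [q] of the chord and gains [q^2 / (2 S)].
    Half of this pays for the variation of the dilation factor, up to a relative error [O(d^2)]. *)
Lemma shift_step (a1 a2 a3 c1 c2 c3 C d M : R) : let S := norm3 (c1 - a1) (c2 - a2) (c3 - a3) in
 let ls := shift_factor C d a2 in let lt := shift_factor C d c2 in
 0 < C -> 0 < d <= 1 -> C * d ^+ 2 <= 1 -> 0 <= a2 <= d -> 0 <= c2 <= d -> 0 <= M ->
 norm3 a1 a2 a3 <= M ->
 norm3 (lt ^+ 2 * c1 - ls ^+ 2 * a1) (lt ^+ 2 * d - ls ^+ 2 * d) (lt ^+ 2 * c3 - ls ^+ 2 * a3) <=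
 (1 + (3 * C + (4 * C * (M + 1)) ^+ 2) * d ^+ 2) * S - (a2 - c2) ^+ 2 / (4 * S).
Proof.
move=> S ls lt C0 /andP[d0 d1] Cd /andP[a20 a2d] /andP[c20 c2d] M0 nM.
(* For [S = 0] the subtracted quotient is 0 by convention, and the shifted chord vanishes as
   well. *)
have [S0|Sn0] := eqVneq S 0.
 have [] := ler_norm3 (c1 - a1) (c2 - a2) (c3 - a3).
 rewrite -/S S0 !normr_le0 !subr_eq0 => /eqP e1 /eqP e2 /eqP e3.
 have lE : lt = ls by rewrite /lt /ls e2.
 by rewrite lE e1 e2 e3 !subrr /norm3 !expr0n !addr0 sqrtr0 !mulr0 invr0 mulr0 subrr.
have Sp : 0 < S by rewrite lt_def Sn0 norm3_ge0.
set q := a2 - c2; have qS : q ^+ 2 <= S ^+ 2.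
 rewrite sqr_norm3; have := sqr_ge0 (c1 - a1); have := sqr_ge0 (c3 - a3).
 have -> : q ^+ 2 = (c2 - a2) ^+ 2 by rewrite /q; ring.
 by clear; lra.
have lt1 : 1 <= lt by rewrite /lt /shift_factor lerDl mulr_ge0 ?subr_ge0// mulr_ge0// ltW.
have ls1 : 1 <= ls by rewrite /ls /shift_factor lerDl mulr_ge0 ?subr_ge0// mulr_ge0// ltW.
have lb u : 0 <= u -> shift_factor C d u <= 1 + C * d ^+ 2.
 move=> u0; rewrite /shift_factor lerD2l expr2 mulrA ler_wpM2l//; first by rewrite mulr_ge0 ?ltW.
 by rewrite gerBl.
have ltb := lb _ c20; have lsb := lb _ a20; rewrite -/lt -/ls in ltb lsb.
have lt2 : lt ^+ 2 <= 1 + 3 * (C * d ^+ 2).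
 move: lt1 ltb Cd; have : 0 < C * d ^+ 2 by rewrite mulr_gt0 ?exprn_gt0.
 by move: (C * d ^+ 2) lt => u l; clear; nra.
have dl : `|lt ^+ 2 - ls ^+ 2| <= 4 * C * d * `|q|.
 have -> : lt ^+ 2 - ls ^+ 2 = C * d * q * (lt + ls) by rewrite /lt /ls /shift_factor /q; ring.
 rewrite normrM [`|lt + ls|]ger0_norm; last by lra.
 have -> : `|C * d * q| = C * d * `|q| by rewrite normrM ger0_norm// mulr_ge0 ?ltW.
 have -> : 4 * C * d * `|q| = C * d * `|q| * 4 by ring.
 apply: ler_wpM2l; first by rewrite !mulr_ge0 ?(ltW C0) ?(ltW d0).
 by clear -ltb lsb Cd; lra.
have n13 : norm3 (c1 - a1) 0 (c3 - a3) <= S - q ^+ 2 / (2 * S).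
 have q2S : q ^+ 2 / (2 * S) <= S / 2.
 rewrite ler_pdivrMr ?mulr_gt0//; have -> : S / 2 * (2 * S) = S ^+ 2 by field.
 exact: qS.
 rewrite -ler_sqr ?nnegrE ?norm3_ge0//; last by clear -q2S Sp; lra.
 rewrite sqr_norm3 expr0n addr0.
 have -> : (S - q ^+ 2 / (2 * S)) ^+ 2 = S ^+ 2 - q ^+ 2 + (q ^+ 2 / (2 * S)) ^+ 2.
 by field; rewrite gt_eqF.
 rewrite /S sqr_norm3 -/S; have -> : q ^+ 2 = (c2 - a2) ^+ 2 by rewrite /q; ring.
 have := sqr_ge0 ((c2 - a2) ^+ 2 / (2 * S)); by clear; lra.
have nd : norm3 a1 d a3 <= M + 1.
 apply: (@le_trans _ _ (norm3 a1 a2 a3 + norm3 0 (d - a2) 0)).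
 by apply: (le_trans _ (norm3D _ _ _ _ _ _)); rewrite !addr0 subrKC.
 rewrite lerD// /norm3 expr0n add0r addr0 sqrtr_sqr ger0_norm ?subr_ge0//.
 by clear -a20 d1; lra.
have -> : lt ^+ 2 * c1 - ls ^+ 2 * a1 = lt ^+ 2 * (c1 - a1) + (lt ^+ 2 - ls ^+ 2) * a1 by ring.
have -> : lt ^+ 2 * d - ls ^+ 2 * d = lt ^+ 2 * 0 + (lt ^+ 2 - ls ^+ 2) * d by ring.
have -> : lt ^+ 2 * c3 - ls ^+ 2 * a3 = lt ^+ 2 * (c3 - a3) + (lt ^+ 2 - ls ^+ 2) * a3 by ring.
apply: (le_trans (norm3D _ _ _ _ _ _)); rewrite !norm3Z.
rewrite [`|lt ^+ 2|]ger0_norm ?sqr_ge0//.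
have B1 : lt ^+ 2 * norm3 (c1 - a1) 0 (c3 - a3) <= (1 + 3 * (C * d ^+ 2)) * S - q ^+ 2 / (2 * S).
 apply: (@le_trans _ _ ((1 + 3 * (C * d ^+ 2)) * (S - q ^+ 2 / (2 * S)))).
 by apply: ler_pM => //; [exact: sqr_ge0|exact: norm3_ge0].
 have : 0 <= 3 * (C * d ^+ 2) * (q ^+ 2 / (2 * S)).
 apply: mulr_ge0 (mulr_ge0 (ler0n _ 3) (mulr_ge0 (ltW C0) (sqr_ge0 _))) _.
 exact: divr_ge0 (sqr_ge0 _) (mulr_ge0 (ler0n _ 2) (ltW Sp)).
 by move: (q ^+ 2 / (2 * S)) (C * d ^+ 2) => u v; clear; nra.
have B2 : `|lt ^+ 2 - ls ^+ 2| * norm3 a1 d a3 <= 4 * C * (M + 1) * d * `|q|.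
 apply: (@le_trans _ _ (4 * C * d * `|q| * (M + 1))).
 by apply: ler_pM => //; exact: norm3_ge0.
 by apply: le_of_eq; ring.
have B3 : 4 * C * (M + 1) * d * `|q| <= q ^+ 2 / (4 * S) + (4 * C * (M + 1)) ^+ 2 * d ^+ 2 * S.
 rewrite -(real_normK (num_real q)); move: `|q| (4 * C * (M + 1)) => r E.
 have -> : r ^+ 2 / (4 * S) + E ^+ 2 * d ^+ 2 * S = E * d * r + (r - 2 * E * d * S) ^+ 2 / (4 * S).
 by field; rewrite gt_eqF.
 by rewrite lerDl divr_ge0 ?sqr_ge0// mulr_ge0 ?(ltW Sp).
apply: (le_trans (lerD B1 (le_trans B2 B3))).
have -> : q ^+ 2 / (2 * S) = q ^+ 2 / (4 * S) + q ^+ 2 / (4 * S) by field; rewrite gt_eqF.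
apply: le_of_eq; ring.
Qed.
End Vectors.

Section ShiftedPotential.
Variables (R : realType) (m : 'I_3 -> R) (h : R).
Hypotheses (hm : posm m) (hh : 0 < h).
Hypothesis m12 : m b1 = m b2.
Implicit Types (q : conf R) (x : R -> conf R).

Lemma spread_inertia q : spread m q = (inertia m q - hopf m q b1) / (2 * mu2 m) +
 (inertia m q + hopf m q b1) / (8 * mu1 m).
Proof.
have p1 := mu1_gt0 hm; have p2 := mu2_gt0 hm; rewrite /spread.
have -> : X2 m q ^+ 2 + Y2 m q ^+ 2 = (inertia m q - hopf m q b1) / (2 * mu2 m).
 apply: (@mulfI _ (mu2 m)); first by rewrite gt_eqF.
 by rewrite hopf_S; move: (mu2 m) p2 => u u0; field; rewrite gt_eqF.
have -> : X1 q ^+ 2 + Y1 q ^+ 2 = (inertia m q + hopf m q b1) / (2 * mu1 m).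
 apply: (@mulfI _ (mu1 m)); first by rewrite gt_eqF.
 by rewrite hopf_P; move: (mu1 m) p1 => u u0; field; rewrite gt_eqF.
by congr (_ + _); move: (mu1 m) p1 => u u0; field; rewrite gt_eqF.
Qed.

Lemma dilate_hopf l q i : hopf m (dilate l q) i = l ^+ 2 * hopf m q i.
Proof.
have [e1 e2 e3 e4] : [/\ X1 (dilate l q) = l * X1 q, Y1 (dilate l q) = l * Y1 q,
 X2 m (dilate l q) = l * X2 m q & Y2 m (dilate l q) = l * Y2 m q].
 by rewrite !X1E !Y1E !X2E !Y2E /dilate !cReZ !cImZ; split; ring.
by rewrite /hopf e1 e2 e3 e4; case: (val i) => [|[|n]]; ring.
Qed.

(** Raising the skew multiplies [1 / r13 + 1 / r23] by at most the factor of [invsum_shift], while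
    the dilation divides the potential by [l]. The constant [1 / (kappa^2 a0^2)] is what makes [l]
    at least that factor. *)
Lemma U_shift q q' a0 d : 0 < a0 -> a0 <= spread m q -> 0 < d -> d <= kappa m * a0 ->
 0 <= hopf m q b2 <= d ->
 let l := shift_factor (kappa m ^+ 2 * a0 ^+ 2)^-1 d (hopf m q b2) in
 hopf m q' b1 = l ^+ 2 * hopf m q b1 -> hopf m q' b2 = l ^+ 2 * d ->
 hopf m q' b3 ^+ 2 = (l ^+ 2 * hopf m q b3) ^+ 2 ->
 (U m q' <= U m q)%E /\ inertia m q <= inertia m q'.
Proof.
move=> a00 a0s d0 dk /andP[c0 cd] l e1 e2 e3.
have k0 := kappa_gt0 hm; have p1 := mu1_gt0 hm; have p2 := mu2_gt0 hm.
have kq : 0 < kappa m ^+ 2 * a0 ^+ 2 by rewrite mulr_gt0 ?exprn_gt0.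
have l1 : 1 <= l.
 by rewrite /l /shift_factor lerDl mulr_ge0 ?subr_ge0// mulr_ge0 ?invr_ge0 ?ltW.
have l0 : 0 < l by lra.
pose r := dilate l^-1 q'.
have qr : q' = dilate l r.
 by apply/funext => i; rewrite /r /dilate mulrA -rmorphM /= divff ?mul1r// gt_eqF.
have ll (u : R) : l^-1 ^+ 2 * (l ^+ 2 * u) = u by rewrite mulrA -exprMn mulVf ?expr1n ?mul1r// gt_eqF.
have r1 : hopf m r b1 = hopf m q b1 by rewrite dilate_hopf e1 ll.
have r2 : hopf m r b2 = d by rewrite dilate_hopf e2 ll.
have r3 : hopf m r b3 ^+ 2 = hopf m q b3 ^+ 2.
 by rewrite dilate_hopf exprMn e3 -exprMn ll.
have Nqr : inertia m q <= inertia m r.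
 rewrite !(inertia_norm3 hm) r1 r2 ler_wsqrtr// r3 lerD2r lerD2l lerXn2r// nnegrE ltW//.
have Nq' : inertia m q' = l ^+ 2 * inertia m r.
 by rewrite !(inertia_norm3 hm) qr !dilate_hopf norm3Z ger0_norm ?sqr_ge0.
split; last first.
 rewrite Nq' (le_trans Nqr)// ler_peMl ?inertia_ge0//.
 by rewrite exprn_ege1.
have [[r0 sl]|H] := pselect (0 < rdist q b1 b2 /\ `|skew m q| < spread m q); last first.
 by rewrite (U_skew_oo hm m12 H) leey.
have P : X1 q ^+ 2 + Y1 q ^+ 2 <= X1 r ^+ 2 + Y1 r ^+ 2.
 by rewrite -(ler_pM2l p1) !hopf_P r1; lra.
have r12 : rdist q b1 b2 <= rdist r b1 b2 by rewrite !rdist12 ler_wsqrtr.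
have sp : spread m q <= spread m r.
 rewrite !spread_inertia r1; apply: lerD; apply: ler_wpM2r; rewrite ?lerD2r//.
 by rewrite invr_ge0 pmulr_rge0 ?ltW.
 by rewrite invr_ge0 pmulr_rge0 ?ltW.
have k2 : 0 < 2 * kappa m by rewrite pmulr_rgt0.
have cq : skew m q = hopf m q b2 / (2 * kappa m) by rewrite hopf_skew; field; rewrite gt_eqF.
have cr : skew m r = d / (2 * kappa m) by rewrite -r2 hopf_skew; field; rewrite gt_eqF.
have cq0 : 0 <= skew m q by rewrite cq divr_ge0// ltW.
have cqr : skew m q <= skew m r by rewrite cq cr ler_pM2r ?invr_gt0.
have cr2 : 2 * skew m r <= a0.
 rewrite cr; have -> : 2 * (d / (2 * kappa m)) = d / kappa m by field; rewrite gt_eqF.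
 by rewrite ler_pdivrMr// mulrC.
have cra : skew m r < spread m q by lra.
have Ur : U m r = (m b1 * m b2 / rdist r b1 b2 + m b1 * m b3 * invsum (spread m r) (skew m r))%:E.
 apply: (U_skew hm m12); first exact: lt_le_trans r12.
 by rewrite ger0_norm ?(le_trans cq0)// (lt_le_trans cra).
rewrite qr (U_dilate hm l0 Ur) (U_skew hm m12 r0 sl) lee_fin ler_pdivrMr//.
have k12 : 0 <= m b1 * m b2 by rewrite mulr_ge0// ltW.
have k13 : 0 <= m b1 * m b3 by rewrite mulr_ge0// ltW.
rewrite mulrDl; apply: lerD.
 apply: (@le_trans _ _ (m b1 * m b2 / rdist q b1 b2)).
 by rewrite ler_wpM2l// lef_pV2 ?posrE// (lt_le_trans r0).
 by rewrite ler_peMr// mulr_ge0// invr_ge0 ltW.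
rewrite -(mulrA (m b1 * m b3)); apply: ler_wpM2l => //.
apply: (@le_trans _ _ (invsum (spread m q) (skew m r))).
 by apply: invsum_anti => //; rewrite ger0_norm// (le_trans cq0).
apply: (le_trans (invsum_shift cq0 cqr cra)); rewrite mulrC ler_wpM2l ?invsum_ge0//.
rewrite /l /shift_factor lerD2l.
have -> : (kappa m ^+ 2 * a0 ^+ 2)^-1 * d * (d - hopf m q b2) =
 (2 * skew m r * (skew m r - skew m q)) / (a0 ^+ 2 / 2).
 by rewrite cr cq; field; rewrite !gt_eqF.
have D0 : a0 ^+ 2 / 2 <= spread m q ^+ 2 - skew m r ^+ 2.
 have : skew m r ^+ 2 <= (a0 / 2) ^+ 2.
 by rewrite lerXn2r ?nnegrE ?(le_trans cq0) ?divr_ge0 ?(ltW a00)//; lra.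
 have : a0 ^+ 2 <= spread m q ^+ 2 by rewrite lerXn2r ?nnegrE ?(le_trans (ltW a00)) ?(ltW a00).
 rewrite expr_div_n; have := sqr_ge0 a0; move: (spread m q ^+ 2) (skew m r ^+ 2) (a0 ^+ 2) => u v w.
 by lra.
have a2 : 0 < a0 ^+ 2 / 2 by rewrite divr_gt0// exprn_gt0.
rewrite subr_sqr; apply: ler_pM.
- apply: mulr_ge0; [by rewrite subr_ge0 | exact: addr_ge0 (le_trans cq0 cqr) cq0].
- by rewrite invr_ge0 (le_trans (ltW a2)).
- by rewrite mulrC ler_wpM2r ?subr_ge0//; lra.
- by rewrite lef_pV2 ?posrE// (lt_le_trans a2).
Qed.

Lemma action_le_factor s t F x y : s <= t -> lipc s t x -> lipc s t y ->
 (JM m h s t x < +oo)%E -> 0 <= F ->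
 (forall u, s <= u <= t -> (U m (y u) <= U m (x u))%E /\ inertia m (x u) <= inertia m (y u)) ->
 (forall u v, s <= u -> u <= v -> v <= t ->
 hopfD m (y v) (y u) <=
 F * hopfD m (x v) (x u)) ->
 (JM m h s t y <= F%:E * JM m h s t x)%E.
Proof.
rewrite le_eqVlt => /predU1P[<- _ _ _ _ _ _|st xL yL xfin F0 HU Hd]; first by rewrite !action_point mule0.
pose D u := F * fine (JM m h s u x).
have fin u v : s <= u -> u <= v -> v <= t -> JM m h u v x \is a fin_num.
 by move=> su uv vt; exact: (action_fin hm xL xfin).
have DB u v : s <= u -> u <= v -> v <= t -> D v - D u = F * fine (JM m h u v x).
 move=> su uv vt; rewrite /D -mulrBr; congr (_ * _).
 rewrite (action_cat h hm su uv (lipc_sub (lexx s) vt xL)) fineD ?fin//.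
 by rewrite addrC addKr.
 exact: le_trans vt.
have -> : (F%:E * JM m h s t x)%E = (D t - D s)%:E.
 by rewrite DB ?lexx ?(ltW st)// EFinM fineK// fin ?lexx ?(ltW st).
apply: (action_le_hopf hm st yL) => [u v su uv vt|u v c su uv vt c0 Hc].
 by rewrite -subr_ge0 DB// mulr_ge0// fine_ge0 ?action_ge0.
rewrite DB//; apply: (@le_trans _ _ (c * (F * hopfD m (x v) (x u)))).
 by rewrite ler_wpM2l ?(ltW c0)// Hd.
rewrite mulrCA ler_wpM2l// -lee_fin fineK ?fin//.
apply: arc_hopf_le_action; [exact: hm|exact: uv|exact: lipc_sub su vt xL|exact: ltW|].
move=> w /andP[uw wv]; have swt : s <= w <= t by rewrite (le_trans su uw) (le_trans wv vt).
have [h1 h2] := HU _ swt; apply: le_trans h1; have := Hc w; rewrite uw wv => /(_ isT).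
by apply: le_trans; rewrite lee_fin lerD2r ler_wpM2l// mulr_ge0 ?sqr_ge0.
Qed.
End ShiftedPotential.

Section Side.
Variables (R : realType) (m : 'I_3 -> R) (h : R).
Hypotheses (hm : posm m) (hh : 0 < h).
Hypothesis m12 : m b1 = m b2.
Implicit Types (q : conf R) (x : R -> conf R).

Lemma inertia_hopf q q' : (forall i, hopf m q i ^+ 2 = hopf m q' i ^+ 2) -> inertia m q = inertia m q'.
Proof. by move=> e; rewrite !(inertia_norm3 hm) /norm3 !e. Qed.
(** The fold gets the sign that [w3] has at [ts], so that it passes through the class of [x ts]; a
    rigid motion then joins the representatives. *)
Lemma fold_after q0 a b x ts : lip_min m h q0 a b x -> a <= ts <= b -> hopf m (x ts) b2 = 0 ->
 exists z, [/\ lipc a b z, forall t, t <= ts -> z t = x t,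
 forall t, ts <= t <= b -> hopf m (z t) b2 = 0,
 forall t, a <= t <= b -> (U m (z t) <= U m (x t))%E /\ inertia m (z t) = inertia m (x t) &
 (JM m h ts b z <= JM m h ts b x)%E].
Proof.
move=> xm /andP[ats tsb] w0; have xL := lm_lip xm.
have [sg sg2 sgE] : exists2 sg : R, sg ^+ 2 = 1 & hopf m (x ts) b3 = sg * `|hopf m (x ts) b3|.
 have [w1|w1] := leP 0 (hopf m (x ts) b3); first by exists 1; rewrite ?expr1n// ger0_norm// mul1r.
 by exists (-1); rewrite ?sqrrN ?expr1n// ltr0_norm// mulN1r opprK.
pose v q := sqrt (xi2sq m q).
pose u q := sqrt (xi1sq q).
pose y t := of_xi m 0 (u (x t)) (sg * v (x t)) 0.
have yh t i : hopf m (y t) i = if i == b3 then sg * hopf m (iso m (x t)) i else hopf m (iso m (x t)) i.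
 rewrite /hopf /y /iso -/(v _) -/(u _).
 have [-> -> -> ->] := of_xiE hm 0 (u (x t)) (sg * v (x t)) 0.
 have [-> -> -> ->] := of_xiE hm 0 (u (x t)) (v (x t)) 0.
 by case: (ord3_cases i) => -> /=; rewrite ?exprMn ?sg2; ring.
have ysq t i : hopf m (iso m (x t)) i ^+ 2 = hopf m (y t) i ^+ 2.
 by rewrite yh; case: ifP => // _; rewrite exprMn sg2 mul1r.
have yN t : inertia m (y t) = inertia m (x t).
 by rewrite -(inertia_iso hm (x t)); apply/esym; apply: inertia_hopf => i; exact: ysq.
have yU t : (U m (y t) <= U m (x t))%E.
 apply: le_trans (U_iso hm m12 (x t)); apply: (U_anti_hopf hm); rewrite ?yh//.
 by rewrite yN (inertia_iso hm).
have y2 t : hopf m (y t) b2 = 0 by rewrite yh /=; have [_ -> _] := hopf_iso hm (x t).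
have yL s t : lipc s t x -> lipc s t y.
 move=> sL; apply: lipschitz_of_xi; [exact: lipon_cst| | |exact: lipon_cst].
 by apply: lipon_sqrt2; [exact: lipon_X1|exact: lipon_Y1].
 by apply: liponZ; apply: lipon_sqrt2; [exact: lipon_X2|exact: lipon_Y2].
have dy s t : hopfD m (y t) (y s) <=
 hopfD m (x t) (x s).
 apply: le_trans (enorm_hopf_iso hm (x s) (x t)); apply: le_enorm => i; rewrite !yh.
 case: ifP => // _; rewrite -mulrBr normrM (_ : `|sg| = 1) ?mul1r//.
 by apply/eqP; rewrite -(@eqrXn2 _ 2)// expr1n -normrX sg2 normr1.
have /(hopf_inj hm)[e [c [e1 ec]]] : hopf m (x ts) = hopf m (y ts).
 apply/funext => i; rewrite yh; have [h1 h2 h3] := hopf_iso hm (x ts).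
 case: (ord3_cases i) => -> /=; rewrite ?h1 ?h2 ?h3//.
 by rewrite w0 expr0n add0r sqrtr_sqr.
have en0 : e != 0 by apply/eqP => e0; move: e1; rewrite e0 Normc.normc0 => /eqP; rewrite eq_sym oner_eq0.
pose yy t : conf R := fun i => e^-1 * y t i + - (e^-1 * c).
have yys t : same_conf (y t) (yy t).
 by exists e^-1, (- (e^-1 * c)); split=> //; rewrite Normc.normcV e1 invr1.
have tsL := lipc_sub ats (lexx b) xL.
have ytsb := yL _ _ tsL.
have yyL : lipc ts b yy by exact: lipschitz_curve_move.
have E0 : x ts = yy ts.
 by apply/funext => i; rewrite /yy ec mulrDr mulrA mulVf// mul1r addrK.
pose z t := if t <= ts then x t else yy t.
have zy t : ts <= t -> z t = yy t.
 rewrite /z le_eqVlt => /predU1P[<-|tst]; first by rewrite lexx.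
 by rewrite leNgt tst.
exists z; split.
- exact: lipschitz_curve_cat ats tsb E0 (lipc_sub (lexx a) tsb xL) yyL.
- by move=> t; rewrite /z => ->.
- by move=> t /andP[tst _]; rewrite zy// (same_conf_hopf hm (yys t)).
- move=> t tab; rewrite /z; case: ifP => // _.
 by rewrite (same_conf_U m (yys t)) -(yN t) -!(enorm_hopf hm) (same_conf_hopf hm (yys t)).
have -> : JM m h ts b z = JM m h ts b y.
 have zyL : lipc ts b z.
 apply/lipcP => i; have /lipcP/(_ i)[l1 l2] := yyL.
 by split; [apply: lipon_ext l1|apply: lipon_ext l2] => t /andP[tst _]; rewrite zy.
 apply/esym; apply: (action_same_conf h hm tsb ytsb zyL) => t /andP[tst _].
 by rewrite zy.
have := @action_le_factor _ m h hm ts b 1 x y tsb tsL ytsb.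
rewrite mul1e; apply => //.
- exact: le_lt_trans (action_mono h hm ats tsb (lexx b) xL) (lm_fin xm).
- by move=> t _; rewrite yN.
- by move=> s t _ _ _; rewrite mul1r.
Qed.

(** For a short chord [S] of weight [V] with drop [q] of [w2], the gain [V q^2 / (4 S)] is at least
    its linearization [kp q / 2 - kp^2 S / (4 V)], for any [kp]. The first term telescopes without
    any knowledge of the speed of [w2]. The second is controlled by [V S <=] action and
    [V^2 >= k g^3 / (8 M)], which bound [S / V] by an increment of the fourth root [g] of the
    remaining action. *)
Lemma action_le_gain q0 a b x y s t F k M kp : lip_min m h q0 a b x ->
 a <= s -> s < t -> t <= b -> lipc s t y -> 0 <= F -> 0 < k -> 0 < M -> 0 <= kp ->
 let g u := root4 (fine (JM m h u b x)) in 0 < g t ->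
 (forall u, s <= u <= t -> [/\ (U m (y u) <= U m (x u))%E, inertia m (x u) <= inertia m (y u),
 inertia m (x u) <= M & k * g u ^+ 3 <= trunc_rate m h (x u)]) ->
 (forall u v, s <= u -> u <= v -> v <= t ->
 let S := hopfD m (x v) (x u) in
 hopfD m (y v) (y u) <=
 F * S - (hopf m (x u) b2 - hopf m (x v) b2) ^+ 2 / (4 * S)) ->
 (JM m h s t y <= (F * fine (JM m h s t x) -
 kp / 2 * (hopf m (x s) b2 - hopf m (x t) b2) + kp ^+ 2 * (8 * M / k) * (g s - g t))%:E)%E.
Proof.
move=> xm as_ st tb yL F0 k0 M0 kp0 g gt0 HU Hd; have xL := lm_lip xm; have xfin := lm_fin xm.
have xLs := lipc_sub as_ tb xL.
have fin u v : s <= u -> u <= v -> v <= b -> JM m h u v x \is a fin_num.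
 by move=> su uv vt; apply: (action_fin hm xL xfin) => //; exact: le_trans as_ su.
pose al u v := fine (JM m h u v x).
have al0 u v : 0 <= al u v by rewrite fine_ge0 ?action_ge0.
have alD u v w : s <= u -> u <= v -> v <= w -> w <= b -> al u w = al u v + al v w.
 move=> su uv vw wt.
 rewrite /al (action_cat h hm uv vw (lipc_sub (le_trans as_ su) wt xL)).
 exact: fineD (fin _ _ su uv (le_trans vw wt)) (fin _ _ (le_trans su uv) vw wt).
have gm u v : s <= u -> u <= v -> v <= t -> g v <= g u.
 by move=> su uv vt; apply: ler_root4; rewrite -!/(al _ _) (alD u v) ?lerDr// (le_trans vt).
pose K := kp ^+ 2 * (8 * M / k).
have K0 : 0 <= K := mulr_ge0 (sqr_ge0 _) (divr_ge0 (mulr_ge0 (ler0n _ 8) (ltW M0)) (ltW k0)).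
pose D u := F * al s u + kp / 2 * hopf m (x u) b2 - K * g u.
have -> : F * al s t - kp / 2 * (hopf m (x s) b2 - hopf m (x t) b2) + K * (g s - g t) = D t - D s.
 have a0 : al s s = 0 by rewrite /al action_point.
 by rewrite /D a0; move: (al s t) (g s) (g t) => A G G'; clear -hm hh m12; ring.
have DB u v : s <= u -> u <= v -> v <= t -> D v - D u =
 F * al u v - kp / 2 * (hopf m (x u) b2 - hopf m (x v) b2) + K * (g u - g v).
 move=> su uv vt; rewrite /D (alD s u v (lexx s) su uv (le_trans vt tb)).
 by move: (al s u) (al u v) (g u) (g v) => A A' G G'; clear -hm hh m12; ring.
have [L L0 HL] : lipon s t (fun u => trunc_rate m h (x u)).
 apply: liponB; last exact: lipon_cst.
 by apply: lipon_potential3 xLs => //; apply: (ereg_gt0 hm); rewrite pmulr_rgt0.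
pose r := k * g t ^+ 3 / 2; have r0 : 0 < r by rewrite divr_gt0// mulr_gt0// exprn_gt0.
have L1 : 0 < L + 1 by rewrite ltr_wpDl.
pose eta := r / (L + 1); have eta0 : 0 < eta by rewrite divr_gt0.
pose S u v := hopfD m (x v) (x u).
pose E u v := hopfD m (y v) (y u).
have main c u v : 0 <= c -> s <= u -> u <= v -> v <= t ->
 (0 < c -> forall w, u <= w <= v -> ((4 * c ^+ 2 * inertia m (y w) + h)%:E <= U m (y w))%E) ->
 c * E u v <= D v - D u.
 move=> c0 su uv vt Hc; apply: (@local_to_global _ u v eta (fun u v => c * E u v)) => //.
 move=> u1 u2 u3; rewrite -mulrDr ler_wpM2l//; apply: le_trans (enormD _ _).
 apply: le_of_eq; congr enorm.
 by apply/funext => i; ring.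
 move=> u1 v1 uu1 uv1 vv1 close.
 have su1 : s <= u1 := le_trans su uu1; have vt1 : v1 <= t := le_trans vv1 vt.
 have ut1 : u1 <= t := le_trans uv1 vt1.
 rewrite DB//; set q := _ - hopf m (x v1) b2.
 (* The weight guaranteed by the lower bound of the rate; half of that bound is given up for the
    variation of the rate over an interval shorter than [eta]. [V] is the better of [c] and [v0]. *)
 pose v0 := sqrt (k * g u1 ^+ 3 / (8 * M)).
 have gu1 : 0 < g u1 := lt_le_trans gt0 (gm _ _ su1 ut1 (lexx t)).
 have M8 : 0 < 8 * M by rewrite pmulr_rgt0.
 have kg : 0 < k * g u1 ^+ 3 by rewrite mulr_gt0// exprn_gt0.
 have v02 : v0 ^+ 2 = k * g u1 ^+ 3 / (8 * M) := sqr_sqrtr (ltW (divr_gt0 kg M8)).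
 have v00 : 0 < v0 by rewrite sqrtr_gt0 divr_gt0.
 pose V := maxr c v0; have V0 : 0 < V by rewrite lt_max v00 orbT.
 have VS : V * S u1 v1 <= al u1 v1.
 rewrite -lee_fin fineK ?fin ?(le_trans vt1)//.
 apply: arc_hopf_le_action; [exact: hm|exact: uv1| |exact: ltW|].
 exact: lipc_sub (le_trans as_ su1) (le_trans vt1 tb) xL.
 move=> w /andP[uw wv]; have swt : s <= w <= t by rewrite (le_trans su1)// (le_trans wv).
 have [h1 h2 h3 h4] := HU _ swt.
 have [cv|vc] := leP c v0.
 apply: le_trans (trunc_rateP hm hh _); rewrite /V max_r// lee_fin lerD2r v02.
 apply: (@le_trans _ _ (k * g u1 ^+ 3 / 2)).
 have -> : 4 * (k * g u1 ^+ 3 / (8 * M)) * inertia m (x w) = k * g u1 ^+ 3 / 2 * (inertia m (x w) / M).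
 by field; rewrite gt_eqF.
 rewrite ler_piMr ?(divr_ge0 (ltW kg))// ler_pdivrMr// mul1r; exact: h3.
 have su1t : s <= u1 <= t by rewrite su1.
 have [_ _ _ h5] := HU _ su1t; have := HL _ _ su1t swt.
 rewrite (ler0_norm (_ : u1 - w <= 0)) ?subr_le0// => HL1.
 have h6 : L * - (u1 - w) <= r.
 apply: (@le_trans _ _ ((L + 1) * eta)); last by rewrite mulrC divfK// gt_eqF.
 by apply: ler_pM => //; clear -hm hh m12 uw wv close L0; lra.
 have h7 : r <= k * g u1 ^+ 3 / 2.
 apply: ler_wpM2r; first by rewrite invr_ge0.
 apply: (ler_wpM2l (ltW k0)).
 exact: (lerXn2r 3 (root4_ge0 _) (root4_ge0 _) (gm _ _ su1 ut1 (lexx t))).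
 have := ler_norm (trunc_rate m h (x u1) - trunc_rate m h (x w)).
 by clear -hm hh m12 HL1 h5 h6 h7; lra.
 rewrite /V max_l ?(ltW vc)//; apply: le_trans h1; apply: le_trans (Hc (lt_trans v00 vc) w _).
 by rewrite lee_fin lerD2r ler_wpM2l// mulr_ge0 ?sqr_ge0.
 by rewrite (le_trans uu1)// (le_trans wv).
 have gg : g v1 <= g u1 := gm _ _ su1 uv1 vt1.
 have S0 : 0 <= S u1 v1 := enorm_ge0 _.
 have SV : S u1 v1 / V <= 32 * M / k * (g u1 - g v1).
 apply: (@le_trans _ _ (al u1 v1 / v0 ^+ 2)).
 rewrite ler_pdivrMr// mulrAC ler_pdivlMr ?exprn_gt0//.
 apply: (@le_trans _ _ (S u1 v1 * V ^+ 2)).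
 by rewrite ler_wpM2l// lerXn2r ?nnegrE ?(ltW v00) ?(ltW V0)// /V le_max lexx orbT.
 by rewrite expr2 mulrA ler_wpM2r ?(ltW V0)// mulrC.
 have := @root4_concave _ (al v1 b) (al u1 b) (al0 _ _).
 rewrite -!/(g _) {1 2}(alD u1 v1 b) ?(le_trans vt1)// lerDr => /(_ (al0 _ _)).
 rewrite addrK => H; rewrite v02 ler_pdivrMr ?divr_gt0//; apply: (le_trans H).
 apply: le_of_eq; rewrite -!/(g _).
 by move: (g u1) (g v1) gu1 => G G' G0; clear -G0 k0 M0; field; rewrite !gt_eqF.
 have cE : c * E u1 v1 <= V * E u1 v1 by rewrite ler_wpM2r ?enorm_ge0// le_max lexx.
 apply: (le_trans cE).
 have HE : E u1 v1 <= F * S u1 v1 - q ^+ 2 / (4 * S u1 v1) := Hd _ _ su1 uv1 vt1.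
 apply: (le_trans (ler_wpM2l (ltW V0) HE)); rewrite mulrBr.
 have FVS : V * (F * S u1 v1) <= F * al u1 v1 by rewrite mulrCA ler_wpM2l.
 have KK : kp ^+ 2 / 4 * (S u1 v1 / V) <= K * (g u1 - g v1).
 apply: (@le_trans _ _ (kp ^+ 2 / 4 * (32 * M / k * (g u1 - g v1)))).
 by rewrite ler_wpM2l// divr_ge0 ?sqr_ge0.
 rewrite /K le_eqVlt; apply/orP; left; apply/eqP; field.
 by rewrite gt_eqF.
 have AG : kp / 2 * q <= V * (q ^+ 2 / (4 * S u1 v1)) + kp ^+ 2 / 4 * (S u1 v1 / V).
 have [Sz|Sn] := eqVneq (S u1 v1) 0.
 have qz : q = 0.
 have := enorm_ge (fun i => hopf m (x v1) i - hopf m (x u1) i) b2.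
 rewrite -/(S u1 v1) Sz normr_le0 subr_eq0 => /eqP qq.
 by rewrite /q qq subrr.
 by rewrite Sz qz expr0n /= !(mul0r, mulr0) addr0.
 have Sp : 0 < S u1 v1 by rewrite lt_def Sn.
 have -> : V * (q ^+ 2 / (4 * S u1 v1)) + kp ^+ 2 / 4 * (S u1 v1 / V) =
 kp / 2 * q + (V * q - kp * S u1 v1) ^+ 2 / (4 * S u1 v1 * V).
 by field; rewrite !gt_eqF.
 rewrite lerDl divr_ge0 ?sqr_ge0//; exact: mulr_ge0 (mulr_ge0 (ler0n _ 4) S0) (ltW V0).
 by clear -hm hh m12 FVS KK AG; lra.
apply: (action_le_hopf hm st yL) => [u v su uv vt|u v c su uv vt c0 Hc].
 by have := main 0 u v (lexx 0) su uv vt; rewrite mul0r subr_ge0 ltxx; apply.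
exact: main (ltW c0) su uv vt (fun=> Hc).
Qed.

Lemma spread_ge_inertia q :
 2 * minr (2 * mu2 m)^-1 (8 * mu1 m)^-1 * inertia m q <= spread m q.
Proof.
have p1 := mu1_gt0 hm; have p2 := mu2_gt0 hm; rewrite (spread_inertia hm).
have [] := ler_norm3 (hopf m q b1) (hopf m q b2) (hopf m q b3).
rewrite -(inertia_norm3 hm) ler_norml => /andP[h1 h2] _ _.
set r := minr _ _; have r1 : r <= (2 * mu2 m)^-1 by rewrite ge_min lexx.
have r2 : r <= (8 * mu1 m)^-1 by rewrite ge_min lexx orbT.
have N1 : 0 <= inertia m q - hopf m q b1 by rewrite subr_ge0.
have N2 : 0 <= inertia m q + hopf m q b1 by move: h1; clear -hm hh m12; lra.
apply: le_trans (lerD (ler_wpM2l N1 r1) (ler_wpM2l N2 r2)).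
by apply: le_of_eq; ring.
Qed.

(** If [w2] first vanishes at [ts], follow [x] until the last passage [s0] at a small level [d]
    before [ts], then keep [w2] at [d] up to the dilation factor. Gain and losses are all of order
    [d^2]: the loss [C1 d^2] times the action, the gain [lam d^2 / 4], and the error [lam^2 d^2 K]
    times an increment of [g]. *)
Lemma lip_min_side q0 a b x : lip_min m h q0 a b x -> 0 < hopf m q0 b2 ->
 forall t, a <= t <= b -> 0 < hopf m (x t) b2.
Proof.
move=> xm q2 t1 /andP[at1 t1b]; rewrite ltNge; apply/negP => wt1.
have xL := lm_lip xm; have ab := ltW (lm_lt xm); have xfin := lm_fin xm.
have wL i : lipon a b (fun t => hopf m (x t) i) by exact: lipon_hopf.
have wa : 0 < hopf m (x a) b2 by rewrite -(same_conf_hopf hm (lm_start xm)).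
have [ts /andP[ats tst1] [wts wbefore]] := first_time at1 (lipon_sub (lexx a) t1b (wL b2)) wa wt1.
have tsb : ts <= b := le_trans tst1 t1b.
have N0 : 0 < inertia m q0.
 rewrite (inertia_norm3 hm) sqrtr_gt0; have : 0 < hopf m q0 b2 ^+ 2 by rewrite exprn_gt0.
 have := sqr_ge0 (hopf m q0 b1); have := sqr_ge0 (hopf m q0 b3); clear -hm hh m12; lra.
have [n0 n00 Hn0] := lipon_pos_min ab (lipon_inertia hm xL) (lip_min_no_triple hm hh xm N0).
have [M M0 HM] := inertia_bounded hm xL.
have tsab : a <= ts <= b by rewrite (ltW ats).
have [z [zL zx z2 zU zA]] := fold_after xm tsab wts.
have p1 := mu1_gt0 hm; have p2 := mu2_gt0 hm; have k0 := kappa_gt0 hm.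
have mm0 : 0 < 2 * minr (2 * mu2 m)^-1 (8 * mu1 m)^-1.
 apply: mulr_gt0 => //; rewrite lt_min !invr_gt0.
 by rewrite (mulr_gt0 (ltr0Sn R 1) p2) (mulr_gt0 (ltr0Sn R 7) p1).
have [a0 a00 Ha0] : exists2 a0, 0 < a0 & forall t, a <= t <= b -> a0 <= spread m (z t).
 exists (2 * minr (2 * mu2 m)^-1 (8 * mu1 m)^-1 * n0).
 exact: mulr_gt0 mm0 n00.
 move=> t tab; apply: le_trans (spread_ge_inertia _); rewrite ler_wpM2l//.
 exact: ltW.
 by have [_ ->] := zU _ tab; exact: Hn0.
have [k kp Hk] := rate_ge_root4 hm hh xm.
pose C := (kappa m ^+ 2 * a0 ^+ 2)^-1.
have C0 : 0 < C by rewrite invr_gt0 mulr_gt0 ?exprn_gt0.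
pose C1 := 3 * C + (4 * C * (M + 1)) ^+ 2.
have C10 : 0 <= C1 := addr_ge0 (mulr_ge0 (ler0n _ 3) (ltW C0)) (sqr_ge0 _).
pose al t := fine (JM m h t b x); pose g t := root4 (al t).
have fin s t : a <= s -> s <= t -> t <= b -> JM m h s t x \is a fin_num.
 by move=> *; exact: (action_fin hm xL xfin).
have al0 t : 0 <= al t by rewrite fine_ge0 ?action_ge0.
have alD s t : a <= s -> s <= t -> t <= b -> al s = fine (JM m h s t x) + al t.
 move=> as_ st tb; rewrite /al (action_cat h hm st tb (lipc_sub as_ (lexx b) xL)).
 exact: fineD (fin _ _ as_ st tb) (fin _ _ (le_trans as_ st) tb (lexx b)).
have alm s t : a <= s -> s <= t -> t <= b -> al t <= al s.
 by move=> as_ st tb; rewrite (alD _ _ as_ st tb) lerDr fine_ge0 ?action_ge0.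
(* [lam / 4] then exceeds the relative loss [C1 * al a] by at least 2, which leaves room for the
   error term, below 1. *)
pose lam := 8 * (C1 * al a + 1).
have CA : 0 <= C1 * al a := mulr_ge0 C10 (al0 a).
have lam0 : 0 < lam by rewrite mulr_gt0// ltr_wpDl.
pose K := 8 * M / k; have K0 : 0 < K by rewrite divr_gt0// mulr_gt0.
(* Bounds the increment of [g] so that the error term stays below 1. By subadditivity of the fourth
   root an arc of action less than [ga^4] suffices. *)
pose ga := (lam ^+ 2 * K)^-1; have ga0 : 0 < ga by rewrite invr_gt0 mulr_gt0// exprn_gt0.
have ga4 : 0 < ga ^+ 4 by rewrite exprn_gt0.
have [e1 e10 He1] := action_small hm (lm_lt xm) xL xfin ga4.
(* Up to [te] the coordinate [w2] is at least [om], so a level [d < om] is last met after [te], on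
   an arc of small action. *)
pose te := maxr a (ts - e1 / 2).
have ate : a <= te by rewrite le_max lexx.
have tets : te < ts by rewrite gt_max ats; move: e10; clear -hm hh m12; lra.
have teb : te <= b := le_trans (ltW tets) tsb.
have [om om0 Hom] : exists2 om, 0 < om & forall t, a <= t <= te -> om <= hopf m (x t) b2.
 apply: (lipon_pos_min ate (lipon_sub (lexx a) teb (wL b2))) => t /andP[at_ tte].
 by apply: wbefore; rewrite at_ (le_lt_trans tte).
pose d := minr (minr (om / 2) 1) (minr (kappa m * a0) (C + 1)^-1).
have C1p : 0 < C + 1 by rewrite ltr_wpDl// ltW.
have d0 : 0 < d by rewrite !lt_min ltr01 invr_gt0 C1p (mulr_gt0 k0 a00) divr_gt0.
have d1 : d <= 1 by rewrite !ge_min lexx !orbT.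
have dom : d <= om / 2 by rewrite !ge_min lexx.
have dk : d <= kappa m * a0 by rewrite !ge_min lexx !orbT.
have Cd : C * d ^+ 2 <= 1.
 have dC : d * (C + 1) <= 1 by rewrite -ler_pdivlMr// div1r !ge_min lexx !orbT.
 have : C * d ^+ 2 <= C * d by rewrite ler_pM2l// expr2 ler_piMl// ltW.
 by move: dC d0; rewrite mulrDr [d * C]mulrC; clear -hm hh m12; lra.
have [|||s0 /andP[as0 s0ts] [ws0 wafter]] := @last_time _ a ts (fun t => d - hopf m (x t) b2) (ltW ats).
- by apply: liponB; [exact: lipon_cst|exact: lipon_sub (lexx a) tsb (wL b2)].
- have := Hom a; rewrite lexx ate => /(_ isT); move: dom om0; clear -hm hh m12; lra.
- by rewrite wts subr0.
have {}ws0 : hopf m (x s0) b2 = d by move: ws0; clear -hm hh m12; lra.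
have s0te : te < s0.
 rewrite ltNge; apply/negP => s0te; have := Hom s0; rewrite as0 s0te ws0 => /(_ isT).
 by move: dom om0; clear -hm hh m12; lra.
have s0b : s0 <= b := le_trans (ltW s0ts) tsb.
have wd t : s0 <= t <= b -> 0 <= hopf m (z t) b2 <= d.
 move=> /andP[s0t tb]; have [tts|tst] := leP t ts; last by rewrite z2 ?(ltW tst)// lexx ltW.
 rewrite zx//; apply/andP; split.
 move: tts; rewrite le_eqVlt => /predU1P[->|tts]; first by rewrite wts.
 by apply/ltW/wbefore; rewrite tts (le_trans as0).
 move: s0t; rewrite le_eqVlt => /predU1P[<-|s0t]; first by rewrite ws0.
 by have := wafter t; rewrite s0t tts => /(_ isT); rewrite subr_gt0 => /ltW.
have wLs := lipon_sub as0 tsb (wL b2).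
have half f u : s0 <= u -> u <= ts -> 0 < f -> f < hopf m (x u) b2 ->
 exists2 r, u < r < ts & hopf m (x r) b2 = f.
 move=> s0u uts f0 fu; have [|||r /andP[ur rts] [wr _]] := @first_time _ u ts (fun t => hopf m (x t) b2 - f) uts.
 - by apply: liponB; [exact: lipon_sub s0u (lexx ts) wLs|exact: lipon_cst].
 - by rewrite subr_gt0.
 - by rewrite wts sub0r oppr_le0 ltW.
 have {}wr : hopf m (x r) b2 = f by move: wr; clear -hm hh m12; lra.
 exists r => //; rewrite ur lt_neqAle rts andbT; apply/eqP => rE.
 by move: wr f0; rewrite rE wts => <-; rewrite ltxx.
have d20 : 0 < d / 2 by rewrite divr_gt0.
have d2d : d / 2 < hopf m (x s0) b2 by rewrite ws0; move: d0; clear -hm hh m12; lra.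
(* The gain is collected only down to the level [d / 2], at [t']. The time [ts] might be the
   endpoint, where the remaining action vanishes; at [t'] it is positive, because [w2] still has to
   pass from [d / 2] to [d / 4]. *)
have [t' /andP[s0t' t'ts] wt'] := half _ _ (lexx s0) (ltW s0ts) d20 d2d.
have d40 : 0 < d / 4 by rewrite divr_gt0.
have d4d : d / 4 < hopf m (x t') b2 by rewrite wt'; move: d0; clear -hm hh m12; lra.
have [r /andP[t'r rts] wr] := half _ _ (ltW s0t') (ltW t'ts) d40 d4d.
have t'b : t' <= b := le_trans (ltW t'ts) tsb.
have at' : a <= t' := le_trans as0 (ltW s0t').
have gt' : 0 < g t'.
 apply: root4_gt0; apply: (@lt_le_trans _ _ (fine (JM m h t' r x))).
 rewrite fine_gt0//; apply/andP; split; last first.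
 by have := fin t' r at' (ltW t'r) (ltW (lt_le_trans rts tsb)); rewrite ge0_fin_numE ?action_ge0.
 apply: (action_gt0 hm hh (i := b2) (ltW t'r)).
 - exact: lipc_sub at' (ltW (lt_le_trans rts tsb)) xL.
 - move=> u /andP[t'u ur]; apply: (lm_before xm).
 by rewrite (le_trans at')// (le_lt_trans ur)// (lt_le_trans rts).
 - by rewrite wt' wr -subr_eq0 (_ : d / 2 - d / 4 = d / 4) ?gt_eqF//; field.
 by rewrite (alD t' r)// ?lerDl// ?(ltW t'r)// ltW// (lt_le_trans rts).
pose lm t := shift_factor C d (hopf m (z t) b2).
pose y t := lift2 m (lm t ^+ 2 * hopf m (z t) b1) (lm t ^+ 2 * d) (lm t ^+ 2 * hopf m (z t) b3).
have zLs := lipc_sub as0 (lexx b) zL.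
have zw i : lipon s0 b (fun t => hopf m (z t) i) by exact: lipon_hopf.
have lmL : lipon s0 b (fun t => lm t ^+ 2).
 have H : lipon s0 b lm.
 apply: liponD; first exact: lipon_cst.
 by apply: liponZ; apply: liponB; [exact: lipon_cst|exact: zw].
 by apply: (@lipon_ext _ _ _ (fun t => lm t * lm t)) => [t _|]; [rewrite expr2|exact: liponM].
have lm1 t : s0 <= t <= b -> 1 <= lm t.
 move=> /wd/andP[_ wtd]; rewrite /lm /shift_factor lerDl mulr_ge0 ?subr_ge0//.
 exact: mulr_ge0 (ltW C0) (ltW d0).
have f1L : lipon s0 b (fun t => lm t ^+ 2 * hopf m (z t) b1) by exact: liponM.
have f2L : lipon s0 b (fun t => lm t ^+ 2 * d) by apply: liponM => //; exact: lipon_cst.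
have f3L : lipon s0 b (fun t => lm t ^+ 2 * hopf m (z t) b3) by exact: liponM.
have [e3 e30 He3] : exists2 e, 0 < e & forall t, s0 <= t <= b -> e <=
 norm3 (lm t ^+ 2 * hopf m (z t) b1) (lm t ^+ 2 * d) (lm t ^+ 2 * hopf m (z t) b3) -
 lm t ^+ 2 * hopf m (z t) b1.
 apply: (lipon_pos_min s0b); first by apply: liponB => //; exact: lipon_norm3.
 move=> t /lm1 l1; set n := norm3 _ _ _; have n1 : 0 < n + 1 by rewrite ltr_wpDl ?norm3_ge0.
 apply: (@lt_le_trans _ _ (d ^+ 2 / (2 * (n + 1)))).
 by rewrite divr_gt0 ?exprn_gt0// mulr_gt0.
 apply: norm3_sub_ge; rewrite -/n ?lerDl//.
 apply: (@le_trans _ _ ((lm t ^+ 2 * d) ^+ 2)); last by rewrite lerDl sqr_ge0.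
 apply: lerXn2r; rewrite ?nnegrE ?(ltW d0)//; first exact: mulr_ge0 (sqr_ge0 _) (ltW d0).
 by rewrite ler_peMl ?(ltW d0)// exprn_ege1.
have yL : lipc s0 b y := lipschitz_lift2 hm e30 f1L f2L f3L He3.
have yh t : s0 <= t <= b -> [/\ hopf m (y t) b1 = lm t ^+ 2 * hopf m (z t) b1,
 hopf m (y t) b2 = lm t ^+ 2 * d & hopf m (y t) b3 = lm t ^+ 2 * hopf m (z t) b3].
 by move=> ht; apply: (hopf_lift2 hm); exact: lt_le_trans e30 (He3 _ ht).
have sab t : s0 <= t <= b -> a <= t <= b.
 by move=> /andP[s0t tb]; rewrite (le_trans as0 s0t).
have Uyz t : s0 <= t <= b -> (U m (y t) <= U m (z t))%E /\ inertia m (z t) <= inertia m (y t).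
 move=> ht; have [h1 h2 h3] := yh _ ht.
 by apply: (U_shift hm m12 a00 (Ha0 _ (sab _ ht)) d0 dk (wd _ ht) h1 h2); rewrite h3.
pose F := 1 + C1 * d ^+ 2.
have F0 : 0 <= F by rewrite addr_ge0// mulr_ge0 ?sqr_ge0.
have dyz u v : s0 <= u <= b -> s0 <= v <= b ->
 let S := hopfD m (z v) (z u) in
 hopfD m (y v) (y u) <=
 F * S - (hopf m (z u) b2 - hopf m (z v) b2) ^+ 2 / (4 * S).
 move=> hu hv; cbv zeta; rewrite !enorm3E; have [-> -> ->] := yh _ hu; have [-> -> ->] := yh _ hv.
 have n1 : norm3 (hopf m (z u) b1) (hopf m (z u) b2) (hopf m (z u) b3) <= M.
 by rewrite -(inertia_norm3 hm); have [_ ->] := zU _ (sab _ hu); exact: HM (sab _ hu).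
 have dd : 0 < d <= 1 by rewrite d0.
 exact: (shift_step (hopf m (z v) b1) (hopf m (z v) b3) C0 dd Cd (wd _ hu) (wd _ hv) (ltW M0) n1).
have ye : (U m (y b) <= h%:E)%E.
 have hb : s0 <= b <= b by rewrite s0b lexx.
 have [h1 _] := Uyz _ hb; have [h2 _] := zU _ (sab _ hb).
 by rewrite -(lm_end xm) (le_trans h1).
have ys : same_conf (x s0) (y s0).
 have hs : s0 <= s0 <= b by rewrite lexx.
 have l1 : lm s0 = 1 by rewrite /lm /shift_factor (zx _ (ltW s0ts)) ws0 subrr mulr0 addr0.
 apply: (hopf_inj hm); apply/funext => i; have [h1 h2 h3] := yh _ hs.
 move: h1 h2 h3; rewrite l1 expr1n !mul1r (zx _ (ltW s0ts)) => h1 h2 h3.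
 by case: (ord3_cases i) => ->; rewrite ?h1 ?h2 ?h3.
have s0ab : a <= s0 <= b by rewrite as0.
have min := lip_min_tail hm xm s0ab s0b yL ys ye.
have yL1 := lipc_sub (lexx s0) t'b yL; have yL2 := lipc_sub (ltW s0t') (lexx b) yL.
have part1 : (JM m h s0 t' y <= (F * fine (JM m h s0 t' x) -
 (d * lam) / 2 * (hopf m (x s0) b2 - hopf m (x t') b2) + (d * lam) ^+ 2 * K * (g s0 - g t'))%:E)%E.
 apply: (action_le_gain xm as0 s0t' t'b yL1 F0 kp M0 _ gt').
 - exact: mulr_ge0 (ltW d0) (ltW lam0).
 - move=> u /andP[su ut']; have uts := le_trans ut' (ltW t'ts).
 have hu : s0 <= u <= b by rewrite su (le_trans uts).
 have [h1 h2] := Uyz _ hu; rewrite zx// in h1 h2; split => //; first exact: HM (sab _ hu).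
 exact: Hk (sab _ hu).
 - move=> u v su uv vt'; have uts := le_trans uv (le_trans vt' (ltW t'ts)).
 have vts := le_trans vt' (ltW t'ts).
 have hu : s0 <= u <= b by rewrite su (le_trans uts).
 have hv : s0 <= v <= b by rewrite (le_trans su uv) (le_trans vts).
 by have := dyz u v hu hv; rewrite (zx _ uts) (zx _ vts).
have zact : (JM m h t' b z <= JM m h t' b x)%E.
 have zt := lipc_sub at' (lexx b) zL; have xt := lipc_sub at' (lexx b) xL.
 rewrite (action_cat h hm (ltW t'ts) tsb zt) (action_cat h hm (ltW t'ts) tsb xt).
 apply: (leeD _ zA); apply: le_of_eq.
 apply: (action_same_conf h hm (ltW t'ts)).
 - exact: lipc_sub (lexx t') tsb zt.
 - exact: lipc_sub (lexx t') tsb xt.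
 - by move=> u /andP[_ uts]; rewrite zx//; exact: same_conf_refl.
have zfin : (JM m h t' b z < +oo)%E.
 by apply: le_lt_trans zact _; have := fin t' b at' t'b (lexx b); rewrite ge0_fin_numE ?action_ge0.
have part2 : (JM m h t' b y <= F%:E * JM m h t' b x)%E.
 apply: le_trans (lee_wpmul2l _ zact); last by rewrite lee_fin.
 have sub u : t' <= u <= b -> s0 <= u <= b by move=> /andP[t'u ->]; rewrite (le_trans (ltW s0t')).
 apply: (action_le_factor hm t'b (lipc_sub at' (lexx b) zL) yL2 zfin F0).
 by move=> u /sub; exact: Uyz.
 move=> u v t'u uv vb.
 have hu : s0 <= u <= b by apply: sub; rewrite t'u (le_trans uv).
 have hv : s0 <= v <= b by apply: sub; rewrite vb (le_trans t'u).
 by apply: (le_trans (dyz _ _ hu hv)); rewrite gerBl divr_ge0 ?sqr_ge0// mulr_ge0// enorm_ge0.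
move: min; rewrite (action_cat h hm (ltW s0t') t'b yL) => min.
have := le_trans min (leeD part1 part2).
rewrite -(fineK (fin s0 b as0 s0b (lexx b))) -(fineK (fin t' b at' t'b (lexx b))) -EFinM -EFinD lee_fin.
rewrite -/(al s0) -/(al t') (alD s0 t' as0 (ltW s0t') t'b) ws0 wt'.
have als0 : al s0 <= al a := alm _ _ (lexx a) as0 s0b.
rewrite (alD s0 t' as0 (ltW s0t') t'b) in als0.
have gd : g s0 - g t' < ga.
 have as0ts : (JM m h s0 ts x < (ga ^+ 4)%:E)%E.
 apply: He1 => //; first exact: ltW.
 have : ts - e1 / 2 <= te by rewrite le_max lexx orbT.
 by move: s0te e10; clear -hm hh m12; lra.
 have gtst' : g ts <= g t' by apply: ler_root4; exact: alm at' (ltW t'ts) tsb.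
 have : g s0 <= root4 (fine (JM m h s0 ts x)) + g ts.
 rewrite /g (alD s0 ts as0 (ltW s0ts) tsb); apply: root4D => //.
 by rewrite fine_ge0 ?action_ge0.
 have : root4 (fine (JM m h s0 ts x)) < ga.
 rewrite ltNge; apply/negP => H; move: as0ts.
 have f1 := fin s0 ts as0 (ltW s0ts) tsb.
 rewrite -(fineK f1) lte_fin -(root4K (fine_ge0 (action_ge0 _ _ _ _ _))) ltNge => /negP; apply.
 by rewrite lerXn2r ?nnegrE ?root4_ge0 ?(ltW ga0).
 by move: gtst'; clear -hm hh m12; lra.
move: als0 gd; rewrite -/(g s0) -/(g t'); move: (fine _) (al t') (g s0 - g t') => A B G AB Gg.
have gaE : lam ^+ 2 * K * ga = 1 by rewrite mulfV// gt_eqF// mulr_gt0// exprn_gt0.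
have lG : lam ^+ 2 * K * G < 1.
 by rewrite -gaE ltr_pM2l// mulr_gt0// exprn_gt0.
have CAB : C1 * (A + B) <= C1 * al a by rewrite ler_wpM2l.
have d2 : 0 < d ^+ 2 by rewrite exprn_gt0.
have -> : F * A - d * lam / 2 * (d - d / 2) + (d * lam) ^+ 2 * K * G + F * B =
 (A + B) + d ^+ 2 * (C1 * (A + B) - lam / 4 + lam ^+ 2 * K * G) by rewrite /F; field.
rewrite lerDl pmulr_rge0//; move: CAB lG CA; rewrite /lam; clear -hm hh m12; lra.
Qed.
End Side.

(** * Invariance under relabelling of equal masses *)

Section Relabelling.
Variables (R : realType) (m : 'I_3 -> R) (h : R).
Hypothesis hm : posm m.
Implicit Types (q : conf R) (x : R -> conf R) (s : {perm 'I_3}).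

(** [pair_re] and [pair_im] are the real and imaginary parts of the sum of
    [m_i m_j (q_i - q_j) conj (q'_i - q'_j)]. Unlike Jacobi coordinates, this Hermitian product is
    visibly invariant under relabelling. *)
Definition pair_re q q' : R := \sum_i \sum_j m i * m j *
 ((Re (q i) - Re (q j)) * (Re (q' i) - Re (q' j)) +
 (Im (q i) - Im (q j)) * (Im (q' i) - Im (q' j))).

Definition pair_im q q' : R := \sum_i \sum_j m i * m j *
 ((Im (q i) - Im (q j)) * (Re (q' i) - Re (q' j)) -
 (Re (q i) - Re (q j)) * (Im (q' i) - Im (q' j))).

Let M := m b1 + m b2 + m b3.
Let M0 : 0 < M. Proof. by rewrite !addr_gt0. Qed.
Let M120 : 0 < m b1 + m b2. Proof. by rewrite addr_gt0. Qed.

Let pair_reE q q' : pair_re q q' = 2 * M *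
 (mu1 m * (X1 q * X1 q' + Y1 q * Y1 q') + mu2 m * (X2 m q * X2 m q' + Y2 m q * Y2 m q')).
Proof.
rewrite /pair_re !big_ord3 /mu1 /mu2 !X1E !Y1E !X2E !Y2E /M.
have := M0; have := M120; rewrite /M; move: (m b1) (m b2) (m b3) => c1 c2 c3 c12 c0.
by field; rewrite !gt_eqF.
Qed.

Let pair_imE q q' : pair_im q q' = 2 * M *
 (mu1 m * (Y1 q * X1 q' - X1 q * Y1 q') + mu2 m * (Y2 m q * X2 m q' - X2 m q * Y2 m q')).
Proof.
rewrite /pair_im !big_ord3 /mu1 /mu2 !X1E !Y1E !X2E !Y2E /M.
have := M0; have := M120; rewrite /M; move: (m b1) (m b2) (m b3) => c1 c2 c3 c12 c0.
by field; rewrite !gt_eqF.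
Qed.

Lemma inertia_pair q : inertia m q = pair_re q q / (2 * M).
Proof. by rewrite pair_reE /inertia -!expr2; field; rewrite gt_eqF. Qed.
(** The Hopf map in invariant form: [|w' - w|^2 = (|w| + |w'|)^2 - 4 |<xi, xi'>|^2], where the
    mass-weighted product [<xi, xi'>] is the pair sum divided by twice the total mass. *)
Lemma sqr_enorm_hopf q q' : enorm (fun i => hopf m q' i - hopf m q i) ^+ 2 =
 (inertia m q + inertia m q') ^+ 2 - (pair_re q q' ^+ 2 + pair_im q q' ^+ 2) / M ^+ 2.
Proof.
rewrite sqr_enorm big_ord3 pair_reE pair_imE /hopf /inertia /=.
have k2 := sqr_kappa hm.
have e u v w z u' v' w' z' : kappa m ^+ 2 * (u * v + w * z - (u' * v' + w' * z')) ^+ 2 =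
 mu1 m * mu2 m * (u * v + w * z - (u' * v' + w' * z')) ^+ 2 by rewrite k2.
have -> : (- (2 * kappa m * (X1 q' * X2 m q' + Y1 q' * Y2 m q')) -
 - (2 * kappa m * (X1 q * X2 m q + Y1 q * Y2 m q))) ^+ 2 =
 4 * (kappa m ^+ 2 * (X1 q' * X2 m q' + Y1 q' * Y2 m q' - (X1 q * X2 m q + Y1 q * Y2 m q)) ^+ 2) by ring.
have -> : (2 * kappa m * (Y1 q' * X2 m q' - X1 q' * Y2 m q') -
 2 * kappa m * (Y1 q * X2 m q - X1 q * Y2 m q)) ^+ 2 =
 4 * (kappa m ^+ 2 * (Y1 q' * X2 m q' - X1 q' * Y2 m q' - (Y1 q * X2 m q - X1 q * Y2 m q)) ^+ 2) by ring.
rewrite k2; move: (mu1 m) (mu2 m) M M0 => c1 c2 c c0.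
by field; rewrite gt_eqF.
Qed.

Section Action.
Variable s : {perm 'I_3}.
Hypothesis ms : forall i, m (s i) = m i.

Lemma U_perm q : U m (q \o s) = U m q.
Proof.
pose t i j := ((m i * m j)%:E / (rdist q i j)%:E)%E.
have tC i j : t i j = t j i by rewrite /t rdistC mulrC.
suff H : (t (s b1) (s b2) + t (s b1) (s b3) + t (s b2) (s b3) = t b1 b2 + t b1 b3 + t b2 b3)%E.
 by rewrite [RHS]potentialE -/(t b1 b2) -/(t b1 b3) -/(t b2 b3) -H potentialE /t !ms.
have i12 : s b1 != s b2 by rewrite (inj_eq perm_inj).
have i13 : s b1 != s b3 by rewrite (inj_eq perm_inj).
have i23 : s b2 != s b3 by rewrite (inj_eq perm_inj).
case: (ord3_cases (s b1)) => e1; case: (ord3_cases (s b2)) => e2; case: (ord3_cases (s b3)) => e3;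
 move: i12 i13 i23; rewrite e1 e2 e3 ?eqxx//= => _ _ _.
- by rewrite (tC b3 b2) (addeC (t b1 b3)).
- by rewrite (tC b2 b1) -!addeA (addeC (t b1 b3)).
- by rewrite (tC b2 b1) (tC b3 b1) -addeA addeC.
- by rewrite (tC b3 b1) (tC b3 b2) addeC addeA.
- by rewrite (tC b3 b2) (tC b3 b1) (tC b2 b1) addeC addeA addeAC.
Qed.

Lemma pair_re_perm q q' : pair_re (q \o s) (q' \o s) = pair_re q q'.
Proof.
rewrite /pair_re [RHS](reindex_inj (@perm_inj _ s)); apply: eq_bigr => i _.
by rewrite [RHS](reindex_inj (@perm_inj _ s)); apply: eq_bigr => j _; rewrite !ms.
Qed.

Lemma pair_im_perm q q' : pair_im (q \o s) (q' \o s) = pair_im q q'.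
Proof.
rewrite /pair_im [RHS](reindex_inj (@perm_inj _ s)); apply: eq_bigr => i _.
by rewrite [RHS](reindex_inj (@perm_inj _ s)); apply: eq_bigr => j _; rewrite !ms.
Qed.

Lemma inertia_perm q : inertia m (q \o s) = inertia m q.
Proof. by rewrite !inertia_pair pair_re_perm. Qed.
Lemma enorm_hopf_perm q q' : hopfD m (q' \o s) (q \o s) =
 enorm (fun i => hopf m q' i - hopf m q i).
Proof.
apply/eqP; rewrite -(@eqrXn2 _ 2) ?enorm_ge0//; apply/eqP.
by rewrite !sqr_enorm_hopf !inertia_perm pair_re_perm pair_im_perm.
Qed.

Lemma same_conf_perm q q' : same_conf q q' -> same_conf (q \o s) (q' \o s).
Proof. by move=> [u [c [u1 H]]]; exists u, c; split=> // i; exact: H. Qed.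
Lemma lipschitz_perm a b x : lipc a b x -> lipc a b (fun t => x t \o s).
Proof. by move=> xL i; exact: xL (s i). Qed.
Lemma action_perm_le a b x : a <= b -> lipc a b x ->
 (JM m h a b (fun t => x t \o s) <= JM m h a b x)%E.
Proof.
move=> ab xL; have [xfin|] := ltP (JM m h a b x) +oo%E; last exact: le_trans (leey _).
have yL := lipschitz_perm xL.
have := @action_le_factor _ m h hm a b 1 x (fun t => x t \o s) ab xL yL xfin ler01.
rewrite mul1e; apply; first by move=> u _; rewrite U_perm inertia_perm.
by move=> u v _ _ _; rewrite mul1r enorm_hopf_perm.
Qed.
End Action.

Lemma perm_invK q s : (q \o s) \o (s^-1)%g = q.
Proof. by apply/funext => i; rewrite /= permKV. Qed.
Lemma perm_mass_inv s : (forall i, m (s i) = m i) -> forall i, m ((s^-1)%g i) = m i.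
Proof. by move=> ms i; rewrite -[RHS](congr1 m (permKV s i)) ms. Qed.
Lemma action_perm s a b x : (forall i, m (s i) = m i) -> a <= b -> lipc a b x ->
 JM m h a b (fun t => x t \o s) = JM m h a b x.
Proof.
move=> ms ab xL; apply/eqP; rewrite eq_le; apply/andP; split; first exact: (action_perm_le ms ab xL).
have H := action_perm_le (perm_mass_inv ms) ab (lipschitz_perm s xL).
have E : (fun t => (x t \o s) \o (s^-1)%g) = x by apply/funext => t; exact: perm_invK.
by rewrite E in H.
Qed.

Lemma lip_min_perm s q0 a b x : (forall i, m (s i) = m i) -> lip_min m h q0 a b x ->
 lip_min m h (q0 \o s) a b (fun t => x t \o s).
Proof.
move=> ms [ab xL xq xb xe xf xm]; split; [exact: ab|exact: (lipschitz_perm s xL)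
 |exact: (same_conf_perm s xq)| | | |].
- by move=> t /xb; rewrite (U_perm ms).
- by rewrite (U_perm ms).
- by rewrite (action_perm ms (ltW ab) xL).
- move=> c d y cd yL yq Uy; rewrite (action_perm ms (ltW ab) xL).
 rewrite -(action_perm (perm_mass_inv ms) cd yL); apply: xm; [exact: cd|exact: (lipschitz_perm _ yL)| |].
 + by have := same_conf_perm (s^-1)%g yq; rewrite perm_invK.
 + by rewrite (U_perm (perm_mass_inv ms)).
Qed.

Hypothesis hh : 0 < h.

(** The relabelled lift is a lifted minimizer from the relabelled starting point, so one comparison
    of [r13] with [r23] serves for every pair of sides. *)
Lemma side_preserved s q0 t0 t1 g : (forall i, m (s i) = m i) -> m b1 = m b2 ->
 JM_minimizer m h q0 t0 t1 g ->
 rdist q0 (s b1) (s b3) < rdist q0 (s b2) (s b3) ->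
 forall t, t \in `[t0, t1] -> rdist (g t) (s b1) (s b3) < rdist (g t) (s b2) (s b3).
Proof.
move=> ms m12 gm; have [a [b [x [xm [phi [cphi mphi p0 p1 pg]]]]]] := minimizer_lift hm hh gm.
rewrite -[_ < _]/(rdist (q0 \o s) b1 b3 < rdist (q0 \o s) b2 b3) (skew_gt0 hm m12) => w0 t tt.
have H := lip_min_side hm hh m12 (lip_min_perm ms xm) w0.
rewrite !(same_conf_rdist _ _ (pg t tt)).
rewrite -[_ < _]/(rdist (x (phi t) \o s) b1 b3 < rdist (x (phi t) \o s) b2 b3) (skew_gt0 hm m12).
have [t0t tt1] : t0 <= t /\ t <= t1 by move: tt; rewrite in_itv/= => /andP.
have t01 := le_trans t0t tt1.
by apply: H; rewrite -p0 -p1 !mphi// in_itv/= ?lexx ?t01.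
Qed.
End Relabelling.

(** * Isosceles minimizers in a fixed frame: width and depth are monotone *)

Section PlanarIsosceles.
Variables (R : realType) (m : 'I_3 -> R) (h : R).
Hypotheses (hm : posm m) (hh : 0 < h).
Hypothesis m12 : m b1 = m b2.
Implicit Types (q : conf R) (x : R -> conf R) (u v w : R).

Definition upright u w : conf R := of_xi m 0 u w 0.

Definition upright_U u w : R :=
 m b1 * m b2 / u + 2 * (m b1 * m b3) / sqrt (w ^+ 2 + u ^+ 2 / 4).

Lemma uprightE u w : [/\ X1 (upright u w) = 0, Y1 (upright u w) = u,
 X2 m (upright u w) = w & Y2 m (upright u w) = 0].
Proof. exact: of_xiE. Qed.
Lemma hopf_upright u w : [/\ hopf m (upright u w) b1 = mu1 m * u ^+ 2 - mu2 m * w ^+ 2,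
 hopf m (upright u w) b2 = 0 & hopf m (upright u w) b3 = 2 * kappa m * (u * w)].
Proof. by rewrite /hopf /=; have [-> -> -> ->] := uprightE u w; split; ring. Qed.
Lemma rdist12_upright u w : 0 <= u -> rdist (upright u w) b1 b2 = u.
Proof.
move=> u0; rewrite rdist12; have [-> -> _ _] := uprightE u w.
by rewrite expr0n add0r sqrtr_sqr ger0_norm.
Qed.

Lemma U_upright u w : 0 < u -> U m (upright u w) = (upright_U u w)%:E.
Proof.
move=> u0; have [e1 e2 e3 e4] := uprightE u w.
have sp : spread m (upright u w) = w ^+ 2 + u ^+ 2 / 4 by rewrite /spread e1 e2 e3 e4; ring.
have sk : skew m (upright u w) = 0 by rewrite /skew e1 e2 e3 e4; ring.
have S0 : 0 < w ^+ 2 + u ^+ 2 / 4 by rewrite ltr_wpDl ?sqr_ge0// divr_gt0// exprn_gt0.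
rewrite (U_skew hm m12) ?rdist12_upright ?(ltW u0)// ?sk ?sp ?normr0//.
by rewrite invsum0// /upright_U; congr (_%:E); ring.
Qed.

Lemma U_upright0 w : U m (upright 0 w) = +oo%E.
Proof. by apply: (U_collision hm); left; rewrite rdist12_upright. Qed.
Lemma upright_U_anti u u' w w' : 0 < u -> u <= u' -> `|w| <= `|w'| ->
 upright_U u' w' <= upright_U u w.
Proof.
move=> u0 uu ww; have u'0 := lt_le_trans u0 uu.
have S0 : 0 < w ^+ 2 + u ^+ 2 / 4 by rewrite ltr_wpDl ?sqr_ge0// divr_gt0// exprn_gt0.
have SS : w ^+ 2 + u ^+ 2 / 4 <= w' ^+ 2 + u' ^+ 2 / 4.
 rewrite -(real_normK (num_real w)) -(real_normK (num_real w')) lerD//.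
 by rewrite lerXn2r.
 by rewrite ler_wpM2r// lerXn2r// nnegrE ltW.
have m12p : 0 <= m b1 * m b2 := mulr_ge0 (ltW (hm _)) (ltW (hm _)).
have m13p : 0 <= 2 * (m b1 * m b3) := mulr_ge0 (ler0n _ 2) (mulr_ge0 (ltW (hm _)) (ltW (hm _))).
apply: lerD.
 by apply: (ler_wpM2l m12p); rewrite lef_pV2 ?posrE.
apply: (ler_wpM2l m13p); rewrite lef_pV2 ?posrE ?sqrtr_gt0//; first exact: ler_wsqrtr.
exact: lt_le_trans SS.
Qed.

Lemma U_upright_anti u u' w w' : 0 <= u -> u <= u' -> `|w| <= `|w'| ->
 (U m (upright u' w') <= U m (upright u w))%E.
Proof.
rewrite le_eqVlt => /predU1P[<- _ _|u0 uu ww]; first by rewrite U_upright0 leey.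
by rewrite !U_upright ?(lt_le_trans u0)// lee_fin upright_U_anti.
Qed.

Lemma lipschitz_upright s t (f g : R -> R) : lipon s t f -> lipon s t g ->
 lipc s t (fun r => upright (f r) (g r)).
Proof. by move=> fL gL; apply: lipschitz_of_xi => //; exact: lipon_cst. Qed.

Definition i41 : 'I_4 := @Ordinal 4 1 isT.
Definition i42 : 'I_4 := @Ordinal 4 2 isT.

Lemma xivec_upright u w : xivec m (upright u w) =
 fun i => if i == i41 then sqrt (mu1 m) * u else if i == i42 then sqrt (mu2 m) * w else 0.
Proof.
have [e1 e2 e3 e4] := uprightE u w; apply/funext => i; rewrite /xivec e1 e2 e3 e4.
by case: i => [[|[|[|[|//]]]] Hi] /=; rewrite ?mulr0.
Qed.

Lemma le_enorm_upright u1 w1 u2 w2 u1' w1' u2' w2' : `|u2' - u1'| <= `|u2 - u1| ->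
 `|w2' - w1'| <= `|w2 - w1| ->
 xiD m (upright u2' w2') (upright u1' w1') <=
 xiD m (upright u2 w2) (upright u1 w1).
Proof.
move=> hu hw; apply: le_enorm => i; rewrite !xivec_upright.
case: ifP => _; first by rewrite -!mulrBr !normrM ler_wpM2l.
by case: ifP => _; rewrite ?subrr// -!mulrBr !normrM ler_wpM2l.
Qed.

Lemma arc_upright_le_action s t (f g : R -> R) c : s <= t -> lipon s t f -> lipon s t g -> 0 <= c ->
 (forall r, s <= r <= t -> ((c ^+ 2 + h)%:E <= U m (upright (f r) (g r)))%E) ->
 ((c * xiD m (upright (f t) (g t)) (upright (f s) (g s))%R)%:E <=
 JM m h s t (fun r => upright (f r) (g r)))%E.
Proof.
rewrite le_eqVlt => /predU1P[<- _ _ _ _|st fL gL c0 H].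
 rewrite action_point lee_fin.
 have -> : (fun i => xivec m (upright (f s) (g s)) i - xivec m (upright (f s) (g s)) i) = fun=> 0.
 by apply/funext => i; rewrite subrr.
 by rewrite /enorm big1 ?sqrtr0 ?mulr0// => i _; rewrite expr0n.
apply: (action_ge_isosceles hm st (lipschitz_upright fL gL) c0 _ H) => r _.
by have [-> _ _ ->] := uprightE (f r) (g r).
Qed.

(** From [1/u - 1/v = (v^2 - u^2) / (u v (u + v))] with [u] and [v] at most [sqrt C]. *)
Lemma sqrt_gap (A B C d : R) : 0 < A -> 0 < d -> A + d <= B -> B <= C ->
 d / (2 * C * sqrt C) <= (sqrt A)^-1 - (sqrt B)^-1.
Proof.
move=> A0 d0 AB BC; have B0 : 0 < B by move: A0 d0 AB; clear -hm hh m12; lra.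
have C0 := lt_le_trans B0 BC.
have sA : 0 < sqrt A by rewrite sqrtr_gt0.
have sB : 0 < sqrt B by rewrite sqrtr_gt0.
have sC : 0 < sqrt C by rewrite sqrtr_gt0.
have eA := sqr_sqrtr (ltW A0); have eB := sqr_sqrtr (ltW B0); have eC := sqr_sqrtr (ltW C0).
have lBC : sqrt B <= sqrt C := ler_wsqrtr BC.
have lAB : sqrt A <= sqrt B by apply: ler_wsqrtr; move: d0 AB; clear -hm hh m12; lra.
move: AB; rewrite -{1}eA -{1}eB -{1}eC; move: (sqrt A) (sqrt B) (sqrt C) sA sB sC lBC lAB => u v w.
move=> u0 v0 w0 vw uv H.
have -> : u^-1 - v^-1 = (v ^+ 2 - u ^+ 2) / (u * v * (u + v)).
 by field; rewrite !gt_eqF// addr_gt0.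
apply: ler_pM; [exact: ltW| |by move: H; clear -hm hh m12; lra|].
 by rewrite invr_ge0 !mulr_ge0// ltW// exprn_gt0.
rewrite lef_pV2 ?posrE.
- apply: (@le_trans _ _ (w * w * (w + w))); last by apply: le_of_eq; ring.
 apply: ler_pM; [exact: mulr_ge0 (ltW u0) (ltW v0)|exact: addr_ge0 (ltW u0) (ltW v0)| |].
 by apply: ler_pM; [exact: ltW|exact: ltW|exact: le_trans vw|].
 exact: lerD (le_trans uv vw) vw.
- by rewrite mulr_gt0// mulr_gt0// exprn_gt0.
- by rewrite mulr_gt0 ?addr_gt0// mulr_gt0.
Qed.

Section Drop.
Variables (q0 : conf R) (a b : R) (f g : R -> R).
Let x r := upright (f r) (g r).
Hypothesis xm : lip_min m h q0 a b x.
Hypotheses (fL : lipon a b f) (gL : lipon a b g).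

(** The scheme common to the two monotonicity lemmas: a curve [(f', g')] that moves no more than
    [(f, g)] and has no larger potential must gain nothing. A strict gap need only be shown where
    the coordinate has lost at least half of its drop. *)
Lemma drop_contra i s t0 (f' g' : R -> R) : a <= s -> s <= t0 -> t0 <= b ->
 lipon s b f' -> lipon s b g' -> f' s = f s -> g' s = g s ->
 (forall u v, s <= u -> u <= v -> v <= b -> `|f' v - f' u| <= `|f v - f u|) ->
 (forall u v, s <= u -> u <= v -> v <= b -> `|g' v - g' u| <= `|g v - g u|) ->
 (forall r, s <= r <= b -> (U m (upright (f' r) (g' r)) <= U m (x r))%E) ->
 let X r := xivec m (x r) i in
 (forall T1 T2, s <= T1 -> T1 <= T2 -> T2 <= t0 -> X t0 < X s -> X T1 < X s ->
 (forall r, T1 <= r <= T2 -> X r <= X s - (X s - X t0) / 2) ->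
 exists e F, 0 < e /\ forall r, T1 <= r <= T2 ->
 (U m (upright (f' r) (g' r)) <= F%:E)%E /\ (U m (upright (f' r) (g' r)) + e%:E <= U m (x r))%E) ->
 X s <= X t0.
Proof.
move=> as_ st0 t0b fL' gL' fs gs df dg HU X HW; rewrite leNgt; apply/negP => drop.
have sb : s <= b := le_trans st0 t0b.
have xL : lipc s b x := lipc_sub as_ (lexx b) (lm_lip xm).
have XL : lipon s t0 X by apply: lipon_sub (lexx s) t0b (lipon_xivec m xL i).
pose M := X s - X t0; have M0 : 0 < M by rewrite subr_gt0.
pose y r := upright (f' r) (g' r).
have yL : lipc s b y := lipschitz_upright fL' gL'.
(* The arc between one half and three quarters of the drop: the coordinate moves on it, so its
   action is positive. *)
have [|||T2 /andP[sT2 T2t] [XT2 _]] := @first_time _ s t0 (fun r => X r - (X s - 3 / 4 * M)) st0.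
- by apply: liponB => //; exact: lipon_cst.
- by move: M0; clear -hm hh m12 xm fL gL; lra.
- by rewrite /M; move: M0; clear -hm hh m12 xm fL gL; rewrite /M; lra.
have {}XT2 : X T2 = X s - 3 / 4 * M by move: XT2; clear -hm hh m12 xm fL gL; lra.
have [|||T1 /andP[sT1 T1T2] [XT1 XT12]] := @last_time _ s T2 (fun r => X s - M / 2 - X r) (ltW sT2).
- by apply: liponB; [exact: lipon_cst|exact: lipon_sub (lexx s) T2t XL].
- by move: M0; clear -hm hh m12 xm fL gL; lra.
- by rewrite XT2; move: M0; clear -hm hh m12 xm fL gL; lra.
have {}XT1 : X T1 = X s - M / 2 by move: XT1; clear -hm hh m12 xm fL gL; lra.
have T2t0 : T2 < t0.
 rewrite lt_neqAle T2t andbT; apply/eqP => e; move: XT2 M0; rewrite e /M; clear -hm hh m12 xm fL gL; lra.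
have T2b : T2 <= b := le_trans T2t t0b.
have [|r hr|e [F [e0 HeF]]] := HW T1 T2 sT1 (ltW T1T2) T2t drop; first by rewrite XT1; move: M0; clear -hm hh m12 xm fL gL; lra.
 rewrite -/M; have /andP[T1r rT2] := hr; move: T1r; rewrite le_eqVlt => /predU1P[<-|T1r].
 by rewrite XT1.
 by have := XT12 r; rewrite T1r rT2 => /(_ isT); clear -hm hh m12 xm fL gL; lra.
have sub u v : s <= u -> v <= b -> lipon u v f /\ lipon u v g.
 by move=> su vb; split; apply: lipon_sub (le_trans as_ su) vb _.
have HJ2 u v c : s <= u -> u <= v -> v <= b -> 0 <= c ->
 (forall r, u <= r <= v -> ((c ^+ 2 * 1 + h)%:E <= U m (x r))%E) ->
 ((c * xiD m (x v) (x u)%R)%:E <= JM m h u v x)%E.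
 move=> su uv vb c0 H; have [f1 g1] := sub _ _ su vb; apply: arc_upright_le_action => // r hr.
 by have := H r hr; rewrite mulr1.
have HJ3 u v (D : R -> R) : s <= u -> u < v -> v <= b ->
 (forall p r, u <= p -> p <= r -> r <= v -> D p <= D r) ->
 (forall p r c, u <= p -> p <= r -> r <= v -> 0 < c ->
 (forall w, p <= w <= r -> ((c ^+ 2 * 1 + h)%:E <= U m (y w))%E) ->
 c * xiD m (y r) (y p) <= D r - D p) ->
 (JM m h u v y <= (D v - D u)%:E)%E.
 move=> su uv vb mD HD; apply: (action_le_xi hm uv (lipc_sub su vb yL) mD).
 move=> p r c up pr rv c0 H; apply: HD => // w hw.
 by have := H w hw; rewrite mulr1.
have xfin : (JM m h s b x < +oo)%E.
 exact: le_lt_trans (action_mono h hm as_ sb (lexx b) (lm_lip xm)) (lm_fin xm).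
have A0 : (0 < JM m h T1 T2 x)%E.
 have [|c2 c20 Hc] := min_rate hm hh (ltW T1T2) (lipc_sub sT1 T2b xL).
 move=> r /andP[T1r rT2]; apply: (lm_before xm); rewrite (le_trans as_ (le_trans sT1 T1r))/=.
 by rewrite (le_lt_trans rT2)// (lt_le_trans T2t0).
 have sq : sqrt c2 ^+ 2 = c2 := sqr_sqrtr (ltW c20).
 apply: (@lt_le_trans _ _ (sqrt c2 *
 xiD m (x T2) (x T1))%:E); last first.
 apply: (HJ2 _ _ _ sT1 (ltW T1T2) T2b (sqrtr_ge0 _)) => r hr; rewrite mulr1 sq; exact: Hc.
 rewrite lte_fin; apply: mulr_gt0; first by rewrite sqrtr_gt0.
 have := enorm_ge (fun i => xivec m (x T2) i - xivec m (x T1) i) i; apply: lt_le_trans.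
 rewrite normr_gt0 subr_eq0 -/(X T2) -/(X T1) XT1 XT2; apply/eqP.
 by move: M0; clear -hm hh m12 xm fL gL; lra.
have ye : (U m (y b) <= h%:E)%E by rewrite -(lm_end xm); apply: HU; rewrite sb lexx.
have ys : same_conf (x s) (y s) by rewrite /x /y fs gs; exact: same_conf_refl.
have sab : a <= s <= b by rewrite as_.
have := lip_min_tail hm xm sab sb yL ys ye; rewrite leNgt => /negP; apply.
apply: (compare_total_lt hm xL yL HJ2 HJ3 _ xfin sT1 (ltW T1T2) T2b e0 HU HeF A0).
by move=> u v su uv vb; apply: le_enorm_upright; [exact: df|exact: dg].
Qed.

Hypotheses (f0 : forall r, a <= r <= b -> 0 <= f r) (g0 : forall r, a <= r <= b -> 0 <= g r).

Let fmax s r := maxr (f r) (f s).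
Let gmax s r := maxr (g r) (g s).

Let maxd (k : R -> R) s u v : `|maxr (k v) (k s) - maxr (k u) (k s)| <= `|k v - k u|.
Proof.
have [h1|h1] := leP (k v) (k s); have [h2|h2] := leP (k u) (k s).
- by rewrite subrr normr0.
- rewrite (ltr0_norm (_ : k s - k u < 0)) ?subr_lt0// ler0_norm ?subr_le0; last by rewrite (le_trans h1) ?ltW.
 by rewrite lerN2 lerD2r.
- rewrite (gtr0_norm (_ : 0 < k v - k s)) ?subr_gt0// ger0_norm ?subr_ge0; last by rewrite (le_trans h2) ?ltW.
 by rewrite lerD2l lerN2.
- by [].
Qed.

Let maxL s (k : R -> R) : a <= s -> lipon a b k -> lipon s b (fun r => maxr (k r) (k s)).
Proof. by move=> as_ kL; apply: lipon_max; [exact: lipon_sub as_ (lexx b) kL|exact: lipon_cst]. Qed.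

Let HU s r : a <= s -> s <= r <= b -> (U m (upright (fmax s r) (gmax s r)) <= U m (x r))%E.
Proof.
move=> as_ /andP[sr rb]; have rab : a <= r <= b by rewrite (le_trans as_ sr).
have sab : a <= s <= b by rewrite as_ (le_trans sr).
apply: U_upright_anti; [exact: f0|by rewrite le_max lexx|].
by rewrite !ger0_norm ?le_max ?lexx ?g0.
Qed.

Let p1 : 0 < sqrt (mu1 m). Proof. by rewrite sqrtr_gt0 mu1_gt0. Qed.
Let p2 : 0 < sqrt (mu2 m). Proof. by rewrite sqrtr_gt0 mu2_gt0. Qed.

(** The competitor replaces width and depth after [s] by their maxima with the values at [s]: it
    moves less and all distances grow. Where the width has dropped, the term in [r12] gains a fixed
    amount. *)
Lemma width_mono s t : a <= s -> s <= t -> t <= b -> f s <= f t.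
Proof.
move=> as_ st tb; rewrite -(ler_pM2l p1).
have XE r : xivec m (x r) i41 = sqrt (mu1 m) * f r by rewrite xivec_upright.
rewrite -!XE; apply: (drop_contra as_ st tb (maxL as_ fL) (maxL as_ gL)).
- by rewrite maxxx.
- by rewrite maxxx.
- by move=> u v _ _ _; exact: maxd.
- by move=> u v _ _ _; exact: maxd.
- by move=> r; exact: HU.
move=> T1 T2 sT1 T12 T2t; rewrite !XE !ltr_pM2l// => ft _ Hd.
have Hf r : T1 <= r <= T2 -> f r <= (f s + f t) / 2.
 move=> hr; rewrite -(ler_pM2l p1) -XE; apply: le_trans (Hd r hr) _.
 by rewrite ?XE le_eqVlt; apply/orP; left; apply/eqP; field.
have ft0 : 0 <= f t by apply: f0; rewrite (le_trans as_).
have fs0 : 0 < f s := le_lt_trans ft0 ft.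
have mid0 : 0 < (f s + f t) / 2 by rewrite divr_gt0// ltr_wpDr.
have mid1 : (f s + f t) / 2 < f s by rewrite ltr_pdivrMr// mulr_natr mulr2n ltrD2l.
have mm : 0 < m b1 * m b2 := mulr_gt0 (hm _) (hm _).
exists (m b1 * m b2 / ((f s + f t) / 2) - m b1 * m b2 / f s), (upright_U (f s) 0); split.
 by rewrite subr_gt0 ltr_pM2l// ltf_pV2 ?posrE.
move=> r hr; have fr := Hf r hr; rewrite (max_r (le_trans fr (ltW mid1))).
rewrite (U_upright _ fs0) lee_fin; split; first by apply: upright_U_anti; rewrite ?normr0.
have rab : a <= r <= b by case/andP: hr => h1 h2; rewrite (le_trans as_ (le_trans sT1 h1)) (le_trans h2 (le_trans T2t tb)).
have := f0 rab; rewrite /x le_eqVlt => /predU1P[<-|fr0]; first by rewrite U_upright0 leey.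
rewrite (U_upright _ fr0) -EFinD lee_fin /upright_U.
have -> (A B C : R) : A + B + (C - A) = C + B by ring.
have m13p : 0 <= 2 * (m b1 * m b3) := mulr_ge0 (ler0n _ 2) (mulr_ge0 (ltW (hm _)) (ltW (hm _))).
apply: lerD; first by apply: (ler_wpM2l (ltW mm)); rewrite lef_pV2 ?posrE.
apply: (ler_wpM2l m13p); rewrite lef_pV2 ?posrE ?sqrtr_gt0.
- apply: ler_wsqrtr; apply: lerD.
 by apply: lerXn2r; rewrite ?nnegrE; [exact: g0|rewrite le_max g0|rewrite le_max lexx].
 by rewrite ler_wpM2r//; apply: lerXn2r; rewrite ?nnegrE ?(ltW fr0) ?(ltW fs0) ?(le_trans fr) ?(ltW mid1).
- by rewrite ltr_wpDl ?sqr_ge0// divr_gt0// exprn_gt0.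
- by rewrite ltr_wpDl ?sqr_ge0// divr_gt0// exprn_gt0.
Qed.

(** The competitor is that of [width_mono]. The gap now comes from [r13 = r23], and it is bounded
    below as long as these distances are bounded. *)
Lemma depth_mono s t : a <= s -> s <= t -> t <= b -> g s <= g t.
Proof.
move=> as_ st tb; rewrite -(ler_pM2l p2).
have XE r : xivec m (x r) i42 = sqrt (mu2 m) * g r by rewrite xivec_upright.
rewrite -!XE; apply: (drop_contra as_ st tb (maxL as_ fL) (maxL as_ gL)).
- by rewrite maxxx.
- by rewrite maxxx.
- by move=> u v _ _ _; exact: maxd.
- by move=> u v _ _ _; exact: maxd.
- by move=> r; exact: HU.
move=> T1 T2 sT1 T12 T2t; rewrite !XE !ltr_pM2l// => gt gT1 Hd.
have T1b : T1 <= b := le_trans T12 (le_trans T2t tb).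
have aT1 : a <= T1 := le_trans as_ sT1.
have Hg r : T1 <= r <= T2 -> g r <= (g s + g t) / 2.
 move=> hr; rewrite -(ler_pM2l p2) -XE; apply: le_trans (Hd r hr) _.
 by rewrite ?XE le_eqVlt; apply/orP; left; apply/eqP; field.
have gt0 : 0 <= g t by apply: g0; rewrite (le_trans as_).
have gs0 : 0 < g s := le_lt_trans gt0 gt.
have mid0 : 0 <= (g s + g t) / 2 by rewrite divr_ge0// addr_ge0// ltW.
have mid1 : (g s + g t) / 2 < g s by rewrite ltr_pdivrMr// mulr_natr mulr2n ltrD2l.
(* If the width vanished at [T1] it would vanish on all of [[s, T1]], and changing the depth inside
   the collision set costs infinite action. *)
have fT1 : 0 < f T1.
 have T1ab : a <= T1 <= b by rewrite aT1.
 rewrite lt_def f0// andbT; apply/eqP => fT0.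
 have fr0 r : s <= r <= T1 -> f r = 0.
 move=> /andP[sr rT1]; have ar := le_trans as_ sr; apply/le_anti; rewrite f0 ?ar ?(le_trans rT1)//.
 by rewrite -fT0 (width_mono ar rT1 T1b).
 have fin : JM m h s T1 x \is a fin_num.
 by apply: (action_fin hm (lm_lip xm) (lm_fin xm)).
 pose N := `|sqrt (mu2 m) * g T1 - sqrt (mu2 m) * g s|.
 have N0 : 0 < N by rewrite normr_gt0 -mulrBr mulf_eq0 negb_or (gt_eqF p2) subr_eq0 lt_eqF.
 pose c := (fine (JM m h s T1 x) + 1) / N.
 have c0 : 0 < c by rewrite divr_gt0// ltr_wpDl// fine_ge0// action_ge0.
 have := @arc_upright_le_action s T1 f g c sT1 (lipon_sub as_ T1b fL) (lipon_sub as_ T1b gL) (ltW c0).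
 rewrite -/x => H; have {}H := H _; have : (c * xiD m (x T1) (x s) <=
 fine (JM m h s T1 x)).
 rewrite -lee_fin fineK//; apply: H => r hr.
 by rewrite fr0// U_upright0 leey.
 rewrite leNgt => /negP; apply.
 apply: (@lt_le_trans _ _ (c * N)); first by rewrite /c divfK ?gt_eqF// ltrDl.
 rewrite ler_pM2l// /N -!XE; exact: (enorm_ge (fun i => xivec m (x T1) i - xivec m (x s) i) i42).
have m13 : 0 < m b1 * m b3 := mulr_gt0 (hm _) (hm _).
have [B B0 HB] := lipon_bounded fL.
pose d := g s ^+ 2 - ((g s + g t) / 2) ^+ 2.
have d0 : 0 < d by rewrite subr_gt0 ltrXn2r// ?nnegrE// ltW.
pose C := g s ^+ 2 + B ^+ 2 / 4.
have C0 : 0 < C by rewrite ltr_wpDr ?exprn_gt0// divr_ge0 ?sqr_ge0.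
have den0 : 0 < 2 * C * sqrt C by rewrite mulr_gt0 ?sqrtr_gt0// mulr_gt0.
exists (2 * (m b1 * m b3) * (d / (2 * C * sqrt C))), (upright_U (f T1) 0); split.
 exact: mulr_gt0 (mulr_gt0 (ltr0Sn _ 1) m13) (divr_gt0 d0 den0).
move=> r hr; have gr := Hg r hr; have /andP[T1r rT2] := hr.
have rb : r <= b := le_trans rT2 (le_trans T2t tb).
have ar : a <= r := le_trans aT1 T1r.
have rab : a <= r <= b by rewrite ar.
have fr : f T1 <= f r := width_mono aT1 T1r rb.
have fr0 := lt_le_trans fT1 fr.
rewrite (max_r (le_trans gr (ltW mid1))) (max_l (width_mono as_ (le_trans sT1 T1r) rb)).
rewrite (U_upright _ fr0) lee_fin; split; first by apply: upright_U_anti; rewrite ?normr0.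
rewrite /x (U_upright _ fr0) -EFinD lee_fin /upright_U -addrA lerD2l -mulrDr.
apply: ler_wpM2l; first by rewrite mulr_ge0 ?ltW.
rewrite addrC -lerBrDr; apply: sqrt_gap => //.
- by rewrite ltr_wpDl ?sqr_ge0// divr_gt0// exprn_gt0.
- rewrite addrAC lerD2r /d -lerBrDr opprB addrC subrK.
 by rewrite lerXn2r ?nnegrE ?g0.
- rewrite lerD2l ler_wpM2r// lerXn2r ?nnegrE ?(ltW fr0)//.
 by rewrite (le_trans (ler_norm _))// HB.
Qed.
End Drop.

(** The folded minimizer has the same potential and no larger action, so it is again a minimizer,
    and its width and depth are monotone. Hence [|w3|], proportional to their product, is
    nondecreasing, so [w3] cannot change sign; this gives the constant [sg]. *)
Lemma planar_lift q0 a b x : rdist q0 b1 b2 = 0 -> lip_min m h q0 a b x ->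
 exists sg f g, [/\ sg ^+ 2 = 1, lipon a b f /\ lipon a b g,
 (forall r, a <= r <= b -> 0 <= f r) /\ (forall s t, a <= s -> s <= t -> t <= b -> f s <= f t),
 lip_min m h q0 a b (fun r => upright (f r) (sg * g r)) &
 forall r, a <= r <= b -> same_conf (x r) (upright (f r) (sg * g r))].
Proof.
move=> r0 xm; have xL := lm_lip xm; have ab := ltW (lm_lt xm).
have w2 := lip_min_isosceles hm hh m12 r0 xm.
pose f r := sqrt (xi1sq (x r)).
pose g r := sqrt (xi2sq m (x r)).
have fL : lipon a b f by apply: lipon_sqrt2; [exact: lipon_X1|exact: lipon_Y1].
have gL : lipon a b g by apply: lipon_sqrt2; [exact: lipon_X2|exact: lipon_Y2].
have f0 r : a <= r <= b -> 0 <= f r by move=> _; exact: sqrtr_ge0.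
have g0 r : a <= r <= b -> 0 <= g r by move=> _; exact: sqrtr_ge0.
have isoE r : iso m (x r) = upright (f r) (g r) by [].
have w1 r : hopf m (x r) b1 = hopf m (upright (f r) (g r)) b1 by rewrite -isoE; have [->] := hopf_iso hm (x r).
have w3 r : a <= r <= b -> `|hopf m (x r) b3| = 2 * kappa m * (f r * g r).
 move=> hr; have [_ _ <-] := hopf_upright (f r) (g r); rewrite -isoE.
 by have [_ _ ->] := hopf_iso hm (x r); rewrite w2// expr0n add0r sqrtr_sqr.
have UE r : a <= r <= b -> U m (upright (f r) (g r)) = U m (x r).
 move=> hr; rewrite -isoE; apply/eqP; rewrite eq_le (U_iso hm m12)/=.
 apply: (U_anti_hopf hm); last by rewrite (inertia_iso hm).
 by have [->] := hopf_iso hm (x r).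
 by have [_ ->] := hopf_iso hm (x r); rewrite w2.
have haa : a <= a <= b by rewrite lexx ab.
have hbb : a <= b <= b by rewrite lexx ab.
have fa : f a = 0 by rewrite /f -rdist12 -(same_conf_rdist _ _ (lm_start xm)) r0.
have xfin := lm_fin xm.
have le_act : (JM m h a b (fun r => upright (f r) (g r)) <= JM m h a b x)%E.
 have yL := lipschitz_upright fL gL.
 have := @action_le_factor _ m h hm a b 1 x _ ab xL yL xfin ler01.
 rewrite mul1e; apply; first by move=> u hu; rewrite UE// -isoE (inertia_iso hm).
 by move=> u v _ _ _; rewrite mul1r -!isoE; exact: enorm_hopf_iso.
have scq y : same_conf y q0 -> same_conf y (x a).
 by move=> yq; exact: same_conf_trans yq (same_conf_sym (lm_start xm)).
have sca : same_conf (upright (f a) (g a)) (x a).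
 apply: (hopf_inj hm); apply/funext => i; case: (ord3_cases i) => ->.
 - by rewrite w1.
 - by rewrite w2//; have [_ -> _] := hopf_upright (f a) (g a).
 - have := w3 a haa; rewrite fa mul0r mulr0 => /eqP; rewrite normr_eq0 => /eqP ->.
 by have [_ _ ->] := hopf_upright 0 (g a); rewrite mul0r mulr0.
have ym : lip_min m h q0 a b (fun r => upright (f r) (g r)).
 split; [exact: lm_lt xm|exact: lipschitz_upright|exact: same_conf_trans sca (lm_start xm)| | | |].
 - by move=> t ht; rewrite UE; [exact: (lm_before xm)|case/andP: ht => -> /ltW].
 - by rewrite UE// (lm_end xm).
 - exact: le_lt_trans le_act xfin.
 - by move=> c d y cd yL yq Uy; apply: le_trans le_act _; exact: (lm_min xm).
have fm := width_mono ym fL gL f0 g0; have gm := depth_mono ym fL gL f0 g0.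
have w3L : lipon a b (fun r => hopf m (x r) b3) by exact: lipon_hopf.
have k0 := kappa_gt0 hm; have k2 : 0 < 2 * kappa m := mulr_gt0 (ltr0Sn _ 1) k0.
have same e r1 r2 : e ^+ 2 = 1 -> a <= r1 -> r1 <= r2 -> r2 <= b -> 0 < e * hopf m (x r1) b3 ->
 0 <= e * hopf m (x r2) b3.
 move=> e2 ar1 r12 r2b p; rewrite leNgt; apply/negP => n.
 have eL : lipon r1 r2 (fun r => e * hopf m (x r) b3) by apply: liponZ; exact: lipon_sub ar1 r2b w3L.
 have [T /andP[r1T Tr2] [TE _]] := first_time r12 eL p (ltW n).
 have e0 : e != 0 by apply/eqP => e0; move: e2; rewrite e0 expr0n => /eqP; rewrite eq_sym oner_eq0.
 have r1in : a <= r1 <= b by rewrite ar1 (le_trans r12).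
 have Tin : a <= T <= b by rewrite (le_trans ar1 (ltW r1T)) (le_trans Tr2).
 have z : hopf m (x T) b3 = 0 by move/eqP: TE; rewrite mulf_eq0 (negbTE e0) => /eqP.
 have := w3 T Tin; rewrite z normr0 => /esym/eqP; rewrite mulf_eq0 gt_eqF//= => /eqP fgT.
 have : f r1 * g r1 <= f T * g T.
 have Tb := le_trans Tr2 r2b; apply: ler_pM; [exact: f0|exact: g0| |].
 exact: fm ar1 (ltW r1T) Tb.
 exact: gm ar1 (ltW r1T) Tb.
 rewrite fgT => fg1; have : hopf m (x r1) b3 = 0.
 apply/eqP; rewrite -normr_le0 w3//; exact: mulr_ge0_le0 (ltW k2) fg1.
 by move=> E; move: p; rewrite E mulr0 ltxx.
have [sg sg2 Hs] : exists2 sg : R, sg ^+ 2 = 1 & forall r, a <= r <= b -> 0 <= sg * hopf m (x r) b3.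
 have [[r1 [r1in n1]]|H] := pselect (exists r1, a <= r1 <= b /\ hopf m (x r1) b3 < 0); last first.
 exists 1; first by rewrite expr1n.
 by move=> r hr; rewrite mul1r leNgt; apply/negP => n; apply: H; exists r.
 have N2 : (-1 : R) ^+ 2 = 1 by rewrite sqrrN expr1n.
 exists (-1) => // r hr; have /andP[ar1 r1b] := r1in; have /andP[ar rb] := hr.
 have [r1r|rr1] := leP r1 r.
 by apply: (same _ r1 r N2) => //; rewrite mulN1r oppr_gt0.
 rewrite mulN1r oppr_ge0 leNgt; apply/negP => p.
 have := same 1 r r1 (expr1n _ 2) ar (ltW rr1) r1b; rewrite !mul1r => /(_ p).
 by rewrite leNgt n1.
have sgE r : a <= r <= b -> same_conf (x r) (upright (f r) (sg * g r)).
 move=> hr; have [e1 e2 e3] := hopf_upright (f r) (sg * g r).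
 apply: (hopf_inj hm); apply/funext => i; case: (ord3_cases i) => ->.
 - by rewrite w1 e1; have [-> _ _] := hopf_upright (f r) (g r); rewrite exprMn sg2 mul1r.
 - by rewrite e2 w2.
 - rewrite e3; have -> : 2 * kappa m * (f r * (sg * g r)) = sg * `|hopf m (x r) b3|.
 by rewrite w3//; ring.
 have sn : `|sg| = 1 by apply/eqP; rewrite -(@eqrXn2 _ 2)// expr1n -normrX sg2 normr1.
 rewrite -[`|_|]mul1r -sn -normrM (ger0_norm (Hs r hr)) mulrA -expr2 sg2 mul1r.
 by [].
have zL : lipc a b (fun r => upright (f r) (sg * g r)).
 by apply: lipschitz_upright => //; exact: liponZ.
have zA := action_same_conf h hm ab xL zL sgE.
exists sg, f, g; split; [exact: sg2|by split|by split| |exact: sgE].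
split; [exact: lm_lt xm|exact: zL| | | | |].
- exact: same_conf_trans (same_conf_sym (sgE a haa)) (lm_start xm).
- move=> t ht; have hab : a <= t <= b by case/andP: ht => -> /ltW.
 by rewrite (same_conf_U m (sgE t hab)); exact: (lm_before xm).
- by rewrite (same_conf_U m (sgE b hbb)) (lm_end xm).
- by rewrite -zA.
- by rewrite -zA; exact: (lm_min xm).
Qed.
End PlanarIsosceles.

(** * Newtonian time along an isosceles minimizer *)

Section ChangeOfTime.
Variable R : realType.
Implicit Types (F rho : R -> R).

Lemma continuous_eps F y0 : (forall e, 0 < e -> exists2 d, 0 < d & forall y, `|y - y0| < d ->
 `|F y - F y0| < e) -> {for y0, continuous F}.
Proof.
move=> H; apply/cvgrPdist_lt => e e0; have [d d0 Hd] := H e e0.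
by apply/nbhs_ballP; exists d => //= y; rewrite /ball/= distrC => /Hd; rewrite distrC.
Qed.

Lemma eps_continuous F y0 e : {for y0, continuous F} -> 0 < e ->
 exists2 d, 0 < d & forall y, `|y - y0| < d -> `|F y - F y0| < e.
Proof.
move=> /cvgrPdist_lt H e0; have /nbhs_ballP[d /= d0 Hd] := H e e0.
by exists d => // y yd; rewrite distrC; apply: Hd; rewrite /ball/= distrC.
Qed.

Lemma primitive rho (a : R) : continuous rho ->
 exists th : R -> R, forall y, a < y -> is_derive y 1 th (rho y).
Proof.
move=> rc; pose th x : R := (\int[leb]_(t in `[a, x]) rho t)%R; exists th => y ay.
have yu : y < y + 1 by rewrite ltrDl.
have ri : leb.-integrable `[a, y + 1] (EFin \o rho).
 by apply: continuous_compact_integrable; [exact: segment_compact|exact: continuous_subspaceT].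
have [dy ey] := @continuous_FTC1_closed R rho a y (y + 1) yu ri ay (rc y).
by apply: DeriveDef; [exact: dy|rewrite -derive1E; exact: ey].
Qed.

Lemma is_derive_continuous F (y d : R) : is_derive y 1 F d -> {for y, continuous F}.
Proof. by move=> [Fd _]; exact/differentiable_continuous/derivable1_diffP. Qed.
Lemma MVT_mean F (df : R -> R) (a b : R) : a < b -> (forall y, a <= y <= b -> is_derive y 1 F (df y)) ->
 exists2 c, a < c < b & F b - F a = df c * (b - a).
Proof.
move=> ab Fd; have [||c cab e] := @MVT R F df a b ab.
- by move=> y; rewrite in_itv/= => /andP[ay yb]; apply: Fd; rewrite !ltW.
- by apply: derivable_within_continuous => y; rewrite in_itv/= => yab; have [] := Fd y yab.
- by exists c => //; move: cab; rewrite in_itv.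
Qed.

(** [psi] inverts the primitive [th] of [rho]. The density may vanish at both ends, which is why
    [psi] is differentiated only inside. *)
Lemma change_of_time rho (Y : R) : continuous rho -> 0 < Y -> (forall y, 0 < y < Y -> 0 < rho y) ->
 exists (th psi : R -> R) (T : R), [/\ 0 < T, th 0 = 0 /\ th Y = T,
 (forall y : R, 0 <= y -> {for y, continuous th}) /\
 (forall y1 y2 : R, 0 <= y1 -> y1 < y2 -> y2 <= Y -> th y1 < th y2),
 (forall t : R, 0 <= t <= T -> 0 <= psi t <= Y /\ th (psi t) = t) /\
 (forall y : R, 0 <= y <= Y -> psi (th y) = y) &
 forall t : R, 0 < t < T -> 0 < psi t < Y /\ is_derive t 1 psi (rho (psi t))^-1].
Proof.
move=> rc Y0 rp; have [th0 dth0] := primitive (-1) rc.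
pose th (y : R) := th0 y - th0 0.
have dth (y : R) : 0 <= y -> is_derive y 1 th (rho y).
 move=> y0; have d := dth0 y (lt_le_trans (ltrN10 R) y0).
 have -> : rho y = rho y - 0 by rewrite subr0.
 apply: is_deriveB.
have thc (y : R) : 0 <= y -> {for y, continuous th} by move=> /dth; exact: is_derive_continuous.
have mono (y1 y2 : R) : 0 <= y1 -> y1 < y2 -> y2 <= Y -> th y1 < th y2.
 move=> y10 y12 y2Y; have [|c /andP[c1 c2]] := @MVT_mean th rho y1 y2 y12.
 by move=> y /andP[h1 _]; apply: dth; exact: le_trans h1.
 rewrite -subr_gt0 => ->; rewrite mulr_gt0 ?subr_gt0// rp// (le_lt_trans y10 c1).
 exact: lt_le_trans y2Y.
have th00 : th 0 = 0 by rewrite /th subrr.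
pose T := th Y; have T0 : 0 < T by rewrite -th00; exact: mono.
have wc : {within `[0, Y], continuous th}.
 apply: derivable_within_continuous => y; rewrite in_itv/= => /andP[y0 _].
 by have [] := dth y y0.
have ivt (t : R) : 0 <= t <= T -> exists y, 0 <= y <= Y /\ th y = t.
 move=> /andP[t0 tT]; have [|c] := @IVT R th 0 Y t (ltW Y0) wc.
 by rewrite th00 -/T minEle maxEle (ltW T0) t0.
 by rewrite in_itv/= => cY e; exists c.
pose psi (t : R) := if pselect (0 <= t <= T) is left H then projT1 (cid (ivt t H)) else 0.
have psiP (t : R) : 0 <= t <= T -> 0 <= psi t <= Y /\ th (psi t) = t.
 move=> tT; rewrite /psi; case: pselect => // H; exact: (projT2 (cid (ivt t H))).
have mono_le (y1 y2 : R) : 0 <= y1 -> y1 <= y2 -> y2 <= Y -> th y1 <= th y2.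
 by move=> y10; rewrite le_eqVlt => /predU1P[->//|y12] y2Y; apply/ltW/mono.
have psiK (y : R) : 0 <= y <= Y -> psi (th y) = y.
 move=> /andP[y0 yY]; have tT : 0 <= th y <= T by rewrite -{1}th00 !mono_le.
 have [/andP[p0 pY] pE] := psiP _ tT.
 by have [lt|gt|//] := ltgtP (psi (th y)) y; [have := mono _ _ p0 lt yY|have := mono _ _ y0 gt pY]; rewrite pE ltxx.
exists th, psi, T; split; [exact: T0|by split|by split|by split|] => t /andP[t0 tT].
have tin : 0 <= t <= T by rewrite !ltW.
have [/andP[p0 pY] pE] := psiP t tin.
have p0' : 0 < psi t.
 by rewrite lt_neqAle p0 andbT; apply/eqP => e; move: t0; rewrite -pE -e th00 ltxx.
have pY' : psi t < Y.
 by rewrite lt_neqAle pY andbT; apply/eqP => e; move: tT; rewrite -pE e -/T ltxx.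
split; first by rewrite p0' pY'.
have nr : \forall y \near psi t, 0 <= y <= Y.
 near=> y; apply/andP; split; [near: y; apply: filterS (lt_nbhsr p0')|near: y; apply: filterS (lt_nbhsl pY')] => z;
 exact: ltW.
rewrite -{1}pE; apply: is_derive_inverse.
- by apply: filterS nr => y; exact: psiK.
- by apply: filterS nr => y /andP[y0 _]; exact: thc.
- exact: dth.
- by rewrite gt_eqF// rp// p0' pY'.
Unshelve. all: by end_near.
Qed.
End ChangeOfTime.

Section OrbitData.
Variables (R : realType) (m : 'I_3 -> R) (h T : R) (W1 W2 A : R -> R).

Definition orbit_rate s := upright_U m (W1 s) (W2 s) - h.

(* Time [s] runs backwards from the brake instant [s = 0] and [A s] is the action
 of the arc from there. *)
Record timed : Prop := Timed {
 td_good : forall s : R, 0 < s < T -> 0 < W1 s /\ h < upright_U m (W1 s) (W2 s);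
 td_cont : forall s : R, 0 <= s < T ->
 {for s, continuous (fun r => W1 `|r|)} /\ {for s, continuous (fun r => W2 `|r|)};
 td_der : forall s : R, 0 < s < T -> is_derive s 1 A (sqrt 2 * orbit_rate s);
 td_arc : forall s t c : R, 0 < s -> s <= t -> t < T -> 0 <= c ->
 (forall r, s <= r <= t -> c ^+ 2 <= orbit_rate r) ->
 c * xiD m (upright m (W1 t) (W2 t)) (upright m (W1 s) (W2 s))
 <= A t - A s;
 td_min : forall (s t c d : R) (z : R -> conf R), 0 < s -> s <= t -> t < T -> c <= d -> lipc c d z ->
 z c = upright m (W1 t) (W2 t) -> z d = upright m (W1 s) (W2 s) ->
 ((A t - A s)%:E <= JM m h c d z)%E }.

End OrbitData.

Section ActionParameter.
Variables (R : realType) (m : 'I_3 -> R) (h : R).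
Hypotheses (hm : posm m) (hh : 0 < h).
Hypothesis m12 : m b1 = m b2.
Variables (q0 : conf R) (a b : R) (f w : R -> R).
Let x r := upright m (f r) (w r).
Hypothesis xm : lip_min m h q0 a b x.
Hypotheses (fL : lipon a b f) (wL : lipon a b w).
Hypothesis f0 : forall r, a <= r <= b -> 0 <= f r.
Hypothesis fm : forall s t, a <= s -> s <= t -> t <= b -> f s <= f t.
Hypothesis fa : f a = 0.

Let ab : a < b. Proof. exact: (lm_lt xm). Qed.
Let xL : lipc a b x. Proof. exact: (lm_lip xm). Qed.
Let p1 : 0 < sqrt (mu1 m). Proof. by rewrite sqrtr_gt0 mu1_gt0. Qed.
Let p2 : 0 < sqrt (mu2 m). Proof. by rewrite sqrtr_gt0 mu2_gt0. Qed.

(* Abstracting the remaining action keeps unification from unfolding integrals. *)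
Variable al : R -> R.
Hypothesis alE : forall r, al r = fine (JM m h r b x).

Let fin s t : a <= s -> s <= t -> t <= b -> JM m h s t x \is a fin_num.
Proof. by move=> *; exact: (action_fin hm xL (lm_fin xm)). Qed.

Let al0 r : 0 <= al r. Proof. by rewrite alE fine_ge0 ?action_ge0. Qed.

Let alD s t : a <= s -> s <= t -> t <= b -> al s = fine (JM m h s t x) + al t.
Proof.
move=> as_ st tb; rewrite !alE (action_cat h hm st tb (lipc_sub as_ (lexx b) xL)).
exact: fineD (fin as_ st tb) (fin (le_trans as_ st) tb (lexx b)).
Qed.

Let al_mono s t : a <= s -> s <= t -> t <= b -> al t <= al s.
Proof. by move=> as_ st tb; rewrite (alD as_ st tb) lerDr fine_ge0 ?action_ge0. Qed.

Let alb : al b = 0. Proof. by rewrite alE action_point. Qed.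

Let dist_ge i j : `|sqrt (mu1 m) * (f j - f i)| <= enorm (fun k => xivec m (x j) k - xivec m (x i) k) /\
 `|sqrt (mu2 m) * (w j - w i)| <= enorm (fun k => xivec m (x j) k - xivec m (x i) k).
Proof.
have H := enorm_ge (fun k => xivec m (x j) k - xivec m (x i) k); split.
 by have := H i41; rewrite !(xivec_upright hm) /= mulrBr.
by have := H i42; rewrite !(xivec_upright hm) /= mulrBr.
Qed.

(** An arc of zero action on which [U > h] does not move. This makes the configuration a function of
    the remaining action. *)
Let rigid r s : a <= r -> r <= s -> s < b -> al r = al s -> f r = f s /\ w r = w s.
Proof.
move=> ar rs sb E; have xLs := lipc_sub ar (ltW sb) xL.
have [|e e0 He] := min_rate hm hh rs xLs.
 by move=> u /andP[ru us]; apply: (lm_before xm); rewrite (le_trans ar ru) (le_lt_trans us).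
have A0 : fine (JM m h r s x) = 0.
 by have := alD ar rs (ltW sb); rewrite E => /eqP; rewrite -subr_eq0 opprD addrCA subrr addr0 oppr_eq0 => /eqP.
have se : 0 < sqrt e by rewrite sqrtr_gt0.
have := @arc_upright_le_action _ m h hm r s f w (sqrt e) rs
 (lipon_sub ar (ltW sb) fL) (lipon_sub ar (ltW sb) wL) (ltW se).
rewrite sqr_sqrtr ?(ltW e0)// => /(_ He); rewrite -(fineK (fin ar rs (ltW sb))) A0 lee_fin.
rewrite pmulr_rle0// => H; have [d1 d2] := dist_ge r s.
have := le_trans d1 H; have := le_trans d2 H.
rewrite !normr_le0 !mulf_eq0 (gt_eqF p1) (gt_eqF p2) /= !subr_eq0 => /eqP -> /eqP -> //.
Qed.

(** Without remaining action the curve would be at rest until [b], hence already on the Hill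
    boundary by continuity. *)
Let al_gt0 r : a <= r -> r < b -> 0 < al r.
Proof.
move=> ar rb; rewrite lt_def al0 andbT; apply/eqP => alr.
have cst s : r <= s -> s < b -> f r = f s /\ w r = w s.
 move=> rs sb; apply: rigid => //; apply/eqP; rewrite eq_le (al_mono ar rs (ltW sb)) andbT alr.
 exact: al0.
have lim (k : R -> R) : lipon a b k -> (forall s, r <= s -> s < b -> k r = k s) -> k r = k b.
 move=> [L L0 kL] kc; apply/eqP; rewrite -subr_eq0 -normr_le0; apply/ler_addgt0Pr => e e0.
 have L1 : 0 < L + 1 by rewrite ltr_wpDl.
 pose s := maxr r (b - e / (L + 1)); have rs : r <= s by rewrite le_max lexx.
 have sb : s < b by rewrite gt_max rb ltrBlDr ltrDl divr_gt0.
 have sab : a <= s <= b by rewrite (le_trans ar rs) ltW.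
 have bab : a <= b <= b by rewrite lexx (ltW ab).
 rewrite (kc s rs sb) add0r (le_trans (kL _ _ sab bab))// ler0_norm ?subr_le0 ?(ltW sb)// opprB.
 apply: (@le_trans _ _ ((L + 1) * (e / (L + 1)))); last by rewrite mulrC divfK// gt_eqF.
 apply: ler_pM => //; [by rewrite subr_ge0 ltW|by rewrite lerDl|].
 by rewrite lerBlDr -lerBlDl le_max lexx orbT.
have fb := lim _ fL (fun s rs sb => (cst s rs sb).1); have wb := lim _ wL (fun s rs sb => (cst s rs sb).2).
have rab : a <= r < b by rewrite ar.
by have := lm_before xm rab; rewrite /x fb wb (lm_end xm) ltxx.
Qed.

Let al_eq r s : a <= r -> r <= s -> s <= b -> al r = al s -> f r = f s /\ w r = w s.
Proof.
move=> ar rs; rewrite le_eqVlt => /predU1P[sb|sb E]; last exact: rigid.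
subst s; rewrite alb => E; move: rs; rewrite le_eqVlt => /predU1P[->//|rb].
by have := al_gt0 ar rb; rewrite E ltxx.
Qed.

(** With [A = y^8] the time density is [8 y^7 / (sqrt 2 (U - h))]. Since [U - h >= k y^6], it tends
    to 0 with [y]; with the fourth root in place of the eighth it would only be bounded. *)
Definition root8 (A : R) : R := sqrt (root4 A).

Let root8K A : 0 <= A -> root8 A ^+ 8 = A.
Proof. by move=> A0; rewrite (exprM _ 2 4) sqr_sqrtr ?root4_ge0// root4K. Qed.

Definition level r : R := root8 (al r).
Local Notation e := level.
Let e0 r : 0 <= e r. Proof. exact: sqrtr_ge0. Qed.
Let e8 r : e r ^+ 8 = al r. Proof. exact: root8K. Qed.
Definition top_level : R := e a.
Local Notation Y := top_level.

Let e_mono s t : a <= s -> s <= t -> t <= b -> e t <= e s.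
Proof. by move=> as_ st tb; apply: ler_wsqrtr; apply: ler_root4; exact: al_mono. Qed.

Let e_gt0 r : a <= r -> r < b -> 0 < e r.
Proof. by move=> ar rb; rewrite sqrtr_gt0 root4_gt0// al_gt0. Qed.

Let eb : e b = 0. Proof. by rewrite /e alb /root8 /root4 !sqrtr0. Qed.

Let Y0 : 0 < Y. Proof. exact: e_gt0 (lexx a) ab. Qed.

Let al_cont : continuous (fun r => al (clamp a b r)).
Proof.
move=> r0; apply: continuous_eps => d d0.
have [n n0 Hn] := action_small hm ab xL (lm_fin xm) d0; exists n => // r rn.
have H s t : a <= s -> s <= t -> t <= b -> `|s - t| < n -> `|al s - al t| < d.
 move=> as_ st tb; rewrite (alD as_ st tb) addrK (ger0_norm (fine_ge0 (action_ge0 _ _ _ _ _))).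
 rewrite ler0_norm ?subr_le0// opprB => stn; rewrite -lte_fin fineK ?(fin as_ st tb)//.
 exact: Hn.
have cn : `|clamp a b r - clamp a b r0| < n by exact: le_lt_trans (clamp_lipschitz _ _ _ _) rn.
have /andP[c1 c2] := clamp_itv r (ltW ab); have /andP[c3 c4] := clamp_itv r0 (ltW ab).
have [le|le] := leP (clamp a b r) (clamp a b r0); first exact: H.
by rewrite distrC; apply: H => //; [exact: ltW|rewrite distrC].
Qed.

Let e_cont : continuous (fun r => e (clamp a b r)).
Proof.
move=> r; apply: (@continuous_comp _ _ _ (fun r => al (clamp a b r)) root8); first exact: al_cont.
have : continuous (@sqrt R \o (@sqrt R \o @sqrt R)).
 move=> A; apply: continuous_comp; last exact: sqrt_continuous.
 by apply: continuous_comp; exact: sqrt_continuous.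
exact.
Qed.

Let eY r : a <= r <= b -> 0 <= e r <= Y.
Proof. by move=> /andP[ar rb]; rewrite e0 /Y (e_mono (lexx a) ar rb). Qed.

Let YE : Y = e a. Proof. by []. Qed.

Let al_e r s : e r = e s -> al r = al s. Proof. by rewrite -(e8 r) -(e8 s) => ->. Qed.

Let e_lt r s : a <= r <= b -> a <= s <= b -> e r < e s -> s < r.
Proof.
move=> /andP[ar rb] /andP[as_ sb] rs; rewrite ltNge; apply/negP => le.
by have := e_mono ar le sb; rewrite leNgt rs.
Qed.

Let ivt y : 0 <= y <= Y -> exists r, a <= r <= b /\ e r = y.
Proof.
move=> /andP[y0 yY].
have [|c] := @IVT R (fun r => e (clamp a b r)) a b y (ltW ab) (continuous_subspaceT e_cont).
 have -> : clamp a b b = b by apply: clamp_id; rewrite (ltW ab) lexx.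
 have -> : clamp a b a = a by apply: clamp_id; rewrite (ltW ab) lexx.
 by rewrite eb -YE /minr /maxr ltNge (ltW Y0) /= y0.
by rewrite in_itv/= => cab ec; exists c; split; [exact: cab|rewrite -ec (clamp_id cab)].
Qed.

(** Some parameter at which the level is [y]. The configuration there does not depend on the choice,
    because arcs of zero action do not move. *)
Definition arrival y : R := if pselect (0 <= y <= Y) is left H then projT1 (cid (ivt H)) else a.
Local Notation rr := arrival.

Let rrP y : 0 <= y <= Y -> a <= rr y <= b /\ e (rr y) = y.
Proof. by move=> yY; rewrite /arrival; case: pselect => // H; exact: (projT2 (cid (ivt H))). Qed.

Definition width_at y := f (rr (clamp 0 Y y)).
Definition depth_at y := w (rr (clamp 0 Y y)).
Local Notation X1 := width_at.
Local Notation X2 := depth_at.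

Let Xe r : a <= r <= b -> X1 (e r) = f r /\ X2 (e r) = w r.
Proof.
move=> rab; rewrite /width_at /depth_at (clamp_id (eY rab)); have [/andP[s1 s2] /al_e sE] := rrP (eY rab).
have /andP[ar rb] := rab; have [le|le] := leP (rr (e r)) r.
 by have [-> ->] := al_eq s1 le rb sE.
by have [-> ->] := al_eq ar (ltW le) s2 (esym sE).
Qed.

Let Xr y : 0 <= y <= Y -> exists r, [/\ a <= r <= b, e r = y, X1 y = f r & X2 y = w r].
Proof. by move=> yY; have [h1 h2] := rrP yY; exists (rr y); rewrite /width_at /depth_at (clamp_id yY). Qed.

Let arcX y1 y2 c : 0 <= y1 -> y1 <= y2 -> y2 <= Y -> 0 <= c ->
 (forall y, y1 <= y <= y2 -> ((c ^+ 2 + h)%:E <= U m (upright m (X1 y) (X2 y)))%E) ->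
 c * xiD m (upright m (X1 y2) (X2 y2)) (upright m (X1 y1) (X2 y1))
 <= y2 ^+ 8 - y1 ^+ 8.
Proof.
move=> y10; rewrite le_eqVlt => /predU1P[<- _ _ _|y12 y2Y c0 Hc].
 rewrite subrr (_ : enorm _ = 0) ?mulr0//; rewrite /enorm big1 ?sqrtr0// => i _.
 by rewrite subrr expr0n.
have y1in : 0 <= y1 <= Y by rewrite y10 (le_trans (ltW y12)).
have y2in : 0 <= y2 <= Y by rewrite (le_trans y10 (ltW y12)).
have [r1 [r1ab er1 f1 w1]] := Xr y1in; have [r2 [r2ab er2 f2 w2]] := Xr y2in.
have r21 : r2 < r1 by apply: (e_lt r1ab r2ab); rewrite er1 er2.
have /andP[ar2 _] := r2ab; have /andP[_ r1b] := r1ab.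
have -> : y2 ^+ 8 - y1 ^+ 8 = fine (JM m h r2 r1 x).
 by rewrite -er1 -er2 !e8 (alD ar2 (ltW r21) r1b) addrK.
rewrite -lee_fin fineK ?(fin ar2 (ltW r21) r1b)// f1 w1 f2 w2.
have -> : (fun i => xivec m (upright m (f r2) (w r2)) i - xivec m (upright m (f r1) (w r1)) i) =
 (fun i => -1 * (xivec m (x r1) i - xivec m (x r2) i)).
 by apply/funext => i; rewrite mulN1r opprB.
rewrite enormZ normrN1 mul1r.
apply: (arc_upright_le_action hm (ltW r21) (lipon_sub ar2 r1b fL) (lipon_sub ar2 r1b wL) c0).
move=> r /andP[r2r rr1]; have rab : a <= r <= b by rewrite (le_trans ar2 r2r) (le_trans rr1).
have [<- <-] := Xe rab; apply: Hc; have /andP[ar rb] := rab.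
by rewrite -er1 -er2 (e_mono ar rr1 r1b) (e_mono ar2 r2r rb).
Qed.

Let minX y1 y2 c d z : 0 <= y1 -> y1 <= y2 -> y2 <= Y -> c <= d -> lipc c d z ->
 z c = upright m (X1 y2) (X2 y2) -> z d = upright m (X1 y1) (X2 y1) ->
 ((y2 ^+ 8 - y1 ^+ 8)%:E <= JM m h c d z)%E.
Proof.
move=> y10 y12 y2Y cd zL zc zd.
have y1in : 0 <= y1 <= Y by rewrite y10 (le_trans y12).
have y2in : 0 <= y2 <= Y by rewrite (le_trans y10 y12).
have [r1 [r1ab er1 f1 w1]] := Xr y1in; have [r2 [r2ab er2 f2 w2]] := Xr y2in.
have /andP[ar1 r1b] := r1ab; have /andP[ar2 r2b] := r2ab.
have sc : same_conf (z d) (x r1) by rewrite zd f1 w1; exact: same_conf_refl.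
have [v [t [ct vL vc vt vA]]] := action_glue h hm cd r1b zL (lipc_sub ar1 (lexx b) xL) sc.
have sc2 : same_conf (x r2) (v c) by rewrite vc zc f2 w2; exact: same_conf_refl.
have Uv : (U m (v t) <= h%:E)%E by rewrite -(same_conf_U m vt) (lm_end xm).
have := lip_min_tail hm xm r2ab ct vL sc2 Uv; rewrite vA.
rewrite -(fineK (fin ar2 r2b (lexx b))) -(fineK (fin ar1 r1b (lexx b))) -!alE.
by rewrite -er1 -er2 !e8 EFinB leeBlDr.
Qed.

Let rate : exists2 k, 0 < k & forall y, 0 <= y <= Y ->
 ((k * y ^+ 6 + h)%:E <= U m (upright m (X1 y) (X2 y)))%E.
Proof.
have [k k0 Hk] := rate_ge_root4 hm hh xm; exists k => // y yY.
have [r [rab er -> ->]] := Xr yY.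
have -> : y ^+ 6 = root4 (al r) ^+ 3 by rewrite -er (exprM _ 2 3) sqr_sqrtr ?root4_ge0.
apply: le_trans (trunc_rateP hm hh (x r)); rewrite lee_fin lerD2r.
by rewrite alE; exact: Hk.
Qed.

Let X_lip d : 0 < d -> d <= Y -> lipon d Y X1 /\ lipon d Y X2.
Proof.
move=> d0 dY; have [k k0 Hk] := rate.
pose c := sqrt (k * d ^+ 6); have kd : 0 < k * d ^+ 6 by rewrite mulr_gt0// exprn_gt0.
have c0 : 0 < c by rewrite sqrtr_gt0.
have c2 : c ^+ 2 = k * d ^+ 6 := sqr_sqrtr (ltW kd).
have key y1 y2 : d <= y1 -> y1 <= y2 -> y2 <= Y -> c * enorm (fun i =>
 xivec m (upright m (X1 y2) (X2 y2)) i - xivec m (upright m (X1 y1) (X2 y1)) i) <= 8 * Y ^+ 7 * (y2 - y1).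
 move=> dy1 y12 y2Y; have y10 := le_trans (ltW d0) dy1.
 have y20 := le_trans y10 y12.
 apply: (@le_trans _ _ (y2 ^+ 8 - y1 ^+ 8)).
 apply: (arcX y10 y12 y2Y (ltW c0)) => y /andP[y1y yy2].
 have yin : 0 <= y <= Y by rewrite (le_trans y10 y1y) (le_trans yy2).
 apply: le_trans (Hk y yin); rewrite c2 lee_fin lerD2r ler_wpM2l ?(ltW k0)// lerXn2r ?nnegrE ?(ltW d0)//.
 by case/andP: yin.
 exact: le_trans y1y.
 rewrite subrXX mulrC; apply: ler_wpM2r; first by rewrite subr_ge0.
 rewrite (_ : 8 * Y ^+ 7 = \sum_(i < 8) Y ^+ 7); last by rewrite sumr_const card_ord mulr_natl.
 apply: ler_sum => i _; have -> : Y ^+ 7 = Y ^+ (8.-1 - i) * Y ^+ i.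
 by rewrite -exprD subnK// -ltnS.
 apply: ler_pM; rewrite ?exprn_ge0//; apply: lerXn2r; rewrite ?nnegrE ?(ltW Y0)//.
 exact: le_trans y2Y.
pose L := 8 * Y ^+ 7 / c; have L0 : 0 <= L by rewrite divr_ge0 ?(ltW c0)// mulr_ge0// exprn_ge0// ltW.
have key2 y1 y2 : d <= y1 <= Y -> d <= y2 <= Y -> enorm (fun i =>
 xivec m (upright m (X1 y2) (X2 y2)) i - xivec m (upright m (X1 y1) (X2 y1)) i) <= L * `|y1 - y2|.
 have K u v : d <= u <= Y -> d <= v <= Y -> u <= v -> enorm (fun i =>
 xivec m (upright m (X1 v) (X2 v)) i - xivec m (upright m (X1 u) (X2 u)) i) <= L * `|u - v|.
 move=> /andP[du uY] /andP[dv vY] uv; rewrite distrC ger0_norm ?subr_ge0// /L mulrAC ler_pdivlMr//.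
 by rewrite mulrC; exact: key.
 move=> h1 h2; have [le|le] := leP y1 y2; first exact: K.
 rewrite distrC; apply: le_trans (K _ _ h2 h1 (ltW le)).
 apply: le_of_eq; rewrite -[RHS]mul1r -normrN1 -enormZ.
 by congr enorm; apply/funext => i; rewrite mulN1r opprB.
have q1 : 0 < (sqrt (mu1 m))^-1 by rewrite invr_gt0.
have q2 : 0 < (sqrt (mu2 m))^-1 by rewrite invr_gt0.
split; [exists ((sqrt (mu1 m))^-1 * L)|exists ((sqrt (mu2 m))^-1 * L)];
 try exact: mulr_ge0 (ltW _) L0.
 move=> s t hs ht; rewrite distrC -mulrA ler_pdivlMl//; apply: le_trans (key2 s t hs ht).
 have := enorm_ge (fun i => xivec m (upright m (X1 t) (X2 t)) i - xivec m (upright m (X1 s) (X2 s)) i) i41.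
 by rewrite !(xivec_upright hm)/= -mulrBr normrM (gtr0_norm p1).
move=> s t hs ht; rewrite distrC -mulrA ler_pdivlMl//; apply: le_trans (key2 s t hs ht).
have := enorm_ge (fun i => xivec m (upright m (X1 t) (X2 t)) i - xivec m (upright m (X1 s) (X2 s)) i) i42.
by rewrite !(xivec_upright hm)/= -mulrBr normrM (gtr0_norm p2).
Qed.

Let X_cont0 (k : R -> R) e1 : lipon a b k -> 0 < e1 ->
 exists2 d, 0 < d & forall y, 0 <= y -> y < d -> y <= Y -> `|k (rr y) - k (rr 0)| < e1.
Proof.
move=> [L L0 kL] e10; have L1 : 0 < L + 1 by rewrite ltr_wpDl.
pose s := maxr a (b - e1 / (L + 1)); have as_ : a <= s by rewrite le_max lexx.
have sb : s < b by rewrite gt_max ab ltrBlDr ltrDl divr_gt0.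
exists (e s) => [|y y0 ys yY]; first exact: e_gt0.
have Yin : 0 <= (0 : R) <= Y by rewrite lexx ltW.
have yin : 0 <= y <= Y by rewrite y0.
have [rab er] := rrP yin; have [/andP[r0a r0b] er0] := rrP Yin.
have r0E : rr 0 = b.
 by apply/eqP; rewrite eq_le r0b /= leNgt; apply/negP => lt; have := e_gt0 r0a lt; rewrite er0 ltxx.
have sab : a <= s <= b by rewrite as_ ltW.
have bab : a <= b <= b by rewrite lexx ltW.
have sr : s < rr y by apply: (e_lt rab sab); rewrite er.
have /andP[_ rb] := rab.
rewrite r0E (le_lt_trans (kL _ _ rab bab))// ler0_norm ?subr_le0// opprB.
have br : b - rr y < e1 / (L + 1).
 by rewrite ltrBlDr -ltrBlDl; apply: le_lt_trans sr; rewrite le_max lexx orbT.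
apply: (@le_lt_trans _ _ ((L + 1) * (b - rr y))); last by rewrite mulrC -ltr_pdivlMr.
by apply: ler_wpM2r; [rewrite subr_ge0|rewrite lerDl].
Qed.

Let X_cont_gen (k : R -> R) : lipon a b k ->
 (forall d, 0 < d -> d <= Y -> lipon d Y (fun y => k (rr (clamp 0 Y y)))) ->
 continuous (fun y => k (rr (clamp 0 Y y))).
Proof.
move=> kL gL y0; apply: continuous_eps => d1 d10; have [y00|y00] := leP y0 0.
 have [d d0 Hd] := X_cont0 kL d10; exists d => // y yd.
 have -> : clamp 0 Y y0 = 0 by rewrite /clamp; apply/max_idPl; rewrite ge_min y00.
 have /andP[c0 cY] := clamp_itv y (ltW Y0); apply: Hd => //.
 rewrite /clamp gt_max d0 gt_min; apply/orP; left.
 by have := le_lt_trans (ler_norm _) yd; rewrite ltrBlDr => /lt_le_trans; apply; rewrite gerDl.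
pose d := minr (y0 / 2) Y; have d0 : 0 < d by rewrite lt_min Y0 divr_gt0.
have dY : d <= Y by rewrite ge_min lexx orbT.
have C := lipon_near_continuous y0 dY (gL d d0 dY).
have cl y : d <= y -> clamp 0 Y (clamp d Y y) = clamp 0 Y y.
 move=> dy; have y_ge0 : 0 <= y := le_trans (ltW d0) dy; have [yY|Yy] := leP y Y.
 by rewrite (@clamp_id _ d Y y) ?dy.
 have E : forall c, 0 <= c -> c <= Y -> clamp c Y y = Y.
 by move=> c _ cY; rewrite /clamp (min_idPr (ltW Yy)); apply/max_idPr.
 by rewrite !E// ?(ltW d0)// ?(ltW Y0)// clamp_id// (ltW Y0) lexx.
have [n n0 Hn] := eps_continuous (C y0) d10.
have dy0 : d <= y0.
 by rewrite ge_min; apply/orP; left; rewrite ler_pdivrMr// mulr_natr mulr2n lerDl ltW.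
exists (minr n (y0 / 2)) => [|y]; first by rewrite lt_min n0 divr_gt0.
rewrite lt_min => /andP[/Hn H1 H2]; have dy : d <= y.
 rewrite ge_min; apply/orP; left; move: H2; rewrite distrC => /(le_lt_trans (ler_norm _)).
 by rewrite ltrBlDr -ltrBlDl => /ltW; apply: le_trans; rewrite lerBrDr -splitr.
by move: H1; rewrite !cl.
Qed.

Let X1c : continuous X1.
Proof. by apply: X_cont_gen => // d d0 dY; exact: (X_lip d0 dY).1. Qed.
Let X2c : continuous X2.
Proof. by apply: X_cont_gen => // d d0 dY; exact: (X_lip d0 dY).2. Qed.

Let X1_ge0 y : 0 <= X1 y.
Proof.
have cY := clamp_itv y (ltW Y0); have [rab _] := rrP cY.
by rewrite /width_at f0.
Qed.

Let XYE : X1 Y = 0.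
Proof.
have aab : a <= a <= b by rewrite lexx (ltW ab).
by have [] := Xe aab; rewrite -YE fa.
Qed.

(** As long as the width is 0 the curve stays in the collision set, where it cannot move at finite
    action. No action is spent, and the level is still [Y]. *)
Let f_gt0 r : a <= r <= b -> e r < Y -> 0 < f r.
Proof.
move=> rab erY; rewrite lt_def f0// andbT; apply/eqP => fr; have /andP[ar rb] := rab.
have z s : a <= s -> s <= r -> f s = 0.
 move=> as_ sr; apply/le_anti; rewrite -{1}fr fm// f0// as_ (le_trans sr)//.
have cw s t : a <= s -> s <= t -> t <= r -> w s = w t.
 move=> as_ st tr; have tb := le_trans tr rb; apply/eqP/negPn/negP => ne.
 have N0 : 0 < `|sqrt (mu2 m) * (w t - w s)|.
 by rewrite normr_gt0 mulf_eq0 negb_or (gt_eqF p2) subr_eq0 eq_sym.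
 pose N := `|sqrt (mu2 m) * (w t - w s)|; pose A := fine (JM m h s t x).
 have A0 : 0 <= A by rewrite fine_ge0 ?action_ge0.
 pose c := (A + 1) / N; have c0 : 0 < c by rewrite divr_gt0// ltr_wpDl.
 have H := arc_upright_le_action hm st (lipon_sub as_ tb fL) (lipon_sub as_ tb wL) (ltW c0) (h := h).
 have {}H : c * xiD m (x t) (x s) <= A.
 rewrite -lee_fin fineK ?(fin as_ st tb)//; apply: H => u /andP[su ut].
 by rewrite (z u (le_trans as_ su) (le_trans ut tr)) (U_upright0 hm) leey.
 have [_ D] := dist_ge s t; have : c * N <= A by apply: le_trans H; rewrite ler_pM2l.
 by rewrite /c divfK ?gt_eqF// leNgt ltrDl ltr01.
have zA : fine (JM m h a r x) = 0.
 apply/eqP; rewrite eq_le fine_ge0 ?action_ge0// andbT.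
 have [ra|ar'] := eqVneq a r; first by rewrite -ra action_point.
 have {}ar : a < r by rewrite lt_neqAle ar'.
 rewrite -lee_fin fineK ?(fin (lexx a) (ltW ar) rb)//.
 have -> : (0 : R) = (fun=> 0 : R) r - (fun=> 0 : R) a by rewrite subrr.
 apply: (action_le_xi hm ar (lipc_sub (lexx a) rb xL)) => // s t c as_ st tr c0 _.
 rewrite /x (z s as_ (le_trans st tr)) (z t (le_trans as_ st) tr) (cw s t as_ st tr).
 rewrite (_ : enorm _ = 0) ?mulr0 ?subrr// /enorm big1 ?sqrtr0// => i _.
 by rewrite subrr expr0n.
have := alD (lexx a) ar rb; rewrite zA add0r => E.
by move: erY; rewrite YE -(@ltr_pXn2r _ 8) ?nnegrE ?e0// !e8 E ltxx.
Qed.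

Let X_good y : 0 < y -> y < Y -> 0 < X1 y /\ h < upright_U m (X1 y) (X2 y).
Proof.
move=> y0 yY; have yin : 0 <= y <= Y by rewrite !ltW.
have [r [rab er -> ->]] := Xr yin; have fr : 0 < f r by apply: f_gt0 => //; rewrite er.
split=> //; have /andP[ar rb] := rab; have rb' : r < b.
 by rewrite lt_neqAle rb andbT; apply/eqP => E; move: y0; rewrite -er E eb ltxx.
have rab' : a <= r < b by rewrite ar.
by have := lm_before xm rab'; rewrite /x (U_upright hm m12 _ fr) lte_fin.
Qed.

(* Newton's time elapses at the rate [1 / (sqrt 2 (U - h))] with respect to the
 action; this form of the rate makes sense at collisions. *)
Definition pace u v : R := u / (sqrt 2 *
 (m b1 * m b2 + 2 * (m b1 * m b3) * (u / sqrt (v ^+ 2 + u ^+ 2 / 4)) - h * u)).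

Let s2 : 0 < sqrt 2 :> R. Proof. by rewrite sqrtr_gt0. Qed.

Let rad_gt0 (u v : R) : 0 < u -> 0 < sqrt (v ^+ 2 + u ^+ 2 / 4).
Proof. by move=> u0; rewrite sqrtr_gt0 ltr_wpDl ?sqr_ge0// divr_gt0// exprn_gt0. Qed.
Lemma paceE (u v : R) : 0 < u -> h < upright_U m u v -> pace u v = (sqrt 2 * (upright_U m u v - h))^-1.
Proof.
move=> u0 hU; have r0 := rad_gt0 v u0; rewrite /pace.
have -> : m b1 * m b2 + 2 * (m b1 * m b3) * (u / sqrt (v ^+ 2 + u ^+ 2 / 4)) - h * u =
 u * (upright_U m u v - h) by rewrite /upright_U; field; rewrite !gt_eqF.
have : 0 < upright_U m u v - h by rewrite subr_gt0.
by move: (upright_U m u v - h) => F F0; field; rewrite !gt_eqF.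
Qed.

Definition time_density y : R := 8 * clamp 0 Y y ^+ 7 * pace (X1 y) (X2 y).
Local Notation rho := time_density.

Let rho_gt0 y : 0 < y < Y -> 0 < rho y.
Proof.
move=> /andP[y0 yY]; have [X0 XU] := X_good y0 yY.
rewrite /time_density clamp_id ?(ltW y0) ?(ltW yY)// paceE// mulr_gt0//.
 by rewrite mulr_gt0// exprn_gt0.
by rewrite invr_gt0 mulr_gt0// subr_gt0.
Qed.

(** At level 0 the lower bound of the rate gives [rho y <= C y]. At the level [Y] of the initial
    collision the pace is bounded by a multiple of the width, which tends to 0. In between all
    factors are continuous. *)
Let rho_cont : continuous rho.
Proof.
have cc : continuous (clamp 0 Y).
 move=> y; apply: continuous_eps => d d0; exists d => // z zd.
 exact: le_lt_trans (clamp_lipschitz _ _ _ _) zd.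
have m12p : 0 < m b1 * m b2 := mulr_gt0 (hm _) (hm _).
have m13p : 0 < m b1 * m b3 := mulr_gt0 (hm _) (hm _).
move=> y0; have [y00|y00] := leP y0 0.
 have [k k0 Hk] := rate; pose C := 8 / (sqrt 2 * k).
 have sk : 0 < sqrt 2 * k := mulr_gt0 s2 k0.
 have C0 : 0 < C by rewrite divr_gt0.
 have c0 y : y <= 0 -> rho y = 0.
 move=> yle; rewrite /time_density (_ : clamp 0 Y y = 0) ?expr0n ?mulr0 ?mul0r//.
 by rewrite /clamp; apply/max_idPl; rewrite ge_min yle.
 apply: continuous_eps => d d0; exists (minr Y (d / C)) => [|y]; first by rewrite lt_min Y0 divr_gt0.
 rewrite lt_min (c0 y0 y00) subr0 => /andP[h1 h2]; have [yle|ygt] := leP y 0.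
 by rewrite c0// normr0.
 have yy : y <= y - y0 by rewrite lerDl oppr_ge0.
 have ltY : y < Y by apply: le_lt_trans yy (le_lt_trans (ler_norm _) h1).
 have ltd : y < d / C by apply: le_lt_trans yy (le_lt_trans (ler_norm _) h2).
 have yin : 0 < y < Y by rewrite ygt.
 rewrite gtr0_norm ?rho_gt0//; apply: le_lt_trans (_ : C * y < d); last by rewrite mulrC -ltr_pdivlMr.
 have [X0 XU] := X_good ygt ltY; have yin' : 0 <= y <= Y by rewrite !ltW.
 rewrite /time_density (clamp_id yin') (paceE X0 XU) ler_pdivrMr ?mulr_gt0 ?subr_gt0//.
 have := Hk y yin'; rewrite (U_upright hm m12 _ X0) lee_fin -lerBrDr => HF.
 apply: (@le_trans _ _ (C * y * (sqrt 2 * (k * y ^+ 6)))); last first.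
 by apply: ler_wpM2l; [exact: mulr_ge0 (ltW C0) (ltW ygt)|rewrite ler_pM2l].
 apply: le_of_eq; rewrite /C; move: (sqrt 2) s2 => r r0; field.
 by rewrite !gt_eqF.
have [Yy0|y0Y] := leP Y y0.
 have cY : clamp 0 Y y0 = Y by rewrite /clamp (min_idPr Yy0); apply/max_idPr; exact: ltW.
 have XyE : X1 y0 = 0.
 rewrite -XYE /width_at cY clamp_id// (ltW Y0) lexx //.
 have z0 : rho y0 = 0 by rewrite /time_density XyE /pace mul0r mulr0.
 pose C := 8 * Y ^+ 7 * (2 / (sqrt 2 * (m b1 * m b2))).
 have YC : 0 < 8 * Y ^+ 7 by rewrite mulr_gt0// exprn_gt0.
 have sm : 0 < sqrt 2 * (m b1 * m b2) := mulr_gt0 s2 m12p.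
 have C0 : 0 < C by rewrite mulr_gt0// divr_gt0.
 apply: continuous_eps => d d0.
 pose e1 := minr (m b1 * m b2 / (2 * h)) (d / C).
 have e10 : 0 < e1 by rewrite lt_min !divr_gt0// mulr_gt0.
 have [n n0 Hn] := eps_continuous (X1c (x := y0)) e10; exists n => // y /Hn.
 rewrite XyE z0 !subr0 ger0_norm// lt_min => /andP[h1 h2].
 have hX : h * X1 y <= m b1 * m b2 / 2.
 move: h1; rewrite ltr_pdivlMr ?mulr_gt0// => h1; rewrite ler_pdivlMr// ltW//.
 by apply: le_lt_trans h1; apply: le_of_eq; ring.
 have D0 : m b1 * m b2 / 2 <= m b1 * m b2 +
 2 * (m b1 * m b3) * (X1 y / sqrt (X2 y ^+ 2 + X1 y ^+ 2 / 4)) - h * X1 y.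
 have : 0 <= 2 * (m b1 * m b3) * (X1 y / sqrt (X2 y ^+ 2 + X1 y ^+ 2 / 4)).
 exact: mulr_ge0 (mulr_ge0 (ler0n _ 2) (ltW m13p)) (divr_ge0 (X1_ge0 y) (sqrtr_ge0 _)).
 by move=> H; rewrite lerBrDr; apply: le_trans (lerD (lexx _) hX) _; rewrite -splitr lerDl.
 have D1 : 0 < m b1 * m b2 / 2 by rewrite divr_gt0.
 have D2 := lt_le_trans D1 D0.
 have P0 : 0 <= pace (X1 y) (X2 y).
 by rewrite /pace divr_ge0// ltW// mulr_gt0.
 have PC : pace (X1 y) (X2 y) <= 2 / (sqrt 2 * (m b1 * m b2)) * X1 y.
 rewrite /pace [leRHS]mulrC ler_wpM2l// -[2 / _]invrK invf_div lef_pV2 ?posrE//.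
 - by rewrite -(mulrA (sqrt 2)) ler_pM2l.
 - by rewrite mulr_gt0.
 - by rewrite -mulrA mulr_gt0.
 have /andP[cl0 clY] := clamp_itv y (ltW Y0).
 have cl7 : 0 <= 8 * clamp 0 Y y ^+ 7 by rewrite mulr_ge0// exprn_ge0.
 rewrite ger0_norm; last exact: mulr_ge0.
 apply: (@le_lt_trans _ _ (C * X1 y)); last by rewrite mulrC -ltr_pdivlMr.
 rewrite /time_density /C -(mulrA (8 * Y ^+ 7)); apply: ler_pM => //.
 by rewrite ler_pM2l// lerXn2r ?nnegrE ?(ltW Y0).
have [X0 XU] := X_good y00 y0Y; have r0 := rad_gt0 (X2 y0) X0.
have X1cy : X1 y @[y --> y0] --> X1 y0 by exact: X1c.
have X2cy : X2 y @[y --> y0] --> X2 y0 by exact: X2c.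
have ccy : clamp 0 Y y @[y --> y0] --> clamp 0 Y y0 by exact: cc.
have ex (g : R -> R) n (l : R) : g y @[y --> y0] --> l -> g y ^+ n @[y --> y0] --> l ^+ n.
 by move=> gl; apply: (cvg_comp g (fun v => v ^+ n) gl); exact: exprn_continuous.
apply: cvgM; first by apply: cvgM; [exact: cvg_cst|exact: ex].
apply: cvgM => //; apply: cvgV.
 have -> : m b1 * m b2 + 2 * (m b1 * m b3) * (X1 y0 / sqrt (X2 y0 ^+ 2 + X1 y0 ^+ 2 / 4)) - h * X1 y0 =
 X1 y0 * (upright_U m (X1 y0) (X2 y0) - h) by rewrite /upright_U; field; rewrite !gt_eqF.
 by rewrite !mulf_neq0 ?gt_eqF// subr_gt0.
apply: cvgM; first exact: cvg_cst.
apply: cvgB; last by apply: cvgM => //; exact: cvg_cst.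
apply: cvgD; first exact: cvg_cst.
apply: cvgM; first exact: cvg_cst.
apply: cvgM => //; apply: cvgV; first by rewrite gt_eqF.
apply: (cvg_comp _ (@sqrt R) _ (@sqrt_continuous R _)).
apply: cvgD; first exact: ex.
by apply: cvgM; [exact: ex|exact: cvg_cst].
Qed.

(** In Newtonian time the action counted from the brake instant is [psi^8], with derivative
    [8 psi^7 / rho = sqrt 2 (U - h)]; the density [rho] was defined for that purpose. *)
Lemma timed_orbit : exists (T : R) (W1 W2 A tau : R -> R),
 [/\ 0 < T /\ (0 < W1 0 /\ upright_U m (W1 0) (W2 0) = h), timed m h T W1 W2 A,
 continuous (fun r => tau (clamp a b r)) /\
 (forall r s, a <= r -> r <= s -> s <= b -> tau s <= tau r),
 tau a = T /\ tau b = 0 &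
 forall r, a <= r <= b -> [/\ 0 <= tau r <= T, W1 (tau r) = f r & W2 (tau r) = w r]].
Proof.
have [th [psi [T [T0 [th0 thY] [thc mono] [psiP psiK] dpsi]]]] := change_of_time rho_cont Y0 rho_gt0.
have monole y1 y2 : 0 <= y1 -> y1 <= y2 -> y2 <= Y -> th y1 <= th y2.
 by move=> y10; rewrite le_eqVlt => /predU1P[->//|y12] y2Y; apply/ltW/mono.
have psim s t : 0 <= s -> s <= t -> t <= T -> psi s <= psi t.
 move=> s0 st tT; rewrite leNgt; apply/negP => lt.
 have sin : 0 <= s <= T by rewrite s0 (le_trans st).
 have tin : 0 <= t <= T by rewrite tT (le_trans s0).
 have [/andP[u1 u2] u3] := psiP _ sin; have [/andP[v1 v2] v3] := psiP _ tin.
 by have := mono _ _ v1 lt u2; rewrite u3 v3 ltNge st.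
have Yin0 : 0 <= (0 : R) <= Y by rewrite lexx ltW.
have psi0 : psi 0 = 0 by rewrite -{1}th0 psiK.
pose W1 s := X1 (psi s); pose W2 s := X2 (psi s).
pose A : R -> R := psi ^+ 8; have AE s : A s = psi s ^+ 8 by rewrite /A exprfctE.
pose tau r := th (e r).
have bab : a <= b <= b by rewrite lexx ltW.
have [f0E w0E] : W1 0 = f b /\ W2 0 = w b by rewrite /W1 /W2 psi0 -eb; exact: Xe.
have fb0 : 0 < f b.
 rewrite lt_def f0// andbT; apply/eqP => fb; have := lm_end xm.
 by rewrite /x fb (U_upright0 hm).
have good s : 0 < s < T -> 0 < W1 s /\ h < upright_U m (W1 s) (W2 s).
 by move=> /dpsi[/andP[h1 h2] _]; exact: X_good.
have psic s : 0 <= s < T -> {for s, continuous (fun r => psi `|r|)}.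
 move=> /andP[s0 sT]; apply: continuous_eps => d d0.
 move: s0; rewrite le_eqVlt => /predU1P[<-|s0].
 pose y := minr (d / 2) Y; have y0 : 0 < y by rewrite lt_min Y0 divr_gt0.
 have yY : y <= Y by rewrite ge_min lexx orbT.
 have yd : y < d by rewrite gt_min; apply/orP; left; rewrite ltr_pdivrMr// mulr_natr mulr2n ltrDl.
 exists (th y) => [|r]; first by rewrite -th0; exact: mono.
 rewrite subr0 normr0 psi0 subr0 => rt; have rT : `|r| <= T.
 by rewrite (le_trans (ltW rt))// -thY; apply: monole => //; exact: ltW.
 have rin : 0 <= `|r| <= T by rewrite normr_ge0.
 have [/andP[u1 u2] u3] := psiP _ rin; rewrite ger0_norm//; apply: lt_trans yd.
 rewrite ltNge; apply/negP => le; have := monole _ _ (ltW y0) le u2.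
 by rewrite u3 leNgt rt.
 have sin : 0 < s < T by rewrite s0.
 have [_ ds] := dpsi s sin; have [n n0 Hn] := eps_continuous (is_derive_continuous ds) d0.
 exists n => // r rs; rewrite (gtr0_norm s0); apply: Hn.
 by rewrite -{1}(gtr0_norm s0); exact: le_lt_trans (ler_dist_dist _ _) rs.
exists T, W1, W2, A, tau; split.
- split=> //; rewrite f0E w0E; split=> //; have := lm_end xm.
 by rewrite /x (U_upright hm m12 _ fb0) => E; exact: (EFin_inj E).
- split; first exact: good.
- move=> s hs; split.
 apply: (@continuous_comp _ _ _ (fun r => psi `|r|) X1); [exact: psic|exact: X1c].
 apply: (@continuous_comp _ _ _ (fun r => psi `|r|) X2); [exact: psic|exact: X2c].
- move=> s hs; have [W0 WU] := good s hs; have [/andP[z0 zY] ds] := dpsi s hs.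
 have dA := is_deriveX 7 ds; apply: is_derive_eq.
 rewrite /GRing.scale /= /orbit_rate /time_density clamp_id ?(ltW z0) ?(ltW zY)// -/(W1 s) -/(W2 s) paceE//.
 have F0 : 0 < upright_U m (W1 s) (W2 s) - h by rewrite subr_gt0.
 move: (upright_U m (W1 s) (W2 s) - h) F0 (sqrt 2) s2 => F F0 r r0.
 by rewrite -[_ *+ _]mulr_natl; field; rewrite !gt_eqF.
- move=> s t c s0 st tT c0 Hc; rewrite !AE.
 have sin : 0 <= s <= T by rewrite (ltW s0) (le_trans st)// ltW.
 have tin : 0 <= t <= T by rewrite (le_trans (ltW s0) st) ltW.
 have [/andP[u1 u2] u3] := psiP _ sin; have [/andP[v1 v2] v3] := psiP _ tin.
 apply: (arcX u1 (psim _ _ (ltW s0) st (ltW tT)) v2 c0) => y /andP[sy yt].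
 have y0 := le_trans u1 sy; have yY := le_trans yt v2.
 have yin : 0 <= y <= Y by rewrite y0.
 have hs : s <= th y <= t by have := monole _ _ u1 sy yY; have := monole _ _ y0 yt v2; rewrite u3 v3 => -> ->.
 have ths : 0 < th y < T by case/andP: hs => h1 h2; rewrite (lt_le_trans s0 h1) (le_lt_trans h2).
 have [X0 _] := good _ ths; rewrite /W1 psiK// in X0.
 rewrite (U_upright hm m12 _ X0) lee_fin -lerBrDr.
 by have := Hc _ hs; rewrite /orbit_rate /W1 /W2 psiK.
- move=> s t c d z s0 st tT cd zL zc zd; rewrite !AE.
 have sin : 0 <= s <= T by rewrite (ltW s0) (le_trans st)// ltW.
 have tin : 0 <= t <= T by rewrite (le_trans (ltW s0) st) ltW.
 have [/andP[u1 u2] u3] := psiP _ sin; have [/andP[v1 v2] v3] := psiP _ tin.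
 exact: (minX u1 (psim _ _ (ltW s0) st (ltW tT)) v2 cd zL zc zd).
- split=> [r|r s ar rs sb].
 apply: (@continuous_comp _ _ _ (fun r => e (clamp a b r)) th); first exact: e_cont.
 exact: thc.
 have /andP[h1 h2] : 0 <= e r <= Y by apply: eY; rewrite ar (le_trans rs).
 by apply: monole; [exact: e0|exact: e_mono|].
- by rewrite /tau -YE eb.
- move=> r rab; have /andP[h1 h2] := eY rab; have [<- <-] := Xe rab.
 by rewrite /W1 /W2 /tau psiK ?h1// -th0 -thY !monole.
Qed.
End ActionParameter.

Section DerivativeRules.
Variable R : realType.
Implicit Types (f g : R -> R) (s a b : R).

Lemma derV f s a : f s != 0 -> is_derive s 1 f a -> is_derive s 1 (fun r => (f r)^-1) (- a / f s ^+ 2).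
Proof.
move=> f0 fa; have H := is_deriveV f0 fa; apply: (is_derive_eq H).
by rewrite /GRing.scale /=; field.
Qed.

Lemma derSqrtV f s a : 0 < f s -> is_derive s 1 f a ->
 is_derive s 1 (fun r => (sqrt (f r))^-1) (- a / (2 * sqrt (f s) ^+ 3)).
Proof.
move=> f0 fa; have S := is_derive1_comp (is_derive1_sqrt f0) fa.
have r0 : 0 < sqrt (f s) by rewrite sqrtr_gt0.
have H : is_derive s 1 (fun r => sqrt (f r)) ((2 * sqrt (f s))^-1 * a) by exact: S.
by apply: (is_derive_eq (derV _ H)); [rewrite gt_eqF|field; rewrite gt_eqF].
Qed.
End DerivativeRules.

(** * First variation of the action by tent-shaped perturbations *)

Section UprightGradient.
Variables (R : realType) (m : 'I_3 -> R).
Implicit Types (u w : R).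

Definition hyp u w : R := sqrt (w ^+ 2 + u ^+ 2 / 4).

Definition upright_Uu u w : R :=
 - (m b1 * m b2 / u ^+ 2) - m b1 * m b3 * u / (2 * hyp u w ^+ 3).
Definition upright_Uw u w : R := - (2 * (m b1 * m b3) * w / hyp u w ^+ 3).

Lemma rad_gt0 u w : 0 < u -> 0 < w ^+ 2 + u ^+ 2 / 4.
Proof. by move=> u0; rewrite ltr_wpDl ?sqr_ge0// divr_gt0// exprn_gt0. Qed.
Lemma hyp_gt0 u w : 0 < u -> 0 < hyp u w.
Proof. by move=> u0; rewrite sqrtr_gt0 rad_gt0. Qed.
Lemma der_upright_U (f g : R -> R) s df dg : 0 < f s -> is_derive s 1 f df -> is_derive s 1 g dg ->
 is_derive s 1 (fun r => upright_U m (f r) (g r))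
 (upright_Uu (f s) (g s) * df + upright_Uw (f s) (g s) * dg).
Proof.
move=> f0 Df Dg; have r0 := rad_gt0 (g s) f0; have h0 := hyp_gt0 (g s) f0.
have f0' : f s != 0 by rewrite gt_eqF.
have H1 := isdZ (m b1 * m b2) (derV f0' Df).
have H2 := isdZ (2 * (m b1 * m b3)) (@derSqrtV _ (fun r => g r ^+ 2 + f r ^+ 2 / 4) s _ r0
 (isdD (isdX2 Dg) (isdM (isdX2 Df) (isd_cst s 4^-1)))).
apply: (is_derive_eq (isdD H1 H2)); rewrite /upright_Uu /upright_Uw -/(hyp (f s) (g s)).
by field; rewrite f0' gt_eqF.
Qed.

Section Limits.
Variables (T : Type) (F : set_system T) (FF : Filter F) (f g : T -> R) (u w : R).
Hypotheses (fu : f x @[x --> F] --> u) (gw : g x @[x --> F] --> w) (u0 : 0 < u).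

Let ex (k : T -> R) n (l : R) : k x @[x --> F] --> l -> k x ^+ n @[x --> F] --> l ^+ n.
Proof. by move=> kl; apply: (cvg_comp k (fun v : R => v ^+ n) kl); exact: exprn_continuous. Qed.
Lemma cvg_hyp : hyp (f x) (g x) @[x --> F] --> hyp u w.
Proof.
apply: (cvg_comp _ (@sqrt R) _ (@sqrt_continuous R _)).
by apply: cvgD; [exact: ex|apply: cvgM; [exact: ex|exact: cvg_cst]].
Qed.

Lemma cvg_upright_U : upright_U m (f x) (g x) @[x --> F] --> upright_U m u w.
Proof.
apply: cvgD; apply: cvgM; do ?exact: cvg_cst; apply: cvgV => //; first by rewrite gt_eqF.
 by rewrite gt_eqF// hyp_gt0.
exact: cvg_hyp.
Qed.

Lemma cvg_upright_Uu : upright_Uu (f x) (g x) @[x --> F] --> upright_Uu u w.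
Proof.
apply: cvgB.
 apply: cvgN; apply: cvgM; first exact: cvg_cst.
 by apply: cvgV; [rewrite gt_eqF// exprn_gt0|exact: ex].
apply: cvgM; first by apply: cvgM => //; exact: cvg_cst.
apply: cvgV; first by rewrite gt_eqF// mulr_gt0// exprn_gt0// hyp_gt0.
by apply: cvgM; [exact: cvg_cst|apply: ex; exact: cvg_hyp].
Qed.

Lemma cvg_upright_Uw : upright_Uw (f x) (g x) @[x --> F] --> upright_Uw u w.
Proof.
apply: cvgN; apply: cvgM; first by apply: cvgM => //; exact: cvg_cst.
by apply: cvgV; [rewrite gt_eqF// exprn_gt0// hyp_gt0|apply: ex; exact: cvg_hyp].
Qed.
End Limits.

Lemma pair_eps (k : R -> R -> R) u w e : 0 < e ->
 (forall (T : Type) (F : set_system T) (FF : Filter F) (f g : T -> R),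
 f x @[x --> F] --> u -> g x @[x --> F] --> w -> k (f x) (g x) @[x --> F] --> k u w) ->
 exists2 d, 0 < d & forall u' w', `|u' - u| < d -> `|w' - w| < d -> `|k u' w' - k u w| < e.
Proof.
move=> e0 H.
have K : k p.1 p.2 @[p --> ((u, w) : R * R)] --> k u w.
 by apply: (H _ (nbhs ((u, w) : R * R))); [exact: cvg_fst|exact: cvg_snd].
move/cvgrPdist_lt : K => /(_ e e0)/nbhs_ballP[d /= d0 Hd].
by exists d => // u' w' h1 h2; rewrite distrC; apply: (Hd (u', w')); split; rewrite /ball/= distrC.
Qed.

(** A one-sided first order expansion with the gradient frozen at [(u0, w0)], uniform for nearby
    [(u, w)]: mean value theorem and continuity of the gradient. *)
Lemma upright_U_step u0 w0 du dw h d : 0 < u0 -> h < upright_U m u0 w0 -> `|du| <= 1 -> `|dw| <= 1 -> 0 < d ->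
 exists2 r, 0 < r & forall u w e, `|u - u0| < r -> `|w - w0| < r -> 0 <= e < r ->
 [/\ 0 < u, 0 < u + e * du, h < upright_U m (u + e * du) (w + e * dw) &
 upright_U m (u + e * du) (w + e * dw) <= upright_U m u w +
 e * (upright_Uu u0 w0 * du + upright_Uw u0 w0 * dw + d)].
Proof.
move=> u00 hU du1 dw1 d0; have d2 : 0 < d / 2 by rewrite divr_gt0.
have [r1 r10 H1] := @pair_eps upright_Uu u0 w0 _ d2 (fun T F FF f g fu gw => cvg_upright_Uu FF fu gw u00).
have [r2 r20 H2] := @pair_eps upright_Uw u0 w0 _ d2 (fun T F FF f g fu gw => cvg_upright_Uw FF fu gw u00).
have hU0 : 0 < upright_U m u0 w0 - h by rewrite subr_gt0.
have [r3 r30 H3] := @pair_eps (upright_U m) u0 w0 _ hU0 (fun T F FF f g fu gw => cvg_upright_U FF fu gw u00).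
pose q := minr u0 (minr r1 (minr r2 r3)); have q0 : 0 < q by rewrite !lt_min u00 r10 r20.
exists (q / 2) => [|u w e hu hw /andP[e0 eq]]; first by rewrite divr_gt0.
have near c : 0 <= c -> c <= e -> `|u + c * du - u0| < q /\ `|w + c * dw - w0| < q.
 move=> c0 ce; have K z v v0 : `|z| <= 1 -> `|v - v0| < q / 2 -> `|v + c * z - v0| < q.
 move=> z1 hv; rewrite addrAC (le_lt_trans (ler_normD _ _))// [ltRHS]splitr ltr_leD//.
 rewrite normrM (ger0_norm c0) (le_trans _ (ltW eq))// (le_trans _ ce)//.
 by rewrite ler_piMr.
 by split; exact: K.
have pos c : 0 <= c -> c <= e -> 0 < u + c * du.
 move=> c0 ce; have [+ _] := near c c0 ce; rewrite lt_min => /andP[+ _].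
 by rewrite distrC => /(le_lt_trans (ler_norm _)); rewrite ltrBlDr ltrDl.
have p0 := pos 0 (lexx 0) e0; rewrite mul0r addr0 in p0.
split; [exact: p0|exact: pos| |].
 have [n1 n2] := near e e0 (lexx e); have := H3 (u + e * du) (w + e * dw).
 move: n1 n2; rewrite !lt_min => /and4P[_ _ _ ->] /and4P[_ _ _ ->] /(_ isT isT).
 by rewrite distrC => H; have := le_lt_trans (ler_norm _) H; rewrite ltrD2l ltrN2.
move: e0; rewrite le_eqVlt => /predU1P[<-|e0]; first by rewrite !mul0r !addr0.
have [|c /andP[c0 ce]] := @MVT_mean _ (fun c => upright_U m (u + c * du) (w + c * dw))
 (fun c => upright_Uu (u + c * du) (w + c * dw) * du + upright_Uw (u + c * du) (w + c * dw) * dw) 0 e e0.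
 move=> c /andP[c0 ce]; apply: der_upright_U; first exact: pos.
 by apply: (is_derive_eq (isdD (isd_cst c u) (isdM (isd_id c) (isd_cst c du)))); rewrite mul1r mulr0 addr0 add0r.
 by apply: (is_derive_eq (isdD (isd_cst c w) (isdM (isd_id c) (isd_cst c dw)))); rewrite mul1r mulr0 addr0 add0r.
rewrite !mul0r !addr0 subr0 => /eqP; rewrite subr_eq => /eqP ->.
rewrite addrC lerD2l mulrC ler_pM2l//.
have [n1 n2] := near c (ltW c0) (ltW ce).
have h1 := H1 (u + c * du) (w + c * dw); have h2 := H2 (u + c * du) (w + c * dw).
move: n1 n2; rewrite !lt_min => /and4P[_ n1 n2 _] /and4P[_ n3 n4 _].
have {}h1 := h1 n1 n3; have {}h2 := h2 n2 n4.
have K (x y z : R) : `|x - y| < d / 2 -> `|z| <= 1 -> x * z <= y * z + d / 2.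
 move=> xy z1; rewrite -lerBlDl -mulrBl (le_trans (ler_norm _))// normrM.
 by rewrite -[leRHS]mulr1 ler_pM// ltW.
by rewrite [d]splitr addrACA; apply: lerD; exact: K.
Qed.
End UprightGradient.

Section Reversal.
Variables (R : realType) (m : 'I_3 -> R) (h : R).
Hypothesis hm : posm m.

Lemma lipon_reverse (c d : R) (f : R -> R) : lipon c d f -> lipon (- d) (- c) (fun r => f (- r)).
Proof.
move=> [L L0 fL]; exists L => // s t hs ht.
have -> : s - t = - (- s - - t) by ring.
by rewrite normrN; apply: fL; rewrite lerNr lerNl andbC.
Qed.

Lemma lipschitz_reverse (c d : R) z : lipc c d z -> lipc (- d) (- c) (fun r => z (- r)).
Proof.
move=> /lipcP zL; apply/lipcP => i; have [h1 h2] := zL i.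
by split; [exact: (lipon_reverse h1)|exact: (lipon_reverse h2)].
Qed.

(** Perturbations are written in the time that runs back from the brake instant, while [td_min]
    compares curves run in the original direction. *)
Lemma action_reverse_le (c d : R) z : c <= d -> lipc c d z ->
 (JM m h (- d) (- c) (fun r => z (- r)%R) <= JM m h c d z)%E.
Proof.
rewrite le_eqVlt => /predU1P[<- _|cd zL]; first by rewrite !action_point.
have [zfin|] := ltP (JM m h c d z) +oo%E; last exact: le_trans (leey _).
have fin s t : c <= s -> s <= t -> t <= d -> JM m h s t z \is a fin_num.
 by move=> *; exact: (action_fin hm zL zfin).
pose D s := - fine (JM m h c (- s) z).
have DB u v : - d <= u -> u <= v -> v <= - c -> D v - D u = fine (JM m h (- v) (- u) z).
 move=> du uv vc; have h1 : c <= - v by rewrite lerNr.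
 have h2 : - v <= - u by rewrite lerN2. have h3 : - u <= d by rewrite lerNl.
 have E : fine (JM m h c (- u) z) =
 fine (JM m h c (- v) z) + fine (JM m h (- v) (- u) z).
 rewrite (action_cat h hm h1 h2 (lipc_sub (lexx c) h3 zL)).
 exact: fineD (fin _ _ (lexx c) h1 (le_trans h2 h3)) (fin _ _ h1 h2 h3).
 by rewrite /D E opprK addKr.
have cd' : - d < - c by rewrite ltrN2.
have -> : JM m h c d z = (D (- c) - D (- d))%:E.
 by rewrite DB ?lexx ?(ltW cd')// !opprK fineK// fin// ltW.
apply: (action_le_hopf hm cd' (lipschitz_reverse zL)) => [u v du uv vc|u v k du uv vc k0 Hk].
 by rewrite -subr_ge0 DB// fine_ge0// action_ge0.
have h1 : c <= - v by rewrite lerNr.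
have h2 : - v <= - u by rewrite lerN2. have h3 : - u <= d by rewrite lerNl.
rewrite DB// -lee_fin fineK ?fin//.
rewrite (_ : enorm _ = hopfD m (z (- u)) (z (- v))).
 apply: arc_hopf_le_action; [exact: hm|exact: h2|exact: lipc_sub h1 h3 zL|exact: ltW|].
 by move=> w /andP[w1 w2]; have := Hk (- w); rewrite opprK; apply; rewrite lerNr w2 lerNl w1.
rewrite -[RHS]mul1r -normrN1 -enormZ; congr enorm; apply/funext => i.
by rewrite mulN1r opprB.
Qed.
End Reversal.

Lemma sqrt2_gt0 (R : realType) : 0 < sqrt 2 :> R. Proof. by rewrite sqrtr_gt0. Qed.

Lemma sqr_enorm_upright (R : realType) (m : 'I_3 -> R) (hm : posm m) (u w u' w' : R) :
 xiD m (upright m u' w') (upright m u w) ^+ 2 =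
 mu1 m * (u' - u) ^+ 2 + mu2 m * (w' - w) ^+ 2.
Proof.
rewrite sqr_enorm !(xivec_upright hm) !big_ord_recl big_ord0 /= !subrr expr0n /= !addr0 !add0r.
by rewrite -!mulrBr !exprMn (sqr_sqrtr (ltW (mu1_gt0 hm))) (sqr_sqrtr (ltW (mu2_gt0 hm))).
Qed.

(** Near [a = phi] the inequality [2 a <= a^2 / phi + phi] is almost an equality; the error is
    linear in [nu]. *)
Lemma quad_gap (R : realType) (a phi nu : R) : 0 < phi -> 0 <= nu -> nu <= phi / 2 -> `|a - phi| <= nu ->
 a ^+ 2 / (phi - nu) + phi <= 2 * a + 5 * nu.
Proof.
move=> f0 n0 nf; rewrite ler_norml => /andP[a1 a2].
have p : 0 < phi - nu by clear -f0 n0 nf; lra.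
rewrite -lerBrDr ler_pdivrMr//; clear -f0 n0 nf a1 a2; nra.
Qed.

Section TimedOrbit.
Variables (R : realType) (m : 'I_3 -> R) (h T : R) (W1 W2 A : R -> R).
Hypotheses (hm : posm m) (td : timed m h T W1 W2 A).

Lemma rate_gt0 s : 0 < s < T -> 0 < orbit_rate m h W1 W2 s.
Proof. by move=> /(td_good td)[_ hF]; rewrite subr_gt0. Qed.
Lemma orbit_continuous s : 0 < s < T -> {for s, continuous W1} /\ {for s, continuous W2}.
Proof.
move=> /andP[s0 sT]; have hs : 0 <= s < T by rewrite ltW.
have [c1 c2] := td_cont td hs; have K (k : R -> R) : {for s, continuous (fun r => k `|r|)} -> {for s, continuous k}.
 move=> kc; apply: continuous_eps => e e0; have [d d0 Hd] := eps_continuous kc e0.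
 exists (minr d s) => [|r]; first by rewrite lt_min d0.
 rewrite lt_min => /andP[h1 h2]; have r0 : 0 < r.
 by move: h2; rewrite distrC => h2; have := le_lt_trans (ler_norm _) h2; rewrite ltrBlDr ltrDl.
 by have := Hd r h1; rewrite (gtr0_norm r0) (gtr0_norm s0).
by split; exact: K.
Qed.

Lemma rate_continuous s :
 0 < s < T -> {for s, continuous (orbit_rate m h W1 W2)}.
Proof.
move=> hs; have [c1 c2] := orbit_continuous hs; have [W0 _] := td_good td hs.
apply: cvgB; last exact: cvg_cst.
by apply: cvg_upright_U; [exact: c1|exact: c2|exact: W0].
Qed.

Lemma action_mean s t : 0 < s -> s < t -> t < T ->
 exists2 c, s < c < t & A t - A s = sqrt 2 * orbit_rate m h W1 W2 c * (t - s).
Proof.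
move=> s0 st tT; apply: (@MVT_mean _ A (fun c => sqrt 2 * orbit_rate m h W1 W2 c)) => // r /andP[sr rt].
by apply: (td_der td); rewrite (lt_le_trans s0) ?(le_lt_trans rt).
Qed.

Lemma rate_bounds
 (s0 t0 : R) (s00 : 0 < s0) (st0 : s0 < t0) (t0T : t0 < T) : exists f M, [/\ 0 < f, 0 < M & forall r, s0 <= r <= t0 -> f <= orbit_rate m h W1 W2 r <= M].
Proof.
pose F := orbit_rate m h W1 W2.
have inT r : s0 <= r <= t0 -> 0 < r < T.
 by move=> /andP[h1 h2]; rewrite (lt_le_trans s00 h1) (le_lt_trans h2).
have F_within : {within `[s0, t0], continuous F}.
 apply: continuous_in_subspaceT => r; rewrite inE/= in_itv/= => hr.
 by apply: (rate_continuous); exact: inT.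
have [c1] := EVT_min (ltW st0) F_within; rewrite in_itv/= => h1 H1.
have [c2] := EVT_max (ltW st0) F_within; rewrite in_itv/= => h2 H2.
exists (F c1), (F c2); split; [exact: (rate_gt0 (inT _ h1))|exact: (rate_gt0 (inT _ h2))|].
by move=> r hr; rewrite H1 ?H2 ?in_itv.
Qed.

(** Where the rate lies between [f] and [M], the action grows at most by [sqrt 2 M] per unit of time
    and the weight is at least [sqrt f], so a chord is at most [sqrt 2 M / sqrt f] times the elapsed
    time. *)
Lemma lipon_orbit
 (s0 t0 : R) (s00 : 0 < s0) (st0 : s0 < t0) (t0T : t0 < T) : lipon s0 t0 W1 /\ lipon s0 t0 W2.
Proof.
have s2 := sqrt2_gt0 R; have p1 := mu1_gt0 hm; have p2 := mu2_gt0 hm.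
have [f [M [f0 M0 HF]]] := rate_bounds s00 st0 t0T; have sf : 0 < sqrt f by rewrite sqrtr_gt0.
have sf2 : sqrt f ^+ 2 = f := sqr_sqrtr (ltW f0).
pose L := sqrt 2 * M / sqrt f.
have L0 : 0 <= L by exact: divr_ge0 (mulr_ge0 (ltW s2) (ltW M0)) (ltW sf).
have key s t : s0 <= s -> s < t -> t <= t0 ->
 xiD m (upright m (W1 t) (W2 t)) (upright m (W1 s) (W2 s)) <= L * (t - s).
 move=> s0s st tt0; have sp := lt_le_trans s00 s0s; have tT := le_lt_trans tt0 t0T.
 rewrite /L mulrAC ler_pdivlMr// mulrC.
 have [c /andP[sc ct] E] := action_mean sp st tT.
 apply: (@le_trans _ _ (A t - A s)).
 apply: (td_arc td sp (ltW st) tT (ltW sf)) => r /andP[sr rt]; rewrite sf2.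
 have rin : s0 <= r <= t0 by rewrite (le_trans s0s sr) (le_trans rt).
 by have /andP[] := HF r rin.
 rewrite E; apply: ler_wpM2r; first by rewrite subr_ge0 ltW.
 have cin : s0 <= c <= t0 by rewrite (le_trans s0s (ltW sc)) (le_trans (ltW ct)).
 by rewrite ler_pM2l//; have /andP[] := HF c cin.
have K (k : R -> R) mu : 0 < mu -> (forall s t, mu * (k t - k s) ^+ 2 <=
 xiD m (upright m (W1 t) (W2 t)) (upright m (W1 s) (W2 s)) ^+ 2) ->
 lipon s0 t0 k.
 move=> mu0 Hk; have sm : 0 < sqrt mu by rewrite sqrtr_gt0.
 exists (L / sqrt mu); first exact: divr_ge0 L0 (ltW sm).
 have K s t : s0 <= s -> s < t -> t <= t0 -> `|k s - k t| <= L / sqrt mu * `|s - t|.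
 move=> h1 h2 h3; rewrite distrC (distrC s) (gtr0_norm (_ : 0 < t - s)) ?subr_gt0//.
 rewrite mulrAC ler_pdivlMr//; apply: le_trans (key s t h1 h2 h3).
 rewrite -ler_sqr ?nnegrE ?enorm_ge0 ?mulr_ge0 ?sqrtr_ge0//.
 by apply: le_trans (Hk s t); rewrite exprMn real_normK ?num_real// sqr_sqrtr ?(ltW mu0)// mulrC.
 move=> s t /andP[h1 h2] /andP[h3 h4]; have [st|ts|->] := ltgtP s t; first exact: K.
 by rewrite distrC (distrC s); exact: K.
 by rewrite !subrr !normr0 mulr0.
split; [apply: (K _ (mu1 m))|apply: (K _ (mu2 m))] => // s t; rewrite (sqr_enorm_upright hm).
 by rewrite lerDl; exact: mulr_ge0 (ltW p2) (sqr_ge0 _).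
by rewrite lerDr; exact: mulr_ge0 (ltW p1) (sqr_ge0 _).
Qed.

Lemma lipon_rate
 (s0 t0 : R) (s00 : 0 < s0) (st0 : s0 < t0) (t0T : t0 < T) : lipon s0 t0 (orbit_rate m h W1 W2).
Proof.
have inT r : s0 <= r <= t0 -> 0 < r < T.
 by move=> /andP[h1 h2]; rewrite (lt_le_trans s00 h1) (le_lt_trans h2).
have [L1 L2] := lipon_orbit s00 st0 t0T.
have [e e0 He] : exists2 e, 0 < e & forall r, s0 <= r <= t0 -> e <= W1 r.
 by apply: (lipon_pos_min (ltW st0) L1) => r /inT/(td_good td)[].
have h1 : lipon s0 t0 (fun r => (W1 r)^-1) := lipon_inv e0 L1 He.
have qL : lipon s0 t0 (fun r => W2 r ^+ 2 + W1 r ^+ 2 / 4).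
 apply: (@lipon_ext _ _ _ (fun r => W2 r * W2 r + W1 r * W1 r * 4^-1)) => [r _|]; first by rewrite !expr2.
 by apply: liponD; [exact: liponM|apply: liponM; [exact: liponM|exact: lipon_cst]].
have [q q0 Hq] := lipon_pos_min (ltW st0) qL (fun r hr => rad_gt0 (W2 r) (td_good td (inT _ hr)).1).
have rL := lipon_sqrt q0 qL Hq; have sq : 0 < sqrt q by rewrite sqrtr_gt0.
have h2 : lipon s0 t0 (fun r => (sqrt (W2 r ^+ 2 + W1 r ^+ 2 / 4))^-1).
 by apply: (lipon_inv sq rL) => r /Hq; exact: ler_wsqrtr.
by apply: liponB; [apply: liponD; exact: liponZ|exact: lipon_cst].
Qed.


(** By [sqrt 2 c N <= N^2 / (2 dl) + c^2 dl] the action is at most the Lagrangian action divided by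
    [sqrt 2], and for the orbit itself the two agree up to the error [d], because its time is
    Newton's. [D] is the Lagrangian action of the perturbed path expanded in [e]: orbit, potential
    term, kinetic cross term, kinetic square, error. *)
Lemma affine_perturbation
 (m12 : m b1 = m b2) (s0 t0 : R) (s00 : 0 < s0) (st0 : s0 < t0) (t0T : t0 < T)
 (du dw e be ka g d : R) : 0 <= e -> 0 < d ->
 (forall r, s0 <= r <= t0 -> let p := e * (be + ka * r) in
 h < upright_U m (W1 r + p * du) (W2 r + p * dw) /\ 0 < W1 r + p * du /\
 upright_U m (W1 r + p * du) (W2 r + p * dw) <= upright_U m (W1 r) (W2 r) + p * g) ->
 let D s := (sqrt 2)^-1 * (sqrt 2 * A s + e * g * (be * s + ka * s ^+ 2 / 2) +
 e * ka * (mu1 m * du * W1 s + mu2 m * dw * W2 s) +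
 2^-1 * (e * ka) ^+ 2 * (mu1 m * du ^+ 2 + mu2 m * dw ^+ 2) * s + d * s) in
 (JM m h s0 t0 (fun r => upright m (W1 r + e * (be + ka * r) * du)
 (W2 r + e * (be + ka * r) * dw)) <= (D t0 - D s0)%:E)%E.
Proof.
move=> e0 d0 HU; cbv zeta; set D := (fun s => _ * _).
have s2 := sqrt2_gt0 R; have p1 := mu1_gt0 hm; have p2 := mu2_gt0 hm; pose F := orbit_rate m h W1 W2.
have [f [M [f0 M0 HF]]] := rate_bounds s00 st0 t0T; have [L1 L2] := lipon_orbit s00 st0 t0T.
have [L L0 HL] := lipon_rate s00 st0 t0T.
pose y r := upright m (W1 r + e * (be + ka * r) * du) (W2 r + e * (be + ka * r) * dw).
have pL (k : R) : lipon s0 t0 (fun r => e * (be + ka * r) * k).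
 apply: liponM; last exact: lipon_cst.
 by apply: liponZ; apply: liponD; [exact: lipon_cst|apply: liponZ; exact: lipon_id].
have yL : lipc s0 t0 y by apply: lipschitz_upright; exact: liponD.
pose nu := minr (f / 2) (d / 5); have nu0 : 0 < nu by rewrite lt_min !divr_gt0.
have nuf : nu <= f / 2 by rewrite ge_min lexx.
have nud : 5 * nu <= d by rewrite -ler_pdivlMl// mulrC ge_min lexx orbT.
have Lp : 0 < L + 1 by rewrite ltr_wpDl.
have z0 : 0 < nu / (L + 1) by rewrite divr_gt0.
have main c u v : 0 <= c -> s0 <= u -> u <= v -> v <= t0 ->
 (0 < c -> forall r, u <= r <= v -> ((c ^+ 2 + h)%:E <= U m (y r))%E) ->
 c * xiD m (y v) (y u) <= D v - D u.
 move=> c0 s0u uv vt0 Hc.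
 apply: (@local_to_global _ u v (nu / (L + 1)) (fun u v => c * xiD m (y v) (y u))) => //.
 move=> a1 a2 a3; rewrite -mulrDr ler_wpM2l//; apply: le_trans (enormD _ _).
 apply: le_of_eq; congr enorm.
 by apply/funext => i; ring.
 move=> u1 v1 uu1 + v1v; rewrite le_eqVlt => /predU1P[<- _|uv1 close].
 rewrite subrr (_ : enorm _ = 0) ?mulr0//; rewrite /enorm big1 ?sqrtr0// => i _.
 by rewrite subrr expr0n.
 set N := enorm _; have s0u1 := le_trans s0u uu1; have v1t0 := le_trans v1v vt0.
 have u10 := lt_le_trans s00 s0u1; have v1T := le_lt_trans v1t0 t0T.
 (* An affine function takes its mean value at the midpoint, so the potential term is integrated
    exactly. *)
 pose mid := (u1 + v1) / 2.
 have um : u1 <= mid <= v1 by apply/andP; split; rewrite /mid; clear -hm td uv1; lra.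
 have win r : u1 <= r <= v1 -> s0 <= r <= t0.
 by move=> /andP[r1 r2]; rewrite (le_trans s0u1 r1) (le_trans r2).
 pose phi := F mid; have /andP[fphi' _] := HF mid (win _ um).
 have fphi : f <= phi by []. have phi0 : 0 < phi := lt_le_trans f0 fphi.
 have close_F r : u1 <= r <= v1 -> `|F r - phi| <= nu.
 move=> hr; apply: (le_trans (HL _ _ (win _ hr) (win _ um))).
 apply: (@le_trans _ _ ((L + 1) * (nu / (L + 1)))); last by rewrite mulrC divfK// gt_eqF.
 apply: ler_pM; [by []|exact: normr_ge0|by rewrite lerDl|].
 move: um hr => /andP[m1 m2] /andP[r1 r2]; rewrite ler_norml.
 by apply/andP; split; clear -hm td m1 m2 r1 r2 close; lra.
 have [c1 /andP[uc1 c1v] EA] := action_mean u10 uv1 v1T.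
 have [c1u c1v'] : u1 <= c1 /\ c1 <= v1 by split; exact: ltW.
 pose a := F c1; have aphi : `|a - phi| <= nu by apply: close_F; rewrite c1u.
 have nphi : nu <= phi / 2 by clear -hm td nuf fphi; lra.
 have p0 : 0 < phi - nu by clear -hm td nphi phi0; lra.
 pose dl := v1 - u1; have dl0 : 0 < dl by rewrite subr_gt0.
 pose a1 := W1 v1 - W1 u1; pose a2 := W2 v1 - W2 u1.
 pose N2 := mu1 m * a1 ^+ 2 + mu2 m * a2 ^+ 2.
 have HN2 : (phi - nu) * N2 <= (sqrt 2 * a * dl) ^+ 2.
 rewrite /N2 -(sqr_enorm_upright hm) -(sqr_sqrtr (ltW p0)) -exprMn.
 have H : sqrt (phi - nu) * xiD m (upright m (W1 v1) (W2 v1)) (upright m (W1 u1) (W2 u1)) <= sqrt 2 * a * dl.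
 rewrite -EA; apply: (td_arc td u10 (ltW uv1) v1T (sqrtr_ge0 _)) => r hr.
 rewrite (sqr_sqrtr (ltW p0)); have := close_F r hr; rewrite ler_norml => /andP[+ _].
 by rewrite lerBrDr addrC.
 have n1 := mulr_ge0 (sqrtr_ge0 (phi - nu)) (enorm_ge0 (fun i => xivec m (upright m (W1 v1) (W2 v1)) i -
 xivec m (upright m (W1 u1) (W2 u1)) i)).
 exact: (lerXn2r 2 n1 (le_trans n1 H) H).
 have sq2 : sqrt 2 ^+ 2 = 2 :> R by rewrite sqr_sqrtr.
 (* On a short arc of the orbit the kinetic and potential parts nearly balance: the chord bound
    gives [N2 <= 2 a^2 dl^2 / (phi - nu)], and [quad_gap] concludes. *)
 have B1 : N2 / (2 * dl) + phi * dl <= sqrt 2 * (A v1 - A u1) + d * dl.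
 have E2 : sqrt 2 * (A v1 - A u1) = 2 * a * dl by rewrite EA -/a -/dl !mulrA -expr2 sq2.
 rewrite E2; have : N2 / (2 * dl) <= a ^+ 2 / (phi - nu) * dl.
 rewrite ler_pdivrMr ?mulr_gt0//.
 have -> : a ^+ 2 / (phi - nu) * dl * (2 * dl) = (sqrt 2 * a * dl) ^+ 2 / (phi - nu).
 by rewrite !exprMn sq2; ring.
 by rewrite ler_pdivlMr// mulrC.
 have H1 := ler_wpM2r (ltW dl0) (quad_gap phi0 (ltW nu0) nphi aphi).
 have H2 := ler_wpM2r (ltW dl0) nud.
 have K (X ph n x1 a0 l d1 : R) : (X + ph) * l <= (2 * a0 + 5 * n) * l -> 5 * n * l <= d1 * l ->
 x1 <= X * l -> x1 + ph * l <= 2 * a0 * l + d1 * l by clear -hm td; lra.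
 by apply: (K (a ^+ 2 / (phi - nu)) phi nu) H2; exact: H1.
 have /HU := win _ um; cbv zeta; set pm := e * (be + ka * mid) => -[U1 [U2 U3]].
 have B2 : c ^+ 2 * dl <= (phi + pm * g) * dl.
 apply: ler_wpM2r; first exact: ltW.
 apply: (@le_trans _ _ (upright_U m (W1 mid + pm * du) (W2 mid + pm * dw) - h)).
 move: c0; rewrite le_eqVlt => /predU1P[<-|c0]; first by rewrite expr0n subr_ge0 ltW.
 have /andP[m1 m2] := um; have midin : u <= mid <= v by rewrite (le_trans uu1 m1) (le_trans m2).
 by have := Hc c0 mid midin; rewrite /y (U_upright hm m12 _ U2) lee_fin lerBrDr.
 have -> : phi + pm * g = upright_U m (W1 mid) (W2 mid) + pm * g - h by rewrite /phi /F /orbit_rate addrAC.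
 by rewrite lerD2r.
 have B3 : N ^+ 2 / (2 * dl) = N2 / (2 * dl) + e * ka * (mu1 m * du * a1 + mu2 m * dw * a2) +
 2^-1 * (e * ka) ^+ 2 * (mu1 m * du ^+ 2 + mu2 m * dw ^+ 2) * dl.
 rewrite /N /y (sqr_enorm_upright hm).
 have -> : W1 v1 + e * (be + ka * v1) * du - (W1 u1 + e * (be + ka * u1) * du) = a1 + e * ka * dl * du.
 by rewrite /a1 /dl; ring.
 have -> : W2 v1 + e * (be + ka * v1) * dw - (W2 u1 + e * (be + ka * u1) * dw) = a2 + e * ka * dl * dw.
 by rewrite /a2 /dl; ring.
 have K (x k c3 c4 x1 x2 : R) : 0 < x -> (c3 * (x1 + k * x * du) ^+ 2 + c4 * (x2 + k * x * dw) ^+ 2) / (2 * x) =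
 (c3 * x1 ^+ 2 + c4 * x2 ^+ 2) / (2 * x) + k * (c3 * du * x1 + c4 * dw * x2) +
 2^-1 * k ^+ 2 * (c3 * du ^+ 2 + c4 * dw ^+ 2) * x by move=> x0; field; rewrite gt_eqF.
 exact: K dl0.
 have AM : sqrt 2 * (c * N) <= N ^+ 2 / (2 * dl) + c ^+ 2 * dl.
 have -> : N ^+ 2 / (2 * dl) + c ^+ 2 * dl =
 sqrt 2 * (c * N) + ((N - sqrt 2 * c * dl) ^+ 2 + (2 - sqrt 2 ^+ 2) * (c * dl) ^+ 2) / (2 * dl).
 have K (x n r : R) : 0 < x -> n ^+ 2 / (2 * x) + c ^+ 2 * x = r * (c * n) +
 ((n - r * c * x) ^+ 2 + (2 - r ^+ 2) * (c * x) ^+ 2) / (2 * x) by move=> x0; field; rewrite gt_eqF.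
 exact: K dl0.
 by rewrite sq2 subrr mul0r addr0 lerDl divr_ge0 ?sqr_ge0// mulr_ge0 ?ltW.
 have E3 : (phi + pm * g) * dl = phi * dl + e * g * (be * dl + ka * (v1 ^+ 2 - u1 ^+ 2) / 2).
 by rewrite /pm /mid /dl; field.
 have KD (x y' : R) : sqrt 2 * ((sqrt 2)^-1 * x - (sqrt 2)^-1 * y') = x - y'.
 by rewrite -mulrBr mulrA divff ?gt_eqF// mul1r.
 rewrite -(ler_pM2l s2) /D KD; apply: (le_trans AM).
 rewrite B3 -/dl; apply: le_trans (lerD (lexx _) B2) _; rewrite E3.
 have -> : sqrt 2 * A v1 + e * g * (be * v1 + ka * v1 ^+ 2 / 2) + e * ka * (mu1 m * du * W1 v1 + mu2 m * dw * W2 v1) +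
 2^-1 * (e * ka) ^+ 2 * (mu1 m * du ^+ 2 + mu2 m * dw ^+ 2) * v1 + d * v1 -
 (sqrt 2 * A u1 + e * g * (be * u1 + ka * u1 ^+ 2 / 2) + e * ka * (mu1 m * du * W1 u1 + mu2 m * dw * W2 u1) +
 2^-1 * (e * ka) ^+ 2 * (mu1 m * du ^+ 2 + mu2 m * dw ^+ 2) * u1 + d * u1) =
 (sqrt 2 * (A v1 - A u1) + d * dl) + e * g * (be * dl + ka * (v1 ^+ 2 - u1 ^+ 2) / 2) +
 e * ka * (mu1 m * du * a1 + mu2 m * dw * a2) +
 2^-1 * (e * ka) ^+ 2 * (mu1 m * du ^+ 2 + mu2 m * dw ^+ 2) * dl by rewrite /a1 /a2 /dl; ring.
 move: B1; move: (N2 / (2 * dl)) (phi * dl) (sqrt 2 * (A v1 - A u1) + d * dl)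
 (e * g * _) (e * ka * _) (_ * dl) => x1 x2 x3 x4 x5 x6; clear -hm td; lra.
apply: (action_le_xi hm st0 yL) => [u v su uv vt|u v c su uv vt c0 Hc].
 by have := main 0 u v (lexx 0) su uv vt; rewrite mul0r subr_ge0 ltxx; apply.
exact: main (ltW c0) su uv vt (fun=> Hc).
Qed.


(** Perturb by [e] times a tent on [[p - n, p + n]]. The slopes of its sides are [1 / n] and
    [- 1 / n], so the two cross terms add up to [- e / n] times the weighted second difference.
    Minimality, divided by [e], then gives the bound as [e] tends to 0. *)
Lemma second_diff (m12 : m b1 = m b2) (p du dw d : R) :
 0 < p < T -> `|du| <= 1 -> `|dw| <= 1 -> 0 < d ->
 exists2 n0, 0 < n0 & forall n, 0 < n < n0 ->
 mu1 m * du * (W1 (p + n) - 2 * W1 p + W1 (p - n)) + mu2 m * dw * (W2 (p + n) - 2 * W2 p + W2 (p - n)) <=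
 n ^+ 2 * (upright_Uu m (W1 p) (W2 p) * du + upright_Uw m (W1 p) (W2 p) * dw + d).
Proof.
move=> pT du1 dw1 d0; have [Wp hU] := td_good td pT; have /andP[p0 pT'] := pT.
have [r r0 Hr] := upright_U_step Wp hU du1 dw1 d0; have s2 := sqrt2_gt0 R.
have [c1 c2] := orbit_continuous pT.
have [d1 d10 Hd1] := eps_continuous c1 r0; have [d2 d20 Hd2] := eps_continuous c2 r0.
pose n0 := minr (minr d1 d2) (minr p (T - p)).
have n00 : 0 < n0 by rewrite !lt_min d10 d20 p0 subr_gt0.
exists n0 => // n /andP[n_gt0]; rewrite !lt_min => /andP[/andP[nd1 nd2] /andP[np nT]].
set g := upright_Uu _ _ _ * _ + _ + d.
have pn0 : 0 < p - n by rewrite subr_gt0.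
have pnT : p + n < T by rewrite addrC -ltrBrDr.
have le1 : p - n <= p by rewrite gerBl ltW. have le2 : p <= p + n by rewrite lerDl ltW.
have lt1 : p - n < p by rewrite gtrBl. have lt2 : p < p + n by rewrite ltrDl.
set Q := _ + _ * _; set S2 := mu1 m * du ^+ 2 + mu2 m * dw ^+ 2.
have key e : 0 < e < r -> e * Q <= e * (n ^+ 2 * g) + e ^+ 2 * S2.
 move=> /andP[e0 er]; apply/ler_addgt0Pr => x x0.
 pose dd := x / (2 * n ^+ 2); have dd0 : 0 < dd by rewrite divr_gt0// mulr_gt0// exprn_gt0.
 (* [b0 + k0 v] and [b1' - k0 v] are the two sides of the tent that is 1 at [p] and 0 at [p - n] and
    [p + n]. *)
 pose b0 := 1 - p / n; pose k0 := n^-1; pose b1' := 1 + p / n.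
 have nn : n != 0 by rewrite gt_eqF.
 have win be ka s t : p - n <= s -> t <= p + n -> (forall v, s <= v <= t -> 0 <= be + ka * v <= 1) ->
 forall v, s <= v <= t -> let q := e * (be + ka * v) in
 h < upright_U m (W1 v + q * du) (W2 v + q * dw) /\ 0 < W1 v + q * du /\
 upright_U m (W1 v + q * du) (W2 v + q * dw) <= upright_U m (W1 v) (W2 v) + q * g.
 move=> ps tp Hpsi v hv; cbv zeta; have /andP[q0 q1] := Hpsi v hv; have /andP[sv vt] := hv.
 have vp : `|v - p| <= n.
 by rewrite ler_norml; apply/andP; split; [rewrite lerBrDr addrC (le_trans ps)|rewrite lerBlDl (le_trans vt)].
 have h1 := Hd1 v (le_lt_trans vp nd1); have h2 := Hd2 v (le_lt_trans vp nd2).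
 have qe : 0 <= e * (be + ka * v) < r.
 by rewrite mulr_ge0 ?(ltW e0)//= (le_lt_trans _ er)// ler_piMr ?(ltW e0).
 by have [z1 z2 z3 z4] := Hr _ _ _ h1 h2 qe.
 have P1 v : p - n <= v <= p -> 0 <= b0 + k0 * v <= 1.
 move=> /andP[v1 v2]; have -> : b0 + k0 * v = 1 - (p - v) / n by rewrite /b0 /k0; field.
 have : 0 <= (p - v) / n <= 1.
 by rewrite divr_ge0 ?subr_ge0 ?(ltW n_gt0)//= ler_pdivrMr// mul1r; move: v1; clear -hm td; lra.
 by move=> /andP[y1 y2]; apply/andP; split; clear -hm td y1 y2; lra.
 have P2 v : p <= v <= p + n -> 0 <= b1' + (- k0) * v <= 1.
 move=> /andP[v1 v2]; have -> : b1' + (- k0) * v = 1 - (v - p) / n by rewrite /b1' /k0; field.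
 have : 0 <= (v - p) / n <= 1.
 by rewrite divr_ge0 ?subr_ge0 ?(ltW n_gt0)//= ler_pdivrMr// mul1r; move: v2; clear -hm td; lra.
 by move=> /andP[y1 y2]; apply/andP; split; clear -hm td y1 y2; lra.
 have A1 := affine_perturbation m12 pn0 lt1 pT' (ltW e0) dd0 (win b0 k0 _ _ (lexx _) le2 P1).
 have A2 := affine_perturbation m12 p0 lt2 pnT (ltW e0) dd0 (win b1' (- k0) _ _ le1 (lexx _) P2).
 cbv zeta in A1, A2.
 pose psi v : R := 1 - `|v - p| / n.
 pose y v := upright m (W1 v + e * psi v * du) (W2 v + e * psi v * dw).
 have [l1 l2] := lipon_orbit pn0 (lt_trans lt1 lt2) pnT.
 have psiL : lipon (p - n) (p + n) psi.
 apply: liponB; first exact: lipon_cst.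
 apply: liponM; last exact: lipon_cst.
 have [L L0 HL] : lipon (p - n) (p + n) (fun v => v - p).
 by apply: liponB; [exact: lipon_id|exact: lipon_cst].
 by exists L => // s t hs ht; apply: le_trans (ler_dist_dist _ _) _; exact: HL.
 have epL (k : R) : lipon (p - n) (p + n) (fun v => e * psi v * k).
 by apply: liponM; [exact: liponZ|exact: lipon_cst].
 have yL : lipc (p - n) (p + n) y.
 by apply: lipschitz_upright; apply: liponD.
 have psi1 v : p - n <= v <= p -> b0 + k0 * v = psi v.
 by move=> /andP[_ v2]; rewrite /psi ler0_norm ?subr_le0// /b0 /k0; field.
 have psi2 v : p <= v <= p + n -> b1' + (- k0) * v = psi v.
 by move=> /andP[v1 _]; rewrite /psi ger0_norm ?subr_ge0// /b1' /k0; field.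
 have same s t be ka : s <= t -> p - n <= s -> t <= p + n -> (forall v, s <= v <= t -> be + ka * v = psi v) ->
 JM m h s t (fun v => upright m (W1 v + e * (be + ka * v) * du) (W2 v + e * (be + ka * v) * dw)) =
 JM m h s t y.
 move=> st s1 t1 E; have yL' := lipc_sub s1 t1 yL.
 apply: (action_same_conf h hm st _ yL').
 apply/lipcP => i; have /lipcP/(_ i)[q1 q2] := yL'.
 by split; [apply: lipon_ext q1|apply: lipon_ext q2] => v /E; rewrite /y => ->.
 by move=> v /E; rewrite /y => ->; exact: same_conf_refl.
 rewrite (same _ _ _ _ le1 (lexx _) le2 psi1) in A1; rewrite (same _ _ _ _ le2 le1 (lexx _) psi2) in A2.
 have le12 := le_trans le1 le2.
 have yA := action_cat h hm le1 le2 yL.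
 have := action_reverse_le h hm le12 yL; rewrite yA => rev.
 have le12' : - (p + n) <= - (p - n) by rewrite lerN2.
 have psi0 v : `|v - p| = n -> y v = upright m (W1 v) (W2 v).
 by move=> E; rewrite /y /psi E divff// subrr mulr0 !mul0r !addr0.
 have mn := td_min td pn0 le12 pnT le12' (lipschitz_reverse yL).
 rewrite !opprK in mn; have {}mn := mn (psi0 _ _) (psi0 _ _).
 have n1 : `|p + n - p| = n by rewrite addrC addKr gtr0_norm.
 have n2 : `|p - n - p| = n by rewrite addrAC subrr add0r normrN gtr0_norm.
 have := le_trans (mn n1 n2) (le_trans rev (leeD A1 A2)); rewrite -EFinD lee_fin => fin.
 have := ler_wpM2l (ltW s2) fin; set rhs := (X in _ <= _ * X -> _).
 have -> : sqrt 2 * rhs = sqrt 2 * (A (p + n) - A (p - n)) +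
 (e * (n ^+ 2 * g) + e ^+ 2 * S2 + x - e * Q) / n.
 rewrite /rhs /Q /S2 /dd /b0 /b1' /k0; move: (sqrt 2) s2 => rt rt0.
 by clear -hm td nn rt0; field; rewrite nn gt_eqF.
 by rewrite lerDl pmulr_lge0 ?invr_gt0// subr_ge0.
have : forall x, 0 < x -> Q <= n ^+ 2 * g + x.
 move=> x x0; have S20 : 0 <= S2.
 exact: addr_ge0 (mulr_ge0 (ltW (mu1_gt0 hm)) (sqr_ge0 _)) (mulr_ge0 (ltW (mu2_gt0 hm)) (sqr_ge0 _)).
 have Sp : 0 < S2 + 1 by rewrite ltr_wpDl.
 pose e := minr (r / 2) (x / (S2 + 1)); have e0 : 0 < e by rewrite lt_min !divr_gt0.
 have er : e < r by rewrite gt_min; apply/orP; left; rewrite ltr_pdivrMr// mulr_natr mulr2n ltrDl.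
 have ex : e * (S2 + 1) <= x by rewrite -ler_pdivlMr// ge_min lexx orbT.
 have eS : e * S2 <= x by apply: le_trans ex; rewrite ler_pM2l// lerDl.
 have ein : 0 < e < r by rewrite e0.
 have := key e ein; have -> : e * (n ^+ 2 * g) + e ^+ 2 * S2 = e * (n ^+ 2 * g + e * S2) by ring.
 by rewrite ler_pM2l// => /le_trans; apply; rewrite lerD2l.
by move=> H; apply/ler_addgt0Pr.
Qed.
End TimedOrbit.

(** * Second derivatives from second differences, across the brake instant *)

Section EvenSecondOrder.
Variable R : realType.
Implicit Types (f g M P Z W G : R -> R) (r s t p n : R).

Lemma near_itv (P : R -> Prop) (a b r : R) : a < r < b -> (forall s, a < s < b -> P s) -> \near r, P r.
Proof.
move=> hr H; have : nbhs r `]a, b[%classic by apply: open_nbhs_nbhs; split; [exact: interval_open|rewrite /= in_itv].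
by apply: filterS => s /=; rewrite in_itv; exact: H.
Qed.

Lemma near_derive1 f P (a b r k : R) : a < r < b -> (forall s, a < s < b -> is_derive s 1 f (P s)) ->
 is_derive r 1 P k -> [/\ is_derive r 1 f (derive1 f r), is_derive r 1 (derive1 f) k & derive1 f r = P r].
Proof.
move=> hr H Pk; have E s : a < s < b -> derive1 f s = P s by move=> /H Hs; rewrite derive1E (@derive_val _ _ _ _ _ _ _ Hs).
split; [by rewrite (E _ hr); exact: H| |exact: E].
by apply: (near_eq_is_derive _ Pk); apply: (near_itv hr) => s hs; rewrite E.
Qed.

(** At an interior maximum the small second differences are nonpositive, so the maximum is attained
    at an end. *)
Lemma max_principle M T : 0 < T -> {within `[0, T], continuous M} -> M 0 <= 0 -> M T <= 0 ->
 (forall p, 0 < p < T -> exists2 n0, 0 < n0 & forall n, 0 < n < n0 -> 0 < M (p + n) - 2 * M p + M (p - n)) ->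
 forall s, 0 <= s <= T -> M s <= 0.
Proof.
move=> T0 Mc M0 MT H; have [p] := EVT_max (ltW T0) Mc; rewrite in_itv/= => /andP[p0 pT] pM.
suff : M p <= 0 by move=> Mp s hs; apply: le_trans Mp; apply: pM; rewrite in_itv.
move: p0; rewrite le_eqVlt => /predU1P[<-//|p0]; move: pT; rewrite le_eqVlt => /predU1P[->//|pT].
have [|n0 n00 Hn] := H p; first by rewrite p0.
pose n := minr (n0 / 2) (minr p (T - p)).
have nn : 0 < n by rewrite !lt_min divr_gt0// p0 subr_gt0.
have h1 : n < n0 by rewrite gt_min; apply/orP; left; rewrite ltr_pdivrMr// mulr_natr mulr2n ltrDl.
have h2 : n <= p by rewrite ge_min; apply/orP; right; rewrite ge_min lexx.
have h3 : n <= T - p by rewrite ge_min; apply/orP; right; rewrite ge_min lexx orbT.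
have := Hn n; rewrite nn h1 => /(_ isT).
have i1 : p + n \in `[0, T] by rewrite in_itv/=; apply/andP; split; clear -p0 nn h3; lra.
have i2 : p - n \in `[0, T] by rewrite in_itv/=; apply/andP; split; clear -pT nn h2; lra.
move: (pM _ i1) (pM _ i2); set x := M (p + n); set y := M (p - n); clear; lra.
Qed.

(* A function whose second differences are [o(n^2)] is affine: comparison with
 the parabolas [e s (s - T)]. *)
Lemma affine_of_second_diff (L : R -> R) T : 0 < T -> {within `[0, T], continuous L} -> L 0 = 0 -> L T = 0 ->
 (forall p d, 0 < p < T -> 0 < d -> exists2 n0, 0 < n0 & forall n, 0 < n < n0 ->
 `|L (p + n) - 2 * L p + L (p - n)| <= n ^+ 2 * d) ->
 forall s, 0 <= s <= T -> L s = 0.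
Proof.
move=> T0 Lc L0 LT H.
suff K k : `|k| = 1 -> forall s, 0 <= s <= T -> k * L s <= 0.
 move=> s hs; apply/eqP; rewrite eq_le -[X in X && _]mul1r (_ : 1 * (L s <= 0)%R = (L s <= 0)%R) ?mul1r//.
 by have := K 1 (normr1 _) s hs; have := K (-1) (normrN1 _) s hs; rewrite mulN1r mul1r oppr_le0 => -> ->.
move=> k1 s hs; apply/ler_addgt0Pr => x x0; rewrite add0r.
pose e := x / T ^+ 2; have T2 : 0 < T ^+ 2 by rewrite exprn_gt0.
have e0 : 0 < e by rewrite divr_gt0.
suff : k * L s + e * s * (s - T) <= 0.
 have : e * T ^+ 2 = x by rewrite /e divfK// gt_eqF.
 move: hs => /andP[s0 sT] ET; have : e * (s * (T - s)) <= e * T ^+ 2.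
 by rewrite ler_pM2l//; clear -s0 sT T0; nra.
 by rewrite -ET; move: (e * T ^+ 2) (k * L s) => z y; clear; lra.
apply: (@max_principle (fun s => k * L s + e * s * (s - T)) T) => //.
- move=> y; apply: cvgD; first by apply: cvgM; [exact: cvg_cst|exact: Lc].
 have C : continuous (fun s => e * s * (s - T)).
 by move=> z; apply: cvgM; [apply: cvgM; [exact: cvg_cst|exact: cvg_id]|apply: cvgB; [exact: cvg_id|exact: cvg_cst]].
 exact: (continuous_subspaceT C).
- by rewrite L0 !mulr0 mul0r addr0.
- by rewrite LT subrr !mulr0 addr0.
move=> p hp; have [n0 n00 Hn] := H p e hp e0; exists n0 => // n hn; have /andP[n_gt0 _] := hn.
have := Hn n hn; have -> : k * L (p + n) + e * (p + n) * (p + n - T) - 2 * (k * L p + e * p * (p - T)) +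
 (k * L (p - n) + e * (p - n) * (p - n - T)) = k * (L (p + n) - 2 * L p + L (p - n)) + 2 * (e * n ^+ 2) by ring.
move: (L (p + n) - _ + _) => y hy; have : `|k * y| <= n ^+ 2 * e by rewrite normrM k1 mul1r.
rewrite ler_norml => /andP[+ _]; have : 0 < e * n ^+ 2 by rewrite mulr_gt0// exprn_gt0.
by rewrite (mulrC (n ^+ 2)); move: (e * n ^+ 2) (k * y) => u v; clear; lra.
Qed.

Variables (W G : R -> R) (T : R).
Hypotheses (T0 : 0 < T)
 (Wc : forall s, 0 <= s < T -> {for s, continuous (fun r => W `|r|)})
 (Gc : forall s, 0 <= s < T -> {for s, continuous (fun r => G `|r|)})
 (W2 : forall p d, 0 < p < T -> 0 < d -> exists2 n0, 0 < n0 & forall n, 0 < n < n0 ->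
 `|W (p + n) - 2 * W p + W (p - n) - n ^+ 2 * G p| <= n ^+ 2 * d)
 (W0 : forall e, 0 < e -> exists2 d, 0 < d & forall s, 0 < s < d -> `|W s - W 0| <= e * s).

Lemma even_continuous (k : R -> R) s : (forall s, 0 <= s < T -> {for s, continuous (fun r => k `|r|)}) ->
 `|s| < T -> {for s, continuous (fun r => k `|r|)}.
Proof.
move=> kc sT; have hs : 0 <= `|s| < T by rewrite normr_ge0.
apply: continuous_eps => e e0; have [d d0 Hd] := eps_continuous (kc _ hs) e0.
exists d => // y yd; have := Hd `|y|; rewrite !normr_id; apply.
exact: le_lt_trans (ler_dist_dist _ _) yd.
Qed.

Let double_primitive (S : R) : 0 < S < T -> exists P Z, [/\ P 0 = 0 /\ Z 0 = 0,
 forall r, -S <= r <= S -> is_derive r 1 P (G `|r|) & forall r, -S <= r <= S -> is_derive r 1 Z (P r)].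
Proof.
move=> /andP[S0 ST]; have SS : - S <= S by clear -R W G T T0 Wc Gc W2 W0 S0; lra.
pose g r := G `|clamp (- S) S r|.
have clampc (k : R -> R) : (forall r, -S <= r <= S -> {for r, continuous k}) -> continuous (fun r => k (clamp (- S) S r)).
 move=> kc y; apply: continuous_eps => e e0.
 have [d d0 Hd] := eps_continuous (kc _ (clamp_itv y SS)) e0.
 by exists d => // z zd; apply: Hd; exact: le_lt_trans (clamp_lipschitz _ _ _ _) zd.
have gc : continuous g.
 apply: (clampc (fun r => G `|r|)) => r hr; apply: (even_continuous Gc).
 by apply: le_lt_trans ST; rewrite ler_norml.
have [P0 HP] := primitive (- S - 1) gc.
have inS r : -S <= r <= S -> - S - 1 < r by move=> /andP[h _]; clear -R W G T T0 Wc Gc W2 W0 h; lra.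
have P0d r : -S <= r <= S -> is_derive r 1 (fun r => P0 r - P0 0) (G `|r|).
 move=> hr; have := HP r (inS _ hr); rewrite /g clamp_id// => D.
 by apply: (is_derive_eq (isdB D (isd_cst r (P0 0)))); rewrite subr0.
have pc : continuous (fun r => P0 (clamp (- S) S r) - P0 0).
 by apply: (clampc (fun r => P0 r - P0 0)) => r hr; exact: (is_derive_continuous (P0d r hr)).
have [Z HZ] := primitive (- S - 1) pc.
exists (fun r => P0 r - P0 0), (fun r => Z r - Z 0); split; [by rewrite !subrr|exact: P0d|move=> r hr].
have := HZ r (inS _ hr); rewrite clamp_id// => D.
by apply: (is_derive_eq (isdB D (isd_cst r (Z 0)))); rewrite subr0.
Qed.

(** Two mean value steps for [u y = Z (p + y) + Z (p - y) - y^2 G p], whose derivative vanishes at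
    0. *)
Let primitive_second_diff (S p d : R) P Z : 0 < p < S -> S < T -> 0 < d ->
 (forall r, -S <= r <= S -> is_derive r 1 P (G `|r|)) -> (forall r, -S <= r <= S -> is_derive r 1 Z (P r)) ->
 exists2 n0, 0 < n0 & forall n, 0 < n < n0 -> `|Z (p + n) - 2 * Z p + Z (p - n) - n ^+ 2 * G p| <= n ^+ 2 * d.
Proof.
move=> /andP[p0 pS] ST d0 HP HZ; have d2 : 0 < d / 2 by rewrite divr_gt0.
have hp : 0 <= p < T by rewrite ltW//= (lt_trans pS).
have [r r0 Hr] := eps_continuous (Gc hp) d2.
pose n0 := minr r (minr p (S - p)); have n00 : 0 < n0 by rewrite !lt_min r0 p0 subr_gt0.
exists n0 => // n /andP[n_gt0]; rewrite !lt_min => /andP[nr /andP[np nS]].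
have win c : 0 <= c <= n -> (-S <= p + c <= S) /\ (-S <= p - c <= S).
 by move=> /andP[c0 cn]; split; apply/andP; split; clear -R W G T T0 Wc Gc W2 W0 c0 cn np nS p0; lra.
have near c : 0 <= c <= n -> `|G (p + c) - G p| < d / 2 /\ `|G (p - c) - G p| < d / 2.
 move=> /andP[c0 cn]; have cr := le_lt_trans cn nr.
 have := Hr (p + c); have := Hr (p - c); rewrite addrC addKr (addrC _ (- p)) addKr normrN (ger0_norm c0).
 have q1 : 0 <= p - c by clear -R W G T T0 Wc Gc W2 W0 cn np; lra.
 by rewrite (gtr0_norm p0) (ger0_norm q1) (ger0_norm (addr_ge0 (ltW p0) c0)) => h1 h2; split; [exact: h2|exact: h1].
have shift (k : R -> R) (s a y : R) : is_derive (p + s * y) 1 k a -> is_derive y 1 (fun y => k (p + s * y)) (a * s).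
 move=> D; have D' : is_derive y 1 (fun y => p + s * y) s.
 by apply: (is_derive_eq (isdD (isd_cst y p) (isdZ s (isd_id y)))); rewrite add0r mulr1.
 exact: (@is_derive1_comp _ k (fun y => p + s * y) y a s D D').
pose v y := P (p + 1 * y) - P (p + -1 * y) - y * (2 * G p).
pose u y := Z (p + 1 * y) + Z (p + -1 * y) - y ^+ 2 * G p.
have uD y : 0 <= y <= n -> is_derive y 1 u (v y).
 move=> /win[w1 w2]; have {}w1 : -S <= p + 1 * y <= S by rewrite mul1r.
 have {}w2 : -S <= p + -1 * y <= S by rewrite mulN1r.
 apply: (is_derive_eq (isdB (isdD (shift _ _ _ _ (HZ _ w1)) (shift _ _ _ _ (HZ _ w2)))
 (isdM (isdX2 (isd_id y)) (isd_cst y (G p))))).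
 by rewrite /v; ring.
have vD y : 0 <= y <= n -> is_derive y 1 v (G (p + y) + G (p - y) - 2 * G p).
 move=> hy; have [w1 w2] := win _ hy.
 have {}w1 : -S <= p + 1 * y <= S by rewrite mul1r.
 have {}w2 : -S <= p + -1 * y <= S by rewrite mulN1r.
 apply: (is_derive_eq (isdB (isdB (shift _ _ _ _ (HP _ w1)) (shift _ _ _ _ (HP _ w2)))
 (isdM (isd_id y) (isd_cst y (2 * G p))))).
 have /andP[y0 yn] := hy; have q1 : 0 <= p - y by clear -R W G T T0 Wc Gc W2 W0 yn np; lra.
 by rewrite mul1r mulN1r (ger0_norm (addr_ge0 (ltW p0) y0)) (ger0_norm q1); ring.
have [c /andP[c0 cn] E1] := MVT_mean n_gt0 uD.
have vD' y : 0 <= y <= c -> is_derive y 1 v (G (p + y) + G (p - y) - 2 * G p).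
 by move=> /andP[y0 yc]; apply: vD; rewrite y0 (le_trans yc)// ltW.
have [c' /andP[c'0 c'c] E2] := MVT_mean c0 vD'.
have : Z (p + n) - 2 * Z p + Z (p - n) - n ^+ 2 * G p = (G (p + c') + G (p - c') - 2 * G p) * c * n.
 have u0 : u n - u 0 = Z (p + n) - 2 * Z p + Z (p - n) - n ^+ 2 * G p.
 by rewrite /u mul1r !mulr0 mulN1r addr0; ring.
 have v0 : v 0 = 0 by rewrite /v !mulr0 mul0r subrr subr0.
 by rewrite -u0 E1 subr0; congr (_ * _); have := E2; rewrite v0 !subr0.
move=> ->; have c'n : 0 <= c' <= n by rewrite ltW//= ltW// (lt_trans c'c).
have [a1 a2] := near c' c'n.
have a3 : `|G (p + c') + G (p - c') - 2 * G p| <= d.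
 have -> : G (p + c') + G (p - c') - 2 * G p = (G (p + c') - G p) + (G (p - c') - G p) by ring.
 by apply: (le_trans (ler_normD _ _)); move: a1 a2; clear -R W G T T0 Wc Gc W2 W0; lra.
rewrite -mulrA normrM mulrC; apply: ler_pM => //; rewrite ger0_norm ?mulr_ge0 ?ltW//.
by rewrite expr2 ltr_pM2r.
Qed.

(** Subtracting a double primitive [Z] of [G] from [W] leaves second differences [o(n^2)], hence an
    affine function. Its slope [be] is 0 because [W] has slope 0 at the brake instant, and [Z] is
    even, so the identity extends to negative times. *)
Let representation (S : R) : 0 < S < T -> exists P, [/\ P 0 = 0,
 forall r, -S <= r <= S -> is_derive r 1 P (G `|r|) & forall r, - S < r < S -> is_derive r 1 (fun s => W `|s|) (P r)].
Proof.
move=> hS; have [P [Z [[P0 Z0] HP HZ]]] := double_primitive hS; have /andP[S0 ST] := hS.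
exists P; split => //.
have N (y : R) : is_derive y 1 (fun s : R => - s) (-1) by exact: is_deriveN.
have opp y : 0 <= y <= S -> (-S <= y <= S) /\ (-S <= - y <= S).
 by move=> /andP[y0 yS]; split; apply/andP; split; clear -R W G T T0 Wc Gc W2 W0 y0 yS S0; lra.
have Podd s : 0 < s <= S -> P (- s) = - P s.
 move=> /andP[s0 sS]; have D y : 0 <= y <= s -> is_derive y 1 (fun y => P y + P (- y)) 0.
 move=> /andP[y0 ys]; have [|o1 o2] := opp y; first by rewrite y0 (le_trans ys).
 by apply: (is_derive_eq (isdD (HP _ o1) (is_derive1_comp (HP _ o2) (N y)))); rewrite normrN mulrN1 subrr.
 have [c _] := MVT_mean s0 D; rewrite mul0r oppr0 P0 !addr0 subr0 => /eqP.
 by rewrite addrC addr_eq0 => /eqP.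
have Zeven s : 0 < s <= S -> Z (- s) = Z s.
 move=> /andP[s0 sS]; have D y : 0 <= y <= s -> is_derive y 1 (fun y => Z y - Z (- y)) 0.
 move=> /andP[y0 ys]; have [|o1 o2] := opp y; first by rewrite y0 (le_trans ys).
 apply: (is_derive_eq (isdB (HZ _ o1) (is_derive1_comp (HZ _ o2) (N y)))).
 move: y0; rewrite le_eqVlt => /predU1P[<-|y0]; first by rewrite oppr0 P0 mul0r subrr.
 by rewrite Podd ?y0 ?(le_trans ys)// mulrN1 opprK subrr.
 have [c _] := MVT_mean s0 D; rewrite mul0r oppr0 Z0 !subr0 => /eqP.
 by rewrite subr_eq0 => /eqP.
suff main : forall s, 0 <= s <= S -> W s = W 0 + Z s.
 move=> r hr; have hr' : -S <= r <= S by move: hr => /andP[h1 h2]; rewrite !ltW.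
 have D : is_derive r 1 (fun s => W 0 + Z s) (P r).
 by apply: (is_derive_eq (isdD (isd_cst r (W 0)) (HZ _ hr'))); rewrite add0r.
 apply: (near_eq_is_derive _ D); apply: (near_itv hr) => s /andP[s1 s2].
 have sS : 0 <= `|s| <= S by rewrite normr_ge0 ler_norml !ltW.
 rewrite (main `|s| sS); congr (_ + _).
 have [s0|s0] := lerP 0 s; first by rewrite ger0_norm.
 have sN : 0 < - s <= S by rewrite oppr_gt0 s0 lerNl ltW.
 by rewrite (ltr0_norm s0) -(Zeven _ sN) opprK.
pose be := (W S - W 0 - Z S) / S; pose L s := W s - W 0 - Z s - s * be.
have ZcS (y : R) : -S <= y <= S -> {for y, continuous Z} by move=> /HZ/is_derive_continuous.
have L0 : forall s, 0 <= s <= S -> L s = 0.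
 apply: (@affine_of_second_diff L S) => //.
 - pose L' s := W `|s| - W 0 - Z s - s * be.
 have C : {within `[0, S], continuous L'}.
 apply: continuous_in_subspaceT => y; rewrite inE/= in_itv/= => /andP[y0 yS].
 apply: cvgB; last by apply: cvgM; [exact: cvg_id|exact: cvg_cst].
 apply: cvgB; last by apply: ZcS; rewrite yS (le_trans _ y0)// oppr_le0 ltW.
 apply: cvgB; last exact: cvg_cst.
 by apply: Wc; rewrite y0 (le_lt_trans yS).
 have E : {in `[0, S]%classic, L' =1 L}.
 by move=> z; rewrite inE/= in_itv/= => /andP[z0 _]; rewrite /L' /L ger0_norm.
 exact: (subspace_eq_continuous E C).
 - by rewrite /L Z0 !subrr mul0r subrr.
 - by rewrite /L /be mulrC divfK ?gt_eqF// subrr.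
 move=> p d /andP[p0 pS] d0; have d2 : 0 < d / 2 by rewrite divr_gt0.
 have pin : 0 < p < S by rewrite p0. have pin' : 0 < p < T by rewrite p0 (lt_trans pS).
 have [n1 n10 H1] := W2 pin' d2; have [n2 n20 H2] := primitive_second_diff pin ST d2 HP HZ.
 exists (minr n1 n2) => [|n]; first by rewrite lt_min n10.
 rewrite lt_min => /andP[n_gt0 /andP[h1 h2]].
 have := H1 n; rewrite n_gt0 h1 => /(_ isT); have := H2 n; rewrite n_gt0 h2 => /(_ isT).
 have -> : L (p + n) - 2 * L p + L (p - n) = (W (p + n) - 2 * W p + W (p - n) - n ^+ 2 * G p) -
 (Z (p + n) - 2 * Z p + Z (p - n) - n ^+ 2 * G p) by rewrite /L; ring.
 move: (Z (p + n) - _ + _ - _) (W (p + n) - _ + _ - _) => u v Hu Hv.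
 by apply: (le_trans (ler_normB _ _)); move: Hu Hv; clear -R W G T T0 Wc Gc W2 W0; lra.
suff be0 : be = 0 by move=> s hs; have := L0 s hs; rewrite /L be0 mulr0 subr0 => /eqP; rewrite subr_eq0 => /eqP <-; rewrite addrC subrK.
apply/eqP; rewrite -normr_le0; apply/ler_addgt0Pr => x x0; rewrite add0r.
have x2 : 0 < x / 2 by rewrite divr_gt0.
have [d1 d10 H1] := W0 x2.
have S00 : -S <= (0:R) <= S by rewrite oppr_le0 ltW.
have [d2 d20 H2] := eps_continuous (is_derive_continuous (HP _ S00)) x2.
pose s := minr S (minr d1 d2) / 2.
have q0 : 0 < minr S (minr d1 d2) by rewrite !lt_min S0 d10.
have s0 : 0 < s by rewrite divr_gt0.
have : s < minr S (minr d1 d2) by rewrite ltr_pdivrMr// mulr_natr mulr2n ltrDl.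
rewrite !lt_min => /andP[sS /andP[sd1 sd2]].
have hs : 0 <= s <= S by rewrite !ltW.
have h1 := H1 s; rewrite s0 sd1 in h1; have {}h1 := h1 isT.
have HZs y : 0 <= y <= s -> is_derive y 1 Z (P y).
 by move=> /andP[y0 ys]; apply: HZ; rewrite (le_trans ys (ltW sS)) (le_trans _ y0)// oppr_le0 ltW.
have [c /andP[c0 cs]] := MVT_mean s0 HZs; rewrite Z0 !subr0 => EZ.
have hc : `|P c| <= x / 2.
 by have := H2 c; rewrite P0 !subr0 (gtr0_norm c0) => /(_ (lt_trans cs sd2))/ltW.
have := L0 s hs; rewrite /L EZ => /eqP; rewrite subr_eq0 => /eqP E.
have : `|s * be| <= s * x.
 rewrite -E; apply: (le_trans (ler_normB _ _)); rewrite normrM (gtr0_norm s0).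
 have := ler_wpM2r (ltW s0) hc; move: h1; move: (`|P c| * s) `|W s - W 0| => y1 y2; clear -R W G T T0 Wc Gc W2 W0; lra.
by rewrite normrM (gtr0_norm s0) ler_pM2l.
Qed.

Lemma even_second_order r : `|r| < T -> let f := fun s => W `|s| in
 [/\ is_derive r 1 f (derive1 f r), is_derive r 1 (derive1 f) (G `|r|) & r = 0 -> derive1 f r = 0].
Proof.
move=> rT; cbv zeta; pose S := (`|r| + T) / 2.
have rS : `|r| < S by rewrite /S; clear -R W G T T0 Wc Gc W2 W0 rT; lra.
have ST : S < T by rewrite /S; clear -R W G T T0 Wc Gc W2 W0 rT; lra.
have [|P [P0 HP HW]] := @representation S; first by rewrite ST (le_lt_trans _ rS).
have hr : -S < r < S by rewrite -ltr_norml.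
have hr' : -S <= r <= S by rewrite -ler_norml ltW.
by have [D1 D2 E] := near_derive1 hr HW (HP r hr'); split; [exact: D1|exact: D2|move=> r0; rewrite E r0].
Qed.
End EvenSecondOrder.

(** * Equations of motion and energy in the isosceles plane *)

Section BrakeDynamics.
Variables (R : realType) (m : 'I_3 -> R) (h T : R) (W1 W2 A : R -> R).
Hypotheses (hm : posm m) (m12 : m b1 = m b2) (td : timed m h T W1 W2 A)
 (T0 : 0 < T) (W10 : 0 < W1 0) (rate0 : upright_U m (W1 0) (W2 0) = h).

Lemma width_gt0 s : 0 <= s < T -> 0 < W1 s.
Proof.
move=> /andP[s0 sT]; move: s0; rewrite le_eqVlt => /predU1P[<-//|s0].
by apply: (td_good td _).1; rewrite s0.
Qed.

Lemma even_cvg (k : R -> R -> R) :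
 (forall (S : Type) (F : set_system S) (FF : Filter F) (f g : S -> R) (u w : R), 0 < u ->
 f x @[x --> F] --> u -> g x @[x --> F] --> w -> k (f x) (g x) @[x --> F] --> k u w) ->
 forall s : R, 0 <= s < T -> {for s, continuous (fun r => k (W1 `|r|) (W2 `|r|))}.
Proof.
move=> H s hs; have [c1 c2] := td_cont td hs; have /andP[s0 _] := hs.
apply: (H _ (nbhs s)); [by rewrite (ger0_norm s0) width_gt0|exact: c1|exact: c2].
Qed.

(** [U - h] tends to 0 at the brake instant, and a short chord is at most a multiple of
    [sqrt (U - h)] times the elapsed time. The bound is summed over short steps and then extended to
    the instant 0 by continuity. *)
Lemma slope_at_brake e : 0 < e -> exists2 d, 0 < d & forall s, 0 < s < d ->
 `|W1 s - W1 0| <= e * s /\ `|W2 s - W2 0| <= e * s.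
Proof.
move=> e0; have p1 := mu1_gt0 hm; have p2 := mu2_gt0 hm; have s2 := sqrt2_gt0 R.
pose k := sqrt (minr (mu1 m) (mu2 m)); have k0 : 0 < k by rewrite sqrtr_gt0 lt_min p1.
have k2 : k ^+ 2 = minr (mu1 m) (mu2 m) by rewrite sqr_sqrtr// le_min !ltW.
(* With weight [c = sqrt (F u / 2)] and rate at most [4 c^2], a short chord is at most [8 c] times
   the elapsed time; [k] converts the weighted norm into the coordinates. *)
pose c0 := e * k / 8; have c00 : 0 < c0 by rewrite divr_gt0// mulr_gt0.
have hT : 0 <= (0 : R) < T by rewrite lexx.
have Fc : {for (0 : R), continuous (fun r => upright_U m (W1 `|r|) (W2 `|r|))}.
 by apply: (@even_cvg (upright_U m)) => // S F FF f g u w u0 fu gw; exact: cvg_upright_U.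
have c02 : 0 < c0 ^+ 2 by rewrite exprn_gt0.
have [d0 d00 Hd0] := eps_continuous Fc c02.
pose d := minr d0 T; have dp : 0 < d by rewrite lt_min d00.
have small r : 0 < r < d -> 0 < orbit_rate m h W1 W2 r <= c0 ^+ 2.
 rewrite lt_min => /andP[r0 /andP[rd rT]]; have rin : 0 < r < T by rewrite r0.
 rewrite (rate_gt0 td rin)/=; have := Hd0 r; rewrite subr0 normr0 (gtr0_norm r0) rate0 => /(_ rd)/ltW.
 exact: le_trans (ler_norm _).
pose N s t := xiD m (upright m (W1 t) (W2 t)) (upright m (W1 s) (W2 s)).
have main s t : 0 < s -> s < t -> t < d -> N s t <= (e * k) * t - (e * k) * s.
 move=> s0 st ht; have tT : t < T by rewrite (lt_le_trans ht)// ge_min lexx orbT.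
 have [f [M [f0 M0 HF]]] := rate_bounds td s0 st tT.
 have [L L0 HL] := lipon_rate hm td s0 st tT.
 have Lp : 0 < L + 1 by rewrite ltr_wpDl.
 have eta0 : 0 < f / 2 / (L + 1) by rewrite !divr_gt0.
 apply: (@local_to_global _ s t (f / 2 / (L + 1)) N (fun r => e * k * r)); [exact: ltW|exact: eta0| |].
 move=> u v w; apply: le_trans (enormD _ _); apply: le_of_eq.
 by congr enorm; apply/funext => i; ring.
 move=> u v su + vt; rewrite le_eqVlt => /predU1P[<- _|uv close].
 by rewrite subrr /N (_ : enorm _ = 0)// /enorm big1 ?sqrtr0// => i _; rewrite subrr expr0n.
 have win r : u <= r <= v -> s <= r <= t by move=> /andP[h1 h2]; rewrite (le_trans su h1) (le_trans h2).
 have u_in : u <= u <= v by rewrite lexx ltW.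
 have u0 := lt_le_trans s0 su; have vT := le_lt_trans vt tT.
 pose F := orbit_rate m h W1 W2; have /andP[fFu _] := HF u (win _ u_in).
 have nearF r : u <= r <= v -> `|F r - F u| <= F u / 2.
 move=> hr; apply: (le_trans (HL _ _ (win _ hr) (win _ u_in))).
 have /andP[r1 r2] := hr; have ru : `|r - u| <= f / 2 / (L + 1).
 rewrite ger0_norm ?subr_ge0//; apply: le_trans (ltW close); exact: lerB.
 apply: le_trans (ler_wpM2l L0 ru) _; apply: (@le_trans _ _ (f / 2)).
 rewrite mulrCA ler_piMr ?(ltW (divr_gt0 f0 _))// ler_pdivrMr// mul1r lerDl; exact: ler01.
 by rewrite ler_pM2r// invr_gt0.
 have Fu : 0 < F u := lt_le_trans f0 fFu.
 pose c := sqrt (F u / 2); have cp : 0 < c by rewrite sqrtr_gt0 divr_gt0.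
 have cE : c ^+ 2 = F u / 2 by rewrite sqr_sqrtr// ltW// divr_gt0.
 have [r /andP[r1 r2] EA] := action_mean td u0 uv vT.
 have H1 : c * N u v <= A v - A u.
 apply: (td_arc td u0 (ltW uv) vT (ltW cp)) => z hz; rewrite cE.
 by have := nearF z hz; rewrite ler_norml => /andP[+ _]; rewrite /F; move: (orbit_rate _ _ _ _ z) (orbit_rate _ _ _ _ u) => x y; clear -R m h T W1 W2 A hm m12 td T0 W10 rate0; lra.
 have rin : u <= r <= v by rewrite !ltW.
 have Fr : F r <= 4 * c ^+ 2.
 by rewrite cE; have := nearF r rin; rewrite ler_norml => /andP[_ +]; move: Fu; move: (F r) (F u) => x y; clear -R m h T W1 W2 A hm m12 td T0 W10 rate0; lra.
 have sq2 : sqrt 2 <= 2 :> R.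
 by rewrite -[leRHS](@ger0_norm R)// -(sqrtr_sqr 2) ler_wsqrtr// expr2 -natrM ler_nat.
 have ud : 0 < u < d by rewrite u0 (lt_trans uv)// (le_lt_trans vt).
 have cc0 : 8 * c <= e * k.
 have : c <= c0.
 suff c2 : c ^+ 2 <= c0 ^+ 2 by move: c2; rewrite ler_pXn2r ?nnegrE ?(ltW cp) ?(ltW c00).
 rewrite cE; apply: (@le_trans _ _ (F u)).
 by move: Fu; move: (F u) => y; clear -R m h T W1 W2 A hm m12 td T0 W10 rate0; lra.
 by have /andP[] := small u ud.
 by rewrite /c0; move: (e * k) => y; clear -R m h T W1 W2 A hm m12 td T0 W10 rate0; lra.
 have dl : 0 <= v - u by rewrite subr_ge0 ltW.
 rewrite -mulrBr; apply: le_trans (ler_wpM2r dl cc0).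
 rewrite -(ler_pM2l cp); apply: (le_trans H1); rewrite EA mulrA; apply: ler_wpM2r => //.
 apply: (@le_trans _ _ (2 * (4 * c ^+ 2))); last by apply: le_of_eq; ring.
 by apply: ler_pM; [exact: ltW|have := rate_gt0 td (_ : 0 < r < T); rewrite (lt_trans u0 r1) (lt_trans r2 vT) => /(_ isT)/ltW|exact: sq2|exact: Fr].
have comp s t : 0 < s -> s < t -> t < d -> `|W1 t - W1 s| <= e * t /\ `|W2 t - W2 s| <= e * t.
 move=> s0 st ht; have H := main s t s0 st ht; have t0 := lt_trans s0 st.
 have {}H : N s t <= k * (e * t).
 apply: (le_trans H); rewrite -mulrA mulrCA lerBlDr lerDl; exact: mulr_ge0 (mulr_ge0 (ltW e0) (ltW k0)) (ltW s0).
 have et : 0 <= e * t := mulr_ge0 (ltW e0) (ltW t0).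
 have {}H : mu1 m * (W1 t - W1 s) ^+ 2 + mu2 m * (W2 t - W2 s) ^+ 2 <= k ^+ 2 * (e * t) ^+ 2.
 by rewrite -(sqr_enorm_upright hm) -exprMn; exact: (lerXn2r 2 (enorm_ge0 _) (mulr_ge0 (ltW k0) et) H).
 have K (mu x : R) : k ^+ 2 <= mu -> mu * x ^+ 2 <= k ^+ 2 * (e * t) ^+ 2 -> `|x| <= e * t.
 move=> kmu hx; rewrite -(@ler_pXn2r _ 2)// ?nnegrE// real_normK ?num_real//.
 by rewrite -(ler_pM2l (exprn_gt0 2 k0)); apply: le_trans hx; apply: ler_wpM2r => //; exact: sqr_ge0.
 split; [apply: (K (mu1 m))|apply: (K (mu2 m))]; rewrite ?k2 ?ge_min ?lexx ?orbT//; rewrite -?k2; apply: le_trans H.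
 by rewrite lerDl; exact: mulr_ge0 (ltW p2) (sqr_ge0 _).
 by rewrite lerDr; exact: mulr_ge0 (ltW p1) (sqr_ge0 _).
exists d => // t /andP[t0 ht]; have [c1 c2] := td_cont td hT.
have K (k0' : R -> R) : {for (0:R), continuous (fun r => k0' `|r|)} ->
 (forall s, 0 < s -> s < t -> `|k0' t - k0' s| <= e * t) -> `|k0' t - k0' 0| <= e * t.
 move=> kc H; apply/ler_addgt0Pr => x x0; have [z z0 Hz] := eps_continuous kc x0.
 pose s := minr z t / 2; have s0 : 0 < s by rewrite divr_gt0// lt_min z0.
 have : s < minr z t by rewrite ltr_pdivrMr// mulr_natr mulr2n ltrDl lt_min z0.
 rewrite lt_min => /andP[sz st]; have := Hz s; rewrite subr0 normr0 (gtr0_norm s0) => /(_ sz)/ltW H2.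
 by have := ler_distD (k0' s) (k0' t) (k0' 0); move/le_trans; apply; exact: lerD (H s s0 st) H2.
by split; apply: K => // s s0 st; have [] := comp s t s0 st ht.
Qed.

Let f1 (r : R) := W1 `|r|. Let f2 (r : R) := W2 `|r|.
Let G1 (r : R) := upright_Uu m (W1 r) (W2 r) / mu1 m. Let G2 (r : R) := upright_Uw m (W1 r) (W2 r) / mu2 m.

(** [second_diff] along one coordinate direction and its opposite bounds the second difference of
    that coordinate from both sides. *)
Lemma orbit_ode (r : R) : `|r| < T ->
 [/\ is_derive r 1 f1 (derive1 f1 r), is_derive r 1 (derive1 f1) (G1 `|r|) & r = 0 -> derive1 f1 r = 0] /\
 [/\ is_derive r 1 f2 (derive1 f2 r), is_derive r 1 (derive1 f2) (G2 `|r|) & r = 0 -> derive1 f2 r = 0].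
Proof.
move=> rT; have p1 := mu1_gt0 hm; have p2 := mu2_gt0 hm.
have sd (W G : R -> R) (mu : R) : 0 < mu -> (forall p d e, 0 < p < T -> 0 < d -> `|e| <= 1 -> exists2 n0, 0 < n0 &
 forall n, 0 < n < n0 -> mu * e * (W (p + n) - 2 * W p + W (p - n)) <= n ^+ 2 * (mu * G p * e + d)) ->
 forall p d, 0 < p < T -> 0 < d -> exists2 n0, 0 < n0 & forall n, 0 < n < n0 ->
 `|W (p + n) - 2 * W p + W (p - n) - n ^+ 2 * G p| <= n ^+ 2 * d.
 move=> mu0 H p d hp d0; have md : 0 < mu * d := mulr_gt0 mu0 d0.
 have [|a a0 Ha] := H p _ 1 hp md; first by rewrite normr1.
 have [|b b0 Hb] := H p _ (- 1) hp md; first by rewrite normrN1.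
 exists (minr a b) => [|n]; first by rewrite lt_min a0.
 rewrite lt_min => /andP[n_gt0 /andP[na nb]].
 have := Ha n; rewrite n_gt0 na => /(_ isT); have := Hb n; rewrite n_gt0 nb => /(_ isT) h1 h2.
 rewrite -(ler_pM2l mu0) -[X in X * `|_|](gtr0_norm mu0) -normrM ler_norml; move: h1 h2.
 move: (W (p + n) - _ + _) (G p) (n ^+ 2) => x y v.
 by clear -R m h T W1 W2 A hm m12 td T0 W10 rate0; move=> h1 h2; apply/andP; split; lra.
split; [apply: (@even_second_order _ W1 G1 T) => //|apply: (@even_second_order _ W2 G2 T) => //].
- by move=> s hs; have [] := td_cont td hs.
- move=> s hs; apply: (@even_cvg (fun u w => upright_Uu m u w / mu1 m)) => // S F FF f g u w u0 fu gw.
 by apply: cvgM; [exact: cvg_upright_Uu|exact: cvg_cst].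
- apply: (sd _ _ _ p1) => p d e hp d0 e1; have z1 : `|0 : R| <= 1 by rewrite normr0.
 have [n0 n00 H] := second_diff hm td m12 hp e1 z1 d0; exists n0 => // n /H.
 by rewrite !mulr0 mul0r !addr0 [mu1 m * G1 p]mulrC divfK// gt_eqF.
- by move=> e e0; have [d d0 H] := slope_at_brake e0; exists d => // s /H[].
- by move=> s hs; have [] := td_cont td hs.
- move=> s hs; apply: (@even_cvg (fun u w => upright_Uw m u w / mu2 m)) => // S F FF f g u w u0 fu gw.
 by apply: cvgM; [exact: cvg_upright_Uw|exact: cvg_cst].
- apply: (sd _ _ _ p2) => p d e hp d0 e1; have z1 : `|0 : R| <= 1 by rewrite normr0.
 have [n0 n00 H] := second_diff hm td m12 hp z1 e1 d0; exists n0 => // n /H.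
 by rewrite !mulr0 mul0r !add0r [mu2 m * G2 p]mulrC divfK// gt_eqF.
- by move=> e e0; have [d d0 H] := slope_at_brake e0; exists d => // s /H[].
Qed.

Lemma energy_conserved (r : R) : `|r| < T ->
 2^-1 * (mu1 m * derive1 f1 r ^+ 2 + mu2 m * derive1 f2 r ^+ 2) = upright_U m (f1 r) (f2 r) - h.
Proof.
move=> rT; have p1 := mu1_gt0 hm; have p2 := mu2_gt0 hm.
pose E r := 2^-1 * (mu1 m * derive1 f1 r ^+ 2 + mu2 m * derive1 f2 r ^+ 2) - upright_U m (f1 r) (f2 r).
have ED (s : R) : `|s| < T -> is_derive s 1 E 0.
 move=> sT; have [[a1 a2 _] [a3 a4 _]] := orbit_ode sT.
 have f10 : 0 < f1 s by apply: width_gt0; rewrite normr_ge0.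
 apply: (is_derive_eq (isdB (isdZ 2^-1 (isdD (isdZ (mu1 m) (isdX2 a2)) (isdZ (mu2 m) (isdX2 a4))))
 (der_upright_U m f10 a1 a3))).
 rewrite /G1 /G2 -/(f1 s) -/(f2 s); move: (upright_Uu _ _ _) (upright_Uw _ _ _) => x y.
 have : mu1 m != 0 by rewrite gt_eqF. have : mu2 m != 0 by rewrite gt_eqF.
 by move: (mu1 m) (mu2 m) => z1 z2 z10 z20; field; rewrite z10 z20.
have norm0 : `|0 : R| < T by rewrite normr0.
have E0 : E 0 = - h.
 have [[_ _ a1] [_ _ a2]] := orbit_ode norm0.
 by rewrite /E a1// a2// expr0n/= !mulr0 addr0 mulr0 /f1 /f2 normr0 rate0 add0r.
suff : E r = - h by rewrite /E => /eqP; rewrite subr_eq => /eqP ->; rewrite addrC.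
rewrite -E0; have [r0|r0|->//] := ltgtP r 0.
 have D y : r <= y <= 0 -> is_derive y 1 E 0.
 by move=> /andP[y1 y2]; apply: ED; apply: le_lt_trans rT; rewrite (ltr0_norm r0) ler0_norm// lerN2.
 by have [c _ /eqP] := MVT_mean r0 D; rewrite mul0r subr_eq0 => /eqP.
have D y : 0 <= y <= r -> is_derive y 1 E 0.
 by move=> /andP[y1 y2]; apply: ED; apply: le_lt_trans rT; rewrite (gtr0_norm r0) ger0_norm.
by have [c _ /eqP] := MVT_mean r0 D; rewrite mul0r subr_eq0 => /eqP.
Qed.
End BrakeDynamics.

(** * Forces on isosceles configurations, and the brake orbit *)

Section Gradient.
Variables (R : realType) (m : 'I_3 -> R).
Implicit Types (q : conf R) (i k l : 'I_3).

Definition gap q k l : R := (Re (q k) - Re (q l)) ^+ 2 + (Im (q k) - Im (q l)) ^+ 2.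

Lemma rdist_gap q k l : rdist q k l = sqrt (gap q k l).
Proof. by rewrite /rdist /gap; case: (q k) (q l) => a b [c d]. Qed.
Lemma der_pair (a b x y c d : R) : 0 < x ^+ 2 + y ^+ 2 ->
 is_derive (0 : R) 1 (fun s => a * b / sqrt ((x + c * s) ^+ 2 + (y + d * s) ^+ 2))
 (- (a * b * (c * x + d * y) / sqrt (x ^+ 2 + y ^+ 2) ^+ 3)).
Proof.
move=> r0; have lin (z e : R) : is_derive (0 : R) 1 (fun s => z + e * s) e.
 by apply: (is_derive_eq (isdD (isd_cst 0 z) (isdZ e (isd_id 0)))); rewrite add0r mulr1.
have r0' : 0 < (x + c * 0) ^+ 2 + (y + d * 0) ^+ 2 by rewrite !mulr0 !addr0.
have s0 : sqrt (x ^+ 2 + y ^+ 2) != 0 by rewrite gt_eqF// sqrtr_gt0.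
apply: (is_derive_eq (isdZ (a * b) (@derSqrtV _ (fun s => (x + c * s) ^+ 2 + (y + d * s) ^+ 2) 0 _ r0'
 (isdD (isdX2 (lin x c)) (isdX2 (lin y d)))))).
by rewrite !mulr0 !addr0; field.
Qed.

(** Derivative of the term of the pair [k], [l] in [U] when body [i] moves in the direction
    [(c, d)]. *)
Definition pull q i k l (c d : R) : R :=
 - (m k * m l * (((k == i)%:R - (l == i)%:R) * c * (Re (q k) - Re (q l)) +
 ((k == i)%:R - (l == i)%:R) * d * (Im (q k) - Im (q l))) / sqrt (gap q k l) ^+ 3).

Lemma der_potential q i (c d : R) : (forall k l, k != l -> 0 < gap q k l) ->
 is_derive (0 : R) 1 (fun s : R => fine (U m (move q i (Complex (c * s) (d * s)))))
 (pull q i b1 b2 c d + pull q i b1 b3 c d + pull q i b2 b3 c d).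
Proof.
move=> gp; pose e k : R := (k == i)%:R.
have gapM s k l : gap (move q i (Complex (c * s) (d * s))) k l =
 (Re (q k) - Re (q l) + (e k - e l) * c * s) ^+ 2 +
 (Im (q k) - Im (q l) + (e k - e l) * d * s) ^+ 2.
 have cr (u v : R[i]) : Re (u + v) = Re u + Re v /\ Im (u + v) = Im u + Im v.
 by case: u v => ? ? [].
 have M j : Re (move q i (Complex (c * s) (d * s)) j) = Re (q j) + e j * c * s /\
 Im (move q i (Complex (c * s) (d * s)) j) = Im (q j) + e j * d * s.
 rewrite /move /e; case: eqP => [->|_]; last by rewrite !mul0r !addr0.
 by rewrite !mul1r; have [-> ->] := cr (q i) (Complex (c * s) (d * s)).
 by rewrite /gap; have [-> ->] := M k; have [-> ->] := M l; congr (_ ^+ 2 + _ ^+ 2); ring.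
have gc k l : k != l -> \forall s \near (0 : R), 0 < gap (move q i (Complex (c * s) (d * s))) k l.
 move=> kl; pose x := Re (q k) - Re (q l); pose y := Im (q k) - Im (q l).
 have lin (z a : R) : is_derive (0 : R) 1 (fun s => (z + a * s) ^+ 2) (2 * z * a).
 apply: (is_derive_eq (isdX2 (isdD (isd_cst 0 z) (isdZ a (isd_id 0))))).
 by rewrite mulr0 addr0 add0r mulr1.
 have C := is_derive_continuous (isdD (lin x ((e k - e l) * c)) (lin y ((e k - e l) * d))).
 have [a a0 Ha] := eps_continuous C (gp k l kl).
 have z0 : - a < (0 : R) < a by rewrite oppr_lt0 a0.
 apply: (near_itv z0) => s /andP[s1 s2].
 have := Ha s; rewrite subr0 ltr_norml s1 s2 => /(_ isT).
 rewrite !mulr0 !addr0 gapM -/x -/y => h1.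
 have : - gap q k l < (x + (e k - e l) * c * s) ^+ 2 + (y + (e k - e l) * d * s) ^+ 2 - (x ^+ 2 + y ^+ 2).
 by move: h1; rewrite ltr_norml => /andP[].
 by rewrite ltrBrDr /gap -/x -/y addNr.
have pr k l : k != l -> is_derive (0 : R) 1 (fun s : R => m k * m l / rdist (move q i (Complex (c * s) (d * s))) k l)
 (pull q i k l c d).
 move=> kl; have := der_pair (m k) (m l) ((e k - e l) * c) ((e k - e l) * d) (gp k l kl).
 rewrite /pull /gap; set f := (f in is_derive _ _ f _ -> _) => D.
 have -> : (fun s : R => m k * m l / rdist (move q i (Complex (c * s) (d * s))) k l) = f.
 by apply/funext => s; rewrite rdist_gap gapM.
 exact: D.
have D := isdD (isdD (pr b1 b2 isT) (pr b1 b3 isT)) (pr b2 b3 isT).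
apply: near_eq_is_derive D.
near=> s; rewrite U_real// rdist_gap sqrtr_gt0; near: s; exact: gc.
Unshelve. all: by end_near.
Qed.

Lemma gradUE q i : (forall k l, k != l -> 0 < gap q k l) ->
 gradU m q i = Complex (pull q i b1 b2 1 0 + pull q i b1 b3 1 0 + pull q i b2 b3 1 0)
 (pull q i b1 b2 0 1 + pull q i b1 b3 0 1 + pull q i b2 b3 0 1).
Proof.
move=> gp; rewrite /gradU; congr Complex; rewrite derive1E.
 have := der_potential i 1 0 gp; set f := (f in is_derive _ _ f _ -> _) => D.
 rewrite (_ : (fun s : R => _) = f); first by rewrite (@derive_val _ _ _ _ _ _ _ D).
 by apply/funext => s; rewrite /f mul1r mul0r.
have := der_potential i 0 1 gp; set f := (f in is_derive _ _ f _ -> _) => D.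
rewrite (_ : (fun s : R => _) = f); first by rewrite (@derive_val _ _ _ _ _ _ _ D).
by apply/funext => s; rewrite /f mul1r mul0r.
Qed.
End Gradient.

Section UprightForces.
Variables (R : realType) (m : 'I_3 -> R).
Hypotheses (hm : posm m) (m12 : m b1 = m b2).

Let M := m b1 + m b2 + m b3.

Definition cw (i : 'I_3) : R := if i == b3 then (m b1 + m b2) / M else - (m b3 / M).
Definition cu (i : 'I_3) : R := if i == b1 then - (m b2 / (m b1 + m b2)) else
 if i == b2 then m b1 / (m b1 + m b2) else 0.

Lemma upright_coord u w i : upright m u w i = Complex (cw i * w) (cu i * u).
Proof.
have [->|->|->] := ord3_cases i; rewrite /upright /of_xi /cw /cu /=; congr Complex; ring.
Qed.

Lemma upright_gap u w : [/\ gap (upright m u w) b1 b2 = u ^+ 2,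
 gap (upright m u w) b1 b3 = w ^+ 2 + u ^+ 2 / 4 & gap (upright m u w) b2 b3 = w ^+ 2 + u ^+ 2 / 4].
Proof.
have [p2 p3] := (hm b2, hm b3); have n1 : m b2 + m b2 + m b3 != 0 by rewrite gt_eqF// !addr_gt0.
have n2 : m b2 + m b2 != 0 by rewrite gt_eqF// addr_gt0.
by rewrite /gap !upright_coord /cw /cu /M /= m12; split; field; rewrite ?n1 ?n2.
Qed.

Lemma upright_gap_gt0 u w k l : 0 < u -> k != l -> 0 < gap (upright m u w) k l.
Proof.
move=> u0; have [g1 g2 g3] := upright_gap u w; have r0 := rad_gt0 w u0; have u2 : 0 < u ^+ 2 by rewrite exprn_gt0.
have gC a b : gap (upright m u w) a b = gap (upright m u w) b a by rewrite /gap; ring.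
by have [->|->|->] := ord3_cases k; have [->|->|->] := ord3_cases l => //= _; rewrite ?g1 ?g2 ?g3//
 gC ?g1 ?g2 ?g3.
Qed.

(** The force on body [i] is [m i] times the vector with the same coefficients [cw i] and [cu i] as
    its position, so Newton's equations reduce to two scalar ones. *)
Lemma upright_gradU u w i : 0 < u -> gradU m (upright m u w) i =
 Complex (m i * (cw i * (upright_Uw m u w / mu2 m))) (m i * (cu i * (upright_Uu m u w / mu1 m))).
Proof.
move=> u0; rewrite (gradUE m i (fun k l => upright_gap_gt0 w u0)).
have [g1 g2 g3] := upright_gap u w.
rewrite /pull g1 g2 g3 -/(hyp u w) sqrtr_sqr (gtr0_norm u0) !upright_coord.
have h0 : hyp u w != 0 by rewrite gt_eqF// hyp_gt0.
have u00 : u != 0 by rewrite gt_eqF.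
have [p2 p3] := (hm b2, hm b3); have n1 : m b2 + m b2 + m b3 != 0 by rewrite gt_eqF// !addr_gt0.
have n2 : m b2 + m b2 != 0 by rewrite gt_eqF// addr_gt0.
have n3 : m b2 != 0 by rewrite gt_eqF. have Mn0 : M != 0 by rewrite gt_eqF// !addr_gt0.
have n4 : m b3 != 0 by rewrite gt_eqF.
rewrite /upright_Uw /upright_Uu /mu1 /mu2 /M m12.
have [->|->|->] := ord3_cases i; rewrite /cw /cu /= ?m12; congr Complex; field; rewrite ?h0 ?u00 ?n1 ?n2 ?n3 ?n4 ?Mn0 //.
Qed.

Lemma sum_cw_cu : [/\ \sum_(i < 3) m i * (cw i * cu i) = 0, \sum_(i < 3) m i * cw i ^+ 2 = mu2 m &
 \sum_(i < 3) m i * cu i ^+ 2 = mu1 m].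
Proof.
have [p2 p3] := (hm b2, hm b3); have n1 : m b2 + m b2 + m b3 != 0 by rewrite gt_eqF// !addr_gt0.
have n2 : m b2 + m b2 != 0 by rewrite gt_eqF// addr_gt0.
have E (F : 'I_3 -> R) : \sum_(i < 3) F i = F b1 + F b2 + F b3.
 rewrite !big_ord_recl big_ord0 addr0 addrA.
 by congr (F _ + F _ + F _); exact/val_inj.
by rewrite !E /cw /cu /M /mu1 /mu2 /= m12; split; field; rewrite ?n1 ?n2.
Qed.

Lemma cu_inj i j : i != j -> cu i != cu j.
Proof.
have [p2 p3] := (hm b2, hm b3); have a : 0 < m b2 / (m b2 + m b2) by rewrite divr_gt0// addr_gt0.
have aN : - (m b2 / (m b2 + m b2)) < 0 by rewrite oppr_lt0.
have ba := lt_trans aN a.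
by have [->|->|->] := ord3_cases i; have [->|->|->] := ord3_cases j; rewrite /cu /= ?m12 // => _;
 rewrite ?(lt_eqF a) ?(gt_eqF a) ?(lt_eqF aN) ?(gt_eqF aN) ?(lt_eqF ba) ?(gt_eqF ba).
Qed.
End UprightForces.

Section BrakeOrbit.
Variables (R : realType) (m : 'I_3 -> R) (h T : R) (W1 W2 A : R -> R).
Hypotheses (hm : posm m) (m12 : m b1 = m b2) (td : timed m h T W1 W2 A)
 (T0 : 0 < T) (W10 : 0 < W1 0) (rate0 : upright_U m (W1 0) (W2 0) = h).

Let f1 (r : R) := W1 `|r|.
Let f2 (r : R) := W2 `|r|.

(* The orbit is symmetric about the brake instant [T]. *)
Definition orbit (t : R) : conf R := upright m (f1 (T - t)) (f2 (T - t)).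

Let normT (t : R) : 0 < t < 2 * T -> `|T - t| < T.
Proof.
move=> /andP[t0 tT]; rewrite ltr_norml ltrBrDr addrC.
by rewrite -[T - t < T]subr_gt0 opprB addrCA subrr addr0 t0 andbT; move: tT; rewrite mulr_natl mulr2n addrC -ltrBlDr addrC.
Qed.

Let der_coord (k G : R -> R) (c t : R) :
 (forall r : R, `|r| < T -> is_derive r 1 k (derive1 k r) /\ is_derive r 1 (derive1 k) (G r)) ->
 0 < t < 2 * T -> let g := fun s => c * k (T - s) in
 [/\ is_derive t 1 g (derive1 g t), is_derive t 1 (derive1 g) (c * G (T - t)) &
 derive1 g t = c * - derive1 k (T - t)].
Proof.
move=> H ht; cbv zeta.
have S (f : R -> R) (s a : R) : is_derive (T - s) 1 f a -> is_derive s 1 (fun s => f (T - s)) (- a).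
 move=> D; have D' : is_derive s 1 (fun s => T - s) (- 1).
 by apply: (is_derive_eq (isdB (isd_cst s T) (isd_id s))); rewrite sub0r.
 by have := @is_derive1_comp _ f (fun s => T - s) s a (- 1) D D'; rewrite mulrN1.
have D1 s : 0 < s < 2 * T -> is_derive s 1 (fun s => c * k (T - s)) (c * - derive1 k (T - s)).
 by move=> /normT/H[D _]; apply: isdZ; exact: S D.
have D2 : is_derive t 1 (fun s => c * - derive1 k (T - s)) (c * G (T - t)).
 have [_ D] := H _ (normT ht); apply: isdZ.
 by apply: (is_derive_eq (is_deriveN (S _ _ _ D))); rewrite opprK.
exact: (near_derive1 ht D1 D2).
Qed.

Let p1 := derive1 f1. Let p2 := derive1 f2.

Let ode1 (r : R) : `|r| < T ->
 is_derive r 1 f1 (p1 r) /\ is_derive r 1 p1 (upright_Uu m (f1 r) (f2 r) / mu1 m).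
Proof. by move=> rT; have [[a b _] _] := orbit_ode hm m12 td T0 W10 rate0 rT. Qed.

Let ode2 (r : R) : `|r| < T ->
 is_derive r 1 f2 (p2 r) /\ is_derive r 1 p2 (upright_Uw m (f1 r) (f2 r) / mu2 m).
Proof. by move=> rT; have [_ [a b _]] := orbit_ode hm m12 td T0 W10 rate0 rT. Qed.

Let orbitRe i : (fun s => Re (orbit s i)) = (fun s => cw m i * f2 (T - s)).
Proof. by apply/funext => s; rewrite /orbit upright_coord. Qed.

Let orbitIm i : (fun s => Im (orbit s i)) = (fun s => cu m i * f1 (T - s)).
Proof. by apply/funext => s; rewrite /orbit upright_coord. Qed.
Lemma orbit_velocity i (t : R) : 0 < t < 2 * T ->
 Defs.derivC (fun s => orbit s i) t = Complex (cw m i * - p2 (T - t)) (cu m i * - p1 (T - t)).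
Proof.
move=> ht; have [_ _ E2] := der_coord (cw m i) ode2 ht; have [_ _ E1] := der_coord (cu m i) ode1 ht.
by rewrite /Defs.derivC orbitRe orbitIm; congr Complex; [exact: E2|exact: E1].
Qed.

Let width t : 0 < t < 2 * T -> 0 < f1 (T - t).
Proof. by move=> /normT rT; apply: (width_gt0 td W10); rewrite normr_ge0. Qed.
Lemma orbit_newton : newton_solution m 0 (2 * T) orbit.
Proof.
move=> t; rewrite in_itv/= => ht; have w0 := width ht; split.
- exact: of_xi_centre hm _ _ _ _.
- move=> i j ij; apply/eqP; rewrite /orbit !upright_coord => -[_ /eqP].
 by rewrite -subr_eq0 -mulrBl mulf_eq0 (gt_eqF w0) orbF subr_eq0; apply/negP; exact: cu_inj.
move=> i; have [a1 a2 a3] := der_coord (cw m i) ode2 ht; have [c1 c2 c3] := der_coord (cu m i) ode1 ht.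
have vRe : (fun s => Re (Defs.derivC (fun s => orbit s i) s)) = derive1 (fun s => cw m i * f2 (T - s)).
 by rewrite -orbitRe.
have vIm : (fun s => Im (Defs.derivC (fun s => orbit s i) s)) = derive1 (fun s => cu m i * f1 (T - s)).
 by rewrite -orbitIm.
split.
- by split; [rewrite orbitRe; case: a1|rewrite orbitIm; case: c1].
- by split; [rewrite vRe; case: a2|rewrite vIm; case: c2].
rewrite /orbit (upright_gradU hm m12 _ _ w0) -/(orbit) {1}/Defs.derivC vRe vIm !derive1E.
rewrite (@derive_val _ _ _ _ _ _ _ a2) (@derive_val _ _ _ _ _ _ _ c2).
by apply/eqP; rewrite eq_complex/= !mul0r subr0 addr0 !eqxx.
Qed.

Lemma orbit_angular_momentum t : 0 < t < 2 * T -> angular_momentum m orbit t = 0.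
Proof.
move=> ht; rewrite /angular_momentum; have [S _ _] := sum_cw_cu hm m12.
transitivity (\sum_(i < 3) m i * (cw m i * cu m i) * (f1 (T - t) * p2 (T - t) - f2 (T - t) * p1 (T - t))).
 by apply: eq_bigr => i _; rewrite (orbit_velocity _ ht) /orbit upright_coord /=; ring.
by rewrite -mulr_suml S mul0r.
Qed.

Lemma orbit_energy t : 0 < t < 2 * T -> energy m orbit t = (- h)%:E.
Proof.
move=> ht; have [_ S2 S1] := sum_cw_cu hm m12.
rewrite /energy (U_upright hm m12 _ (width ht)) -EFinB; congr EFin.
have -> : \sum_(i < 3) m i * normc (Defs.derivC (fun s => orbit s i) t) ^+ 2 =
 mu1 m * p1 (T - t) ^+ 2 + mu2 m * p2 (T - t) ^+ 2.
 rewrite -S1 -S2 !mulr_suml -big_split; apply: eq_bigr => i _.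
 rewrite (orbit_velocity _ ht) /= sqr_sqrtr ?addr_ge0 ?sqr_ge0//; ring.
by rewrite (energy_conserved hm m12 td T0 W10 rate0 (normT ht)) addrAC subrr sub0r.
Qed.

Lemma orbit_at_rest i : Defs.derivC (fun s => orbit s i) T = 0.
Proof.
have ht : 0 < T < 2 * T by rewrite T0 mulr_natl mulr2n ltrDl.
have n0 : `|0 : R| < T by rewrite normr0.
have [[_ _ a] [_ _ b]] := orbit_ode hm m12 td T0 W10 rate0 n0.
by rewrite (orbit_velocity _ ht) subrr /p1 /p2 a// b// oppr0 !mulr0.
Qed.
End BrakeOrbit.

Lemma minimizer_brake_orbit (R : realType) (m : 'I_3 -> R) (h : R) (q0 : conf R) (t0 t1 : R) (g : R -> conf R) :
 (posm m) -> 0 < h -> m b1 = m b2 -> rdist q0 b1 b2 = 0 ->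
 JM_minimizer m h q0 t0 t1 g -> brake_orbit m h t0 t1 g.
Proof.
move=> hm hh m12 r0 gm; have [a [b [x [xm [phi [phic phim phi0 phi1 phig]]]]]] := minimizer_lift hm hh gm.
have [sg [f [w [_ [fL wL] [f0 fm] ym xy]]]] := planar_lift hm hh m12 r0 xm.
have ab := ltW (lm_lt xm); have ain : a <= a <= b by rewrite lexx.
have fa : f a = 0.
 have := same_conf_rdist b1 b2 (lm_start ym); rewrite r0 (rdist12_upright hm _ (f0 a ain)).
 by move=> /esym.
have [T [W1 [W2 [A [tau [[T0 [W10 rate0]] td [tauc taum] [taua taub] tauE]]]]]] :=
 timed_orbit hm hh m12 ym fL (liponZ sg wL) f0 fm fa (fun=> erefl).
have t01 : t0 < t1 by case: gm => -[].
have phiin t : t \in `[t0, t1] -> a <= phi t <= b.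
 rewrite in_itv/= => /andP[h1 h2]; rewrite -phi0 -phi1.
 by apply/andP; split; apply: phim; rewrite ?in_itv/= ?lexx ?h1 ?h2 ?(ltW t01).
exists T, (2 * T), (orbit m T W1 W2); split.
- by rewrite T0 mulr_natl mulr2n ltrDl.
- exact: (orbit_newton hm m12 td T0 W10 rate0).
- move=> t; rewrite in_itv/= => ht.
 by split; [exact: (orbit_angular_momentum hm m12 td)|exact: (orbit_energy hm m12 td)].
- exact: (orbit_at_rest hm m12 td T0 W10 rate0).
(* [tau] counts time back from the brake instant, so [T - tau] runs from 0 at the start to [T] on
   the Hill boundary. *)
exists (fun t => T - tau (clamp a b (phi t))); split.
- move=> t; apply: cvgB; first exact: cvg_cst.
 exact: (cvg_comp phi (fun r => tau (clamp a b r)) (phic t) (tauc (phi t))).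
- move=> s t hs ht st; have /andP[s1 s2] := phiin s hs; have /andP[u1 u2] := phiin t ht.
 by rewrite lerB// !clamp_id ?s1 ?u1//; apply: taum => //; exact: phim.
- by rewrite phi0 clamp_id// taua subrr.
- by rewrite phi1 clamp_id ?lexx ?ab// taub subr0.
move=> t ht; have hp := phiin t ht; rewrite clamp_id// /orbit subKr.
have [/andP[ta0 _] E1 E2] := tauE _ hp; rewrite ger0_norm// E1 E2.
exact: same_conf_trans (same_conf_sym (xy _ hp)) (phig t ht).
Qed.

Theorem theorem4 (R : realType) (m : 'I_3 -> R) (h : R) (q0 : conf R)
  (hm : forall i, 0 < m i) (hh : 0 < h) (hq0 : hill_interior m h q0) :
 (m b1 = m b2 -> rdist q0 b1 b2 = 0 ->
  forall t0 t1 g, JM_minimizer m h q0 t0 t1 g ->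
   brake_orbit m h t0 t1 g /\
   forall t, t \in `[t0, t1] -> rdist (g t) b1 b3 = rdist (g t) b2 b3)
 /\
 (m b1 = m b2 -> collinear q0 ->
  forall t0 t1 g, JM_minimizer m h q0 t0 t1 g ->
   (rdist q0 b1 b3 < rdist q0 b2 b3 ->
    forall t, t \in `[t0, t1] -> rdist (g t) b1 b3 < rdist (g t) b2 b3) /\
   (rdist q0 b1 b3 > rdist q0 b2 b3 ->
    forall t, t \in `[t0, t1] -> rdist (g t) b1 b3 > rdist (g t) b2 b3))
 /\
 (m b1 = m b2 -> m b2 = m b3 -> collinear q0 ->
  forall t0 t1 g, JM_minimizer m h q0 t0 t1 g ->
  forall s : {perm 'I_3},
   rdist q0 (s b1) (s b2) < rdist q0 (s b1) (s b3) < rdist q0 (s b2) (s b3) ->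
   forall t, t \in `[t0, t1] ->
    rdist (g t) (s b1) (s b2) < rdist (g t) (s b1) (s b3)
     < rdist (g t) (s b2) (s b3)).
Proof.
have e12 : b1 <> b2 by []. have e13 : b3 <> b1 by []. have e23 : b3 <> b2 by [].
split=> [m12 r0 t0 t1 g gm|].
 split=> [|t ht]; first exact: minimizer_brake_orbit gm.
 have [a [b [x [xm [phi [_ phim phi0 phi1 phig]]]]]] := minimizer_lift hm hh gm.
 have t01 : t0 <= t1 by move: ht; rewrite in_itv/= => /andP[]; exact: le_trans.
 have hp : a <= phi t <= b.
  move: ht; rewrite in_itv/= => /andP[h1 h2]; rewrite -phi0 -phi1.
  by apply/andP; split; apply: phim; rewrite ?in_itv/= ?lexx ?h1 ?h2 ?t01.
 have gx := phig t ht; rewrite !(same_conf_rdist _ _ gx).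
 exact: (skew_eq0 hm m12 (lip_min_isosceles hm hh m12 r0 xm hp)).
split=> [m12 _ t0 t1 g gm|m12 m23 _ t0 t1 g gm s /andP[r12 r23] t ht].
 split=> H t ht.
  by have := side_preserved hm hh (s := 1%g) (fun i => congr1 m (perm1 i)) m12 gm; rewrite !perm1; apply.
 (* Exchanging bodies 1 and 2 reverses the inequality. *)
 pose s := tperm b1 b2.
 have sm i : m (s i) = m i by rewrite /s permE/=; do 2 case: eqP => [->|_] //.
 have := side_preserved hm hh sm m12 gm; rewrite /s tpermL tpermR tpermD; [|by []|by []].
 by apply.
have mc i j : m i = m j.
 have E k : m k = m b1 by have [->|->|->] := ord3_cases k; rewrite ?m12 ?m23 -?m23 -?m12.
 by rewrite !E.
(* For the labelling [s] the sides [r13] and [r23] give the second inequality. Preceded by this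
   cyclic relabelling, they become the sides [s b2], [s b1] and [s b3], [s b1] of the first one. *)
have [c [c1 c2 c3]] : exists c : {perm 'I_3}, [/\ c b1 = b2, c b2 = b3 & c b3 = b1].
 exists (tperm b1 b2 * tperm b1 b3)%g.
 by rewrite !permM tpermL tpermD // tpermR tpermL (tpermD (z := b3)) // tpermR.
apply/andP; split; last exact: (side_preserved hm hh (s := s) (fun i => mc _ _) m12 gm).
have := side_preserved hm hh (s := (c * s)%g) (fun i => mc _ _) m12 gm.
rewrite !permM c1 c2 c3 => H; rewrite rdistC (rdistC (g t) (s b1)).
by apply: H => //; rewrite rdistC (rdistC q0 (s b3)).
Qed.
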